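(* Let $X$ be a metric space, $n \geq 1$, $d \in [n-1,n[$ and $T \in \mathscr D_n(X)$ for which there is a sequence $(R_k)_{k\geq 0}$ in $\mathbf N_n(X)$ (or in $\mathbf I_n(X)$) such that (1) $T = \sum_{k \geq 0} R_k$ weakly; (2) there are $V \geq 0$ and $\rho > 1$ such that for all $k \geq 0$, $\mathbf M(R_k) \leq V \rho^{k(d-n)}$ and $\mathbf M(\partial R_k) \leq V \rho^{k(d-(n-1))}$. If $d = n-1$ assume $T = R_0 \in \mathbf N_n(X)$. Given $\varphi=(\varphi^1,\dots,\varphi^n) : X \to \mathbb R^n$ and $\alpha_1,\dots,\alpha_n \in \,]0,1]$ with $\max_{i} \mathrm{Lip}^{\alpha_i}(\varphi^i) \leq H < \infty$ and $\tau_n := \alpha_1 + \dots + \alpha_n > d$, the current $\varphi_\# T$ is well defined by approximation and is equal to $[\![v_{T,\varphi}]\!]$ for some $v_{T,\varphi} \in L_c^1(\mathbb R^n)$ (or $v_{T,\varphi} \in L_c^1(\mathbb R^n,\mathbb Z)$). Indeed, if there is some $\epsilon \in \,]0,1]$ and maps $\varphi,\psi : X \to \mathbb R^n$ that satisfy (A) $\max_i\{\mathrm{Lip}^{\alpha_i}(\varphi^i),\mathrm{Lip}^{\alpha_i}(\psi^i)\} \leq H$, and (B) $\|\varphi^i - \psi^i\|_\infty \leq H \epsilon^{\alpha_i}$ for all $i \in \{1,\dots,n\}$, then \[\|v_{T,\varphi}-v_{T,\psi}\|_{L^1} \leq C' VH^n \epsilon^{\tau_n-d}\] for some constant $C'=C'(n,d,\tau_n,\rho)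 \geq 0$. Moreover, $\partial \varphi_\# T = \varphi_\# \partial T$. Further, there are $v_k \in \mathrm{BV}_c(\mathbb R^n)$, $k\ge0$, with: (i) $v_{T,\varphi} = \sum_{k \geq 0} v_k$ in $L^1$ and such that $\bigcup_k \operatorname{spt}(v_k)$ is bounded. (ii) There is some $C=C(n,d,\rho) \geq 0$ such that for all $k \geq 0$, \[\|v_k\|_{L^1} \leq CV H^{n}\eta^{k(d'- n)},\qquad \mathbf V(v_k) \leq CV H^{n-1}\eta^{k(d'-(n-1))},\] where $\eta := \rho^{\tau_{n}-\tau_{n-1}} > 1$, $d' := n-1 + \frac{d-\tau_{n-1}}{\tau_{n}-\tau_{n-1}} = n + \frac{d-\tau_{n}}{\tau_{n}-\tau_{n-1}}$ and $\tau_{n-1} := \tau_n - \max_i \alpha_i$. (Note that if $\alpha = \alpha_i$ for all $i$, then $\eta = \rho^\alpha$ and $d' = \frac{d}{\alpha}$.)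
   Context: $\mathrm{Lip}^\alpha(f)=\sup_{x\ne y}|f(x)-f(y)|/d(x,y)^\alpha$, $\mathrm{Lip}=\mathrm{Lip}^1$. $L^1_c(\mathbb R^n)$ (resp. $L^1_c(\mathbb R^n,\mathbb Z)$): (integer valued) integrable functions with essentially compact support. $\mathbf V(u)=\sup\{\int u\operatorname{div}\phi:\phi\in C_c^1(\mathbb R^n,\mathbb R^n),\|\phi\|_\infty\le1\}$; $\mathrm{BV}_c(\mathbb R^n)=\{u\in L^1_c:\mathbf V(u)<\infty\}$. Metric currents (with compact support). For a metric space $X$ and $m\ge0$, $\mathscr D_m(X)$ is the space of multilinear maps $T:\mathrm{Lip}(X)^{m+1}\to\mathbb R$ such that (i) $T(f,g^1,\dots,g^m)=0$ whenever some $g^i$ is constant in a neighbourhood of $\operatorname{spt}(f)$; (ii) there is a compact $K\subset X$ with $T(f,g)=0$ whenever $\operatorname{spt}(f)\cap K=\emptyset$; (iii) $T(f_k,g_k)\to T(f,g)$ whenever $f_k\to f$, $g^i_k\to g^i$ uniformly with uniformly bounded Lipschitz constants. $\operatorname{spt}(T)$ is the smallest closed set $A$ such that $T(f,g)=0$ whenever $\operatorname{spt}(f)\cap A=\emptyset$. $\partial T(f,g^1,\dots,g^{m-1})=T(1,f,g^1,\dots,g^{m-1})$ ($\partial T=0$ if $m=0$). For Lipschitz $\psi$, $\psi_\#T(f,g)=T(f\circ\psi,g\circ\psi)$. $\mathbf M(T)$ is the supremum of $\sum_{\lambda}T(f_\lambda,g^1_\lambda,\dots,g_\lambda^m)$ over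 finite families with $\sum_\lambda|f_\lambda|\le1$, $\mathrm{Lip}(g^i_\lambda)\le1$; $\mathbf N_m(X)=\{T\in\mathscr D_m(X):\mathbf M(T)+\mathbf M(\partial T)<\infty\}$; $\mathbf I_m(X)$ is the space of integral currents with compact support (Ambrosio–Kirchheim/Lang). Weak convergence: supports in one compact set and pointwise convergence. For $u\in L^1_c(\mathbb R^n)$, $[\![u]\!](f,g^1,\dots,g^n)=\int uf\det D(g^1,\dots,g^n)\,dx$. ''$\varphi_\#T$ is well defined by approximation'' means: whenever $(\varphi_k)$ are Lipschitz maps $X\to\mathbb R^n$ converging uniformly to $\varphi$ with $\sup_{i,k}\mathrm{Lip}^{\alpha_i}(\varphi_k^i)<\infty$, the currents $\varphi_{k\#}T$ converge weakly to a limit, independent of the sequence, denoted $\varphi_\#T$. $\varphi_\#\partial T$ is defined as the weak limit $\lim_{k\to\infty}\varphi_\#\,\partial\sum_{l=0}^kR_l$, where for a normal current $N\in\mathbf N_{n-1}(X)$ one sets $\varphi_\#N:=\lim_{t\downarrow0}(\tilde\varphi_t)_\#N$ (weak limit) with the Lipschitz maps $\tilde\varphi_t:X\to\mathbb R^n$, $t\in\,]0,1]$, given by $\tilde\varphi^i_t(x)=\inf_{y\in X}\bigl(\varphi^i(y)+Ht^{\alpha_i-1}d(x,y)\bigr)$. *)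

(* Defs.v *)
From HB Require Import structures.
From mathcomp Require Import all_boot all_order all_algebra.
From mathcomp Require Import all_classical all_reals all_analysis.

Set Implicit Arguments.
Unset Strict Implicit.
Unset Printing Implicit Defensive.

Import Order.TTheory GRing.Theory Num.Theory.
Import numFieldNormedType.Exports.

Local Open Scope classical_set_scope.
Local Open Scope ring_scope.

(* R^n is 'rV[R]_n with the distance of the sup norm.  It is bi-Lipschitz to the
   Euclidean distance, and only qualitative notions (Lipschitz functions, compact
   sets, supports, uniform convergence) are taken with respect to it on R^n. *)
Section row_metric.
Variables (R : realType) (n : nat).
Implicit Types x y : 'rV[R]_n.

Let dist x y := `|y - x|.

Let dist_ge0 x y : 0 <= dist x y.
Proof. exact: normr_ge0. Qed.

Let dist_positivity x y : dist x y = 0 -> x = y.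
Proof. by move/normr0_eq0/eqP; rewrite subr_eq0 => /eqP. Qed.

Let ballEmdist x d : ball x d = [set y | dist x y < d].
Proof.
by rewrite -ball_normE; apply/seteqP; split => y; rewrite /ball_ /dist /= distrC.
Qed.

HB.instance Definition _ := @PseudoMetric_isMetric.Build R 'rV[R]_n
  dist dist_ge0 dist_positivity ballEmdist.
End row_metric.

(* The sigma-algebra generated by the coordinates, i.e. the Borel sets of R^n. *)
Section row_measurable.
Variables (R : realType) (n : nat).

Let coord (i : 'I_n) (x : 'rV[R]_n) : R := x ord0 i.

Let row_set0 : g_sigma_preimage coord set0.
Proof. exact: sigma_algebra0. Qed.

Let row_setC A : g_sigma_preimage coord A -> g_sigma_preimage coord (~` A).
Proof. exact: sigma_algebraC. Qed.

Let row_bigcup (F : _^nat) : (forall i, g_sigma_preimage coord (F i)) ->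
  g_sigma_preimage coord (\bigcup_i (F i)).
Proof. exact: sigma_algebra_bigcup. Qed.

HB.instance Definition _ := @isMeasurable.Build default_measure_display
  'rV[R]_n (g_sigma_preimage coord) row_set0 row_setC row_bigcup.
End row_measurable.

Lemma measurable_row_coord (R : realType) n (i : 'I_n) :
  measurable_fun [set: 'rV[R]_n] (fun x : 'rV[R]_n => x ord0 i).
Proof.
move=> _ Y mY; rewrite setTI; apply: sub_sigma_algebra => /=.
rewrite -bigcup_seq/=; exists i => /=; first by rewrite mem_index_enum.
by exists Y => //; rewrite setTI.
Qed.

Lemma measurable_fun_row d (T : measurableType d) (R : realType) n
    (f : T -> 'rV[R]_n) :
  (forall i, measurable_fun setT (fun t => f t ord0 i)) -> measurable_fun setT f.
Proof.
move=> mf _ A; rewrite setTI => mA.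
pose G : set_system 'rV[R]_n := [set B | measurable (f @^-1` B)].
have : (measurable : set (set 'rV[R]_n)) `<=` G.
  apply: smallest_sub.
    split => //=.
    - by rewrite /G/= preimage_set0; exact: measurable0.
    - by move=> B; rewrite /G/= setTD -preimage_setC => mB; exact (measurableC mB).
    - move=> F mF; rewrite /G/= preimage_bigcup; apply: bigcup_measurable => k _; exact: mF.
  rewrite -bigcup_seq; apply: bigcup_sub => i _ B [Y mY <-].
  by rewrite /G/= setTI; have := mf i measurableT Y mY; rewrite setTI.
exact.
Qed.

Section lebesgue_succ.
Local Open Scope ereal_scope.
Variables (R : realType) (n : nat).
Variable mu : {sigma_finite_measure set 'rV[R]_n -> \bar R}.

Definition row_cons (p : measurableTypeR R * 'rV[R]_n) : 'rV[R]_n.+1 :=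
  @row_mx R 1 1 n (const_mx p.1) p.2.

Let row_uncons (x : 'rV[R]_n.+1) : measurableTypeR R * 'rV[R]_n :=
  (x ord0 ord0, @rsubmx R 1 1 n x).

Let measurable_row_cons : measurable_fun setT row_cons.
Proof.
apply: measurable_fun_row => i.
rewrite /row_cons; case: (split_ordP (i : 'I_(1 + n))) => j ->.
  rewrite [X in measurable_fun _ X](_ : _ = fst).
    exact: measurable_fst.
  by apply/funext => p; apply: etrans (row_mxEl _ _ _ _) _; rewrite mxE.
rewrite [X in measurable_fun _ X](_ : _ = (fun x : 'rV_n => x ord0 j) \o snd).
  exact: (measurableT_comp (measurable_row_coord j) measurable_snd).
by apply/funext => p; exact: row_mxEr.
Qed.

Let measurable_row_uncons : measurable_fun setT row_uncons.
Proof.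
apply/measurable_fun_pair; first exact: measurable_row_coord.
apply: measurable_fun_row => i.
rewrite [X in measurable_fun _ X](_ : _ =
    (fun x : 'rV_(1 + n) => x ord0 (rshift 1 i))).
  exact: measurable_row_coord.
by apply/funext => x; rewrite mxE.
Qed.

Let row_consK : cancel row_cons row_uncons.
Proof.
move=> [a x]; rewrite /row_cons /row_uncons /=; congr pair; last by rewrite row_mxKr.
have -> : (ord0 : 'I_n.+1) = lshift n (ord0 : 'I_1) by exact: val_inj.
by apply: etrans (row_mxEl _ _ _ _) _; rewrite mxE.
Qed.

Definition lebesgue_succ : set 'rV[R]_n.+1 -> \bar R :=
  pushforward (@lebesgue_measure R \x mu) row_cons.

Let lebesgue_succ0 : lebesgue_succ set0 = 0.
Proof. by rewrite /lebesgue_succ /pushforward preimage_set0 measure0. Qed.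

Let lebesgue_succ_ge0 A : 0 <= lebesgue_succ A.
Proof. exact: measure_ge0. Qed.

Let lebesgue_succ_sigma_additive : semi_sigma_additive lebesgue_succ.
Proof.
move=> F mF tF mUF; rewrite /lebesgue_succ /pushforward preimage_bigcup.
apply: measure_semi_sigma_additive.
- by move=> k; rewrite -[X in measurable X]setTI; exact: measurable_row_cons.
- apply/trivIsetP => /= i j _ _ ij; rewrite -preimage_setI.
  by move/trivIsetP : tF => /(_ _ _ _ _ ij) ->//; rewrite preimage_set0.
- rewrite -preimage_bigcup -[X in measurable X]setTI.
  exact: measurable_row_cons.
Qed.

HB.instance Definition _ := isMeasure.Build _ _ _ lebesgue_succ
  lebesgue_succ0 lebesgue_succ_ge0 lebesgue_succ_sigma_additive.

Let lebesgue_succ_sigma_finite : sigma_finite setT lebesgue_succ.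
Proof.
have /sigma_finiteP[F [FT ndF Foo]] := sigma_finiteT (@lebesgue_measure R).
have /sigma_finiteP[G [GT ndG Goo]] := sigma_finiteT mu.
exists (fun k => row_uncons @^-1` (F k `*` G k)).
  rewrite -preimage_bigcup; apply/esym/seteqP; split => // x _.
  have [k _ Fk] : (\bigcup_i F i) (row_uncons x).1 by rewrite -FT.
  have [l _ Gl] : (\bigcup_i G i) (row_uncons x).2 by rewrite -GT.
  exists (maxn k l) => //; split.
  - by move: Fk; exact/subsetPset/ndF/leq_maxl.
  - by move: Gl; exact/subsetPset/ndG/leq_maxr.
move=> k; have [mF Fk] := Foo k; have [mG Gk] := Goo k; split.
  by rewrite -[X in measurable X]setTI; apply: measurable_row_uncons => //;
    exact: measurableX.
rewrite /lebesgue_succ /pushforward -comp_preimage.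
rewrite (_ : _ \o _ = id) ?preimage_id; last first.
  by apply/funext => p; exact: row_consK.
by rewrite product_measure1E// lte_mul_pinfty// ge0_fin_numE.
Qed.

HB.instance Definition _ := Measure_isSigmaFinite.Build _ _ _ lebesgue_succ
  lebesgue_succ_sigma_finite.

End lebesgue_succ.

(* Lebesgue measure on R^n, as an iterated product measure. *)
Fixpoint lebesgue_row (R : realType) (n : nat) :
    {sigma_finite_measure set 'rV[R]_n -> \bar R} :=
  if n is m.+1 then lebesgue_succ (lebesgue_row R m)
  else dirac (0 : 'rV[R]_0).

Section currents.
Variable R : realType.

(* On spaces with at most one point the supremum is over the empty set of
   nonnegative reals, i.e. 0, hence the maxe. *)
Definition Lip (X : metricType R) (a : R) (f : X -> R) : \bar R :=
  maxe 0%E (ereal_sup [set q | exists x y : X,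
    x != y /\ q = (`|f x - f y| / mdist x y `^ a)%:E]).

Definition is_lip (X : metricType R) (f : X -> R) : Prop := (Lip 1 f < +oo)%E.

Definition lipschitz_map_on (X Y : metricType R) (A : set X) (psi : X -> Y) :=
  exists L : R, forall x y, A x -> A y ->
    mdist (psi x) (psi y) <= L * mdist x y.

Definition spt (X : metricType R) (f : X -> R) : set X :=
  closure [set x | f x != 0].

(* The carrier of m-dimensional currents: only the values at tuples of Lipschitz
   functions are meaningful, the others are never constrained nor used. *)
Definition functional (X : metricType R) (m : nat) : Type :=
  (X -> R) -> ('I_m -> X -> R) -> R.

Definition eq_current (X : metricType R) m (S T : functional X m) : Prop :=
  forall f g, is_lip f -> (forall i, is_lip (g i)) -> S f g = T f g.

Definition subst_at (X : metricType R) m (g : 'I_m -> X -> R) (i : 'I_m)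
    (h : X -> R) : 'I_m -> X -> R :=
  fun j => if j == i then h else g j.

Definition vanishes_off (X : metricType R) m (T : functional X m)
    (A : set X) : Prop :=
  forall f g, is_lip f -> (forall i, is_lip (g i)) ->
    spt f `&` A = set0 -> T f g = 0.

Record is_current (X : metricType R) m (T : functional X m) : Prop := {
  current_linear : forall a f1 f2 g,
    is_lip f1 -> is_lip f2 -> (forall i, is_lip (g i)) ->
    T (fun x => a * f1 x + f2 x) g = a * T f1 g + T f2 g ;
  current_multilinear : forall a f g i h1 h2,
    is_lip f -> (forall j, is_lip (g j)) -> is_lip h1 -> is_lip h2 ->
    T f (subst_at g i (fun x => a * h1 x + h2 x)) =
    a * T f (subst_at g i h1) + T f (subst_at g i h2) ;
  current_local : forall f g, is_lip f -> (forall i, is_lip (g i)) ->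
    (exists (i : 'I_m) (c : R) (U : set X),
      [/\ open U, spt f `<=` U & forall x, U x -> g i x = c]) ->
    T f g = 0 ;
  current_compact : exists K : set X, compact K /\ vanishes_off T K ;
  current_continuous : forall (f_ : nat -> X -> R) (g_ : nat -> 'I_m -> X -> R)
      f g,
    (exists L : R, forall k,
      (Lip 1 (f_ k) <= L%:E)%E /\ forall i, (Lip 1 (g_ k i) <= L%:E)%E) ->
    is_lip f -> (forall i, is_lip (g i)) ->
    {uniform, f_ @ \oo --> f} ->
    (forall i, {uniform, (fun k => g_ k i) @ \oo --> g i}) ->
    (fun k => T (f_ k) (g_ k)) @ \oo --> T f g }.

Definition current_support (X : metricType R) m (T : functional X m) : set X :=
  \bigcap_(A in [set A | closed A /\ vanishes_off T A]) A.

Definition extend_head (X : metricType R) m (f : X -> R) (g : 'I_m -> X -> R) :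
    'I_m.+1 -> X -> R :=
  fun i => if unlift ord0 i is Some j then g j else f.

Definition boundary (X : metricType R) m : functional X m -> functional X m.-1 :=
  match m with
  | 0 => fun _ _ _ => 0
  | _.+1 => fun T f g => T (fun=> 1) (extend_head f g)
  end.

Definition pushforward_current (X Y : metricType R) m (psi : X -> Y)
    (T : functional X m) : functional Y m :=
  fun f g => T (f \o psi) (fun i => g i \o psi).

Definition mass (X : metricType R) m (T : functional X m) : \bar R :=
  ereal_sup [set q | exists (N : nat) (f_ : 'I_N -> X -> R)
      (g_ : 'I_N -> 'I_m -> X -> R),
    [/\ forall l, is_lip (f_ l),
        forall l i, (Lip 1 (g_ l i) <= 1)%E,
        forall x, \sum_(l < N) `|f_ l x| <= 1 &
        q = (\sum_(l < N) T (f_ l) (g_ l))%:E]].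

Definition is_normal (X : metricType R) m (T : functional X m) : Prop :=
  is_current T /\ (mass T + mass (boundary T) < +oo)%E.

(* Weak convergence of a family indexed by D along the filter F: all supports lie
   in one compact set, and the values converge pointwise. *)
Definition weak_cvg (X : metricType R) m (I : Type) (D : set I)
    (F : set_system I) (S : I -> functional X m) (T : functional X m) : Prop :=
  (exists K : set X, compact K /\ forall i, D i -> current_support (S i) `<=` K)
  /\ forall f g, is_lip f -> (forall j, is_lip (g j)) ->
     (fun i => S i f g) @ F --> T f g.

Definition partial_sum (X : metricType R) m (S : nat -> functional X m)
    (k : nat) : functional X m :=
  fun f g => \sum_(l < k.+1) S l f g.

End currents.

Section functions_on_Rn.
Variables (R : realType) (n : nat).
Local Notation Rn := 'rV[R]_n.
Local Notation leb := (lebesgue_row R n).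

Definition basis_vector (i : 'I_n) : Rn := delta_mx ord0 i.

Definition L1c (u : Rn -> R) : Prop :=
  leb.-integrable setT (EFin \o u) /\
  exists K : set Rn, compact K /\ {ae leb, forall x, ~ K x -> u x = 0}.

Definition L1cZ (u : Rn -> R) : Prop :=
  L1c u /\ {ae leb, forall x, u x \is a Num.int}.

Definition L1_dist (u v : Rn -> R) : \bar R :=
  (\int[leb]_x (`|u x - v x|)%:E)%E.

Definition L1_norm (u : Rn -> R) : \bar R := (\int[leb]_x (`|u x|)%:E)%E.

Definition ess_support (u : Rn -> R) : set Rn :=
  [set x | forall U, open U -> U x ->
    ~ leb.-negligible (U `&` [set y | u y != 0])].

Definition divergence (phi : Rn -> Rn) (x : Rn) : R :=
  \sum_(i < n) 'D_(basis_vector i) (fun y => phi y ord0 i) x.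

Definition C1c (phi : Rn -> Rn) : Prop :=
  [/\ forall x, differentiable phi x,
      forall i, continuous (fun x => 'D_(basis_vector i) phi x) &
      compact (closure [set x | phi x != 0])].

(* The bound |phi| <= 1 is for the Euclidean norm. *)
Definition variation_Rn (u : Rn -> R) : \bar R :=
  ereal_sup [set q | exists phi : Rn -> Rn,
    [/\ C1c phi, forall x, \sum_(i < n) phi x ord0 i ^+ 2 <= 1 &
        q = (\int[leb]_x (u x * divergence phi x))%:E]].

Definition BVc (u : Rn -> R) : Prop := L1c u /\ (variation_Rn u < +oo)%E.

(* Lipschitz maps are differentiable almost everywhere (Rademacher), so that the
   default value of the differential elsewhere is irrelevant; the library's jacobian
   is the transpose of the usual matrix, with the same determinant. *)
Definition current_of (u : Rn -> R) : functional Rn n :=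
  fun f g => \int[leb]_x
    (u x * f x * \det (jacobian (fun y : Rn => \row_(i < n) g i y) x)).

End functions_on_Rn.

(* The library's measurable types are pointed, and X may be empty; in what follows
   a point of X is therefore part of the Borel space of X. *)
Definition pointed_at (R : realType) (X : metricType R) (x0 : X) : Type := X.
HB.instance Definition _ (R : realType) (X : metricType R) (x0 : X) :=
  Choice.on (pointed_at x0).
HB.instance Definition _ (R : realType) (X : metricType R) (x0 : X) :=
  isPointed.Build (pointed_at x0) x0.

Definition borel_space (R : realType) (X : metricType R) (x0 : X) :=
  g_sigma_algebraType (@open X : set (set (pointed_at x0))).

Section integral_currents.
Variable R : realType.

Definition controls_current (X : metricType R) (x0 : X) m
    (T : functional X m)
    (mu : {finite_measure set (borel_space x0) -> \bar R}) : Prop :=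
  forall f g, is_lip f -> (forall i, is_lip (g i)) ->
    ((`|T f g|)%:E <= (\prod_(i < m) fine (Lip 1 (g i)))%:E *
                      \int[mu]_x (`|f x|)%:E)%E.

(* The mass measure ||T|| of Ambrosio and Kirchheim. *)
Definition is_mass_measure (X : metricType R) (x0 : X) m
    (T : functional X m)
    (mu : {finite_measure set (borel_space x0) -> \bar R}) : Prop :=
  controls_current T mu /\
  forall nu : {finite_measure set (borel_space x0) -> \bar R},
    controls_current T nu -> forall A, measurable A -> (mu A <= nu A)%E.

(* S is the restriction of T to B, S(f,g) = T(1_B f, g), where T is extended to
   L^1(||T||) in the first argument by density of the Lipschitz functions. *)
Definition is_restriction (X : metricType R) (x0 : X) m
    (T : functional X m)
    (mu : {finite_measure set (borel_space x0) -> \bar R})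
    (B : set X) (S : functional X m) : Prop :=
  forall f g (f_ : nat -> X -> R),
    is_lip f -> (forall i, is_lip (g i)) -> (forall k, is_lip (f_ k)) ->
    (fun k => \int[mu]_x (`|f_ k x - \1_B x * f x|)%:E)%E @ \oo --> 0%E ->
    (fun k => T (f_ k) g) @ \oo --> S f g.

Definition countably_rectifiable (X : metricType R) (m : nat)
    (E : set X) : Prop :=
  exists (A : nat -> set 'rV[R]_m) (gamma : nat -> 'rV[R]_m -> X),
    (forall j, lipschitz_map_on (A j) (gamma j)) /\
    E `<=` \bigcup_j (gamma j @` A j).

Definition integer_rectifiable (X : metricType R) m
    (T : functional X m) : Prop :=
  forall x0 : X, exists mu : {finite_measure set (borel_space x0) -> \bar R},
    [/\ is_mass_measure T mu,
        exists E : set (borel_space x0),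
          [/\ measurable E, countably_rectifiable m (E : set X) &
              mu (~` E) = 0%E] &
        forall (B : set (borel_space x0)) (pi : X -> 'rV[R]_m),
          measurable B -> lipschitz_map_on setT pi ->
          exists S u, [/\ is_restriction T mu B S, L1cZ u &
            eq_current (pushforward_current pi S) (current_of u)]].

(* By the boundary rectifiability theorem, the boundary of such a T is integer
   rectifiable as well. *)
Definition is_integral (X : metricType R) m (T : functional X m) : Prop :=
  is_normal T /\ integer_rectifiable T.

End integral_currents.

Section pushforward_by_approximation.
Variables (R : realType) (X : metricType R) (n : nat).
Local Notation Rn := 'rV[R]_n.

Definition coordinate (phi : X -> Rn) (i : 'I_n) : X -> R :=
  fun x => phi x ord0 i.

Definition holder_le (alpha : 'I_n -> R) (H : R) (phi : X -> Rn) : Prop :=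
  forall i, (Lip (alpha i) (coordinate phi i) <= H%:E)%E.

Definition approximates (alpha : 'I_n -> R) (phi : X -> Rn)
    (phi_ : nat -> X -> Rn) : Prop :=
  [/\ forall k, lipschitz_map_on setT (phi_ k),
      {uniform, phi_ @ \oo --> phi} &
      exists L : R, forall k, holder_le alpha L (phi_ k)].

(* phi_# T is well defined by approximation and equal to S.  The existence of an
   approximating sequence is included, so that S is determined by T and phi. *)
Definition is_pushforward m (alpha : 'I_n -> R) (phi : X -> Rn)
    (T : functional X m) (S : functional Rn m) : Prop :=
  (exists phi_, approximates alpha phi phi_) /\
  forall phi_, approximates alpha phi phi_ ->
    weak_cvg setT \oo (fun k => pushforward_current (phi_ k) T) S.

Definition inf_convolution (alpha : 'I_n -> R) (H : R) (phi : X -> Rn)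
    (t : R) : X -> Rn :=
  fun x => \row_(i < n)
    inf (range (fun y => phi y ord0 i + H * t `^ (alpha i - 1) * mdist x y)).

Definition is_pushforward_normal m (alpha : 'I_n -> R) (H : R) (phi : X -> Rn)
    (N : functional X m) (S : functional Rn m) : Prop :=
  weak_cvg [set t : R | 0 < t <= 1] (0^'+)
    (fun t => pushforward_current (inf_convolution alpha H phi t) N) S.

(* S = phi_# (boundary of T), for T the weak sum of the currents R_ k. *)
Definition is_pushforward_boundary m (alpha : 'I_n -> R) (H : R)
    (phi : X -> Rn) (R_ : nat -> functional X m)
    (S : functional Rn m.-1) : Prop :=
  exists P : nat -> functional Rn m.-1,
    (forall k, is_pushforward_normal alpha H phi
                 (boundary (partial_sum R_ k)) (P k)) /\
    weak_cvg setT \oo P S.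

End pushforward_by_approximation.

(* Main.v *)
(* Everything is read off the numbers T(f o phi, phi^1, ..., phi^n), with phi
   Lipschitz, f Lipschitz and |f| <= 1.  If psi differs from phi in one component,
   expanding f as a partial derivative D_i F turns the change of this number into
   a value of the boundary of T, so that it is at most
   M(dT) |phi^i - psi^i| prod_(j != i) Lip(phi^j), without any derivative of f.

   For a normal current this bounds f |-> T(f o phi, phi) both by the mass and, on
   derivatives f = D_i F, by sup |F|; such a functional is integration against an L^1
   density u, and the chain rule T(f, F o phi) = T(f det DF o phi, phi) for F of class
   C^(1,1), quasi-interpolation by splines and Rademacher's theorem give
   phi_# T = [[u]].  By duality, L^1 distances of densities are bounded by
   differences of such numbers.

   A Hoelder map phi is approximated by its inf-convolutions phi_t, which are
   t^alpha_i-close to phi with Lipschitz constants of order t^(alpha_i - 1).  For R_l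
   one passes from the mass bound to the boundary bound at the scale t = rho^-l, and both
   contribute rho^(l (d - tau)).  The density of the image of R_0 + ... + R_k under phi_t
   with t = rho^-k is v_0 + ... + v_k; the estimates for v_k and the stability
   estimate are the resulting geometric series. *)

(* The constants may depend only on [n], [d], [rho] and [tau], so no Lipschitz constant of an
   individual map may survive; hence the telescoping over scales, where such a constant is
   multiplied by a null sequence. The axioms of a current admit only Lipschitz arguments, which
   makes C^(1,1) the natural smooth class: both [F] and its partial derivatives can be composed with
   a Lipschitz map and inserted. Alternation and the chain rule are not axioms; they are derived
   from locality, continuity and finite mass. Densities are built by hand from quadratic B-splines:
   these are C^(1,1), sum to one, give affine functions the right gradient, and a coarse spline
   differs from a multiple of finer ones by a divergence with small primitives. For [d = n - 1] the
   sums of the boundary masses are not controlled geometrically; a majorant [b] treats this case,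
   the case [d > n - 1] and the partial sums alike. The quantity [tau - max alpha] stems from the
   variation: a derivative in direction i omits the i-th factor from the product of Lipschitz
   constants, and the direction with the largest exponent is the worst. *)
Require Import Defs.
From HB Require Import structures.
From mathcomp Require Import all_boot all_order all_algebra.
From mathcomp Require Import all_classical all_reals all_analysis.
From mathcomp Require Import fingroup perm measurable_realfun.
From mathcomp Require Import ring lra zify.

Set Implicit Arguments.
Unset Strict Implicit.
Unset Printing Implicit Defensive.

Import Order.TTheory GRing.Theory Num.Theory.
Import numFieldNormedType.Exports.

Local Open Scope classical_set_scope.
Local Open Scope ring_scope.

(** * Lipschitz functions *)

Section lipschitz.
Context {R : realType}.

Definition lipc (X : metricType R) (c : R) (f : X -> R) : Prop :=
  forall x y, `|f x - f y| <= c * mdist x y.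

Definition bounded_by (X : Type) (c : R) (f : X -> R) : Prop :=
  forall x, `|f x| <= c.

(** Being 1-Lipschitz, this truncation serves to make first arguments bounded, to build cut-offs
    and, applied coordinatewise, to retract onto cubes. *)
Definition clamp (a b x : R) : R := Num.max a (Num.min b x).

Lemma clamp_lip a b x y : `|clamp a b x - clamp a b y| <= `|x - y|.
Proof.
rewrite /clamp /Num.max /Num.min ler_norml.
case: (ger0P (x - y)) => xy; case: (ltP b x) => bx; case: (ltP b y) => b_y;
  case: (ltP a b) => ab; case: (ltP a x) => ax; case: (ltP a y) => ay; lra.
Qed.

Lemma clamp_itv a b x : a <= b -> a <= clamp a b x <= b.
Proof.
rewrite /clamp /Num.max /Num.min => ab.
by case: (ltP b x) => bx; case: ltP => ax; apply/andP; split; lra.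
Qed.

Lemma clamp_id a b x : a <= x <= b -> clamp a b x = x.
Proof.
rewrite /clamp /Num.max /Num.min => /andP[ax xb].
by case: (ltP b x) => bx; case: ltP => aX; lra.
Qed.

Variable X : metricType R.
Implicit Types (f g : X -> R) (c : R).

Lemma LipP c f : 0 <= c -> (Lip 1 f <= c%:E)%E <-> lipc c f.
Proof.
move=> c0; rewrite /Lip; split.
  rewrite ge_max => /andP[_ h] x y.
  have [->|xy] := eqVneq x y; first by rewrite subrr normr0 mdistxx mulr0.
  have : ((`|f x - f y| / mdist x y `^ 1)%:E <= c%:E)%E.
    by apply: le_trans h; apply: ereal_sup_ubound; exists x, y.
  by rewrite lee_fin powRr1 ?mdist_ge0// ler_pdivrMr ?mdist_gt0.
move=> h; rewrite ge_max lee_fin c0/=; apply: ge_ereal_sup => q [x [y [xy ->]]].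
by rewrite lee_fin powRr1 ?mdist_ge0// ler_pdivrMr ?mdist_gt0//; exact: h.
Qed.

Lemma lipc_le c c' f : c <= c' -> lipc c f -> lipc c' f.
Proof.
by move=> cc' h x y; apply: le_trans (h x y) _; rewrite ler_wpM2r// mdist_ge0.
Qed.

Lemma is_lipP f : is_lip f <-> exists2 c, 0 <= c & lipc c f.
Proof.
rewrite /is_lip; split => [h|[c c0 /(LipP _ c0)]]; last first.
  by move=> /le_lt_trans; apply; exact: ltry.
have h0 : (0 <= Lip 1 f)%E by rewrite /Lip le_max lexx.
have hf : Lip 1 f \is a fin_num by rewrite ge0_fin_numE.
exists (fine (Lip 1 f)); first exact: fine_ge0.
by apply/LipP; rewrite ?fineK// fine_ge0.
Qed.

Lemma is_lip_lipc c f : 0 <= c -> lipc c f -> is_lip f.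
Proof. by move=> c0 h; apply/is_lipP; exists c. Qed.

Lemma lipc_cst a : lipc 0 (fun _ : X => a).
Proof. by move=> x y; rewrite subrr normr0 mul0r. Qed.

Lemma is_lip_cst a : is_lip (fun _ : X => a).
Proof. exact: is_lip_lipc (lexx _) (lipc_cst a). Qed.

Lemma lipcD c d f g : lipc c f -> lipc d g -> lipc (c + d) (fun x => f x + g x).
Proof.
move=> hf hg x y; rewrite opprD addrACA mulrDl.
by apply: le_trans (ler_normD _ _) _; exact: lerD.
Qed.

Lemma lipcZ c a f : lipc c f -> lipc (`|a| * c) (fun x => a * f x).
Proof. by move=> hf x y; rewrite -mulrBr normrM -mulrA ler_wpM2l. Qed.

Lemma lipcN c f : lipc c f -> lipc c (fun x => - f x).
Proof. by move=> hf x y; rewrite -opprD normrN. Qed.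

Lemma lipcM a b c d f g : bounded_by a f -> bounded_by b g ->
  lipc c f -> lipc d g -> lipc (a * d + b * c) (fun x => f x * g x).
Proof.
move=> ha hb hf hg x y.
rewrite (_ : _ - _ = f x * (g x - g y) + g y * (f x - f y)); last by ring.
rewrite mulrDl; apply: le_trans (ler_normD _ _) _; rewrite !normrM -!mulrA.
by rewrite lerD// ler_pM.
Qed.

Lemma is_lipD f g : is_lip f -> is_lip g -> is_lip (fun x => f x + g x).
Proof.
move=> /is_lipP[c c0 hc] /is_lipP[d d0 hd].
by apply: is_lip_lipc (lipcD hc hd); exact: addr_ge0.
Qed.

Lemma is_lipZ a f : is_lip f -> is_lip (fun x => a * f x).
Proof.
by move=> /is_lipP[c c0 hc]; apply: is_lip_lipc (lipcZ a hc); exact: mulr_ge0.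
Qed.

Lemma is_lipN f : is_lip f -> is_lip (fun x => - f x).
Proof. by move=> /is_lipP[c c0 hc]; apply: is_lip_lipc (lipcN hc). Qed.

Lemma is_lipB f g : is_lip f -> is_lip g -> is_lip (fun x => f x - g x).
Proof. by move=> hf hg; apply: is_lipD => //; exact: is_lipN. Qed.

Lemma is_lipM a b f g : bounded_by a f -> bounded_by b g ->
  is_lip f -> is_lip g -> is_lip (fun x => f x * g x).
Proof.
move=> ha hb /is_lipP[c c0 hc] /is_lipP[d d0 hd].
(* A negative bound is possible only if [X] is empty, and then every function has Lipschitz constant
   0. *)
have [a0|a0] := lerP 0 a; last first.
  apply: (@is_lip_lipc 0) => // x y.
  by have := le_lt_trans (ha x) a0; rewrite normr_lt0.
have [b0|b0] := lerP 0 b; last first.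
  apply: (@is_lip_lipc 0) => // x y.
  by have := le_lt_trans (hb x) b0; rewrite normr_lt0.
by apply: is_lip_lipc (lipcM ha hb hc hd); rewrite addr_ge0// mulr_ge0.
Qed.

Lemma is_lip_sum (I : Type) (r : seq I) (P : pred I) (f : I -> X -> R) :
  (forall i, is_lip (f i)) -> is_lip (fun x => \sum_(i <- r | P i) f i x).
Proof.
move=> h; elim: r => [|i r ih].
  rewrite (_ : (fun x => _) = fun=> 0); first exact: is_lip_cst.
  by apply/funext => x; rewrite big_nil.
rewrite (_ : (fun x => _) = fun x => (if P i then f i x else 0) +
    \sum_(j <- r | P j) f j x).
  by apply: is_lipD => //; case: (P i) => //; exact: is_lip_cst.
by apply/funext => x; rewrite big_cons; case: (P i) => //; rewrite add0r.
Qed.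

Lemma is_lip_clamp a b f : is_lip f -> is_lip (fun x => clamp a b (f x)).
Proof.
move=> /is_lipP[c c0 hc]; apply: is_lip_lipc c0 _ => x y.
exact: le_trans (clamp_lip _ _ _ _) (hc x y).
Qed.

Lemma lipc_continuous c f : lipc c f -> continuous f.
Proof.
move=> hf x; apply/cvgrPdist_lt => e e0; near=> y.
apply: le_lt_trans (hf x y) _.
have c1 : 0 < `|c| + 1 by rewrite ltr_wpDl.
apply: (@le_lt_trans _ _ ((`|c| + 1) * mdist x y)).
  by rewrite ler_wpM2r ?mdist_ge0// (le_trans (ler_norm _))// lerDl.
rewrite mulrC -ltr_pdivlMr//.
have : ball x (e / (`|c| + 1)) y.
  by near: y; apply: nbhsx_ballx; rewrite divr_gt0.
by rewrite ballEmdist.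
Unshelve. all: by end_near. Qed.

Lemma is_lip_continuous f : is_lip f -> continuous f.
Proof. by move=> /is_lipP[c _ /lipc_continuous]. Qed.

End lipschitz.

Lemma lipc_comp (R : realType) (X Y : metricType R) (c d : R) (f : Y -> R)
    (phi : X -> Y) : 0 <= c ->
  (forall x y, mdist (phi x) (phi y) <= d * mdist x y) ->
  lipc c f -> lipc (c * d) (f \o phi).
Proof.
move=> c0 hphi hf x y; apply: le_trans (hf _ _) _.
by rewrite -mulrA ler_wpM2l.
Qed.

(** * Mass and locality *)

Section multilinear.
Context {R : realType}.
Variables (X : metricType R) (n : nat).
Implicit Types (T : functional X n) (f h : X -> R) (g : 'I_n -> X -> R).

Lemma subst_at_id g i : subst_at g i (g i) = g.
Proof. by apply/funext => j; rewrite /subst_at; case: eqP => // ->. Qed.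

Lemma subst_at_eq g i h : subst_at g i h i = h.
Proof. by rewrite /subst_at eqxx. Qed.

Lemma subst_at_neq g i j h : j != i -> subst_at g i h j = g j.
Proof. by rewrite /subst_at => /negPf ->. Qed.

Lemma subst_at_comm g i j h h' : i != j ->
  subst_at (subst_at g i h) j h' = subst_at (subst_at g j h') i h.
Proof.
move=> ij; apply/funext => k; rewrite /subst_at.
by case: (eqVneq k j) => // ->; rewrite eq_sym (negPf ij).
Qed.

Lemma is_lip_subst g i h : (forall j, is_lip (g j)) -> is_lip h ->
  forall j, is_lip (subst_at g i h j).
Proof. by move=> hg hh j; rewrite /subst_at; case: eqP. Qed.

(* Boundaries of currents satisfy this as well, which is all that the mass bounds
   require. *)
Record mlin T : Prop := {
  mlin_linear : forall a f1 f2 g,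
    is_lip f1 -> is_lip f2 -> (forall i, is_lip (g i)) ->
    T (fun x => a * f1 x + f2 x) g = a * T f1 g + T f2 g ;
  mlin_multilinear : forall a f g i h1 h2,
    is_lip f -> (forall j, is_lip (g j)) -> is_lip h1 -> is_lip h2 ->
    T f (subst_at g i (fun x => a * h1 x + h2 x)) =
    a * T f (subst_at g i h1) + T f (subst_at g i h2) ;
  mlin_cst : forall f g i c, is_lip f -> (forall j, is_lip (g j)) ->
    (forall x, g i x = c) -> T f g = 0 }.

Lemma current_mlin T : is_current T -> mlin T.
Proof.
move=> hT; split; [exact: current_linear|exact: current_multilinear|].
move=> f g i c hf hg gc; apply: (current_local hT) => //.
by exists i, c, setT; split => //; exact: openT.
Qed.

Variable T : functional X n.
Hypothesis hT : mlin T.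

Lemma mlin0 g : (forall i, is_lip (g i)) -> T (fun=> 0) g = 0.
Proof.
move=> hg; have h0 := is_lip_cst X (0 : R).
have := mlin_linear hT (-1) h0 h0 hg.
rewrite (_ : (fun x => _) = fun=> 0); last by apply/funext => x; rewrite mulr0 addr0.
by rewrite mulN1r addNr.
Qed.

Lemma mlinZ a f g : is_lip f -> (forall i, is_lip (g i)) ->
  T (fun x => a * f x) g = a * T f g.
Proof.
move=> hf hg; have h0 := is_lip_cst X (0 : R).
rewrite -[RHS]addr0 -(mlin0 hg) -(mlin_linear hT)//.
by congr (T _ g); apply/funext => x; rewrite addr0.
Qed.

Lemma mlinD f1 f2 g : is_lip f1 -> is_lip f2 -> (forall i, is_lip (g i)) ->
  T (fun x => f1 x + f2 x) g = T f1 g + T f2 g.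
Proof.
move=> h1 h2 hg; rewrite -[T f1 g]mul1r -(mlin_linear hT)//.
by congr (T _ g); apply/funext => x; rewrite mul1r.
Qed.

Lemma mlinN f g : is_lip f -> (forall i, is_lip (g i)) ->
  T (fun x => - f x) g = - T f g.
Proof.
move=> hf hg; rewrite -mulN1r -mlinZ//.
by congr (T _ g); apply/funext => x; rewrite mulN1r.
Qed.

Lemma mlinB f1 f2 g : is_lip f1 -> is_lip f2 -> (forall i, is_lip (g i)) ->
  T (fun x => f1 x - f2 x) g = T f1 g - T f2 g.
Proof.
by move=> h1 h2 hg; rewrite mlinD// ?mlinN//; exact: is_lipN.
Qed.

Lemma mlin_sum (I : Type) (r : seq I) (P : pred I) (F : I -> X -> R) g :
  (forall i, is_lip (F i)) -> (forall i, is_lip (g i)) ->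
  T (fun x => \sum_(i <- r | P i) F i x) g = \sum_(i <- r | P i) T (F i) g.
Proof.
move=> hF hg; elim: r => [|i r ih].
  rewrite [RHS]big_nil -[RHS](mlin0 hg); congr (T _ g).
  by apply/funext => x; rewrite big_nil.
rewrite big_cons -ih; case: ifPn => Pi.
  rewrite -mlinD//; last exact: is_lip_sum.
  by congr (T _ g); apply/funext => x; rewrite big_cons Pi.
by congr (T _ g); apply/funext => x; rewrite big_cons (negPf Pi).
Qed.

Lemma mlin_slot0 f g i : is_lip f -> (forall i, is_lip (g i)) ->
  T f (subst_at g i (fun=> 0)) = 0.
Proof.
move=> hf hg; apply: (mlin_cst hT (i := i) (c := 0)) => //.
  by apply: is_lip_subst => //; exact: is_lip_cst.
by rewrite subst_at_eq.
Qed.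

Lemma mlin_slotZ a f g i h : is_lip f -> (forall i, is_lip (g i)) -> is_lip h ->
  T f (subst_at g i (fun x => a * h x)) = a * T f (subst_at g i h).
Proof.
move=> hf hg hh; have h0 := is_lip_cst X (0 : R).
rewrite -[RHS]addr0 -(mlin_slot0 i hf hg) -(mlin_multilinear hT)//.
by congr (T f (subst_at _ _ _)); apply/funext => x; rewrite addr0.
Qed.

Lemma mlin_slotD f g i h1 h2 : is_lip f -> (forall i, is_lip (g i)) ->
  is_lip h1 -> is_lip h2 ->
  T f (subst_at g i (fun x => h1 x + h2 x)) =
  T f (subst_at g i h1) + T f (subst_at g i h2).
Proof.
move=> hf hg h1l h2l; rewrite -[T f (subst_at g i h1)]mul1r -(mlin_multilinear hT)//.
by congr (T f (subst_at _ _ _)); apply/funext => x; rewrite mul1r.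
Qed.

Lemma mlin_slotB f g i h1 h2 : is_lip f -> (forall i, is_lip (g i)) ->
  is_lip h1 -> is_lip h2 ->
  T f (subst_at g i (fun x => h1 x - h2 x)) =
  T f (subst_at g i h1) - T f (subst_at g i h2).
Proof.
move=> hf hg h1l h2l; rewrite -[- T f _]mulN1r -mlin_slotZ// -mlin_slotD//; last exact: is_lipZ.
by congr (T f (subst_at _ _ _)); apply/funext => x; rewrite mulN1r.
Qed.

Lemma mlin_slot_sum (I : Type) (r : seq I) (P : pred I) (F : I -> X -> R) f g i :
  (forall k, is_lip (F k)) -> is_lip f -> (forall j, is_lip (g j)) ->
  T f (subst_at g i (fun x => \sum_(k <- r | P k) F k x)) =
  \sum_(k <- r | P k) T f (subst_at g i (F k)).
Proof.
move=> hF hf hg; elim: r => [|k r ih].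
  rewrite [RHS]big_nil -[RHS](mlin_slot0 i hf hg); congr (T f (subst_at _ _ _)).
  by apply/funext => x; rewrite big_nil.
rewrite big_cons -ih; case: ifPn => Pk.
  rewrite -mlin_slotD//; last exact: is_lip_sum.
  by congr (T f (subst_at _ _ _)); apply/funext => x; rewrite big_cons Pk.
by congr (T f (subst_at _ _ _)); apply/funext => x; rewrite big_cons (negPf Pk).
Qed.

Lemma mlin_scale (k : 'I_n -> R) f g : is_lip f -> (forall i, is_lip (g i)) ->
  T f (fun i x => k i * g i x) = (\prod_i k i) * T f g.
Proof.
move=> hf hg.
suff H (s : seq 'I_n) : uniq s ->
    T f (fun i x => (if i \in s then k i else 1) * g i x) =
    (\prod_(i <- s) k i) * T f g.
  have := H (enum 'I_n) (enum_uniq _); rewrite big_enum => <-.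
  by congr (T f _); apply/funext => i; apply/funext => x; rewrite mem_enum.
elim: s => [_|i s ih /= /andP[is_ us]].
  rewrite big_nil mul1r; congr (T f _).
  by apply/funext => i; apply/funext => x; rewrite mul1r.
rewrite big_cons -mulrA -ih//.
set gs := (fun i x => (if i \in s then _ else _) * _).
have hgs j : is_lip (gs j) by exact: is_lipZ.
rewrite -[X in _ = _ * T f X](subst_at_id gs i) -mlin_slotZ//.
congr (T f _); apply/funext => j; rewrite /subst_at inE /gs.
case: eqP => [->|//]; rewrite (negPf is_) orTb.
by apply/funext => x; rewrite mul1r.
Qed.

(** Homogeneity reduces this to the definition of [mass]: divide the first arguments by [a], with a
    sign, and slot [i] by [c i]. Stating it for a finite family is essential: after a partition of
    unity the pieces are paid for by the sum of the [|f_ p|], not by their number. *)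
Lemma mass_bound (M : R) (P : finType) (f_ : P -> X -> R) (g_ : P -> 'I_n -> X -> R)
    (a : R) (c : 'I_n -> R) : (mass T <= M%:E)%E ->
  0 <= a -> (forall i, 0 <= c i) ->
  (forall p, is_lip (f_ p)) -> (forall p i, lipc (c i) (g_ p i)) ->
  (forall x, \sum_p `|f_ p x| <= a) ->
  `|\sum_p T (f_ p) (g_ p)| <= M * a * \prod_i c i.
Proof.
move=> hM a0 c0 hf hg fa.
have hg' p i : is_lip (g_ p i) by apply: is_lip_lipc (hg p i).
(* The empty family is admissible in [mass T] and has value 0. *)
have M0 : 0 <= M.
  rewrite -lee_fin; apply: le_trans hM; apply: ereal_sup_ubound.
  exists 0%N, (fun _ _ => 0), (fun _ _ _ => 0); split => //.
  - by case.
  - by case.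
  - by move=> x; rewrite big_ord0.
  - by rewrite big_ord0.
have [a00|a00] := eqVneq a 0.
  rewrite a00 mulr0 mul0r big1 ?normr0// => p _.
  rewrite (_ : f_ p = fun=> 0) ?mlin0//.
  apply/funext => x; apply/eqP; rewrite -normr_le0 -[leRHS]a00.
  by apply: le_trans (fa x); rewrite (bigD1 p)//= lerDl sumr_ge0.
(* A zero Lipschitz constant makes the slot constant, once [X] has a point to supply the
   constant. *)
have [/existsP[i /eqP ci0]|] := boolP [exists i, c i == 0].
  rewrite [X in _ * X](bigD1 i)//= ci0 mul0r mulr0 big1 ?normr0// => p _.
  have [[x0]|nx] := pselect (inhabited X); last first.
    rewrite (_ : f_ p = fun=> 0) ?mlin0//; apply/funext => x.
    by exfalso; apply: nx; split.
  apply: (mlin_cst hT (i := i) (c := g_ p i x0)) => // x.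
  apply/eqP; rewrite -subr_eq0 -normr_le0.
  by have := hg p i x x0; rewrite ci0 mul0r.
move=> /existsPn cn0.
have cgt i : 0 < c i by rewrite lt_neqAle eq_sym (cn0 i) c0.
have agt : 0 < a by rewrite lt_neqAle eq_sym a00.
have Cgt : 0 < \prod_i c i by apply: prodr_gt0.
have key (e : R) : `|e| = 1 -> e * \sum_p T (f_ p) (g_ p) <= M * a * \prod_i c i.
  move=> e1; rewrite -mulrA -ler_pdivrMr ?mulr_gt0// -lee_fin.
  apply: le_trans hM; apply: ereal_sup_ubound.
  exists #|P|, (fun l x => (e / a) * f_ (enum_val l) x),
    (fun l i x => (c i)^-1 * g_ (enum_val l) i x); split.
  - by move=> l; exact: is_lipZ.
  - move=> l i; apply/LipP => //.
    have := lipcZ (c i)^-1 (hg (enum_val l) i).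
    by rewrite gtr0_norm ?invr_gt0// mulVf ?gt_eqF.
  - move=> x; rewrite -(big_enum_val (fun p => `|e / a * f_ p x|))/=.
    rewrite (eq_bigr (fun p => a^-1 * `|f_ p x|)); last first.
      by move=> p _; rewrite !normrM e1 mul1r normfV (gtr0_norm agt).
    by rewrite -mulr_sumr mulrC ler_pdivrMr// mul1r.
  - congr EFin; rewrite mulr_sumr mulr_suml.
    rewrite -(big_enum_val (fun p => T (fun x => e / a * f_ p x)
      (fun i x => (c i)^-1 * g_ p i x)))/=.
    apply: eq_bigr => p _; rewrite mlinZ//; last by move=> i; exact: is_lipZ.
    rewrite mlin_scale// invfM prodfV; ring.
have [s0|s0] := ger0P (\sum_p T (f_ p) (g_ p)).
  by have := key 1 (normr1 _); rewrite mul1r.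
by have := key (-1) (normrN1 _); rewrite mulN1r.
Qed.

Lemma mass_bound1 (M : R) f g (a : R) (c : 'I_n -> R) : (mass T <= M%:E)%E ->
  0 <= a -> (forall i, 0 <= c i) ->
  is_lip f -> (forall i, lipc (c i) (g i)) -> (forall x, `|f x| <= a) ->
  `|T f g| <= M * a * \prod_i c i.
Proof.
move=> hM a0 c0 hf hg fa.
have := @mass_bound M unit (fun=> f) (fun=> g) a c hM a0 c0 (fun=> hf) (fun=> hg).
rewrite (big_pred1 tt) => [|[]//]; apply => x.
by rewrite (big_pred1 tt) => [|[]//]; exact: fa.
Qed.

End multilinear.

Section localization.
Context {R : realType}.
Variables (X : metricType R) (n : nat) (T : functional X n).
Hypothesis hT : is_current T.
Implicit Types (f h : X -> R) (g : 'I_n -> X -> R).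

(** [vanishes_off] speaks of the closed support, so [f] has to vanish on a whole neighbourhood of
    [K]: the complement of [U] is closed and contains the closure of the set where [f] is
    nonzero. *)
Lemma current_off (K U : set X) f g : vanishes_off T K -> open U -> K `<=` U ->
  is_lip f -> (forall i, is_lip (g i)) -> (forall x, U x -> f x = 0) ->
  T f g = 0.
Proof.
move=> hK oU KU hf hg fU; apply: hK => //.
rewrite -subset0 => x [fx Kx].
have : closure (~` U) x.
  by apply: closure_subset fx => y /= fy Uy; move: fy; rewrite fU// eqxx.
have /closure_id <- : closed (~` U) by exact: open_closedC.
by move=> nUx; apply: nUx; exact: KU.
Qed.

Lemma current_eq_near (K U : set X) f f' g : vanishes_off T K -> open U ->
  K `<=` U -> is_lip f -> is_lip f' -> (forall i, is_lip (g i)) ->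
  (forall x, U x -> f x = f' x) -> T f g = T f' g.
Proof.
move=> hK oU KU hf hf' hg e; apply/eqP; rewrite -subr_eq0.
rewrite -(mlinB (current_mlin hT))//; apply/eqP.
apply: (current_off hK oU KU) => //; first exact: is_lipB.
by move=> x Ux; rewrite e// subrr.
Qed.

Lemma current_slot_eq (U : set X) f g i h h' : open U -> spt f `<=` U ->
  is_lip f -> (forall j, is_lip (g j)) -> is_lip h -> is_lip h' ->
  (forall x, U x -> h x = h' x) ->
  T f (subst_at g i h) = T f (subst_at g i h').
Proof.
move=> oU fU hf hg hh hh' e; apply/eqP; rewrite -subr_eq0.
rewrite -(mlin_slotB (current_mlin hT))//; apply/eqP.
apply: (current_local hT) => //.
  by apply: is_lip_subst => //; exact: is_lipB.
by exists i, 0, U; split => // x Ux; rewrite subst_at_eq e// subrr.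
Qed.

Lemma current_slots_eq (U : set X) f g g' : open U -> spt f `<=` U ->
  is_lip f -> (forall j, is_lip (g j)) -> (forall j, is_lip (g' j)) ->
  (forall i x, U x -> g i x = g' i x) -> T f g = T f g'.
Proof.
move=> oU fU hf hg hg' e.
suff H (s : seq 'I_n) : T f g = T f (fun i => if i \in s then g' i else g i).
  rewrite (H (enum 'I_n)); congr (T f _); apply/funext => i.
  by rewrite mem_enum.
elim: s => [//|i s ->].
set gs := (fun i => if i \in s then _ else _).
have hgs j : is_lip (gs j) by rewrite /gs; case: ifP.
have -> : (fun j => if j \in i :: s then g' j else g j) = subst_at gs i (g' i).
  by apply/funext => j; rewrite /subst_at inE /gs; case: eqP => [->|].
rewrite -{1}(subst_at_id gs i).
apply: (@current_slot_eq U) => //.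
by move=> x Ux; rewrite /gs; case: ifP => // _; exact: e.
Qed.

(** Clamping [f] to [[-a, a]] alters it only off [U], which the current does not see; a bound near
    [K] is as good as a global one. *)
Lemma current_bound_near (M : R) (K U : set X) f g (a : R) (c : 'I_n -> R) :
  (mass T <= M%:E)%E -> vanishes_off T K -> open U -> K `<=` U ->
  0 <= a -> (forall i, 0 <= c i) ->
  is_lip f -> (forall i, lipc (c i) (g i)) -> (forall x, U x -> `|f x| <= a) ->
  `|T f g| <= M * a * \prod_i c i.
Proof.
move=> hM hK oU KU a0 c0 hf hg fa.
have hg' i : is_lip (g i) by apply: is_lip_lipc (hg i).
rewrite (@current_eq_near K U f (fun x => clamp (- a) a (f x)))//.
- apply: (mass_bound1 (current_mlin hT) hM) => //; first exact: is_lip_clamp.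
  by move=> x; rewrite ler_norml clamp_itv//; lra.
- exact: is_lip_clamp.
- by move=> x Ux; rewrite clamp_id// -ler_norml fa.
Qed.

(* A compact set carrying T reduces everything to bounded first arguments. *)
Lemma current_trunc (K : set X) f : compact K -> is_lip f ->
  exists a, [/\ 0 <= a, open [set x | `|f x| < a] & K `<=` [set x | `|f x| < a]].
Proof.
move=> cK hf; have cf := is_lip_continuous hf.
have : compact (f @` K).
  by apply: continuous_compact => //; exact: continuous_subspaceT.
move=> /compact_bounded [M [_ hM]]; exists (`|M| + 2); split.
- by rewrite addr_ge0.
- apply: (@open_comp _ _ (fun x => `|f x|) [set y | y < `|M| + 2]).
    by move=> x _; apply: continuous_comp; [exact: cf|exact: norm_continuous].
  exact: open_lt.
- move=> x Kx /=; apply: (@le_lt_trans _ _ (`|M| + 1)); last lra.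
  apply: hM; last by exists x.
  by rewrite (le_lt_trans (ler_norm _))// ltrDl.
Qed.

End localization.

Section boundary_multilinear.
Context {R : realType}.
Variables (X : metricType R) (n : nat) (T : functional X n.+1).
Hypothesis hT : is_current T.

Lemma extend_head_lip (f : X -> R) (g : 'I_n -> X -> R) : is_lip f ->
  (forall i, is_lip (g i)) -> forall j, is_lip (extend_head f g j).
Proof. by move=> hf hg j; rewrite /extend_head; case: unliftP. Qed.

Lemma extend_head0 (f : X -> R) (g : 'I_n -> X -> R) :
  extend_head f g ord0 = f.
Proof. by rewrite /extend_head unlift_none. Qed.

Lemma extend_head_lift (f : X -> R) (g : 'I_n -> X -> R) i :
  extend_head f g (lift ord0 i) = g i.
Proof. by rewrite /extend_head liftK. Qed.

Lemma extend_headE (f h : X -> R) (g : 'I_n -> X -> R) :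
  extend_head f g = subst_at (extend_head h g) ord0 f.
Proof.
apply/funext => j; rewrite /subst_at; case: (unliftP ord0 j) => [i ->|->].
  by rewrite !extend_head_lift eq_sym (negPf (neq_lift _ _)).
by rewrite extend_head0 eqxx.
Qed.

Lemma extend_head_subst (f h : X -> R) (g : 'I_n -> X -> R) i :
  extend_head f (subst_at g i h) = subst_at (extend_head f g) (lift ord0 i) h.
Proof.
apply/funext => j; rewrite /subst_at; case: (unliftP ord0 j) => [k ->|->].
  by rewrite !extend_head_lift (inj_eq lift_inj).
by rewrite !extend_head0 (negPf (neq_lift _ _)).
Qed.

Lemma boundary_mlin : mlin (boundary T).
Proof.
have h1 := is_lip_cst X (1 : R).
split => /=.
- move=> a f1 f2 g hf1 hf2 hg.
  rewrite (extend_headE (fun x => a * f1 x + f2 x) (fun=> 0)).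
  rewrite (extend_headE f1 (fun=> 0)) (extend_headE f2 (fun=> 0)).
  rewrite (mlin_multilinear (current_mlin hT))//.
  by apply: extend_head_lip => //; exact: is_lip_cst.
- move=> a f g i h1' h2' hf hg hh1 hh2; rewrite !extend_head_subst.
  by rewrite (mlin_multilinear (current_mlin hT))//; exact: extend_head_lip.
- move=> f g i c hf hg gc.
  apply: (mlin_cst (current_mlin hT) (i := lift ord0 i) (c := c)) => //.
    exact: extend_head_lip.
  by move=> x; rewrite extend_head_lift gc.
Qed.

End boundary_multilinear.

Section row_norm.
Context {R : realType} {n : nat}.
Implicit Types x y : 'rV[R]_n.

Lemma row_norm_coord x i : `|x ord0 i| <= `|x|.
Proof. by rewrite [leRHS]/Num.norm/= mx_normrE; apply/bigmax_geP; right; exists (ord0, i). Qed.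

Lemma row_norm_le x (c : R) : 0 <= c -> (forall i, `|x ord0 i| <= c) -> `|x| <= c.
Proof.
move=> c0 h; rewrite [leLHS]/Num.norm/= mx_normrE; apply/bigmax_leP; split => //.
by move=> [i j] _ /=; rewrite ord1.
Qed.

Lemma row_norm_lt x (c : R) : 0 < c -> (forall i, `|x ord0 i| < c) -> `|x| < c.
Proof.
move=> c0 h; rewrite [ltLHS]/Num.norm/= mx_normrE; apply/bigmax_ltP; split => //.
by move=> [i j] _ /=; rewrite ord1.
Qed.

Lemma mdist_rowE x y : mdist x y = `|y - x|.
Proof. by []. Qed.

End row_norm.

(** * Splines and functions with Lipschitz gradient *)

Section c11_line.
Context {R : realType}.
Implicit Types (a da : R -> R).

(** [da] is the derivative of [a], expressed by a quadratic Taylor bound so that sums, products and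
    dilations require no differentiation. One constant serves for all the bounds, as only its
    existence matters. *)
Definition C11_line a da : Prop := exists L : R, [/\ 0 <= L,
  forall y, `|da y| <= L, forall y z, `|da y - da z| <= L * `|y - z|,
  forall y z, `|a y - a z| <= L * `|y - z| &
  forall y z, `|a y - a z - da z * (y - z)| <= L * `|y - z| ^+ 2].

Lemma mean_value a da (y z : R) : (forall x, is_derive (x : R) (1 : R) a (da x)) ->
  exists2 c, `|c - z| <= `|y - z| & a y - a z = da c * (y - z).
Proof.
move=> ha; have ca x : {for x, continuous a}.
  by apply: differentiable_continuous; apply/derivable1_diffP; case: (ha x).
have [zy|yz] := leP z y.
  have [|c] := @MVT_segment R a da z y zy (fun x _ => ha x).
    by apply: continuous_subspaceT.
  rewrite in_itv/= => /andP[zc cy] e; exists c => //.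
  by rewrite !ger0_norm ?subr_ge0// lerB.
have [|c] := @MVT_segment R a da y z (ltW yz) (fun x _ => ha x).
  by apply: continuous_subspaceT.
rewrite in_itv/= => /andP[yc cz] e; exists c.
  by rewrite !ler0_norm ?subr_le0// ?(ltW yz)//; lra.
by rewrite -[LHS]opprB e; ring.
Qed.

Lemma C11_line_derive a da (L : R) : 0 <= L -> (forall x, is_derive (x : R) (1 : R) a (da x)) ->
  (forall y, `|da y| <= L) -> (forall y z, `|da y - da z| <= L * `|y - z|) ->
  C11_line a da.
Proof.
move=> L0 ha hb hl; exists L; split => // y z; have [c cz ->] := mean_value y z ha.
  by rewrite normrM ler_wpM2r.
rewrite -mulrBl normrM expr2 mulrA ler_wpM2r//.
by apply: le_trans (hl _ _) _; rewrite ler_wpM2l.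
Qed.

Lemma is_derive_quadratic a (z d C : R) : 0 <= C ->
  (forall y, `|y - z| <= 1 -> `|a y - a z - d * (y - z)| <= C * `|y - z| ^+ 2) ->
  is_derive z (1 : R) a d.
Proof.
move=> C0 h; have tA (t : R) : t *: (1 : R) = t by rewrite /GRing.scale/= mulr1.
have H : (fun t => t^-1 *: ((a \o shift z) (t *: (1 : R)) - a z)) @ 0^' --> d.
  apply/cvgrPdist_le => e e0; near=> t; rewrite /= tA.
  have t0 : t != 0 by near: t; exact: nbhs_dnbhs_neq.
  have tn : 0 < `|t| by rewrite normr_gt0.
  have t1 : `|t| <= 1 by near: t; exact: dnbhs0_le.
  have te : `|t| <= e / (C + 1).
    by near: t; apply: dnbhs0_le; rewrite divr_gt0// ltr_wpDl.
  have := h (t + z); rewrite addrK => /(_ t1) ht.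
  rewrite distrC (_ : _ - d = t^-1 * (a (t + z) - a z - d * t)); last first.
    by rewrite /GRing.scale/=; field.
  rewrite normrM normfV mulrC ler_pdivrMr//; apply: le_trans ht _.
  rewrite expr2 mulrA ler_wpM2r//.
  move: te; rewrite ler_pdivlMr ?ltr_wpDl//; nra.
have dv : derivable a z 1 by apply/cvg_ex; exists d.
apply: DeriveDef => //; exact: (cvg_lim _ H).
Unshelve. all: by end_near. Qed.

Lemma C11_line_affine a da (s t : R) : C11_line a da ->
  C11_line (fun x => a (s * x + t)) (fun x => s * da (s * x + t)).
Proof.
move=> [L [L0 h1 h2 h3 h4]]; exists (L * (`|s| + `|s| ^+ 2)).
have s0 := normr_ge0 s; have e y z : s * y + t - (s * z + t) = s * (y - z) by ring.
split.
- by rewrite mulr_ge0// addr_ge0// exprn_ge0.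
- move=> y; rewrite normrM; have := h1 (s * y + t); nra.
- move=> y z; rewrite -mulrBr normrM.
  have := h2 (s * y + t) (s * z + t); rewrite e normrM.
  set u := `|da _ - _|; have := normr_ge0 (y - z); set v := `|y - z| => v0 huv.
  have : `|s| * u <= `|s| * (L * (`|s| * v)) by rewrite ler_wpM2l.
  have : 0 <= L * `|s| * v by rewrite !mulr_ge0.
  nra.
- move=> y z; have := h3 (s * y + t) (s * z + t); rewrite e normrM.
  move=> /le_trans; apply; rewrite mulrA ler_wpM2r// ler_wpM2l//.
  by rewrite lerDl exprn_ge0.
- move=> y z; have := h4 (s * y + t) (s * z + t); rewrite e normrM mulrCA mulrA.
  move=> /le_trans; apply; rewrite exprMn mulrA ler_wpM2r ?exprn_ge0//.
  by rewrite ler_wpM2l// lerDr.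
Qed.

End c11_line.

Section splines.
Context {R : realType}.
Implicit Types (x y z : R).

(** [pos], [sq] and [cu] are the truncated powers of degree 1, 2, 3, normalized so that each is the
    derivative of the next; B-splines are their finite differences. *)
Definition pos x : R := Num.max 0 x.
Definition sq x : R := pos x ^+ 2 / 2.
Definition cu x : R := pos x ^+ 3 / 6.

Lemma posE x : (pos x = 0 /\ x <= 0) \/ (pos x = x /\ 0 <= x).
Proof. by rewrite /pos /Num.max; case: ltP => h; [right|left]; split => //; exact: ltW. Qed.

Lemma sq_quadratic y z : `|sq y - sq z - pos z * (y - z)| <= 1 * `|y - z| ^+ 2.
Proof.
rewrite mul1r real_normK ?num_real// /sq ler_norml.
have d0 := sqr_ge0 (y - z).
by case: (posE y) => -[-> hy]; case: (posE z) => -[-> hz];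
  rewrite ?expr0n/=; apply/andP; split; nra.
Qed.

Lemma pos_id x : 0 <= x -> pos x = x.
Proof. by case: (posE x) => -[-> //] h1 h2; apply/eqP; rewrite eq_le h1 h2. Qed.

Lemma pos_lip y z : `|pos y - pos z| <= `|y - z|.
Proof.
have := posE y; have := posE z.
case: (ger0P (y - z)) => h [[-> hz]|[-> hz]] [[-> hy]|[-> hy]];
  rewrite ler_norml; lra.
Qed.

Lemma cu_quadratic y z : `|y - z| <= 1 ->
  `|cu y - cu z - sq z * (y - z)| <= (`|z| + 1) * `|y - z| ^+ 2.
Proof.
move=> h1; rewrite /cu /sq real_normK ?num_real// ler_norml.
move: h1; rewrite ler_norml => /andP[h1 h2].
have z0 := normr_ge0 z; have z1 := ler_norm z.
have d0 := sqr_ge0 (y - z).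
case: (posE y) => -[-> hy]; case: (posE z) => -[-> hz].
- by rewrite !expr0n/= !mul0r subrr sub0r oppr0; nra.
- have -> : 0 ^+ 3 / 6 - z ^+ 3 / 6 - z ^+ 2 / 2 * (y - z) = z ^+ 2 / 6 * (2 * z - 3 * y) by field.
  have zz : z ^+ 2 <= (y - z) ^+ 2 by nra.
  have : 2 * z - 3 * y <= 3 by lra.
  have : 0 <= 2 * z - 3 * y by lra.
  set w := 2 * z - 3 * y => w0 w3.
  have zz0 := sqr_ge0 z; have : z ^+ 2 / 6 * w <= z ^+ 2 / 6 * 3 by nra.
  by move=> H; apply/andP; split; nra.
- have -> : y ^+ 3 / 6 - 0 ^+ 3 / 6 - 0 ^+ 2 / 2 * (y - z) = y ^+ 2 / 6 * y by field.
  have yy : y ^+ 2 <= (y - z) ^+ 2 by nra.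
  have y1 : y <= 1 by lra.
  have yy0 := sqr_ge0 y; have : y ^+ 2 / 6 * y <= y ^+ 2 / 6 * 1 by nra.
  by move=> H; apply/andP; split; nra.
- have -> : y ^+ 3 / 6 - z ^+ 3 / 6 - z ^+ 2 / 2 * (y - z) =
    (y - z) ^+ 2 * ((y + 2 * z) / 6) by field.
  rewrite ger0_norm// in z0 z1 *.
  by apply/andP; split; nra.
Qed.

(** [hat] is the linear B-spline on [0, 2] and [spl] the quadratic one on [0, 3]; [Th] and [Spl] are
    their primitives, rising from 0 to 1, and [dspl] is the derivative of [spl]. Degree 2 is the
    least for which the splines are C^(1,1). *)
Definition hat x := pos x - 2 * pos (x - 1) + pos (x - 2).
Definition Th x := sq x - 2 * sq (x - 1) + sq (x - 2).
Definition dspl x := hat x - hat (x - 1).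
Definition spl x := Th x - Th (x - 1).
Definition Spl x := cu x - 3 * cu (x - 1) + 3 * cu (x - 2) - cu (x - 3).

Lemma hat_ge0 x : 0 <= hat x.
Proof.
rewrite /hat; case: (posE x) => -[-> ?]; case: (posE (x - 1)) => -[-> ?];
  case: (posE (x - 2)) => -[-> ?]; lra.
Qed.

Lemma hat_le1 x : hat x <= 1.
Proof.
rewrite /hat; case: (posE x) => -[-> ?]; case: (posE (x - 1)) => -[-> ?];
  case: (posE (x - 2)) => -[-> ?]; lra.
Qed.

Lemma hat_lo x : x <= 0 -> hat x = 0.
Proof.
move=> x0; rewrite /hat; case: (posE x) => -[-> ?]; case: (posE (x - 1)) => -[-> ?];
  case: (posE (x - 2)) => -[-> ?]; lra.
Qed.

Lemma hat_hi x : 2 <= x -> hat x = 0.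
Proof.
move=> x0; rewrite /hat; case: (posE x) => -[-> ?]; case: (posE (x - 1)) => -[-> ?];
  case: (posE (x - 2)) => -[-> ?]; lra.
Qed.

Lemma Th_lo x : x <= 0 -> Th x = 0.
Proof.
move=> x0; rewrite /Th /sq; case: (posE x) => -[-> ?]; case: (posE (x - 1)) => -[-> ?];
  case: (posE (x - 2)) => -[-> ?]; nra.
Qed.

Lemma Th_hi x : 2 <= x -> Th x = 1.
Proof.
by move=> x0; rewrite /Th /sq !pos_id; try lra; field.
Qed.

Lemma Th_itv x : 0 <= Th x <= 1.
Proof.
rewrite /Th /sq; case: (posE x) => -[-> ?]; case: (posE (x - 1)) => -[-> ?];
  case: (posE (x - 2)) => -[-> ?]; apply/andP; split; nra.
Qed.

Lemma spl_ge0 x : 0 <= spl x.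
Proof.
rewrite /spl /Th /sq; have -> : x - 1 - 1 = x - 2 by ring.
have -> : x - 1 - 2 = x - 3 by ring.
case: (posE x) => -[-> ?]; case: (posE (x - 1)) => -[-> ?];
  case: (posE (x - 2)) => -[-> ?]; case: (posE (x - 3)) => -[-> ?]; try lra; nra.
Qed.

Lemma spl_le1 x : spl x <= 1.
Proof. by rewrite /spl; have := Th_itv x; have := Th_itv (x - 1); lra. Qed.

Lemma spl_lo x : x <= 0 -> spl x = 0.
Proof. by move=> x0; rewrite /spl !Th_lo ?subrr//; lra. Qed.

Lemma spl_hi x : 3 <= x -> spl x = 0.
Proof. by move=> x0; rewrite /spl !Th_hi ?subrr//; lra. Qed.

Lemma Spl_lo x : x <= 0 -> Spl x = 0.
Proof.
move=> x0; rewrite /Spl /cu; case: (posE x) => -[-> ?]; case: (posE (x - 1)) => -[-> ?];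
  case: (posE (x - 2)) => -[-> ?]; case: (posE (x - 3)) => -[-> ?]; try lra; nra.
Qed.

Lemma Spl_hi x : 3 <= x -> Spl x = 1.
Proof.
by move=> x0; rewrite /Spl /cu !pos_id; try lra; field.
Qed.

Lemma hat_lip y z : `|hat y - hat z| <= 4 * `|y - z|.
Proof.
have := pos_lip y z; have := pos_lip (y - 1) (z - 1); have := pos_lip (y - 2) (z - 2).
have -> : y - 1 - (z - 1) = y - z by ring.
have -> : y - 2 - (z - 2) = y - z by ring.
rewrite /hat !ler_norml; lra.
Qed.

Lemma dspl_lip y z : `|dspl y - dspl z| <= 8 * `|y - z|.
Proof.
have := hat_lip y z; have := hat_lip (y - 1) (z - 1).
have -> : y - 1 - (z - 1) = y - z by ring.
rewrite /dspl !ler_norml; lra.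
Qed.

Lemma dspl_bound y : `|dspl y| <= 8.
Proof.
have := hat_ge0 y; have := hat_ge0 (y - 1); have := hat_le1 y; have := hat_le1 (y - 1).
rewrite /dspl !ler_norml; lra.
Qed.

Lemma spl_quadratic y z : `|spl y - spl z - dspl z * (y - z)| <= 8 * `|y - z| ^+ 2.
Proof.
have := sq_quadratic y z; have := sq_quadratic (y - 1) (z - 1).
have := sq_quadratic (y - 2) (z - 2); have := sq_quadratic (y - 3) (z - 3).
have -> : y - 1 - (z - 1) = y - z by ring.
have -> : y - 2 - (z - 2) = y - z by ring.
have -> : y - 3 - (z - 3) = y - z by ring.
rewrite /spl /dspl /Th /hat.
have -> : y - 1 - 1 = y - 2 by ring. have -> : y - 1 - 2 = y - 3 by ring.
have -> : z - 1 - 1 = z - 2 by ring. have -> : z - 1 - 2 = z - 3 by ring.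
rewrite !ler_norml; lra.
Qed.

Lemma spl_derive z : is_derive z (1 : R) spl (dspl z).
Proof. by apply: (@is_derive_quadratic _ _ _ _ 8) => // y _; exact: spl_quadratic. Qed.

Lemma Spl_derive z : is_derive z (1 : R) Spl (spl z).
Proof.
apply: (@is_derive_quadratic _ _ _ _ (8 * (`|z| + 4))).
  by rewrite mulr_ge0// addr_ge0.
move=> y h; have := @cu_quadratic y z h.
have := @cu_quadratic (y - 1) (z - 1); have := @cu_quadratic (y - 2) (z - 2).
have := @cu_quadratic (y - 3) (z - 3).
have -> : y - 1 - (z - 1) = y - z by ring.
have -> : y - 2 - (z - 2) = y - z by ring.
have -> : y - 3 - (z - 3) = y - z by ring.
have B (k : R) : 0 <= k -> k <= 3 -> (`|z - k| + 1) * `|y - z| ^+ 2 <=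
    (`|z| + 4) * `|y - z| ^+ 2.
  move=> k0 k3; rewrite ler_wpM2r ?exprn_ge0//.
  have : `|z - k| <= `|z| + `|k| by exact: ler_normB.
  by rewrite (ger0_norm k0); lra.
move=> /(_ h) h3 /(_ h) h2 /(_ h) h1 h0.
have {}h3 := le_trans h3 (B 3 ltac:(lra) ltac:(lra)).
have {}h2 := le_trans h2 (B 2 ltac:(lra) ltac:(lra)).
have {}h1 := le_trans h1 (B 1 ltac:(lra) ltac:(lra)).
have {}h0 : `|cu y - cu z - sq z * (y - z)| <= (`|z| + 4) * `|y - z| ^+ 2.
  by apply: le_trans h0 _; rewrite ler_wpM2r ?exprn_ge0//; lra.
move: h0 h1 h2 h3; rewrite -[8 * _ * _]mulrA.
rewrite /Spl /spl /Th.
have -> : z - 1 - 1 = z - 2 by ring. have -> : z - 1 - 2 = z - 3 by ring.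
set Q := (`|z| + 4) * _.
rewrite !ler_norml; lra.
Qed.

Lemma spl_C11 : C11_line spl dspl.
Proof.
apply: (@C11_line_derive _ _ _ 8) => //; [exact: spl_derive|exact: dspl_bound|].
exact: dspl_lip.
Qed.

Lemma spl_lip y z : `|spl y - spl z| <= 8 * `|y - z|.
Proof.
have [c _ ->] := mean_value y z spl_derive.
by rewrite normrM ler_wpM2r// dspl_bound.
Qed.

Lemma Spl_C11 : C11_line Spl spl.
Proof.
apply: (@C11_line_derive _ _ _ 8) => //; [exact: Spl_derive| |exact: spl_lip].
by move=> y; rewrite ger0_norm ?spl_ge0//; have := spl_le1 y; lra.
Qed.

Lemma Spl_homo y z : y <= z -> Spl y <= Spl z.
Proof.
move=> yz; rewrite -subr_ge0; have [c _ ->] := mean_value z y Spl_derive.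
by rewrite mulr_ge0 ?spl_ge0// subr_ge0.
Qed.

Lemma Spl_itv x : 0 <= Spl x <= 1.
Proof.
apply/andP; split.
  have [x0|x0] := leP x 0; first by rewrite Spl_lo.
  by rewrite -(@Spl_lo 0)//; apply: Spl_homo; exact: ltW.
have [x3|x3] := leP 3 x; first by rewrite Spl_hi.
by rewrite -(@Spl_hi 3)//; apply: Spl_homo; exact: ltW.
Qed.

Lemma telescope_ord (u : nat -> R) M : \sum_(p < M) (u p - u p.+1) = u 0%N - u M.
Proof.
elim: M => [|M ih]; first by rewrite big_ord0 subrr.
by rewrite big_ord_recr/= ih; ring.
Qed.

Lemma telescope_shift (u : R -> R) z M :
  \sum_(p < M) (u (z - p%:R) - u (z - p%:R - 1)) = u z - u (z - M%:R).
Proof.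
rewrite -[in u z](subr0 z) -(telescope_ord (fun p => u (z - p%:R))).
apply: eq_bigr => p _; congr (_ - u _); rewrite -natr1; ring.
Qed.

(** [spl] is a difference of shifts of [Th], so the sum telescopes to [Th z - Th (z - M)]; the two
    inequalities place [z] where the first term is already 1 and the second still 0. *)
Lemma sum_spl z M : 2 <= z -> z <= M%:R -> \sum_(p < M) spl (z - p%:R) = 1.
Proof. by move=> z2 zM; rewrite telescope_shift Th_hi// Th_lo ?subr0// subr_le0. Qed.

Lemma sum_spl_le1 z M : \sum_(p < M) spl (z - p%:R) <= 1.
Proof.
by rewrite telescope_shift; have := Th_itv z; have := Th_itv (z - M%:R); lra.
Qed.

Lemma sum_dspl z M : 2 <= z -> z <= M%:R -> \sum_(p < M) dspl (z - p%:R) = 0.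
Proof. by move=> z2 zM; rewrite telescope_shift hat_hi// hat_lo ?subrr// subr_le0. Qed.

Lemma sum_hat z M :
  \sum_(p < M) hat (z - p%:R) = (pos z - pos (z - 1)) - (pos (z - M%:R) - pos (z - M%:R - 1)).
Proof.
rewrite -(telescope_shift (fun z => pos z - pos (z - 1))); apply: eq_bigr => p _.
by rewrite /hat (_ : z - p%:R - 2 = z - p%:R - 1 - 1); [ring|ring].
Qed.

Lemma sum_hat_le1 z M : \sum_(p < M) hat (z - p%:R) <= 1.
Proof.
rewrite sum_hat; case: (posE z) => -[-> ?]; case: (posE (z - 1)) => -[-> ?];
case: (posE (z - M%:R)) => -[-> ?]; case: (posE (z - M%:R - 1)) => -[-> ?]; lra.
Qed.

Lemma sum_abs_dspl z M : \sum_(p < M) `|dspl (z - p%:R)| <= 2.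
Proof.
apply: (@le_trans _ _ (\sum_(p < M) (hat (z - p%:R) + hat (z - 1 - p%:R)))).
  apply: ler_sum => p _; rewrite /dspl (_ : z - 1 - p%:R = z - p%:R - 1); last by ring.
  have := hat_ge0 (z - p%:R); have := hat_ge0 (z - p%:R - 1).
  by rewrite ler_norml; lra.
by rewrite big_split/=; have := sum_hat_le1 z M; have := sum_hat_le1 (z - 1) M; lra.
Qed.

(** Summation by parts: the boundary terms vanish and what remains is a full sum of shifts of [hat].
    The identity says that the spline sum with coefficients [p] has slope 1. *)
Lemma sum_lin_dspl z M : 2 <= z -> z <= M%:R ->
  \sum_(p < M) p%:R * dspl (z - p%:R) = 1.
Proof.
move=> z2 zM.
pose u (p : nat) := p%:R * hat (z - p%:R).
have -> : \sum_(p < M) p%:R * dspl (z - p%:R) =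
    \sum_(p < M) (u p - u p.+1) + \sum_(p < M) hat (z - 1 - p%:R).
  rewrite -big_split; apply: eq_bigr => p _; rewrite /= /u /dspl.
  rewrite (_ : z - 1 - p%:R = z - p%:R - 1); last by ring.
  rewrite (_ : z - p.+1%:R = z - p%:R - 1); last by rewrite -natr1; ring.
  by rewrite -natr1; ring.
rewrite telescope_ord /u mul0r (hat_lo (x := z - M%:R)) ?subr_le0// mulr0 subrr add0r.
rewrite sum_hat.
case: (posE (z - 1)) => -[-> ?]; case: (posE (z - 1 - 1)) => -[-> ?];
case: (posE (z - 1 - M%:R)) => -[-> ?]; case: (posE (z - 1 - M%:R - 1)) => -[-> ?]; lra.
Qed.

End splines.

Section c11.
Context {R : realType} {n : nat}.
Local Notation Rn := 'rV[R]_n.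
Implicit Types (F G : Rn -> R) (D E : 'I_n -> Rn -> R).

(** [D i] is the i-th partial derivative of [F]. The bounds are global, so that composition with a
    Lipschitz map again gives Lipschitz functions, and bounded ones for [D i]. *)
Definition C11 F D : Prop := exists L : R, [/\ 0 <= L,
  forall i y, `|D i y| <= L, forall i y z, `|D i y - D i z| <= L * `|y - z|,
  forall y z, `|F y - F z| <= L * `|y - z| &
  forall y z, `|F y - F z - \sum_i D i z * (y ord0 i - z ord0 i)| <=
    L * `|y - z| ^+ 2].

Lemma C11_ext F D E : C11 F D -> (forall i y, D i y = E i y) -> C11 F E.
Proof.
move=> h e; have -> : E = D by apply/funext => i; apply/funext => y; rewrite e.
exact: h.
Qed.

Lemma coord_sub_le (y z : Rn) i : `|y ord0 i - z ord0 i| <= `|y - z|.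
Proof. by have := row_norm_coord (y - z) i; rewrite !mxE. Qed.

Lemma C11_line_coord (a da : R -> R) j : C11_line a da ->
  C11 (fun y => a (y ord0 j)) (fun i y => if i == j then da (y ord0 j) else 0).
Proof.
move=> [L [L0 h1 h2 h3 h4]]; exists L; split => //.
- by move=> i y; case: eqP => _ //; rewrite normr0.
- move=> i y z; case: eqP => _; last by rewrite subrr normr0 mulr_ge0.
  by apply: le_trans (h2 _ _) _; rewrite ler_wpM2l// coord_sub_le.
- by move=> y z; apply: le_trans (h3 _ _) _; rewrite ler_wpM2l// coord_sub_le.
- move=> y z; rewrite (bigD1 j)//= eqxx big1 ?addr0; last first.
    by move=> i /negPf ->; rewrite mul0r.
  apply: le_trans (h4 _ _) _; rewrite ler_wpM2l//.
  by rewrite lerXn2r ?nnegrE// coord_sub_le.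
Qed.

Lemma C11_coord j : C11 (fun y => y ord0 j) (fun i _ => (i == j)%:R).
Proof.
have h : C11_line (@id R) (fun=> 1).
  exists 1; split => // y; try move=> z; rewrite ?normr1 ?mul1r//.
    by rewrite subrr normr0.
  by rewrite subrr normr0 exprn_ge0.
apply: C11_ext (C11_line_coord j h) _ => i y; by case: eqP.
Qed.

Lemma C11_cst c : C11 (fun=> c) (fun _ _ => 0).
Proof.
exists 0; split => // *; rewrite ?subrr ?normr0 ?mul0r// big1 ?subr0 ?normr0// => i _.
by rewrite mul0r.
Qed.

Lemma C11_lin c F D G E : C11 F D -> C11 G E ->
  C11 (fun y => c * F y + G y) (fun i y => c * D i y + E i y).
Proof.
move=> [L [L0 h1 h2 h3 h4]] [K [K0 k1 k2 k3 k4]]; exists (`|c| * L + K).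
have A (a b a' b' : R) : `|a| <= a' -> `|b| <= b' -> `|c * a + b| <= `|c| * a' + b'.
  by move=> ha hb; apply: le_trans (ler_normD _ _) _; rewrite normrM lerD// ler_wpM2l.
split.
- by rewrite addr_ge0// mulr_ge0.
- by move=> i y; exact: A.
- move=> i y z; rewrite mulrDl -mulrA.
  by rewrite (_ : _ - _ = c * (D i y - D i z) + (E i y - E i z)); [exact: A|ring].
- move=> y z; rewrite mulrDl -mulrA.
  by rewrite (_ : _ - _ = c * (F y - F z) + (G y - G z)); [exact: A|ring].
- move=> y z; rewrite mulrDl -mulrA.
  rewrite (_ : _ - _ = c * (F y - F z - \sum_i D i z * (y ord0 i - z ord0 i)) +
    (G y - G z - \sum_i E i z * (y ord0 i - z ord0 i))); first exact: A.
  rewrite (eq_bigr (fun i => c * (D i z * (y ord0 i - z ord0 i)) +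
    E i z * (y ord0 i - z ord0 i))); last by move=> i _; ring.
  by rewrite big_split -mulr_sumr/=; ring.
Qed.

Lemma C11_sum (I : Type) (r : seq I) (c : I -> R) (F : I -> Rn -> R)
    (D : I -> 'I_n -> Rn -> R) : (forall q, C11 (F q) (D q)) ->
  C11 (fun y => \sum_(q <- r) c q * F q y) (fun i y => \sum_(q <- r) c q * D q i y).
Proof.
move=> h; elim: r => [|q r ih].
  rewrite (_ : (fun y => _) = fun=> 0); last by apply/funext => y; rewrite big_nil.
  by apply: C11_ext (C11_cst 0) _ => i y; rewrite big_nil.
rewrite (_ : (fun y => _) = fun y => c q * F q y + \sum_(q <- r) c q * F q y); last first.
  by apply/funext => y; rewrite big_cons.
by apply: C11_ext (C11_lin (c q) (h q) ih) _ => i y; rewrite big_cons.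
Qed.

Lemma C11_mul F D G E (a b : R) : bounded_by a F -> bounded_by b G ->
  C11 F D -> C11 G E ->
  C11 (fun y => F y * G y) (fun i y => F y * E i y + G y * D i y).
Proof.
move=> ha hb [L [L0 h1 h2 h3 h4]] [K [K0 k1 k2 k3 k4]].
have a0 : 0 <= a by apply: le_trans (ha 0).
have b0 : 0 <= b by apply: le_trans (hb 0).
exists (a * K + b * L + L * K + L * K).
have P : [/\ 0 <= a * K, 0 <= b * L & 0 <= L * K] by split; exact: mulr_ge0.
case: P => P1 P2 P3.
split.
- lra.
- move=> i y; apply: (@le_trans _ _ (a * K + b * L)); last lra.
  by apply: le_trans (ler_normD _ _) _; rewrite !normrM lerD// ler_pM.
- move=> i y z; have d0 := normr_ge0 (y - z).
  rewrite (_ : _ - _ = F y * (E i y - E i z) + G y * (D i y - D i z) +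
    (F y - F z) * E i z + (G y - G z) * D i z); last by ring.
  rewrite (_ : _ * `|y - z| = a * (K * `|y - z|) + b * (L * `|y - z|) +
    (L * `|y - z|) * K + (K * `|y - z|) * L); last by ring.
  apply: le_trans (ler_normD _ _) _; apply: lerD; last by rewrite normrM ler_pM.
  apply: le_trans (ler_normD _ _) _; apply: lerD; last by rewrite normrM ler_pM.
  by apply: le_trans (ler_normD _ _) _; apply: lerD; rewrite normrM ler_pM.
- move=> y z; have d0 := normr_ge0 (y - z).
  apply: (@le_trans _ _ ((a * K + b * L) * `|y - z|)); last first.
    by rewrite ler_wpM2r//; lra.
  rewrite (_ : _ - _ = F y * (G y - G z) + G z * (F y - F z)); last by ring.
  rewrite (_ : _ * `|y - z| = a * (K * `|y - z|) + b * (L * `|y - z|)); last by ring.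
  apply: le_trans (ler_normD _ _) _; apply: lerD; by rewrite normrM ler_pM.
- move=> y z; have d0 := normr_ge0 (y - z).
  have -> : \sum_i (F z * E i z + G z * D i z) * (y ord0 i - z ord0 i) =
    F z * \sum_i E i z * (y ord0 i - z ord0 i) +
    G z * \sum_i D i z * (y ord0 i - z ord0 i).
    by rewrite !mulr_sumr -big_split; apply: eq_bigr => i _ /=; ring.
  rewrite (_ : _ - _ = F z * (G y - G z - \sum_i E i z * (y ord0 i - z ord0 i)) +
    G z * (F y - F z - \sum_i D i z * (y ord0 i - z ord0 i)) +
    (F y - F z) * (G y - G z)); last by ring.
  apply: (@le_trans _ _ (a * (K * `|y - z| ^+ 2) + b * (L * `|y - z| ^+ 2) +
    (L * `|y - z|) * (K * `|y - z|))); last first.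
    have : 0 <= `|y - z| ^+ 2 by rewrite exprn_ge0.
    set d := `|y - z|; rewrite (_ : L * d * (K * d) = (L * K) * d ^+ 2); last by ring.
    by nra.
  apply: le_trans (ler_normD _ _) _; apply: lerD; last first.
    by rewrite normrM ler_pM.
  by apply: le_trans (ler_normD _ _) _; apply: lerD; rewrite normrM ler_pM.
Qed.

Lemma C11_tensor_seq (w dw : 'I_n -> R -> R) (b : 'I_n -> R) (s : seq 'I_n) :
  (forall j, C11_line (w j) (dw j)) -> (forall j, bounded_by (b j) (w j)) -> uniq s ->
  C11 (fun y => \prod_(j <- s) w j (y ord0 j))
    (fun i y => if i \in s then
       dw i (y ord0 i) * \prod_(j <- s | j != i) w j (y ord0 j) else 0).
Proof.
move=> hw hb; elim: s => [_|j s ih /= /andP[js us]].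
  rewrite (_ : (fun y => _) = fun=> 1); last by apply/funext => y; rewrite big_nil.
  exact: C11_ext (C11_cst 1) _.
rewrite (_ : (fun y : Rn => _) = fun y : Rn => w j (y ord0 j) * \prod_(j <- s) w j (y ord0 j)); last first.
  by apply/funext => y; rewrite big_cons.
have hbs : bounded_by (\prod_(j <- s) b j) (fun y : Rn => \prod_(j <- s) w j (y ord0 j)).
  by move=> y; rewrite normr_prod; apply: ler_prod => i _; rewrite normr_ge0 hb.
have hbj : bounded_by (b j) (fun y : Rn => w j (y ord0 j)) by move=> y; exact: hb.
apply: C11_ext (C11_mul hbj hbs (C11_line_coord j (hw j)) (ih us)) _ => i y.
rewrite inE; have [->|ij] := eqVneq i j.
  rewrite (negPf js) mulr0 add0r mulrC; congr (_ * _).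
  rewrite big_cons eqxx/= big_seq_cond [RHS]big_seq_cond; apply: eq_bigl => k.
  by case: (boolP (k \in s)) => //= ks; apply/esym; apply: contraNneq js => <-.
rewrite mulr0 addr0/=; case: ifP => _; last by rewrite mulr0.
by rewrite big_cons eq_sym ij; ring.
Qed.

Lemma C11_tensor (w dw : 'I_n -> R -> R) (b : 'I_n -> R) :
  (forall j, C11_line (w j) (dw j)) -> (forall j, bounded_by (b j) (w j)) ->
  C11 (fun y => \prod_j w j (y ord0 j))
    (fun i y => dw i (y ord0 i) * \prod_(j | j != i) w j (y ord0 j)).
Proof.
move=> hw hb; have := C11_tensor_seq hw hb (enum_uniq 'I_n).
rewrite (_ : (fun y : Rn => _) = fun y : Rn => \prod_j w j (y ord0 j)); last first.
  by apply/funext => y; rewrite big_enum.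
move=> h; apply: C11_ext h _ => i y; rewrite mem_enum.
by rewrite big_enum_cond.
Qed.

Lemma C11_is_lip F D : C11 F D -> is_lip F.
Proof.
move=> [L [L0 _ _ h _]]; apply: (is_lip_lipc L0) => x y.
by rewrite mdist_rowE distrC; have := h y x.
Qed.

Lemma C11_grad_lip F D i : C11 F D -> is_lip (D i).
Proof.
move=> [L [L0 _ h _ _]]; apply: (is_lip_lipc L0) => x y.
by rewrite mdist_rowE distrC; exact: h.
Qed.

Lemma C11_grad_bounded F D : C11 F D -> exists L, forall i, bounded_by L (D i).
Proof. by move=> [L [L0 h _ _ _]]; exists L. Qed.

Lemma C11_derive F D i (x : Rn) t : C11 F D ->
  is_derive t (1 : R) (fun s => F (x + s *: delta_mx ord0 i)) (D i (x + t *: delta_mx ord0 i)).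
Proof.
move=> [L [L0 _ _ _ h]]; apply: (is_derive_quadratic L0) => s _.
have e : x + s *: delta_mx ord0 i - (x + t *: delta_mx ord0 i) =
    (s - t) *: delta_mx ord0 i :> Rn.
  by rewrite opprD addrACA subrr add0r scalerBl.
have n1 : `|delta_mx ord0 i : Rn| <= 1.
  by apply: row_norm_le => // j; rewrite mxE eqxx/=; case: eqP => _; rewrite ?normr1 ?normr0.
have := h (x + s *: delta_mx ord0 i) (x + t *: delta_mx ord0 i).
rewrite (bigD1 i)//= big1 ?addr0; last first.
  move=> j ji; rewrite !mxE eqxx/= (negPf ji) mulr0 !mulr0 subrr; by rewrite mulr0.
rewrite (_ : _ ord0 i - _ = s - t); last by rewrite !mxE !eqxx/= !mulr1; ring.
rewrite e => /le_trans; apply; rewrite ler_wpM2l//.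
rewrite lerXn2r ?nnegrE// normrZ -[leRHS]mulr1 ler_wpM2l//.
Qed.

End c11.

Section grid.
Context {R : realType} {n : nat}.
Variables (k N : nat).
Local Notation Rn := 'rV[R]_n.
Implicit Types (x y z : Rn).

(** The points [node p] form the lattice of mesh [2^-k] in the box of half-width [N]; [gcoord] is
    the affine change of variable that turns their coordinates into the integers [p]. *)
Definition gsize : nat := (2 ^ k * (2 * N))%N.
Definition grid : finType := {ffun 'I_n -> 'I_gsize}.
Implicit Types p : grid.

Definition mesh : R := 2 ^- k.
Definition gcoord (t : R) : R := 2 ^+ k * (t + N%:R).
Definition node p : Rn := \row_j ((p j)%:R * mesh - N%:R).

Definition bspline p y : R := \prod_j spl (gcoord (y ord0 j) - (p j)%:R).
Definition dbspline p (i : 'I_n) y : R :=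
  2 ^+ k * dspl (gcoord (y ord0 i) - (p i)%:R) *
  \prod_(j | j != i) spl (gcoord (y ord0 j) - (p j)%:R).

Lemma mesh_gt0 : 0 < mesh. Proof. by rewrite invr_gt0 exprn_gt0. Qed.

Lemma meshK : 2 ^+ k * mesh = 1 :> R.
Proof. by rewrite mulfV// expf_neq0. Qed.

Lemma pow2_gt0 : 0 < 2 ^+ k :> R. Proof. exact: exprn_gt0. Qed.

Lemma gsizeE : gsize%:R = 2 ^+ k * (N%:R + N%:R) :> R.
Proof. by rewrite /gsize mul2n -addnn natrM natrX natrD. Qed.

(** The margin 2 is the one required by [sum_spl]; it suffices at every level because [2^k >= 1]. *)
Lemma gcoord_core (t : R) : `|t| + 2 <= N%:R ->
  2 <= gcoord t /\ gcoord t <= gsize%:R.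
Proof.
move=> h; rewrite /gcoord gsizeE; have h2 : 1 <= 2 ^+ k :> R by rewrite exprn_ege1 ?ler1n.
have := ler_norm t; have := ler_norm (- t); rewrite normrN => h3 h4; split.
  by rewrite -[leLHS]mul1r ler_pM//; lra.
by rewrite ler_pM2l ?pow2_gt0//; lra.
Qed.

Lemma row_core (y : Rn) j : `|y| + 2 <= N%:R -> `|y ord0 j| + 2 <= N%:R.
Proof. by apply: le_trans; rewrite lerD2r row_norm_coord. Qed.

Lemma sum_grid_prod (f : 'I_n -> nat -> R) :
  \sum_(p : grid) \prod_j f j (p j) = \prod_j \sum_(m < gsize) f j m.
Proof. by rewrite bigA_distr_bigA. Qed.

Lemma prod_at (i : 'I_n) (a : R) (b : 'I_n -> R) :
  a * \prod_(j | j != i) b j = \prod_j (if j == i then a else b j).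
Proof.
rewrite [RHS](bigD1 i)//= eqxx; congr (_ * _); apply: eq_bigr => j /negPf -> //.
Qed.

Lemma bspline_ge0 p y : 0 <= bspline p y.
Proof. by apply: prodr_ge0 => j _; exact: spl_ge0. Qed.

Lemma sum_bspline_le1 y : \sum_p bspline p y <= 1.
Proof.
rewrite (sum_grid_prod (fun j m => spl (gcoord (y ord0 j) - m%:R))).
apply: prodr_ile1 => j _; rewrite sum_spl_le1 andbT.
by apply: sumr_ge0 => m _; exact: spl_ge0.
Qed.

Lemma sum_bspline y : `|y| + 2 <= N%:R -> \sum_p bspline p y = 1.
Proof.
move=> h; rewrite (sum_grid_prod (fun j m => spl (gcoord (y ord0 j) - m%:R))).
apply: big1 => j _; have [h1 h2] := gcoord_core (row_core j h).
exact: sum_spl.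
Qed.

Lemma spl_bounded : bounded_by 1 (@spl R).
Proof. by move=> t; rewrite ger0_norm ?spl_ge0// spl_le1. Qed.

Lemma spl_gcoord_C11 (m : R) : C11_line (fun t => spl (gcoord t - m))
  (fun t => 2 ^+ k * dspl (gcoord t - m)).
Proof.
have := C11_line_affine (2 ^+ k) (2 ^+ k * N%:R - m) (@spl_C11 R).
have e t : 2 ^+ k * t + (2 ^+ k * N%:R - m) = gcoord t - m by rewrite /gcoord; ring.
have -> : (fun x : R => spl (2 ^+ k * x + (2 ^+ k * N%:R - m))) =
  (fun t => spl (gcoord t - m)) by apply/funext => t; rewrite e.
have -> : (fun x : R => 2 ^+ k * dspl (2 ^+ k * x + (2 ^+ k * N%:R - m))) =
  (fun t => 2 ^+ k * dspl (gcoord t - m)) by apply/funext => t; rewrite e.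
by [].
Qed.

Lemma Spl_gcoord_C11 (m : R) : C11_line (fun t => mesh * Spl (gcoord t - m))
  (fun t => spl (gcoord t - m)).
Proof.
have [L [L0 h1 h2 h3 h4]] := C11_line_affine (2 ^+ k) (2 ^+ k * N%:R - m) (@Spl_C11 R).
have e t : 2 ^+ k * t + (2 ^+ k * N%:R - m) = gcoord t - m by rewrite /gcoord; ring.
exists (mesh * L); have m0 := mesh_gt0.
have E a : a = mesh * (2 ^+ k * a) by rewrite mulrA [mesh * _]mulrC meshK mul1r.
split.
- by rewrite mulr_ge0// ltW.
- move=> y; have := h1 y; rewrite e => h.
  by rewrite (E (spl _)) normrM gtr0_norm// ler_wpM2l// ltW.
- move=> y z; have := h2 y z; rewrite !e => h.
  by rewrite (E (spl _ - _)) normrM gtr0_norm// mulrBr -mulrA ler_wpM2l// ltW.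
- move=> y z; have := h3 y z; rewrite !e => h.
  by rewrite -mulrBr normrM gtr0_norm// -mulrA ler_wpM2l// ltW.
- move=> y z; have := h4 y z; rewrite !e => h.
  rewrite (E (spl _)) -mulrBr -[mesh * _ * _]mulrA -mulrBr normrM gtr0_norm// -[mesh * L * _]mulrA.
  by rewrite ler_wpM2l// ltW.
Qed.

Lemma bspline_C11 p : C11 (bspline p) (dbspline p).
Proof.
exact: (C11_tensor (fun j => spl_gcoord_C11 (p j)%:R)
  (fun j t => spl_bounded (gcoord t - (p j)%:R))).
Qed.

Lemma bspline_bounded p : bounded_by 1 (bspline p).
Proof.
move=> y; rewrite ger0_norm ?bspline_ge0//; apply: prodr_ile1 => j _.
by rewrite spl_ge0 spl_le1.
Qed.

Lemma spl_gcoord_neq0 (t m : R) : spl (gcoord t - m) != 0 ->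
  `|t - (m * mesh - N%:R)| <= 3 * mesh.
Proof.
move=> h; have h1 : 0 < gcoord t - m < 3.
  apply/andP; split; rewrite ltNge; apply/negP => h'; move: h.
    by rewrite spl_lo ?eqxx.
  by rewrite spl_hi ?eqxx.
have -> : t - (m * mesh - N%:R) = mesh * (gcoord t - m).
  by rewrite /gcoord mulrBr mulrA [mesh * _]mulrC meshK mul1r; ring.
rewrite normrM gtr0_norm ?mesh_gt0// mulrC ler_wpM2r ?(ltW mesh_gt0)//.
by rewrite ger0_norm; lra.
Qed.

Lemma dspl_gcoord_neq0 (t m : R) : dspl (gcoord t - m) != 0 ->
  `|t - (m * mesh - N%:R)| <= 3 * mesh.
Proof.
move=> h; have h1 : 0 < gcoord t - m < 3.
  apply/andP; split; rewrite ltNge; apply/negP => h'; move: h; rewrite /dspl.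
    by rewrite !hat_lo ?subrr ?eqxx//; lra.
  by rewrite !hat_hi ?subrr ?eqxx//; lra.
have -> : t - (m * mesh - N%:R) = mesh * (gcoord t - m).
  by rewrite /gcoord mulrBr mulrA [mesh * _]mulrC meshK mul1r; ring.
rewrite normrM gtr0_norm ?mesh_gt0// mulrC ler_wpM2r ?(ltW mesh_gt0)//.
by rewrite ger0_norm; lra.
Qed.

Lemma bspline_supp p y : bspline p y != 0 -> `|y - node p| <= 3 * mesh.
Proof.
move=> h; apply: row_norm_le => [|j]; first by rewrite mulr_ge0// (ltW mesh_gt0).
rewrite !mxE; apply: spl_gcoord_neq0.
by move: h; rewrite /bspline (bigD1 j)//= mulf_eq0 negb_or => /andP[].
Qed.

Lemma dbspline_supp p i y : dbspline p i y != 0 -> `|y - node p| <= 3 * mesh.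
Proof.
move=> h; apply: row_norm_le => [|j]; first by rewrite mulr_ge0// (ltW mesh_gt0).
rewrite !mxE; move: h; rewrite /dbspline !mulf_eq0 !negb_or => /andP[/andP[_ h1] h2].
have [->|ji] := eqVneq j i; first exact: dspl_gcoord_neq0.
apply: spl_gcoord_neq0.
by move: h2; rewrite (bigD1 j)//= mulf_eq0 negb_or => /andP[].
Qed.

Lemma sum_abs_dbspline i y : \sum_p `|dbspline p i y| <= 2 * 2 ^+ k.
Proof.
rewrite (eq_bigr (fun p : grid => \prod_j (if j == i then
    2 ^+ k * `|dspl (gcoord (y ord0 i) - (p j)%:R)|
    else spl (gcoord (y ord0 j) - (p j)%:R)))); last first.
  move=> p _; rewrite /dbspline normrM [X in _ * X]ger0_norm; last first.
    by apply: prodr_ge0 => j _; exact: spl_ge0.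
  rewrite normrM (gtr0_norm pow2_gt0) prod_at; apply: eq_bigr => j _.
  by case: eqP => [->|].
rewrite (sum_grid_prod (fun j m => if j == i then
    2 ^+ k * `|dspl (gcoord (y ord0 i) - m%:R)|
    else spl (gcoord (y ord0 j) - m%:R))) (bigD1 i)//= eqxx -mulr_sumr.
rewrite -[leRHS]mulr1 ler_pM//.
- by rewrite mulr_ge0 ?(ltW pow2_gt0)// sumr_ge0.
- by apply: prodr_ge0 => j /negPf ->; apply: sumr_ge0 => m _; exact: spl_ge0.
- by rewrite mulrC ler_wpM2r ?(ltW pow2_gt0)// sum_abs_dspl.
- apply: prodr_ile1 => j /negPf ->; rewrite sum_spl_le1 andbT.
  by apply: sumr_ge0 => m _; exact: spl_ge0.
Qed.

Lemma sum_dbspline i y : `|y| + 2 <= N%:R -> \sum_p dbspline p i y = 0.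
Proof.
move=> h; rewrite (eq_bigr (fun p : grid => \prod_j (if j == i then
    2 ^+ k * dspl (gcoord (y ord0 i) - (p j)%:R)
    else spl (gcoord (y ord0 j) - (p j)%:R)))); last first.
  move=> p _; rewrite /dbspline prod_at; apply: eq_bigr => j _; by case: eqP => [->|].
rewrite (sum_grid_prod (fun j m => if j == i then
    2 ^+ k * dspl (gcoord (y ord0 i) - m%:R)
    else spl (gcoord (y ord0 j) - m%:R))) (bigD1 i)//= eqxx -mulr_sumr.
have [h1 h2] := gcoord_core (row_core i h).
by rewrite sum_dspl// mulr0 mul0r.
Qed.

(** Together with [sum_dbspline] this means that the quasi-interpolant of an affine function has the
    right gradient. The sum factors over the coordinates; for [i != l] the factor of direction [i]
    is a full sum of [dspl], which is 0. *)
Lemma sum_node_dbspline i l y : `|y| + 2 <= N%:R ->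
  \sum_p node p ord0 l * dbspline p i y = (i == l)%:R.
Proof.
move=> h; rewrite (eq_bigr (fun p : grid =>
    mesh * ((p l)%:R * dbspline p i y) - N%:R * dbspline p i y)); last first.
  by move=> p _; rewrite mxE; ring.
rewrite sumrB -!mulr_sumr sum_dbspline// mulr0 subr0.
have [->|il] := eqVneq i l.
  rewrite (eq_bigr (fun p : grid => \prod_j (if j == l then
      2 ^+ k * ((p j)%:R * dspl (gcoord (y ord0 l) - (p j)%:R))
      else spl (gcoord (y ord0 j) - (p j)%:R)))); last first.
    move=> p _; rewrite /dbspline mulrA prod_at; apply: eq_bigr => j _.
    by case: eqP => [->|]//; ring.
  rewrite (sum_grid_prod (fun j m => if j == l then
      2 ^+ k * (m%:R * dspl (gcoord (y ord0 l) - m%:R))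
      else spl (gcoord (y ord0 j) - m%:R))) (bigD1 l)//= eqxx -mulr_sumr.
  have [h1 h2] := gcoord_core (row_core l h).
  rewrite sum_lin_dspl// big1 ?mulr1; last first.
    move=> j /negPf ->; have [h3 h4] := gcoord_core (row_core j h).
    exact: sum_spl.
  by rewrite mulrC meshK.
rewrite (eq_bigr (fun p : grid => \prod_j (if j == i then
    2 ^+ k * dspl (gcoord (y ord0 i) - (p j)%:R) else
    (if j == l then (p j)%:R else 1) * spl (gcoord (y ord0 j) - (p j)%:R)))); last first.
  move=> p _; rewrite /dbspline mulrCA (_ : _ * \prod_(j | j != i) _ =
    \prod_(j | j != i) ((if j == l then (p j)%:R else 1) *
       spl (gcoord (y ord0 j) - (p j)%:R))); last first.
    rewrite big_split/=; congr (_ * _).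
    rewrite (bigD1 l) ?eqxx 1?eq_sym//= big1 ?mulr1// => j /andP[_ /negPf ->] //.
  by rewrite prod_at; apply: eq_bigr => j _; case: eqP => [->|].
rewrite (sum_grid_prod (fun j m => if j == i then
    2 ^+ k * dspl (gcoord (y ord0 i) - m%:R) else
    (if j == l then m%:R else 1) * spl (gcoord (y ord0 j) - m%:R))).
rewrite (bigD1 i)//= eqxx -mulr_sumr.
have [h1 h2] := gcoord_core (row_core i h).
by rewrite sum_dspl// mulr0 mul0r mulr0.
Qed.

(** The coefficient is the value at the corner [node p] of the support, not the solution of an
    interpolation problem. This preserves sup bounds and is accurate to order [mesh k] on Lipschitz
    functions. *)
Definition interp (f : Rn -> R) y : R := \sum_p f (node p) * bspline p y.
Definition dinterp (f : Rn -> R) (i : 'I_n) y : R := \sum_p f (node p) * dbspline p i y.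

Lemma interp_C11 f : C11 (interp f) (dinterp f).
Proof. exact: (C11_sum (index_enum grid) (fun p => f (node p)) bspline_C11). Qed.

Lemma interp_bounded (c : R) f : bounded_by c f -> bounded_by c (interp f).
Proof.
move=> h y; apply: le_trans (ler_norm_sum _ _ _) _.
have c0 : 0 <= c by apply: le_trans (h 0).
apply: (@le_trans _ _ (\sum_p c * bspline p y)).
  by apply: ler_sum => p _; rewrite normrM (ger0_norm (bspline_ge0 _ _)) ler_wpM2r ?bspline_ge0.
by rewrite -mulr_sumr -[leRHS]mulr1 ler_wpM2l// sum_bspline_le1.
Qed.

Lemma interp_approx (L : R) f y : 0 <= L -> (forall y z, `|f y - f z| <= L * `|y - z|) ->
  `|y| + 2 <= N%:R -> `|interp f y - f y| <= L * (3 * mesh).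
Proof.
move=> L0 hf hy; rewrite -[f y]mulr1 -(sum_bspline hy) mulr_sumr -sumrB.
apply: le_trans (ler_norm_sum _ _ _) _.
apply: (@le_trans _ _ (\sum_p L * (3 * mesh) * bspline p y)); last first.
  by rewrite -mulr_sumr sum_bspline// mulr1.
apply: ler_sum => p _; rewrite -mulrBl normrM (ger0_norm (bspline_ge0 _ _)).
have [->|h] := eqVneq (bspline p y) 0; first by rewrite !mulr0.
rewrite ler_wpM2r ?bspline_ge0//; apply: le_trans (hf _ _) _.
by rewrite ler_wpM2l// distrC bspline_supp.
Qed.

End grid.

Arguments mesh {R}.
Arguments node {R n k N}.
Arguments bspline {R n k N}.
Arguments dbspline {R n k N}.
Arguments bspline_ge0 {R n k N}.
Arguments bspline_C11 {R n k N}.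
Arguments bspline_bounded {R n k N}.
Arguments bspline_supp {R n k N}.
Arguments dbspline_supp {R n k N}.

Lemma mesh_cvg0 (R : realType) : mesh k @[k --> \oo] --> (0 : R).
Proof.
rewrite (_ : (fun k => mesh k) = (fun k => 2^-1 ^+ k)); last first.
  by apply/funext => k; rewrite /mesh exprVn.
by apply: cvg_expr; rewrite ger0_norm ?invr_ge0// invf_lt1// ltr1n.
Qed.

Lemma cvg_ge_cst (R : realType) (T : Type) (F : set_system T) (FF : ProperFilter F)
    (u : T -> R) (a l : R) : u @ F --> l -> (forall t, a <= u t) -> a <= l.
Proof.
by move=> ul h; apply: (closed_cvg (fun y => a <= y) _ _ _ ul);
  [exact: closed_ge|exact: nearW].
Qed.

Lemma cvg_le_cst (R : realType) (T : Type) (F : set_system T) (FF : ProperFilter F)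
    (u : T -> R) (a l : R) : u @ F --> l -> (forall t, u t <= a) -> l <= a.
Proof.
by move=> ul h; apply: (closed_cvg (fun y => y <= a) _ _ _ ul);
  [exact: closed_le|exact: nearW].
Qed.

Lemma mesh_le0 (R : realType) (a C : R) : (forall k, a <= C * mesh k) -> a <= 0.
Proof.
move=> h; have cC : C * mesh k @[k --> \oo] --> (0 : R).
  by rewrite -[X in _ --> X](mulr0 C); apply: cvgMl_tmp; exact: mesh_cvg0.
exact: cvg_ge_cst cC h.
Qed.

Lemma current_bounded_repr (R : realType) (X : metricType R) (n : nat)
    (T : functional X n) (K : set X) (f : X -> R) :
  is_current T -> compact K -> vanishes_off T K -> is_lip f ->
  exists (f' : X -> R) (a : R), [/\ is_lip f', bounded_by a f' &
    forall g, (forall j, is_lip (g j)) -> T f g = T f' g].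
Proof.
move=> hT cK hK hf; have [a [a0 oU KU]] := current_trunc cK hf.
exists (fun x => clamp (- a) a (f x)), a; split; first exact: is_lip_clamp.
  by move=> x; rewrite ler_norml clamp_itv//; lra.
move=> g' hg'; apply: (current_eq_near hT hK oU KU) => //; first exact: is_lip_clamp.
by move=> x /= h; rewrite clamp_id// -ler_norml ltW.
Qed.

(** * The chain rule *)

Section chain_rule.
Context {R : realType}.
Variables (X : metricType R) (n m : nat) (T : functional X n) (M : R) (K : set X).
Hypothesis hT : is_current T.
Hypothesis hM : (mass T <= M%:E)%E.
Hypothesis cK : compact K.
Hypothesis hK : vanishes_off T K.
Variable phi : X -> 'rV[R]_m.
Variable Lphi : R.
Hypothesis Lphi0 : 0 <= Lphi.
Hypothesis phi_lip : forall x y, `|phi x - phi y| <= Lphi * mdist x y.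

Let norm_cont (c : 'rV[R]_m) : continuous (fun x => `|phi x - c|).
Proof.
apply: (@lipc_continuous _ _ Lphi) => x y.
apply: le_trans (ler_dist_dist _ _) _.
by rewrite (_ : _ - _ = phi x - phi y); [exact: phi_lip|rewrite opprB addrA subrK].
Qed.

Let open_norm_lt (c : 'rV[R]_m) (r : R) : open [set x | `|phi x - c| < r].
Proof.
apply: (@open_comp _ _ (fun x => `|phi x - c|) [set y | y < r]); last exact: open_lt.
by move=> x _; exact: norm_cont.
Qed.

Let closed_norm_le (c : 'rV[R]_m) (r : R) : closed [set x | `|phi x - c| <= r].
Proof.
apply: (@closed_comp _ _ (fun x => `|phi x - c|) [set y | y <= r]); last exact: closed_le.
by move=> x _; exact: norm_cont.
Qed.

Lemma lip_map_box : exists N : nat,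
  open [set x | `|phi x| + 2 < N%:R] /\ K `<=` [set x | `|phi x| + 2 < N%:R].
Proof.
have : compact ((fun x => `|phi x - 0|) @` K).
  by apply: continuous_compact => //; exact: continuous_subspaceT.
move=> /compact_bounded [B [_ hB]]; exists (Num.bound (`|B| + 3)); split.
  rewrite (_ : mkset _ = [set x | `|phi x - 0| < (Num.bound (`|B| + 3))%:R - 2]).
    exact: open_norm_lt.
  by apply/seteqP; split => x /=; rewrite subr0; lra.
move=> x Kx /=; have := archi_boundP (_ : 0 <= `|B| + 3); rewrite addr_ge0// => /(_ isT).
have : `|(`|phi x|)| <= `|B| + 1.
  by apply: hB; [rewrite (le_lt_trans (ler_norm _))// ltrDl|exists x => //; rewrite subr0].
rewrite normr_id.
lra.
Qed.

Let comp_lip (f : 'rV[R]_m -> R) : is_lip f -> is_lip (f \o phi).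
Proof.
move=> /is_lipP[c c0 hc]; apply: (@is_lip_lipc _ _ (c * Lphi)); first exact: mulr_ge0.
apply: lipc_comp hc => // x y.
by rewrite mdist_rowE distrC; exact: phi_lip.
Qed.

Definition recenter (c : 'rV[R]_m) (r : R) (y : 'rV[R]_m) : 'rV[R]_m :=
  \row_j clamp (c ord0 j - r) (c ord0 j + r) (y ord0 j).

Lemma recenter_lip c r y z : `|recenter c r y - recenter c r z| <= `|y - z|.
Proof.
apply: row_norm_le => // j; rewrite !mxE.
by apply: le_trans (clamp_lip _ _ _ _) _; exact: coord_sub_le.
Qed.

Lemma recenter_near c r y : 0 <= r -> `|recenter c r y - c| <= r.
Proof.
move=> r0; apply: row_norm_le => // j; rewrite !mxE ler_norml.
by have /andP[] : c ord0 j - r <= clamp (c ord0 j - r) (c ord0 j + r) (y ord0 j)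
  <= c ord0 j + r; [apply: clamp_itv; lra|lra].
Qed.

Lemma recenter_id c r y : `|y - c| <= r -> recenter c r y = y.
Proof.
move=> h; apply/rowP => j; rewrite mxE clamp_id//.
by have := le_trans (coord_sub_le y c j) h; rewrite ler_norml; lra.
Qed.

(* The error of the affine approximation at c is extended from the cube of radius r
   as the small Lipschitz function [F - affine] \o recenter c r. *)
Lemma affine_error_lip (F : 'rV[R]_m -> R) D : C11 F D ->
  exists2 C, 0 <= C & forall c r, 0 <= r ->
   forall y z : 'rV[R]_m, `|(F (recenter c r y) - \sum_j D j c * (recenter c r y) ord0 j) -
     (F (recenter c r z) - \sum_j D j c * (recenter c r z) ord0 j)| <= C * r * `|y - z|.
Proof.
move=> [L [L0 h1 h2 h3 h4]]; exists ((2 + m%:R) * L) => [|c r r0 y z].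
  by rewrite mulr_ge0// addr_ge0.
set y' := recenter c r y; set z' := recenter c r z.
have yz : `|y' - z'| <= `|y - z| by exact: recenter_lip.
apply: (@le_trans _ _ ((2 + m%:R) * L * r * `|y' - z'|)); last first.
  by rewrite ler_wpM2l// !mulr_ge0// addr_ge0.
have yc : `|y' - c| <= r by exact: recenter_near.
have zc : `|z' - c| <= r by exact: recenter_near.
have yz2 : `|y' - z'| <= 2 * r.
  rewrite (_ : y' - z' = (y' - c) - (z' - c)); last by rewrite opprB addrA subrK.
  by apply: le_trans (ler_normB _ _) _; lra.
rewrite (_ : _ - _ = (F y' - F z' - \sum_j D j z' * (y' ord0 j - z' ord0 j)) +
    \sum_j (D j z' - D j c) * (y' ord0 j - z' ord0 j)); last first.
  have -> : \sum_j (D j z' - D j c) * (y' ord0 j - z' ord0 j) =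
      \sum_j D j z' * (y' ord0 j - z' ord0 j) -
      (\sum_j D j c * y' ord0 j - \sum_j D j c * z' ord0 j).
    by rewrite -!sumrB; apply: eq_bigr => j _; ring.
  by ring.
rewrite (_ : _ * r * _ = L * (2 * r * `|y' - z'|) + m%:R * (L * r * `|y' - z'|)); last by ring.
apply: le_trans (ler_normD _ _) _; apply: lerD.
  apply: le_trans (h4 _ _) _; rewrite ler_wpM2l// expr2 ler_wpM2r//.
apply: le_trans (ler_norm_sum _ _ _) _.
rewrite (_ : m%:R * _ = \sum_(j < m) (L * r * `|y' - z'|)); last first.
  by rewrite sumr_const card_ord -[RHS]mulr_natl.
apply: ler_sum => j _; rewrite normrM ler_pM ?coord_sub_le//.
by apply: le_trans (h2 _ _ _) _; rewrite ler_wpM2l.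
Qed.

(** [f] is cut up by the splines of mesh [2^-k]. On the support of each piece, locality permits
    replacing [F] by its affine part at the node plus an error whose Lipschitz constant is O(mesh).
    The affine parts add up to the quasi-interpolants of [D j], which are O(mesh) away from [D j].
    As [mass_bound] treats all pieces at once, the total error is O(mesh) although their number
    grows. *)
Lemma slot_chain_bounded (F : 'rV[R]_m -> R) D f (a : R) (g : 'I_n -> X -> R) i :
  C11 F D -> is_lip f -> bounded_by a f -> (forall j, is_lip (g j)) ->
  T f (subst_at g i (F \o phi)) =
  \sum_(j < m) T (fun x => f x * D j (phi x)) (subst_at g i (fun x => phi x ord0 j)).
Proof.
move=> hF hf fa hg.
have mT := current_mlin hT.
have [N [oU KU]] := lip_map_box; set U := (X in open X) in oU KU.
have [L [L0 hD1 hD2 hF1 hF2]] := hF.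
have [C C0 hC] := affine_error_lip hF.
have /choice[c hc] : forall j, exists cj : R, 0 <= cj /\ lipc cj (g j).
  by move=> j; have /is_lipP[cj] := hg j; exists cj.
have [[x0]|nX] := pselect (inhabited X); last first.
  have e0 (h : X -> R) : h = fun=> 0.
    by apply/funext => x; exfalso; apply: nX; split.
  rewrite (e0 f) mlin0//; last first.
    by apply: is_lip_subst => //; apply: comp_lip; exact: C11_is_lip hF.
  rewrite big1// => j _; rewrite (e0 (fun x => _ * _)) mlin0//.
  apply: is_lip_subst => //; apply: (comp_lip (f := fun y => y ord0 j)).
  exact: C11_is_lip (C11_coord j).
have a0 : 0 <= a by apply: le_trans (fa x0).
have hphi j : is_lip (fun x => phi x ord0 j).
  by apply: (comp_lip (f := fun y => y ord0 j)); exact: C11_is_lip (C11_coord j).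
have hphic j : lipc Lphi (fun x => phi x ord0 j).
  by move=> x y; apply: le_trans (phi_lip x y); exact: coord_sub_le.
have hFphi : is_lip (F \o phi) by apply: comp_lip; exact: C11_is_lip hF.
have M0 : 0 <= M.
  rewrite -lee_fin; apply: le_trans hM; apply: ereal_sup_ubound.
  exists 0%N, (fun _ _ => 0), (fun _ _ _ => 0); split => //.
  - by case.
  - by case.
  - by move=> x; rewrite big_ord0.
  - by rewrite big_ord0.
set lhs := T f _; set rhs := \sum_(j < m) _.
pose P := \prod_(j | j != i) c j.
have P0 : 0 <= P by apply: prodr_ge0 => j _; case: (hc j).
have bDb j : bounded_by L (D j \o phi) by move=> x; exact: hD1.
(* The first summand pays for the affine errors [Er p], with 4 from the radius [r]; the second for
   replacing [D j] by its quasi-interpolant, with 3 from [interp_approx]. *)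
suff H k : `|lhs - rhs| <= (M * a * (C * 4 * Lphi * P) + m%:R * (M * (a * (L * 3)) * (Lphi * P))) * mesh k.
  have := mesh_le0 H; rewrite normr_le0 subr_eq0 => /eqP //.
have mk0 : 0 < mesh k :> R by exact: mesh_gt0.
pose th (p : grid k N) := bspline p \o phi : X -> R.
have hth p : is_lip (th p) by apply: comp_lip; exact: C11_is_lip (bspline_C11 p).
have thb p : bounded_by 1 (th p) by move=> x; exact: bspline_bounded.
pose fp (p : grid k N) := fun x => f x * th p x.
have hfp p : is_lip (fp p) by exact: is_lipM fa (thb p) _ _.
(* Splines live within [3 * mesh k] of their nodes; the larger radius leaves an open neighbourhood
   of the support, as locality requires. *)
have [r rE r0] : exists2 r : R, r = 4 * mesh k & 0 <= r.
  by exists (4 * mesh k) => //; rewrite mulr_ge0// ltW.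
pose Er (p : grid k N) := fun x => F (recenter (node p) r (phi x)) -
   \sum_j D j (node p) * recenter (node p) r (phi x) ord0 j.
have hErc p : lipc (C * r * Lphi) (Er p).
  move=> x y; apply: le_trans (hC _ _ r0 _ _) _.
  rewrite -[C * r * Lphi * _]mulrA; have Cr0 : 0 <= C * r by exact: mulr_ge0.
  exact: (ler_wpM2l Cr0 (phi_lip x y)).
have hEr p : is_lip (Er p) by apply: is_lip_lipc (hErc p); rewrite !mulr_ge0.
have split_p p : T (fp p) (subst_at g i (F \o phi)) =
    T (fp p) (subst_at g i (Er p)) +
    \sum_j D j (node p) * T (fp p) (subst_at g i (fun x => phi x ord0 j)).
  rewrite (eq_bigr (fun j => T (fp p) (subst_at g i (fun x => D j (node p) * phi x ord0 j)))); last first.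
    by move=> j _; rewrite (mlin_slotZ mT).
  rewrite -(mlin_slot_sum mT) => [|j| |]//; last exact: is_lipZ.
  rewrite -(mlin_slotD mT)//; last by apply: is_lip_sum => j; exact: is_lipZ.
  apply: (@current_slot_eq _ _ _ _ hT [set x | `|phi x - node p| < r]) => //.
  - have : spt (fp p) `<=` [set x | `|phi x - node p| <= 3 * mesh k].
      have /closure_id -> : closed [set x | `|phi x - node p| <= 3 * mesh k].
        exact: closed_norm_le.
      apply: closure_subset => x /=; rewrite /fp mulf_eq0 negb_or => /andP[_].
      exact: bspline_supp.
    move=> /subset_trans; apply => x /= h; apply: le_lt_trans h _.
    by rewrite rE ltr_pM2r// ltr_nat.
  - by apply: is_lipD => //; apply: is_lip_sum => j; exact: is_lipZ.
  - by move=> x /= h; rewrite /Er recenter_id ?subrK// ltW.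
have lhsE : lhs = \sum_p T (fp p) (subst_at g i (F \o phi)).
  rewrite -(mlin_sum mT)//; last exact: is_lip_subst.
  apply: (current_eq_near hT hK oU KU) => //.
  - exact: is_lip_sum.
  - exact: is_lip_subst.
  - move=> x Ux; rewrite -mulr_sumr /th /= sum_bspline ?mulr1// ltW//.
pose Q j := fun x => \sum_p D j (node p) * fp p x.
have hQ j : is_lip (Q j) by apply: is_lip_sum => p; exact: is_lipZ.
have hfD j : is_lip (fun x => f x * D j (phi x)).
  apply: is_lipM fa (bDb j) hf _; apply: (comp_lip (f := D j)).
  exact: C11_grad_lip hF.
have -> : lhs - rhs = \sum_p T (fp p) (subst_at g i (Er p)) +
    \sum_j T (fun x => Q j x - f x * D j (phi x)) (subst_at g i (fun x => phi x ord0 j)).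
  rewrite lhsE (eq_bigr _ (fun p _ => split_p p)) big_split/= -addrA; congr (_ + _).
  rewrite exchange_big/= -sumrB; apply: eq_bigr => j _.
  rewrite (mlinB mT)//; last exact: is_lip_subst.
  congr (_ - _); rewrite (mlin_sum mT) => [|p|]; last exact: is_lip_subst.
    by apply: eq_bigr => p _; rewrite (mlinZ mT)//; exact: is_lip_subst.
  exact: is_lipZ.
have slotc (e : R) : \prod_j (if j == i then e else c j) = e * P.
  rewrite (bigD1 i)//= eqxx; congr (_ * _); apply: eq_bigr => j /negPf ->//.
rewrite mulrDl; apply: le_trans (ler_normD _ _) _; apply: lerD.
  rewrite (_ : _ * mesh k = M * a * (C * r * Lphi * P)); last by rewrite rE; ring.
  rewrite -slotc; apply: (mass_bound mT hM) => //.
  - by move=> j; case: eqP => _; [rewrite !mulr_ge0|case: (hc j)].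
  - move=> p j; rewrite /subst_at; case: eqP => _; first exact: hErc.
    by case: (hc j).
  - move=> x; rewrite (eq_bigr (fun p => `|f x| * bspline p (phi x))); last first.
      by move=> p _; rewrite normrM (ger0_norm (bspline_ge0 _ _)).
    rewrite -mulr_sumr -[leRHS]mulr1 ler_pM ?sum_bspline_le1//.
    by apply: sumr_ge0 => p _; exact: bspline_ge0.
apply: le_trans (ler_norm_sum _ _ _) _.
rewrite (_ : _ * mesh k = \sum_(j < m) (M * (a * (L * (3 * mesh k))) * (Lphi * P))); last first.
  by rewrite sumr_const card_ord -[RHS]mulr_natl; ring.
apply: ler_sum => j _; rewrite -slotc.
apply: (current_bound_near hT hM hK oU KU) => //.
- by rewrite !mulr_ge0// ltW.
- by move=> l; case: eqP => _ //; case: (hc l).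
- exact: is_lipB.
- by move=> l; rewrite /subst_at; case: eqP => _ //; case: (hc l).
- move=> x Ux; rewrite /Q (_ : _ - _ = f x * (interp k N (D j) (phi x) - D j (phi x))).
    rewrite normrM ler_pM//; apply: interp_approx => //; exact: ltW.
  by rewrite /interp mulrBr mulr_sumr; congr (_ - _); apply: eq_bigr => p _;
    rewrite /fp /th /=; ring.
Qed.

End chain_rule.

Lemma uniform_cvg_ballP (R : realType) (U : choiceType) (V : pseudoMetricType R)
    (f_ : nat -> U -> V) (f : U -> V) :
  {uniform, f_ @ \oo --> f} <->
  forall e : R, 0 < e -> \forall k \near \oo, forall x, ball (f x) e (f_ k x).
Proof.
split=> [h e e0|h P].
  apply: (h [set g | forall x, ball (f x) e (g x)]).
  apply/uniform_nbhs; exists [set xy | ball xy.1 e xy.2]; split => [|g /= hg x].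
    by rewrite -entourage_ballE; exists e.
  exact: hg.
move=> /uniform_nbhs [E [+ EP]]; rewrite -entourage_ballE => -[e /= e0 eE].
apply: filterS (h e e0) => k hk; apply: EP => x _.
by apply: eE => /=; exact: hk.
Qed.

Lemma uniform_cvg_le (R : realType) (X : metricType R) (f_ : nat -> X -> R) (f : X -> R)
    (u : nat -> R) : u @ \oo --> (0 : R) -> (forall k x, `|f_ k x - f x| <= u k) ->
  {uniform, f_ @ \oo --> f}.
Proof.
move=> u0 h; apply/(@uniform_cvg_ballP R) => e e0.
move/cvgrPdist_lt : u0 => /(_ e e0); apply: filterS => k; rewrite sub0r normrN => uk x.
rewrite -ball_normE/= distrC; apply: le_lt_trans (h k x) _.
by apply: le_lt_trans uk; exact: ler_norm.
Qed.

(** * Alternation of currents and the determinant chain rule *)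

Section oscillation.
Context {R : realType}.

Lemma sin_C11 : C11_line (@sin R) cos.
Proof.
apply: (@C11_line_derive _ _ _ 1) => //; first by move=> y; rewrite ler_norml cos_geN1 cos_le1.
move=> y z; have [c _ ->] := @mean_value R cos (fun x => - sin x) y z (fun x => is_derive_cos x).
by rewrite normrM ler_wpM2r// normrN ler_norml sin_geN1 sin_le1.
Qed.

(** A perturbation that tends to the identity uniformly with bounded Lipschitz constants, while its
    derivative [1 + s * cos (k.+1%:R * t)] keeps oscillating. *)
Definition osc (k : nat) (s t : R) : R := t + s * (k.+1%:R^-1 * sin (k.+1%:R * t)).

Lemma osc_C11 k (s : R) : C11 (fun y : 'rV[R]_1 => osc k s (y ord0 ord0))
  (fun i y => 1 + s * cos (k.+1%:R * y ord0 ord0)).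
Proof.
have h0 := C11_line_affine k.+1%:R 0 sin_C11.
have := C11_lin (s * k.+1%:R^-1) (C11_line_coord (ord0 : 'I_1) h0) (C11_coord (ord0 : 'I_1)).
rewrite (_ : (fun y : 'rV[R]_1 => _ + _) = fun y : 'rV[R]_1 => osc k s (y ord0 ord0)); last first.
  by apply/funext => y; rewrite /osc addr0 addrC mulrA.
move=> h; apply: C11_ext h _ => i y; rewrite ord1 eqxx addr0.
by rewrite mulrA -[_ * _ * k.+1%:R]mulrA mulVf ?mulr1 ?pnatr_eq0// addrC.
Qed.

Lemma osc_lip k (s y z : R) : `|s| <= 1 -> `|osc k s y - osc k s z| <= 2 * `|y - z|.
Proof.
move=> s1; have hs (u v : R) : `|sin u - sin v| <= `|u - v|.
  have [c _ ->] := @mean_value R sin cos u v (fun x => is_derive_sin x).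
  by rewrite normrM -[leRHS]mul1r ler_wpM2r// ler_norml cos_geN1 cos_le1.
rewrite /osc (_ : _ - _ = (y - z) + s * (k.+1%:R^-1 * (sin (k.+1%:R * y) - sin (k.+1%:R * z)))); last by ring.
apply: le_trans (ler_normD _ _) _.
suff : `|s * (k.+1%:R^-1 * (sin (k.+1%:R * y) - sin (k.+1%:R * z)))| <= `|y - z| by lra.
rewrite normrM -[leRHS]mul1r ler_pM// normrM ger0_norm ?invr_ge0//.
rewrite ler_pdivrMl//; apply: le_trans (hs _ _) _.
by rewrite -mulrBr normrM ger0_norm.
Qed.

Lemma osc_dist k (s t : R) : `|s| <= 1 -> `|osc k s t - t| <= k.+1%:R^-1.
Proof.
move=> s1; rewrite /osc addrC addKr normrM -[leRHS]mul1r ler_pM//.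
by rewrite normrM ger0_norm ?invr_ge0// ler_piMr ?invr_ge0// ler_norml sin_geN1 sin_le1.
Qed.

Lemma harmonic_cvg0 : (fun k => k.+1%:R^-1 : R) @ \oo --> (0 : R).
Proof. exact: cvg_harmonic. Qed.

End oscillation.

Section alternation.
Context {R : realType}.
Variables (X : metricType R) (n : nat) (T : functional X n) (M : R).
Hypothesis hT : is_current T.
Hypothesis hM : (mass T <= M%:E)%E.

Lemma current_slot_cvg (f : X -> R) (g : 'I_n -> X -> R) (h_ : nat -> 'I_n -> X -> R)
    (c : R) (u : nat -> R) : is_lip f -> (forall i, is_lip (g i)) ->
  0 <= c -> (forall k i, lipc c (h_ k i)) -> u @ \oo --> (0 : R) ->
  (forall k i x, `|h_ k i x - g i x| <= u k) ->
  (fun k => T f (h_ k)) @ \oo --> T f g.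
Proof.
move=> hf hg c0 hc u0 hu.
apply: (current_continuous hT (f_ := fun=> f) (g_ := h_)) => //.
- have /is_lipP[d d0 hd] := hf; exists (c + d) => k; split.
    by apply/LipP; [exact: addr_ge0|apply: lipc_le hd; rewrite lerDr].
  by move=> i; apply/LipP; [exact: addr_ge0|apply: lipc_le (hc k i); rewrite lerDl].
- apply: (@uniform_cvg_le _ _ _ _ (fun=> 0)); first exact: cvg_cst.
  by move=> k x; rewrite subrr normr0.
- by move=> i; apply: uniform_cvg_le u0 _ => k x; exact: hu.
Qed.

Lemma slot_osc (f : X -> R) (a : R) (g : 'I_n -> X -> R) i (p : X -> R) k s :
  is_lip f -> bounded_by a f -> (forall j, is_lip (g j)) -> is_lip p ->
  T f (subst_at g i (fun x => osc k s (p x))) =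
  T (fun x => f x * (1 + s * cos (k.+1%:R * p x))) (subst_at g i p).
Proof.
move=> hf fa hg hp; have [K [cK hK]] := current_compact hT.
have /is_lipP[c c0 hc] := hp.
pose phi x : 'rV[R]_1 := \row__ p x.
have hphi x y : `|phi x - phi y| <= c * mdist x y.
  by apply: row_norm_le => [|j]; rewrite ?mulr_ge0 ?mdist_ge0// !mxE; exact: hc.
have := slot_chain_bounded hT hM cK hK c0 hphi i (osc_C11 k s) hf fa hg.
rewrite big_ord1 => h.
rewrite (_ : (fun x => osc _ _ _) = (fun y : 'rV[R]_1 => osc k s (y ord0 ord0)) \o phi); last first.
  by apply/funext => x /=; rewrite mxE.
rewrite h; congr (T _ (subst_at _ _ _)).
  by apply/funext => x; rewrite mxE.
by apply/funext => x; rewrite mxE.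
Qed.

(* Replacing the two equal slots p by p + sin(k p)/k and p - sin(k p)/k, which converge to
   p uniformly with bounded Lipschitz constants, multiplies f by
   1 - cos(k p)^2 = 1/2 - cos(2 k p)/2, and T(f cos(2 k p), g) tends to 0, as one sees by
   replacing only one of the slots.  Hence the value is equal to its half. *)
Lemma current_alternate (f : X -> R) (g : 'I_n -> X -> R) i j : i != j -> g i = g j ->
  is_lip f -> (forall l, is_lip (g l)) -> T f g = 0.
Proof.
move=> ij gij hf hg; have mT := current_mlin hT.
have [K [cK hK]] := current_compact hT.
have [f' [a [hf' fa' ->]]] := current_bounded_repr hT cK hK hf; last exact: hg.
move: hf fa' => _; move: f' hf' => {}f hf fa.
pose p := g i; have hp : is_lip p by exact: hg.
have hosc k s : `|s| <= 1 -> is_lip (fun x => osc k s (p x)).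
  move=> s1; have /is_lipP[c c0 hc] := hp.
  apply: (@is_lip_lipc _ _ (2 * c)); first by rewrite mulr_ge0.
  move=> x y; apply: le_trans (osc_lip k (p x) (p y) s1) _.
  by rewrite -mulrA ler_wpM2l.
have [c c0 hc] : exists2 c : R, 0 <= c & forall l, lipc c (g l).
  have /choice[c hc] : forall l, exists cl : R, 0 <= cl /\ lipc cl (g l).
    by move=> l; have /is_lipP[cl] := hg l; exists cl.
  exists (\sum_l c l) => [|l]; first by apply: sumr_ge0 => l _; case: (hc l).
  apply: lipc_le (hc l).2; rewrite (bigD1 l)//= lerDl.
  by apply: sumr_ge0 => l' _; case: (hc l').
have hcc k s l : `|s| <= 1 -> l = i \/ l = j -> lipc (2 * c + c) (fun x => osc k s (g l x)).
  move=> s1 _; apply: (@lipc_le _ _ (2 * c)); first by lra.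
  move=> x y; apply: le_trans (osc_lip k _ _ s1) _.
  by rewrite -mulrA ler_wpM2l//; exact: hc.
have c3 : 0 <= 2 * c + c by lra.
have s1 : `|1 : R| <= 1 by rewrite normr1.
have s2 : `|- 1 : R| <= 1 by rewrite normrN1.
have gl l : lipc (2 * c + c) (g l) by apply: lipc_le (hc l); lra.
have hcos k : is_lip (fun x => cos (k.+1%:R * p x)).
  have /is_lipP[d d0 hd] := hp.
  apply: (@is_lip_lipc _ _ (k.+1%:R * d)); first by rewrite mulr_ge0.
  move=> x y; have [e _ ->] := @mean_value R cos (fun x => - sin x)
    (k.+1%:R * p x) (k.+1%:R * p y) (fun x => is_derive_cos x).
  rewrite normrM -mulrBr normrM (ger0_norm (ler0n _ _)).
  apply: (@le_trans _ _ (1 * (k.+1%:R * `|p x - p y|))).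
    by rewrite ler_wpM2r ?mulr_ge0// normrN ler_norml sin_geN1 sin_le1.
  by rewrite mul1r -mulrA ler_wpM2l.
have cosb k : bounded_by 1 (fun x => cos (k.+1%:R * p x)).
  by move=> x; rewrite ler_norml cos_geN1 cos_le1.
have hfc k : is_lip (fun x => f x * cos (k.+1%:R * p x)) by exact: is_lipM fa (cosb k) hf _.
have hf1 k s : `|s| <= 1 -> is_lip (fun x => f x * (1 + s * cos (k.+1%:R * p x))).
  move=> _; rewrite (_ : (fun x => _) = fun x => s * (f x * cos (k.+1%:R * p x)) + f x).
    by apply: is_lipD => //; exact: is_lipZ.
  by apply/funext => x; ring.
have fb1 k s : `|s| <= 1 -> bounded_by (a * 2) (fun x => f x * (1 + s * cos (k.+1%:R * p x))).
  move=> hs x; rewrite normrM ler_pM//; apply: le_trans (ler_normD _ _) _.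
  by rewrite normr1 normrM -[leRHS]/(1 + 1) lerD2l -[leRHS]mulr1 ler_pM// cosb.
have gE : subst_at g i p = g by exact: subst_at_id.
have gE' : subst_at g j p = g by rewrite /p gij; exact: subst_at_id.
have single k : T f (subst_at g i (fun x => osc k 1 (p x))) =
    T f g + T (fun x => f x * cos (k.+1%:R * p x)) g.
  rewrite (slot_osc i k 1 hf fa hg hp) gE -(mlinD mT)//; congr (T _ g).
  by apply/funext => x; ring.
(* The doubled frequency is the one of index [k.*2.+1], so the oscillating term runs through a
   subsequence of the null sequence [lim0]. *)
have double k : T f (subst_at (subst_at g i (fun x => osc k 1 (p x))) j
      (fun x => osc k (-1) (p x))) =
    2^-1 * T f g - 2^-1 * T (fun x => f x * cos ((k.*2.+1).+1%:R * p x)) g.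
  rewrite (slot_osc j k (-1) hf fa _ hp); last first.
    by apply: is_lip_subst => //; exact: hosc.
  rewrite subst_at_comm// gE' (slot_osc i k 1 (hf1 k _ s2) (fb1 k _ s2) hg hp) gE.
  rewrite -!(mlinZ mT)// -(mlinB mT)//; [|exact: is_lipZ..].
  congr (T _ g); apply/funext => x.
  rewrite (_ : k.*2.+2%:R * p x = (k.+1%:R * p x) *+ 2); last first.
    by rewrite -doubleS -mul2n natrM mulr2n; ring.
  by rewrite cos_mulr2n mulr2n expr2; field.
have lim1 : (fun k => T f g + T (fun x => f x * cos (k.+1%:R * p x)) g) @ \oo --> T f g.
  rewrite (_ : (fun k => _) = fun k => T f (subst_at g i (fun x => osc k 1 (p x)))); last first.
    by apply/funext => k; rewrite single.
  apply: (current_slot_cvg hf hg c3 _ harmonic_cvg0).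
    by move=> k l; rewrite /subst_at; case: eqP => // _; apply: hcc => //; left.
  move=> k l x; rewrite /subst_at; case: eqP => [->|_]; last first.
    by rewrite subrr normr0 invr_ge0.
  exact: osc_dist.
have lim0 : (fun k => T (fun x => f x * cos (k.+1%:R * p x)) g) @ \oo --> (0 : R).
  rewrite -(subrr (T f g)) (_ : (fun k => _) = fun k =>
    (T f g + T (fun x => f x * cos (k.+1%:R * p x)) g) - T f g); last first.
    by apply/funext => k; rewrite addrC addKr.
  by apply: cvgB => //; exact: cvg_cst.
have lim2 : (fun k => 2^-1 * T f g - 2^-1 * T (fun x => f x * cos ((k.*2.+1).+1%:R * p x)) g) @ \oo
    --> T f g.
  rewrite (_ : (fun k => _) = fun k => T f (subst_at (subst_at g i (fun x => osc k 1 (p x))) j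
      (fun x => osc k (-1) (p x)))); last by apply/funext => k; rewrite double.
  apply: (current_slot_cvg hf hg c3 _ harmonic_cvg0).
    move=> k l; rewrite /subst_at; case: eqP => _.
      by apply: hcc => //; left.
    by case: eqP => // _; apply: hcc => //; left.
  move=> k l x; rewrite /subst_at; case: eqP => [->|_].
    by rewrite /p gij; exact: osc_dist.
  case: eqP => [->|_]; first exact: osc_dist.
  by rewrite subrr normr0 invr_ge0.
have lim3 : (fun k => 2^-1 * T f g - 2^-1 * T (fun x => f x * cos ((k.*2.+1).+1%:R * p x)) g) @ \oo
    --> 2^-1 * T f g - 2^-1 * 0.
  apply: cvgB; first exact: cvg_cst.
  apply: cvgMl_tmp; apply: cvg_trans lim0.
  apply: (@cvg_comp _ _ _ (fun k : nat => k.*2.+1) (fun k => T (fun x => f x * cos (k.+1%:R * p x)) g) _ \oo).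
    move=> A [N _ hN]; exists N => // k /= Nk; apply: hN => /=.
    by apply: leq_trans Nk _; rewrite -addnn; lia.
  exact: cvg_id.
have : T f g = 2^-1 * T f g - 2^-1 * 0 by apply: cvg_unique lim2 lim3; exact: Rhausdorff.
lra.
Qed.

End alternation.

Section bounded_lipschitz.
Context {R : realType} {X : metricType R}.
Implicit Types f g : X -> R.

(** Bounded Lipschitz functions form an algebra, in which determinants of gradients can be
    computed. *)
Definition blip f : Prop := is_lip f /\ exists a, bounded_by a f.

Lemma blip_cst c : blip (fun=> c).
Proof. by split; [exact: is_lip_cst|exists `|c|]. Qed.

Lemma blipM f g : blip f -> blip g -> blip (fun x => f x * g x).
Proof.
move=> [hf [a ha]] [hg [b hb]]; split; first exact: is_lipM ha hb hf hg.
by exists (a * b) => x; rewrite normrM ler_pM.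
Qed.

Lemma blipD f g : blip f -> blip g -> blip (fun x => f x + g x).
Proof.
move=> [hf [a ha]] [hg [b hb]]; split; first exact: is_lipD.
by exists (a + b) => x; apply: le_trans (ler_normD _ _) _; exact: lerD.
Qed.

Lemma blip_sum (I : Type) (r : seq I) (P : pred I) (F : I -> X -> R) :
  (forall i, blip (F i)) -> blip (fun x => \sum_(i <- r | P i) F i x).
Proof.
move=> h; elim: r => [|i r ih].
  rewrite (_ : (fun x => _) = fun=> 0); first exact: blip_cst.
  by apply/funext => x; rewrite big_nil.
rewrite (_ : (fun x => _) = fun x => (if P i then F i x else 0) +
    \sum_(j <- r | P j) F j x).
  by apply: blipD => //; case: (P i) => //; exact: blip_cst.
by apply/funext => x; rewrite big_cons; case: (P i) => //; rewrite add0r.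
Qed.

Lemma blip_prod (I : Type) (r : seq I) (P : pred I) (F : I -> X -> R) :
  (forall i, blip (F i)) -> blip (fun x => \prod_(i <- r | P i) F i x).
Proof.
move=> h; elim: r => [|i r ih].
  rewrite (_ : (fun x => _) = fun=> 1); first exact: blip_cst.
  by apply/funext => x; rewrite big_nil.
rewrite (_ : (fun x => _) = fun x => (if P i then F i x else 1) *
    \prod_(j <- r | P j) F j x).
  by apply: blipM => //; case: (P i) => //; exact: blip_cst.
by apply/funext => x; rewrite big_cons; case: (P i) => //; rewrite mul1r.
Qed.

Lemma blip_det n (A : 'I_n -> 'I_n -> X -> R) : (forall i j, blip (A i j)) ->
  blip (fun x => \det (\matrix_(i, j) A i j x)).
Proof.
move=> h; rewrite (_ : (fun x => _) = fun x => \sum_(s : 'S_n) (-1) ^+ s * \prod_i A i (s i) x).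
  by apply: blip_sum => s; apply: blipM; [exact: blip_cst|exact: blip_prod].
apply/funext => x; apply: eq_bigr => s _; congr (_ * _).
by apply: eq_bigr => i _; rewrite mxE.
Qed.

End bounded_lipschitz.

Section determinant_chain_rule.
Context {R : realType}.
Variables (X : metricType R) (n : nat) (T : functional X n) (M : R).
Hypothesis hT : is_current T.
Hypothesis hM : (mass T <= M%:E)%E.

(** Polarization: expand the vanishing value with [g i + g j] in both slots. *)
Lemma current_tperm f (g : 'I_n -> X -> R) i j : i != j -> is_lip f ->
  (forall l, is_lip (g l)) -> T f (fun l => g (tperm i j l)) = - T f g.
Proof.
move=> ij hf hg; have mT := current_mlin hT.
pose s := fun x => g i x + g j x; have hs : is_lip s by exact: is_lipD.
pose G a b := T f (subst_at (subst_at g i a) j b).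
have alt a : is_lip a -> G a a = 0.
  move=> ha; apply: (current_alternate hT hM ij) => //.
    by rewrite subst_at_eq subst_at_neq// subst_at_eq.
  by do 2 apply: is_lip_subst => //.
have GD a b b' : is_lip a -> is_lip b -> is_lip b' ->
    G a (fun x => b x + b' x) = G a b + G a b'.
  by move=> ha hb hb'; rewrite /G (mlin_slotD mT)//; exact: is_lip_subst.
have GC a b : G a b = T f (subst_at (subst_at g j b) i a).
  by rewrite /G subst_at_comm.
have GD' a a' b : is_lip a -> is_lip a' -> is_lip b ->
    G (fun x => a x + a' x) b = G a b + G a' b.
  by move=> ha hb hb'; rewrite !GC (mlin_slotD mT)//; exact: is_lip_subst.
have := alt s hs; rewrite /s GD'// ?GD// !alt// add0r addr0.
have -> : G (g i) (g j) = T f g by rewrite /G subst_at_id subst_at_id.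
have -> : G (g j) (g i) = T f (fun l => g (tperm i j l)).
  congr (T f _); apply/funext => l; rewrite /subst_at.
  by case: tpermP => [->|->|/eqP/negPf -> /eqP/negPf ->]; rewrite ?eqxx// (negPf ij).
by move=> e; apply/eqP; rewrite -addr_eq0 addrC e.
Qed.

Lemma current_perm f (g : 'I_n -> X -> R) (s : 'S_n) : is_lip f ->
  (forall l, is_lip (g l)) -> T f (fun l => g (s l)) = (-1) ^+ s * T f g.
Proof.
move=> hf hg; have [ts -> dts] := prod_tpermP s.
elim: ts dts => [_|[i j] ts ih /= /andP[ij dts]].
  rewrite big_nil odd_perm1 mul1r; congr (T f _); apply/funext => l.
  by rewrite perm1.
rewrite big_cons odd_permM odd_tperm ij/= signrN mulNr -(ih dts).
rewrite -(current_tperm ij hf (g := fun l => g ((\prod_(t <- ts) tperm t.1 t.2)%g l)))//.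
by congr (T f _); apply/funext => l; rewrite permM.
Qed.

(** For injective [s] the matrix is a permutation matrix; otherwise two slots agree, hence two rows,
    and both sides vanish. *)
Lemma current_select f (g : 'I_n -> X -> R) (s : 'I_n -> 'I_n) : is_lip f ->
  (forall l, is_lip (g l)) ->
  T f (fun l => g (s l)) = \det (\matrix_(i, j) (s i == j)%:R) * T f g.
Proof.
move=> hf hg; have [/injectiveP si|/injectivePn[i [j ij sij]]] := boolP (injectiveb s).
  rewrite (_ : \matrix_(i, j) _ = perm_mx (perm si)); last first.
    by apply/matrixP => i j; rewrite !mxE permE.
  rewrite det_perm -current_perm//; congr (T f _); apply/funext => l.
  by rewrite permE.
rewrite (current_alternate hT hM ij)//; last by rewrite sij.
by rewrite (determinant_alternate ij) ?mul0r// => l; rewrite !mxE sij.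
Qed.

Variable phi : X -> 'rV[R]_n.
Variable Lphi : R.
Hypothesis Lphi0 : 0 <= Lphi.
Hypothesis phi_lip : forall x y, `|phi x - phi y| <= Lphi * mdist x y.

Let comp_lip (f : 'rV[R]_n -> R) : is_lip f -> is_lip (f \o phi).
Proof.
move=> /is_lipP[c c0 hc]; apply: (@is_lip_lipc _ _ (c * Lphi)); first exact: mulr_ge0.
apply: lipc_comp hc => // x y.
by rewrite mdist_rowE distrC; exact: phi_lip.
Qed.

(** The slots are replaced one after the other by [slot_chain_bounded]. Rows of slots already
    replaced are unit vectors, so Laplace expansion along the next row turns the resulting sum back
    into one determinant. When all slots are coordinates, [current_select] concludes. *)
Lemma det_chain (f : X -> R) (F : 'I_n -> 'rV[R]_n -> R) (D : 'I_n -> 'I_n -> 'rV[R]_n -> R) :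
  is_lip f -> (exists a, bounded_by a f) -> (forall i, C11 (F i) (D i)) ->
  T f (fun i => F i \o phi) =
  T (fun x => f x * \det (\matrix_(i, j) D i j (phi x))) (fun j x => phi x ord0 j).
Proof.
move=> hf0 hb0 hF; have mT := current_mlin hT.
have [K [cK hK]] := current_compact hT.
have hphi j : is_lip (fun x => phi x ord0 j).
  by apply: (comp_lip (f := fun y => y ord0 j)); exact: C11_is_lip (C11_coord j).
have hFphi i : is_lip (F i \o phi) by apply: comp_lip; exact: C11_is_lip (hF i).
have bD i j : blip (fun x => D i j (phi x)).
  split; first by apply: (comp_lip (f := D i j)); exact: C11_grad_lip (hF i).
  by have [L hL] := C11_grad_bounded (hF i); exists L => x; exact: hL.
(* Slots of index < k have already been replaced by coordinates of phi. *)
pose G (k : nat) (s : 'I_n -> 'I_n) (i : 'I_n) : X -> R :=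
  if (i < k)%N then fun x => phi x ord0 (s i) else F i \o phi.
pose A (k : nat) (s : 'I_n -> 'I_n) (i j : 'I_n) (x : X) : R :=
  if (i < k)%N then (s i == j)%:R else D i j (phi x).
have hG k s i : is_lip (G k s i) by rewrite /G; case: (i < k)%N.
have bA k s i j : blip (A k s i j) by rewrite /A; case: (i < k)%N => //; exact: blip_cst.
have bdA k s := blip_det (bA k s).
suff H k s f' : (k <= n)%N -> blip f' ->
    T f' (G (n - k)%N s) = T (fun x => f' x * \det (\matrix_(i, j) A (n - k)%N s i j x))
      (fun j x => phi x ord0 j).
  have := H n id f (leqnn n) (conj hf0 hb0); rewrite subnn => ->.
  by congr (T _ _).
elim: k s f' => [|k ih] s f' kn bf'.
  rewrite subn0; transitivity (\det (\matrix_(i, j) (s i == j)%:R) * T f' (fun j x => phi x ord0 j)).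
    rewrite -current_select//; last by case: bf'.
    by congr (T f' _); apply/funext => i; rewrite /G ltn_ord.
  rewrite -(mlinZ mT)//; last by case: bf'.
  congr (T _ _); apply/funext => x; rewrite mulrC; congr (_ * \det _).
  by apply/matrixP => i j; rewrite !mxE /A ltn_ord.
have nk : (n - k.+1 < n)%N by lia.
pose i0 := Ordinal nk.
have e : (n - k = (n - k.+1).+1)%N by lia.
have split_s j : subst_at (G (n - k.+1)%N s) i0 (fun x => phi x ord0 j) =
    G (n - k)%N (fun i => if i == i0 then j else s i).
  apply/funext => i; rewrite /subst_at /G e ltnS [(i <= n - k.+1)%N]leq_eqVlt.
  have -> : (i == n - k.+1 :> nat)%N = (i == i0) by [].
  by case: eqP => // ->.
have Gi0 : G (n - k.+1)%N s i0 = F i0 \o phi by rewrite /G ltnn.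
rewrite -(subst_at_id (G (n - k.+1)%N s) i0) Gi0.
have [hf' [a fa]] := bf'.
rewrite (slot_chain_bounded hT hM cK hK Lphi0 phi_lip i0 (hF i0) hf' fa)//.
have bfD j : blip (fun x => f' x * D i0 j (phi x)) by exact: blipM.
rewrite (eq_bigr (fun j => T (fun x => f' x * D i0 j (phi x) *
    \det (\matrix_(i, l) A (n - k)%N (fun i => if i == i0 then j else s i) i l x))
    (fun j x => phi x ord0 j))); last first.
  by move=> j _; rewrite split_s ih// ltnW.
rewrite -(mlin_sum mT)//; last by move=> j; case: (blipM (bfD j) (bdA (n - k)%N (fun i => if i == i0 then j else s i))).
congr (T _ _); apply/funext => x.
rewrite (expand_det_row _ i0) mulr_sumr; apply: eq_bigr => j _.
have -> : (\matrix_(i, j0) A (n - k.+1)%N s i j0 x) i0 j = D i0 j (phi x).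
  by rewrite mxE /A ltnn.
rewrite -mulrA; congr (_ * (_ * _)).
rewrite (expand_det_row _ i0) (bigD1 j)//= big1 ?addr0; last first.
  by move=> l lj; rewrite !mxE /A e ltnS leqnn eqxx eq_sym (negPf lj) mul0r.
rewrite mxE /A e ltnS leqnn !eqxx mul1r /cofactor; congr (_ * \det _).
apply/matrixP => a' b; rewrite !mxE ltnS [(lift i0 a' <= n - k.+1)%N]leq_eqVlt.
have -> : (lift i0 a' == n - k.+1 :> nat)%N = (lift i0 a' == i0) by [].
by rewrite eq_sym (negPf (neq_lift _ _)).
Qed.

End determinant_chain_rule.

Section spline_primitive.
Context {R : realType} {n : nat}.
Implicit Types f : 'rV[R]_n -> R.

(** Replacing the factor of direction [i] by its primitive [mesh k * Spl] exhibits every spline sum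
    as a partial derivative in any prescribed direction. This gives general test functions access to
    the boundary. *)
Lemma interp_primitive k N f (i : 'I_n) : exists F D,
  [/\ C11 F D, exists a, bounded_by a F & forall y, D i y = interp k N f y].
Proof.
pose w (p : @grid n k N) (j : 'I_n) (t : R) : R :=
  if j == i then mesh k * Spl (gcoord k N t - (p j)%:R) else spl (gcoord k N t - (p j)%:R).
pose dw (p : @grid n k N) (j : 'I_n) (t : R) : R :=
  if j == i then spl (gcoord k N t - (p j)%:R) else 2 ^+ k * dspl (gcoord k N t - (p j)%:R).
have hw p j : C11_line (w p j) (dw p j).
  by rewrite /w /dw; case: (j == i); [exact: Spl_gcoord_C11|exact: spl_gcoord_C11].
have hb p j : bounded_by 1 (w p j).
  move=> t; rewrite /w; case: (j == i); last exact: spl_bounded.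
  rewrite normrM !ger0_norm ?(ltW (mesh_gt0 k))//; last by case/andP: (Spl_itv (gcoord k N t - (p j)%:R)).
  rewrite -[leRHS]mulr1 ler_pM ?(ltW (mesh_gt0 k))//; [by case/andP: (Spl_itv (gcoord k N t - (p j)%:R))| |by case/andP: (Spl_itv (gcoord k N t - (p j)%:R))].
  by rewrite invf_le1 ?exprn_gt0// exprn_ege1// ler1n.
pose F y := \sum_(p : @grid n k N) f (node p) * \prod_j w p j (y ord0 j).
have hF := C11_sum (index_enum (@grid n k N)) (fun p => f (node p))
  (fun p => C11_tensor (hw p) (hb p)).
eexists; eexists; split; first exact: hF.
  exists (\sum_(p : @grid n k N) `|f (node p)|) => y.
  apply: le_trans (ler_norm_sum _ _ _) _; apply: ler_sum => p _.
  rewrite normrM -[leRHS]mulr1 ler_pM// normr_prod; apply: prodr_ile1 => j _.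
  by rewrite normr_ge0; exact: hb.
move=> y /=; rewrite /interp; apply: eq_bigr => p _; congr (_ * _).
rewrite /bspline [RHS](bigD1 i)//= /dw eqxx; congr (_ * _); apply: eq_bigr => j ji.
by rewrite /w (negPf ji).
Qed.

End spline_primitive.

Lemma prod_lift (R : realType) n (i : 'I_n.+1) (c : 'I_n.+1 -> R) :
  \prod_(j | j != i) c j = \prod_(l < n) c (lift i l).
Proof.
have := bigD1_ord (op := *%R) (x := 1) i (P := xpredT)
  (F := fun j => if j == i then 1 else c j) isT.
rewrite (bigD1 i)//= eqxx !mul1r => e.
transitivity (\prod_(j | j != i) (if j == i then 1 else c j)).
  by apply: eq_bigr => j /negPf ->.
by rewrite e; apply: eq_bigr => l _; rewrite eq_sym (negPf (neq_lift _ _)).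
Qed.

(** * Pushforwards under Lipschitz maps *)

Section homotopy.
Context {R : realType}.
Variables (X : metricType R) (n : nat) (T : functional X n.+1) (M B : R).
Hypothesis hT : is_current T.
Hypothesis hM : (mass T <= M%:E)%E.
Hypothesis hB : (mass (boundary T) <= B%:E)%E.

Definition coords (phi : X -> 'rV[R]_n.+1) : 'I_n.+1 -> X -> R := fun j x => phi x ord0 j.

(** Moving slot [i] to the head is the permutation [lift_perm ord0 i 1], and [current_perm] supplies
    its sign. *)
Lemma boundary_slot (g : 'I_n.+1 -> X -> R) i h : (forall j, is_lip (g j)) -> is_lip h ->
  T (fun=> 1) (subst_at g i h) =
  (-1) ^+ (lift_perm ord0 i 1%g) * boundary T h (fun l => g (lift i l)).
Proof.
move=> hg hh; rewrite /boundary.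
have -> : extend_head h (fun l => g (lift i l)) =
    fun l => subst_at g i h (lift_perm ord0 i 1%g l).
  apply/funext => l; case: (unliftP ord0 l) => [j ->|->].
    by rewrite extend_head_lift lift_perm_lift perm1 subst_at_neq// eq_sym neq_lift.
  by rewrite extend_head0 lift_perm_id subst_at_eq.
rewrite (current_perm hT hM)//; first by rewrite mulrA -signr_addb addbb mul1r.
  exact: is_lip_cst.
exact: is_lip_subst.
Qed.

Section one_map.
Variable phi : X -> 'rV[R]_n.+1.
Variable c : 'I_n.+1 -> R.
Hypothesis c0 : forall i, 0 <= c i.
Hypothesis phi_lip : forall i, lipc (c i) (coords phi i).

Lemma coords_lip : exists2 L, 0 <= L & forall x y, `|phi x - phi y| <= L * mdist x y.
Proof.
exists (\sum_i c i) => [|x y]; first exact: sumr_ge0.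
apply: row_norm_le => [|i]; first by rewrite mulr_ge0 ?mdist_ge0// sumr_ge0.
rewrite !mxE; apply: le_trans (phi_lip i x y) _.
by rewrite ler_wpM2r ?mdist_ge0// (bigD1 i)//= lerDl sumr_ge0.
Qed.

Lemma coords_is_lip i : is_lip (coords phi i).
Proof. exact: is_lip_lipc (phi_lip i). Qed.

Lemma comp_is_lip (f : 'rV[R]_n.+1 -> R) : is_lip f -> is_lip (f \o phi).
Proof.
have [L L0 hL] := coords_lip.
move=> /is_lipP[a a0 ha]; apply: (@is_lip_lipc _ _ (a * L)); first exact: mulr_ge0.
by apply: lipc_comp ha => // x y; rewrite mdist_rowE distrC; exact: hL.
Qed.

(** Integration by parts. The chain rule writes the value with [F] in slot [i] as a sum over [j];
    for [j != i] two slots carry the same coordinate and alternation kills the term. *)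
Lemma grad_boundary (F : 'rV[R]_n.+1 -> R) D i : C11 F D ->
  T (D i \o phi) (coords phi) =
  (-1) ^+ (lift_perm ord0 i 1%g) * boundary T (F \o phi) (fun l => coords phi (lift i l)).
Proof.
move=> hF; have [L L0 hL] := coords_lip.
have [K [cK hK]] := current_compact hT.
have hcl := coords_is_lip.
rewrite -boundary_slot//; last by apply: comp_is_lip; exact: C11_is_lip hF.
have h1 : bounded_by 1 (fun _ : X => 1 : R) by move=> x; rewrite normr1.
rewrite (slot_chain_bounded hT hM cK hK L0 hL i hF (is_lip_cst _ _) h1)//.
rewrite (bigD1 i)//= big1 ?addr0 => [|j ji].
  rewrite -[in LHS](subst_at_id (coords phi) i); congr (T _ _).
  by apply/funext => x; rewrite mul1r.
apply: (current_alternate hT hM ji).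
- by rewrite subst_at_neq// subst_at_eq.
- rewrite (_ : (fun x => _) = D j \o phi); last by apply/funext => x; rewrite mul1r.
  apply: comp_is_lip; exact: C11_grad_lip hF.
- by apply: is_lip_subst => //; exact: hcl.
Qed.

Lemma push_bound f : is_lip f -> (forall y, `|f y| <= 1) ->
  `|T (f \o phi) (coords phi)| <= M * \prod_i c i.
Proof.
move=> hf f1; rewrite -[M]mulr1.
by apply: (mass_bound1 (current_mlin hT) hM) => //; [exact: comp_is_lip|move=> x; exact: f1].
Qed.

Lemma push_interp_cvg f (a : R) (K : set X) (N : nat) : is_lip f -> bounded_by a f ->
  vanishes_off T K ->
  open [set x | `|phi x| + 2 < N%:R] -> K `<=` [set x | `|phi x| + 2 < N%:R] ->
  exists C, forall k, `|T (f \o phi) (coords phi) - T (interp k N f \o phi) (coords phi)| <=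
    C * mesh k.
Proof.
move=> hf fa hK oU KU; have /is_lipP[l l0 hl] := hf.
have mT := current_mlin hT.
exists (M * (l * 3) * \prod_i c i) => k.
have hI : is_lip (interp k N f) by exact: C11_is_lip (interp_C11 k N f).
rewrite -(mlinB mT); [|exact: comp_is_lip|exact: comp_is_lip|exact: coords_is_lip].
rewrite (_ : _ * mesh k = M * (l * (3 * mesh k)) * \prod_i c i); last by ring.
apply: (current_bound_near hT hM hK oU KU) => //.
- by rewrite !mulr_ge0// (ltW (mesh_gt0 k)).
- by apply: is_lipB; exact: comp_is_lip.
- move=> x /= h; rewrite distrC; apply: (interp_approx _ l0); last exact: ltW.
  by move=> y z; have := hl z y; rewrite mdist_rowE distrC.
Qed.

End one_map.

(** The points lie on a line in direction [i], along which the mean value theorem sees only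
    [D i]. *)
Lemma grad_slab (F : 'rV[R]_n.+1 -> R) D i (y z : 'rV[R]_n.+1) : C11 F D ->
  (forall u, `|D i u| <= 1) -> (forall l, l != i -> y ord0 l = z ord0 l) ->
  `|F y - F z| <= `|y ord0 i - z ord0 i|.
Proof.
move=> hF D1 yz; set t := y ord0 i - z ord0 i.
have -> : y = z + t *: delta_mx ord0 i.
  apply/rowP => l; rewrite !mxE eqxx /=; have [->|li] := eqVneq l i.
    by rewrite mulr1 /t addrC subrK.
  by rewrite mulr0 addr0 yz.
have e : z = z + 0 *: delta_mx ord0 i by rewrite scale0r addr0.
rewrite [X in _ - F X]e.
have [s _ ->] := mean_value t 0 (fun s => C11_derive i z s hF).
by rewrite subr0 normrM ler_piMl.
Qed.

(** The gain is that the displacement [e] stands in place of the Lipschitz constant [d]: after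
    integration by parts the component [i] survives only inside [F], where [grad_slab] measures how
    far it moved. A general [f] is reached through its quasi-interpolants, which are exact partial
    derivatives. *)
Lemma push_slot_move (phi psi : X -> 'rV[R]_n.+1) (c : 'I_n.+1 -> R) (d e : R) i f :
  (forall j, 0 <= c j) -> 0 <= d ->
  (forall j, j != i -> lipc (c j) (coords phi j)) ->
  lipc d (coords phi i) -> lipc d (coords psi i) ->
  (forall j, j != i -> coords psi j = coords phi j) ->
  0 <= e -> (forall x, `|coords phi i x - coords psi i x| <= e) ->
  is_lip f -> (forall y, `|f y| <= 1) ->
  `|T (f \o phi) (coords phi) - T (f \o psi) (coords psi)| <=
  B * e * \prod_(j | j != i) c j.
Proof.
move=> c0 d0 hphi hphii hpsii hpsi e0 he hf f1.
pose c' j := if j == i then d else c j.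
have c'0 j : 0 <= c' j by rewrite /c'; case: eqP.
have lphi j : lipc (c' j) (coords phi j).
  by rewrite /c'; case: eqP => [->|/eqP/hphi].
have lpsi j : lipc (c' j) (coords psi j).
  by rewrite /c'; case: eqP => [->|/eqP ji]//; rewrite hpsi//; exact: hphi.
rewrite prod_lift.
have key h : (forall y, `|h y| <= 1) -> (exists F D, [/\ C11 F D, exists a, bounded_by a F &
     forall y, D i y = h y]) ->
   `|T (h \o phi) (coords phi) - T (h \o psi) (coords psi)| <= B * e * \prod_(l < n) c (lift i l).
  move=> h1 [F [D [hF _ hD]]].
  have -> : h = D i by apply/funext => y; rewrite hD.
  rewrite (grad_boundary c'0 lphi i hF) (grad_boundary c'0 lpsi i hF) -mulrBr.
  have -> : (fun l => coords psi (lift i l)) = (fun l => coords phi (lift i l)).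
    by apply/funext => l; rewrite hpsi// eq_sym neq_lift.
  have hFphi : is_lip (F \o phi) by apply: (comp_is_lip c'0 lphi); exact: C11_is_lip hF.
  have hFpsi : is_lip (F \o psi) by apply: (comp_is_lip c'0 lpsi); exact: C11_is_lip hF.
  have hl l : lipc (c (lift i l)) (coords phi (lift i l)).
    by apply: hphi; rewrite eq_sym neq_lift.
  rewrite -(mlinB (boundary_mlin hT))//; last first.
    by move=> l; exact: is_lip_lipc (hl l).
  rewrite normrM normrX normrN1 expr1n mul1r.
  apply: (mass_bound1 (boundary_mlin hT) hB) => //; first exact: is_lipB.
  move=> x; apply: le_trans (he x); apply: (grad_slab hF) => [u|l li].
    by rewrite hD.
  by have := congr1 (fun h => h x) (hpsi l li).
have [K [cK hK]] := current_compact hT.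
have [L L0 hL] := coords_lip c'0 lphi; have [L' L'0 hL'] := coords_lip c'0 lpsi.
have [N [oU KU]] := lip_map_box cK hL; have [N' [oU' KU']] := lip_map_box cK hL'.
have big (chi : X -> 'rV[R]_n.+1) (a b : nat) : (a <= b)%N ->
    K `<=` [set x | `|chi x| + 2 < a%:R] -> K `<=` [set x | `|chi x| + 2 < b%:R].
  by move=> ab h x /h /=; move/lt_le_trans; apply; rewrite ler_nat.
have opn (chi : X -> 'rV[R]_n.+1) (b : nat) : (forall j, lipc (c' j) (coords chi j)) ->
    open [set x | `|chi x| + 2 < b%:R].
  move=> lchi; have [l l0 hl] := coords_lip c'0 lchi.
  apply: (@open_comp _ _ (fun x => `|chi x| + 2) [set y | y < b%:R]); last exact: open_lt.
  move=> x _; apply: (@lipc_continuous _ _ l) => y z.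
  by rewrite opprD addrACA subrr addr0; apply: le_trans (ler_dist_dist _ _) _; exact: hl.
(* One box for both maps, so that the same quasi-interpolant of [f] serves both. *)
pose N2 := maxn N N'.
have [C hC] := push_interp_cvg c'0 lphi hf f1 hK (opn _ N2 lphi) (big _ _ _ (leq_maxl _ _) KU).
have [C' hC'] := push_interp_cvg c'0 lpsi hf f1 hK (opn _ N2 lpsi) (big _ _ _ (leq_maxr _ _) KU').
rewrite -subr_le0; apply: (mesh_le0 (C := C + C')) => k.
have := key _ (interp_bounded k N2 f1) (interp_primitive k N2 f i).
have := hC k; have := hC' k.
set A1 := T _ _; set A2 := T _ _; set A3 := T _ _; set A4 := T _ _.
set E := B * e * _ => h1 h2 h3.
have : `|A3 - A1| <= `|A3 - A4| + `|A4 - A2| + `|A1 - A2|.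
  rewrite [`|A1 - A2|]distrC (_ : A3 - A1 = (A3 - A4) + (A4 - A2) + (A2 - A1)); last by ring.
  by apply: le_trans (ler_normD _ _) _; rewrite lerD2r ler_normD.
lra.
Qed.

(** The maps [chi k], with the first [k] components of [psi] and the others of [phi], change one
    component at a time. *)
Lemma push_move (phi psi : X -> 'rV[R]_n.+1) (c e : 'I_n.+1 -> R) f :
  (forall j, 0 <= c j) -> (forall j, 0 <= e j) ->
  (forall j, lipc (c j) (coords phi j)) -> (forall j, lipc (c j) (coords psi j)) ->
  (forall j x, `|coords phi j x - coords psi j x| <= e j) ->
  is_lip f -> (forall y, `|f y| <= 1) ->
  `|T (f \o phi) (coords phi) - T (f \o psi) (coords psi)| <=
  B * \sum_i e i * \prod_(j | j != i) c j.
Proof.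
move=> c0 e0 hphi hpsi he hf f1.
pose chi (k : nat) (x : X) : 'rV[R]_n.+1 :=
  \row_j (if (j < k)%N then coords psi j x else coords phi j x).
have hchi k j : lipc (c j) (coords (chi k) j).
  move=> x y; rewrite /coords !mxE; case: (j < k)%N; [exact: hpsi|exact: hphi].
have c0E : chi 0%N = phi.
  by apply/funext => x; apply/rowP => j; rewrite mxE ltn0.
have cnE : chi n.+1 = psi.
  by apply/funext => x; apply/rowP => j; rewrite mxE ltn_ord.
pose t k := T (f \o chi k) (coords (chi k)).
have -> : T (f \o phi) (coords phi) - T (f \o psi) (coords psi) = \sum_(i < n.+1) (t i - t i.+1).
  by rewrite telescope_ord /t c0E cnE.
rewrite mulr_sumr; apply: le_trans (ler_norm_sum _ _ _) _; apply: ler_sum => i _.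
rewrite mulrA; apply: (push_slot_move (d := c i)) => //.
- move=> j ji; apply/funext => x; rewrite /coords !mxE ltnS leq_eqVlt.
  by rewrite (_ : (j == i :> nat) = false)//; apply/negbTE.
- by move=> x; rewrite /coords !mxE ltnn ltnSn; exact: he.
Qed.

End homotopy.

(** * Integration on R^n *)

Section row_borel.
Context {R : realType}.

Lemma row_cons0 n (p : R * 'rV[R]_n) (i : 'I_1) : row_cons p i ord0 = p.1.
Proof.
have -> : (ord0 : 'I_n.+1) = lshift n (ord0 : 'I_1) by exact: val_inj.
by apply: etrans (row_mxEl _ _ _ _) _; rewrite mxE.
Qed.

Lemma row_cons_lift n (p : R * 'rV[R]_n) (i : 'I_1) j :
  row_cons p i (lift ord0 j) = p.2 ord0 j.
Proof.
rewrite [i]ord1.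
have -> : lift ord0 j = rshift 1 j :> 'I_(1 + n) by exact: val_inj.
exact: row_mxEr.
Qed.

Lemma measurable_rowcons n :
  measurable_fun setT (@row_cons R n : measurableTypeR R * 'rV[R]_n -> 'rV[R]_n.+1).
Proof.
apply: measurable_fun_row => i; case: (unliftP ord0 i) => [j ->|->].
  rewrite [X in measurable_fun _ X](_ : _ = (fun x : 'rV[R]_n => x ord0 j) \o snd).
    exact: (measurableT_comp (measurable_row_coord j) measurable_snd).
  by apply/funext => p; exact: row_cons_lift.
rewrite [X in measurable_fun _ X](_ : _ = fst); first exact: measurable_fst.
by apply/funext => p; exact: row_cons0.
Qed.

Lemma measurable_forall_ord n d (T : measurableType d) (A : 'I_n -> set T) :
  (forall i, measurable (A i)) -> measurable [set x | forall i, A i x].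
Proof.
move=> h; rewrite (_ : mkset _ = ~` \bigcup_i ~` A i).
  by apply: measurableC; apply: countable_bigcupT_measurable => // i; exact: measurableC.
apply/seteqP; split => x /= hx.
  by move=> [i _]; apply; exact: hx.
by move=> i; apply: contrapT => h'; apply: hx; exists i.
Qed.

(** As the sigma-algebra is generated by coordinates, the open set is covered by those of the
    countably many cubes with rational centres and radii [1/(m+1)] that it contains. *)
Lemma open_measurable_row n (U : set 'rV[R]_n) : open U -> measurable U.
Proof.
move=> oU.
pose rad (m : nat) : R := m.+1%:R^-1.
pose C (q : 'rV[rat]_n * nat) : set 'rV[R]_n :=
  [set x | forall i, ball (ratr (q.1 ord0 i) : R) (rad q.2) (x ord0 i)].
pose P q := `[< C q `<=` U >].
rewrite (_ : U = \bigcup_q (if P q then C q else set0)).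
  apply: countable_bigcupT_measurable => // q; case: (P q) => //.
  apply: measurable_forall_ord => i.
  have := @measurable_row_coord R n i measurableT (ball (ratr (q.1 ord0 i) : R) (rad q.2)).
  by rewrite setTI; apply; exact: measurable_ball.
apply/seteqP; split => [x Ux|x [q _]]; last first.
  by case: ifP => [/asboolP h /h//|_ []].
have : nbhs x U by exact: open_nbhs_nbhs.
move/nbhs_ballP => -[e /= e0 eU].
have [m me] : exists m, rad m < e / 2.
  have /cvgrPdist_lt/(_ (e / 2)) : (fun k => k.+1%:R^-1 : R) @ \oo --> (0 : R) by exact: cvg_harmonic.
  rewrite divr_gt0// => /(_ isT) [m _ hm]; exists m.
  by have := hm m (leqnn m); rewrite /= sub0r normrN ger0_norm.
have rm : 0 < rad m by rewrite invr_gt0.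
have /choice[q hq] : forall i, exists q : rat, `|x ord0 i - ratr q| < rad m.
  move=> i; have := @rat_in_itvoo R (x ord0 i - rad m) (x ord0 i + rad m).
  rewrite ltrD2l gtrN// => /(_ isT) [q]; rewrite in_itv/= => hq; exists q.
  by rewrite ltr_norml; lra.
exists (\row_i q i, m) => //.
have -> : P (\row_i q i, m).
  apply/asboolP => y /= hy; apply: eU; rewrite -ball_normE/=.
  apply: (@row_norm_lt _ _ _ e e0) => i; rewrite !mxE.
  have := hy i; rewrite -ball_normE /= !mxE => h1; have h2 := hq i.
  rewrite (_ : _ - _ = (x ord0 i - ratr (q i)) + (ratr (q i) - y ord0 i)); last by ring.
  apply: le_lt_trans (ler_normD _ _) _.
  by have := ltrD h2 h1; move: me; lra.
by move=> i /=; rewrite -ball_normE/= mxE distrC.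
Qed.

Lemma closed_measurable_row n (A : set 'rV[R]_n) : closed A -> measurable A.
Proof.
by move=> cA; rewrite -(setCK A); apply: measurableC; apply: open_measurable_row; exact: closed_openC.
Qed.

Lemma continuous_measurable_row n (f : 'rV[R]_n -> R) : continuous f ->
  measurable_fun [set: 'rV[R]_n] f.
Proof.
move=> cf; apply: (measurability _ (RGenOpens.measurableE R)).
move=> _ [_ [a [b ->] <-]]; rewrite setTI; apply: open_measurable_row.
by apply: open_comp => //; exact: interval_open.
Qed.

Lemma is_lip_measurable n (f : 'rV[R]_n -> R) : is_lip f ->
  measurable_fun [set: 'rV[R]_n] f.
Proof. by move=> /is_lip_continuous; exact: continuous_measurable_row. Qed.

Lemma lebesgue_rowS n (A : set 'rV[R]_n.+1) : lebesgue_row R n.+1 A =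
  (@lebesgue_measure R \x lebesgue_row R n)%E ((@row_cons R n) @^-1` A).
Proof. by []. Qed.

Lemma lebesgue_row_box n (a b : 'I_n -> R) : (forall i, a i <= b i) ->
  lebesgue_row R n [set x | forall i, a i <= x ord0 i < b i] = (\prod_i (b i - a i))%:E.
Proof.
elim: n a b => [a b _|n ih a b ab].
  rewrite big_ord0 (_ : mkset _ = setT); first by rewrite /= diracT.
  by apply/seteqP; split => // x _ [].
rewrite lebesgue_rowS (_ : _ @^-1` _ = `[a ord0, b ord0[%classic `*`
    [set x : 'rV[R]_n | forall i, a (lift ord0 i) <= x ord0 i < b (lift ord0 i)]).
  rewrite product_measure1E//; last first.
    apply: measurable_forall_ord => i.
    have := @measurable_row_coord R n i measurableT `[a (lift ord0 i), b (lift ord0 i)[%classic.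
    rewrite setTI => /(_ (measurable_itv _)).
    by congr measurable; apply/seteqP; split => x /=; rewrite in_itv.
  rewrite ih//; rewrite [X in (X * _)%E](lebesgue_measure_itv `[a ord0, b ord0[)/= big_ord_recl.
  rewrite lte_fin; case: ltP => h; first by rewrite -EFinB -EFinM.
  rewrite (_ : b ord0 - a ord0 = 0); last first.
    by apply/eqP; rewrite subr_eq0 eq_le h ab.
  by rewrite mul0r mul0e.
apply/seteqP; split => -[t x] /=.
  move=> h; split; first by have := h ord0; rewrite row_cons0 in_itv.
  by move=> i; have := h (lift ord0 i); rewrite row_cons_lift.
move=> [h1 h2] i; case: (unliftP ord0 i) => [j ->|->].
  by rewrite row_cons_lift.
by rewrite row_cons0; move: h1; rewrite in_itv.
Qed.

Definition upd n (i : 'I_n) (x : 'rV[R]_n) (t : R) : 'rV[R]_n :=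
  \row_j (if j == i then t else x ord0 j).

(** Fubini's theorem, by induction on the dimension. A direction other than the first is handled
    inside the slices by the induction hypothesis; the first one requires integrating in the other
    order. *)
Lemma lebesgue_row_lines n (i : 'I_n) (A : set 'rV[R]_n) : measurable A ->
  (forall x, @lebesgue_measure R [set t | A (upd i x t)] = 0%E) ->
  lebesgue_row R n A = 0%E.
Proof.
elim: n i A => [[]//|n ih] i A mA h; rewrite lebesgue_rowS.
set A' := _ @^-1` A.
have mA' : measurable A'.
  by have := @measurable_rowcons n measurableT A mA; rewrite setTI.
case: (unliftP ord0 i) h => [j ->|->] h.
  rewrite /product_measure1/= integral0_eq// => t _ /=.
  apply: (ih j); first exact: measurable_xsection.
  move=> y; rewrite -[RHS](h (row_cons (t, y))); congr (lebesgue_measure _).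
  apply/funext => s /=; rewrite /xsection /= in_setE /A' /=.
  congr A; apply/rowP => l; case: (unliftP ord0 l) => [m ->|->].
    rewrite [RHS]mxE (inj_eq lift_inj); apply: etrans (row_cons_lift _ _ _) _.
    by rewrite /= mxE; case: eqP => // _; apply/esym; exact: (row_cons_lift (t, y)).
  rewrite [RHS]mxE (negPf (neq_lift _ _)); apply: etrans (row_cons0 _ _) _.
  by apply/esym; exact: (row_cons0 (t, y)).
rewrite (@product_measure_unique _ _ _ _ _ _ _ (@lebesgue_measure R \x^ lebesgue_row R n)%E)//; last first.
  by move=> B C mB mC; exact: product_measure2E.
apply: integral0_eq => y _ /=.
rewrite -[RHS](h (row_cons (0, y))); congr (lebesgue_measure _).
apply/funext => s /=; rewrite /ysection /= in_setE /A' /=.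
congr A; apply/rowP => l; case: (unliftP ord0 l) => [m ->|->].
  rewrite [RHS]mxE eq_sym (negPf (neq_lift _ _)); apply: etrans (row_cons_lift _ _ _) _.
  by apply/esym; exact: (row_cons_lift (0, y)).
by rewrite [RHS]mxE eqxx; exact: (row_cons0 (s, y)).
Qed.

End row_borel.

Section real_integrals.
Context d (T : measurableType d) (R : realType) (mu : {measure set T -> \bar R}).
Implicit Types (u v f g : T -> R).

Definition intg u : Prop := mu.-integrable setT (EFin \o u).
Local Notation I u := (\int[mu]_x u x).

Lemma intg_measurable u : intg u -> measurable_fun setT u.
Proof. by move=> /measurable_int /measurable_EFinP. Qed.

Lemma intgD u v : intg u -> intg v -> intg (fun x => u x + v x).
Proof. by move=> hu hv; exact: (integrableD measurableT hu hv). Qed.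

Lemma intgZ a u : intg u -> intg (fun x => a * u x).
Proof. by move=> hu; exact: (integrableZl measurableT a hu). Qed.

Lemma intgN u : intg u -> intg (fun x => - u x).
Proof. by move=> hu; exact: (integrableN hu). Qed.

Lemma intgB u v : intg u -> intg v -> intg (fun x => u x - v x).
Proof. by move=> hu hv; apply: intgD => //; exact: intgN. Qed.

Lemma intg0 : intg (fun=> 0).
Proof. exact: integrable0. Qed.

Lemma intg_sum (J : Type) (r : seq J) (P : pred J) (w : J -> T -> R) :
  (forall j, intg (w j)) -> intg (fun x => \sum_(j <- r | P j) w j x).
Proof.
move=> h; elim: r => [|j r ih].
  by rewrite (_ : (fun x => _) = fun=> 0); [exact: intg0|apply/funext => x; rewrite big_nil].
rewrite (_ : (fun x => _) = fun x => (if P j then w j x else 0) +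
    \sum_(j <- r | P j) w j x).
  by apply: intgD => //; case: (P j) => //; exact: intg0.
by apply/funext => x; rewrite big_cons; case: (P j) => //; rewrite add0r.
Qed.

Lemma intg_abs u : intg u -> intg (fun x => `|u x|).
Proof. by move=> hu; exact: (integrable_abse hu). Qed.

Lemma intg_le u v : measurable_fun setT u -> intg v -> (forall x, `|u x| <= `|v x|) -> intg u.
Proof.
move=> mu_ hv uv; apply: le_integrable hv => //; first exact/measurable_EFinP.
by move=> x _; rewrite /= lee_fin.
Qed.

Lemma intg_mulb c u f : intg u -> measurable_fun setT f -> (forall x, `|f x| <= c) ->
  intg (fun x => u x * f x).
Proof.
move=> hu mf fc; apply: (@intg_le _ (fun x => c * u x)).
- exact: measurable_funM (intg_measurable hu) mf.
- exact: intgZ.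
- move=> x; rewrite !normrM mulrC ler_wpM2r//.
  exact: le_trans (fc x) (ler_norm c).
Qed.

Lemma IntD u v : intg u -> intg v -> I (fun x => u x + v x) = I u + I v.
Proof. by move=> hu hv; rewrite RintegralD. Qed.

Lemma IntB u v : intg u -> intg v -> I (fun x => u x - v x) = I u - I v.
Proof. by move=> hu hv; rewrite RintegralB. Qed.

Lemma IntZ a u : intg u -> I (fun x => a * u x) = a * I u.
Proof. by move=> hu; rewrite RintegralZl. Qed.

Lemma Int_le u v : intg u -> intg v -> (forall x, u x <= v x) -> I u <= I v.
Proof. by move=> hu hv uv; apply: le_Rintegral. Qed.

Lemma Int_abs u : intg u -> `|I u| <= I (fun x => `|u x|).
Proof. by move=> hu; exact: le_normr_Rintegral. Qed.

Lemma Int_ge0 u : (forall x, 0 <= u x) -> 0 <= I u.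
Proof. by move=> h; exact: Rintegral_ge0. Qed.

Lemma Int_sum (J : Type) (r : seq J) (w : J -> T -> R) : (forall j, intg (w j)) ->
  I (fun x => \sum_(j <- r) w j x) = \sum_(j <- r) I (w j).
Proof.
move=> h; elim: r => [|j r ih].
  rewrite big_nil (_ : (fun x => _) = fun=> 0); last by apply/funext => x; rewrite big_nil.
  by rewrite Rintegral_cst// mul0r.
rewrite big_cons -ih -IntD//; last exact: intg_sum.
by apply: eq_Rintegral => x _; rewrite big_cons.
Qed.

Lemma EFin_Int u : intg u -> (I u)%:E = (\int[mu]_x (u x)%:E)%E.
Proof. by move=> hu; rewrite fineK//; exact: integrable_fin_num. Qed.

Lemma Int_norm_le c u f : intg u -> measurable_fun setT f -> (forall x, `|f x| <= c) ->
  `|I (fun x => u x * f x)| <= c * I (fun x => `|u x|).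
Proof.
move=> hu mf fc; apply: le_trans (Int_abs _) _; first exact: intg_mulb hu mf fc.
rewrite -IntZ; last exact: intg_abs.
apply: Int_le.
- by apply: intg_abs; exact: intg_mulb hu mf fc.
- by apply: intgZ; exact: intg_abs.
- by move=> x; rewrite normrM mulrC ler_wpM2r.
Qed.

Lemma Int_dct (f_ : nat -> T -> R) f g : (forall k, measurable_fun setT (f_ k)) ->
  measurable_fun setT f -> intg g ->
  {ae mu, forall x, (fun k => f_ k x) @ \oo --> f x} ->
  (forall k x, `|f_ k x| <= g x) ->
  intg f /\ (fun k => I (fun x => `|f_ k x - f x|)) @ \oo --> (0 : R).
Proof.
move=> mf_ mf ig cf fg.
have [||||if_ h _] := @dominated_convergence _ _ _ mu setT measurableT
  (fun k => EFin \o f_ k) (EFin \o f) (EFin \o g) _ _ _ ig.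
- by move=> k; exact/measurable_EFinP.
- exact/measurable_EFinP.
- apply: filterS cf => x hx _; by apply/fine_cvgP; split; [exact: nearW|exact: hx].
- by apply: aeW => x k _ /=; rewrite lee_fin.
split => //; have h' : (fun k => fine (\int[mu]_x `|(EFin \o f_ k) x - (EFin \o f) x|)%E) @ \oo --> (0 : R).
  exact: fine_cvg h.
exact: h'.
Qed.

Import HBNNSimple.

(** Neither function is assumed measurable, which matters for integrands containing [jacobian]. The
    integral of a nonnegative function is a supremum over simple functions below it, and cutting
    these down to the complement of a null set does not change their integrals. *)
Lemma int_ae_eq (f g : T -> \bar R) : {ae mu, forall x, f x = g x} ->
  (\int[mu]_x f x = \int[mu]_x g x)%E.
Proof.
suff H (f1 g1 : T -> \bar R) : (forall x, 0 <= f1 x)%E -> (forall x, 0 <= g1 x)%E ->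
    {ae mu, forall x, f1 x = g1 x} -> (\int[mu]_x f1 x <= \int[mu]_x g1 x)%E.
  have E (f1 g1 : T -> \bar R) : (forall x, 0 <= f1 x)%E -> (forall x, 0 <= g1 x)%E ->
      {ae mu, forall x, f1 x = g1 x} -> (\int[mu]_x f1 x = \int[mu]_x g1 x)%E.
    move=> f0 g0 e; apply/eqP; rewrite eq_le; apply/andP; split; apply: H => //.
    by apply: filterS e => x ->.
  move=> fg; rewrite [LHS]integralE [RHS]integralE; congr (_ - _)%E; apply: E => //.
    by apply: filterS fg => x e; rewrite !funeposE e.
  by apply: filterS fg => x e; rewrite !funenegE e.
move=> f0 g0 [N [mN N0 hN]].
rewrite [in leLHS]ge0_integralTE//; apply: ge_ereal_sup => _ [h hf <-].
have mNC : measurable (~` N) by exact: measurableC.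
rewrite -integralT_nnsfun.
rewrite (_ : (\int[mu]_x (h x)%:E = \int[mu]_x (proj_nnsfun h mNC x)%:E)%E); last first.
  apply: ae_eq_integral => //; [exact/measurable_EFinP|exact/measurable_EFinP|].
  exists N; split => // x /= nx; apply: contrapT => Nx; apply: nx => _.
  by rewrite /= mindicE mem_set// mulr1.
rewrite integralT_nnsfun ge0_integralTE//; apply: ereal_sup_ubound.
exists (proj_nnsfun h mNC) => // x /=; rewrite mindicE.
have [Nx|Nx] := pselect ((~` N) x); last by rewrite memNset// mulr0.
rewrite mem_set// mulr1; have <- : f1 x = g1 x; last exact: hf.
by apply: contrapT => e; apply: Nx; apply: hN.
Qed.

Lemma Int_ae_eq u v : {ae mu, forall x, u x = v x} -> I u = I v.
Proof. by move=> h; congr fine; apply: int_ae_eq; apply: filterS h => x ->. Qed.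

Lemma Int_eq0_ae u : intg u -> I (fun x => `|u x|) = 0 -> {ae mu, forall x, u x = 0}.
Proof.
move=> hu h; have : (\int[mu]_x `|(u x)%:E| = 0)%E.
  by rewrite -[LHS]/(\int[mu]_x (`|u x|)%:E)%E -EFin_Int ?h//; exact: intg_abs.
have mE : measurable_fun setT (EFin \o u) by exact: measurable_int hu.
move=> /(ae_eq_integral_abs mu measurableT mE); apply: filterS => x /(_ Logic.I) /=.
by move=> [].
Qed.

(** Completeness of L^1. The pointwise clause hands the supports of the terms on to the sum. *)
Lemma intg_series (w : nat -> T -> R) (S : R) : (forall k, intg (w k)) ->
  (forall N, \sum_(k < N) I (fun x => `|w k x|) <= S) ->
  exists2 v, intg v /\ (forall x, (forall k, w k x = 0) -> v x = 0) &
    (fun N => I (fun x => `|\sum_(k < N) w k x - v x|)) @ \oo --> (0 : R).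
Proof.
move=> hw hS.
pose h x : \bar R := (\sum_(k <oo) (`|w k x|)%:E)%E.
have h0 k x : (0 <= (`|w k x|)%:E)%E by rewrite lee_fin.
have mw k : measurable_fun setT (fun x => (`|w k x|)%:E).
  by apply/measurable_EFinP; apply: measurableT_comp => //; exact: intg_measurable (hw k).
have mh : measurable_fun setT h.
  by apply: ge0_emeasurable_sum => // k _; exact: mw.
have hge x N : ((\sum_(k < N) `|w k x|)%:E <= h x)%E.
  by rewrite -sumEFin -(big_mkord xpredT (fun k => (`|w k x|)%:E)); apply: nneseries_lim_ge.
have hpos x : (0 <= h x)%E by apply: nneseries_ge0.
have ih : mu.-integrable setT h.
  apply/integrableP; split => //.
  apply: (@le_lt_trans _ _ S%:E); last exact: ltry.
  rewrite (eq_integral h); last by move=> x _; rewrite gee0_abs.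
  rewrite integral_nneseries//; apply: lime_le.
    by apply: is_cvg_nneseries => k _ _; apply: integral_ge0.
  apply: nearW => N; rewrite big_mkord.
  rewrite (eq_bigr (fun k : 'I_N => (I (fun x => `|w k x|))%:E)); last first.
    by move=> k _; rewrite EFin_Int//; exact: intg_abs.
  by rewrite sumEFin lee_fin; exact: hS.
(* Multiplied by the indicator of [E], the partial sums converge at every point, so the limit is
   measurable; [E] has full measure because [h] is integrable. *)
pose E := [set x | h x \is a fin_num].
have mE : measurable E.
  by rewrite -[E]setTI; exact: emeasurable_fin_num.
pose p N x := \sum_(k < N) w k x.
pose q N x := p N x * \1_E x.
have mp N : measurable_fun setT (p N) by apply: intg_measurable; exact: intg_sum.
have mq N : measurable_fun setT (q N) by apply: measurable_funM.
have qcvg x : cvgn (fun N => q N x).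
  have [Ex|nEx] := pselect (E x); last first.
    rewrite (_ : (fun N => _) = fun=> 0); first exact: is_cvg_cst.
    by apply/funext => N; rewrite /q indicE memNset// mulr0.
  rewrite (_ : (fun N => q N x) = series (fun k => w k x)); last first.
    by apply/funext => N; rewrite /q indicE mem_set// mulr1 /p /series/= big_mkord.
  apply: normed_cvg; apply: nondecreasing_is_cvgn.
    by apply: nondecreasing_series => k _ _; exact: normr_ge0.
  exists (fine (h x)) => _ [N _ <-]; rewrite -lee_fin fineK//.
  by apply: le_trans (hge x N); rewrite lee_fin /= /series /= big_mkord.
pose v x := limn (fun N => q N x).
have qv x : (fun N => q N x) @ \oo --> v x by exact: qcvg.
have mv : measurable_fun setT v by apply: (measurable_fun_cvg mq) => x _; exact: qv.
pose g x := fine (h x).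
have g0 x : 0 <= g x by apply: fine_ge0.
have ig : intg g.
  apply: le_integrable ih => //.
    by apply/measurable_EFinP; apply: measurableT_comp => //; exact: measurable_fine.
  move=> x _; have -> : (`|(EFin \o g) x| = (g x)%:E)%E by rewrite /= ger0_norm.
  rewrite (gee0_abs (hpos x)) /g.
  by have := hpos x; case: (h x) => [r| |]//= _; rewrite lexx.
have qg N x : `|q N x| <= g x.
  rewrite /q indicE; have [Ex|nEx] := pselect (E x).
    rewrite mem_set// mulr1; apply: le_trans (ler_norm_sum _ _ _) _.
    by rewrite -lee_fin /g fineK//; exact: hge.
  by rewrite memNset// mulr0 normr0.
have [iv cv] := Int_dct mq mv ig (aeW _ qv) qg.
exists v; first split => // x hx.
  apply/cvg_lim => //.
  rewrite (_ : (fun N => _) = fun=> 0); first exact: cvg_cst.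
  by apply/funext => N; rewrite /q /p big1 ?mul0r.
apply: cvg_trans cv; apply: near_eq_cvg; apply: nearW => N.
apply: Int_ae_eq; have := integrable_ae measurableT ih.
apply: filterS => x /(_ Logic.I) Ex.
by rewrite /q indicE mem_set// mulr1.
Qed.

End real_integrals.

(** * Lipschitz test functions determine the L^1 norm *)

Section lipschitz_approximation.
Context {R : realType} {n : nat}.
Local Notation Rn := 'rV[R]_n.
Local Notation leb := (lebesgue_row R n).
Local Notation I u := (\int[leb]_x u x).

Variable w : Rn -> R.
Hypothesis iw : intg leb w.
Hypothesis w0 : forall x, 0 <= w x.

(** Approximability of an indicator in L^1 of the weight [w]. The sets with this property form a
    sigma-algebra containing the coordinate half-spaces, hence all measurable sets have it. *)
Definition lip_approx (A : set Rn) : Prop := measurable A /\ forall e : R, 0 < e ->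
  exists f : Rn -> R, [/\ is_lip f, forall x, 0 <= f x <= 1 &
    I (fun x => w x * `|\1_A x - f x|) <= e].

Let mabs (A : set Rn) (f : Rn -> R) : measurable A -> is_lip f ->
  measurable_fun setT (fun x => `|\1_A x - f x| : R).
Proof.
move=> mA hf; apply: measurableT_comp => //; apply: measurable_funB => //.
exact: is_lip_measurable.
Qed.

Let iabs (A : set Rn) (f : Rn -> R) : measurable A -> is_lip f -> (forall x, 0 <= f x <= 1) ->
  intg leb (fun x => w x * `|\1_A x - f x|).
Proof.
move=> mA hf f01; apply: (@intg_mulb _ _ _ _ 1) => //; first exact: mabs.
move=> x; rewrite normr_id indicE; have := f01 x.
by case: (x \in A) => /=; rewrite ler_norml; lra.
Qed.

Lemma lip_approx0 : lip_approx set0.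
Proof.
split => // e e0; exists (fun=> 0); split => [|x|]; rewrite ?ler01 ?lexx//.
  exact: is_lip_cst.
rewrite (_ : (fun x => _) = fun=> 0); first by rewrite Rintegral_cst// mul0r ltW.
by apply/funext => x; rewrite indicE in_set0 subrr normr0 mulr0.
Qed.

Lemma lip_approxC A : lip_approx A -> lip_approx (~` A).
Proof.
move=> [mA h]; split => [|e e0]; first exact: measurableC.
have [f [hf f01 fe]] := h e e0; exists (fun x => 1 - f x); split.
- by apply: is_lipB => //; exact: is_lip_cst.
- by move=> x; have := f01 x; lra.
- rewrite (_ : (fun x => _) = fun x => w x * `|\1_A x - f x|)//.
  apply/funext => x; rewrite !indicE in_setC; congr (_ * _).
  by rewrite -normrN; congr `|_|; case: (x \in A) => /=; ring.
Qed.

Lemma lip_approxI A B : lip_approx A -> lip_approx B -> lip_approx (A `&` B).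
Proof.
move=> [mA hA] [mB hB]; split => [|e e0]; first exact: measurableI.
have e20 : 0 < e / 2 by rewrite divr_gt0.
have [f [hf f01 fe]] := hA _ e20; have [g [hg g01 ge]] := hB _ e20.
have fb : bounded_by 1 f by move=> x; have := f01 x; rewrite ler_norml; lra.
have gb : bounded_by 1 g by move=> x; have := g01 x; rewrite ler_norml; lra.
have hfg : is_lip (fun x => f x * g x) by exact: is_lipM fb gb hf hg.
have fg01 x : 0 <= f x * g x <= 1.
  have /andP[a b] := f01 x; have /andP[a' b'] := g01 x.
  by rewrite mulr_ge0//= -[leRHS]mulr1 ler_pM.
exists (fun x => f x * g x); split => //.
apply: (@le_trans _ _ (I (fun x => w x * `|\1_A x - f x| + w x * `|\1_B x - g x|))).
  apply: Int_le.
  - by apply: iabs => //; exact: measurableI.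
  - by apply: intgD; exact: iabs.
  - move=> x; rewrite -mulrDr ler_wpM2l// !indicE in_setI.
    have /andP[a b] := f01 x; have /andP[a' b'] := g01 x.
    case: (x \in A); case: (x \in B) => /=; rewrite ?sub0r ?normrN.
    + rewrite [`|1 - f x|]ger0_norm ?subr_ge0// [`|1 - g x|]ger0_norm ?subr_ge0//.
      by rewrite ler_norml; nra.
    + rewrite [`|1 - f x|]ger0_norm ?subr_ge0// [`|g x|]ger0_norm// ger0_norm ?mulr_ge0//.
      by nra.
    + rewrite [`|f x|]ger0_norm// [`|1 - g x|]ger0_norm ?subr_ge0// ger0_norm ?mulr_ge0//.
      by nra.
    + rewrite [`|f x|]ger0_norm// [`|g x|]ger0_norm// ger0_norm ?mulr_ge0//.
      by nra.
by rewrite IntD; [lra|exact: iabs|exact: iabs].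
Qed.

Lemma lip_approx_cvg (A : set Rn) (A_ : nat -> set Rn) : measurable A ->
  (forall k, lip_approx (A_ k)) ->
  (forall x, (fun k => \1_(A_ k) x) @ \oo --> (\1_A x : R)) -> lip_approx A.
Proof.
move=> mA hA cA; split => // e e0; have e20 : 0 < e / 2 by rewrite divr_gt0.
have mA_ k : measurable (A_ k) by case: (hA k).
have md k : measurable_fun setT (fun x : Rn => `|\1_A x - \1_(A_ k) x| : R).
  by apply: measurableT_comp => //; exact: measurable_funB.
have [_ c] : intg leb (fun=> 0) /\ (fun k => I (fun x => `|w x * `|\1_A x - \1_(A_ k) x| - 0|)) @ \oo
    --> (0 : R).
  apply: (@Int_dct _ _ _ _ _ (fun=> 0) w) => //.
  - by move=> k; apply: measurable_funM => //; exact: intg_measurable iw.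
  - apply: aeW => x; rewrite -[X in _ --> X](mulr0 (w x)); apply: cvgMl_tmp.
    rewrite -[X in _ --> X](@normr0 R R) -(subrr (\1_A x)).
    by apply: cvg_norm; apply: cvgB => //; exact: cvg_cst.
  - move=> k x; rewrite normrM normr_id (ger0_norm (w0 x)) ler_piMr//.
    by rewrite !indicE ler_norml; case: (x \in A); case: (x \in A_ k) => /=; lra.
move/cvgrPdist_le : c => /(_ _ e20) [k _ /(_ k (leqnn k))] /=.
rewrite sub0r normrN => ck.
have [f [hf f01 fe]] := (hA k).2 _ e20; exists f; split => //.
have id : intg leb (fun x => w x * `|\1_A x - \1_(A_ k) x|).
  apply: (@intg_mulb _ _ _ _ 1) => // x; rewrite normr_id.
  by rewrite !indicE ler_norml; case: (x \in A); case: (x \in A_ k) => /=; lra.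
apply: (@le_trans _ _ (I (fun x => w x * `|\1_A x - \1_(A_ k) x| + w x * `|\1_(A_ k) x - f x|))).
  apply: Int_le; [exact: iabs|by apply: intgD => //; exact: iabs|].
  move=> x; rewrite -mulrDr ler_wpM2l//.
  by rewrite -[X in `|X|](subrKA (\1_(A_ k) x)) ler_normD.
rewrite IntD//; last exact: iabs.
have : I (fun x => w x * `|\1_A x - \1_(A_ k) x|) <= e / 2.
  apply: le_trans ck; apply: le_trans (ler_norm _); apply: Int_le => //.
    by apply: intg_abs; apply: intgB => //; exact: intg0.
  by move=> x; rewrite subr0 ler_norm.
lra.
Qed.

Lemma lip_approxU A B : lip_approx A -> lip_approx B -> lip_approx (A `|` B).
Proof.
move=> hA hB; rewrite -(setCK (A `|` B)) setCU; apply: lip_approxC.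
by apply: lip_approxI; exact: lip_approxC.
Qed.

Lemma indic_bigcup_cvg (F : nat -> set Rn) x :
  (fun k => \1_(\big[setU/set0]_(i < k) F i) x) @ \oo --> (\1_(\bigcup_k F k) x : R).
Proof.
have [[k _ Fk]|h] := pselect ((\bigcup_k F k) x).
  apply: cvg_near_cst; exists k.+1 => // l /= kl.
  rewrite !indicE !mem_set//; first by exists k.
  by rewrite -bigcup_mkord; exists k.
apply: cvg_near_cst; apply: nearW => k; rewrite !indicE !memNset//.
by rewrite -bigcup_mkord => -[i _ Fi]; apply: h; exists i.
Qed.

Lemma lip_approx_bigcup (F : nat -> set Rn) : (forall k, lip_approx (F k)) ->
  lip_approx (\bigcup_k F k).
Proof.
move=> hF; apply: (@lip_approx_cvg _ (fun k => \big[setU/set0]_(i < k) F i)).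
- by apply: bigcup_measurable => k _; case: (hF k).
- elim=> [|k ih]; first by rewrite big_ord0; exact: lip_approx0.
  by rewrite big_ord_recr; exact: lip_approxU.
- exact: indic_bigcup_cvg.
Qed.

Lemma lip_approx_ray (i : 'I_n) (a : R) : lip_approx [set x : Rn | a < x ord0 i].
Proof.
set A := mkset _.
have mA : measurable A.
  have := @measurable_row_coord R n i measurableT `]a, +oo[%classic.
  rewrite setTI => /(_ (measurable_itv _)).
  by congr measurable; apply/seteqP; split => x /=; rewrite in_itv/= andbT.
split => // e e0.
pose f (k : nat) (x : Rn) : R := clamp 0 1 (k%:R * (x ord0 i - a)).
have hf k : is_lip (f k).
  apply: is_lip_clamp; apply: is_lipZ; apply: is_lipB; last exact: is_lip_cst.
  exact: C11_is_lip (C11_coord i).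
have f01 k x : 0 <= f k x <= 1 by apply: clamp_itv.
have [_ c] : intg leb (fun=> 0) /\ (fun k => I (fun x => `|w x * `|\1_A x - f k x| - 0|)) @ \oo
    --> (0 : R).
  apply: (@Int_dct _ _ _ _ _ (fun=> 0) w) => //.
  - by move=> k; apply: measurable_funM; [exact: intg_measurable iw|exact: mabs].
  - apply: aeW => x; rewrite -[X in _ --> X](mulr0 (w x)); apply: cvgMl_tmp.
    have [ax|xa] := ltP a (x ord0 i).
      apply: cvg_near_cst; exists (Num.bound (x ord0 i - a)^-1) => // k /= hk.
      rewrite indicE mem_set//=.
      suff -> : f k x = 1 by rewrite subrr normr0.
      have d0 : 0 < x ord0 i - a by rewrite subr_gt0.
      rewrite /f /clamp; suff h1 : 1 <= k%:R * (x ord0 i - a) by rewrite (min_idPl h1) (max_idPr _).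
      rewrite -ler_pdivrMr// mul1r; apply: le_trans (ltW (archi_boundP _)) _.
        by rewrite invr_ge0 ltW.
      by rewrite ler_nat.
    apply: cvg_near_cst; apply: nearW => k.
    rewrite indicE memNset /=; last by rewrite /A/=; apply/negP; rewrite -leNgt.
    suff -> : f k x = 0 by rewrite subrr normr0.
    rewrite /f /clamp; apply/max_idPl; rewrite ge_min; apply/orP; right.
    by rewrite mulr_ge0_le0// subr_le0.
  - move=> k x; rewrite normrM normr_id (ger0_norm (w0 x)) ler_piMr//.
    by have := f01 k x; rewrite !indicE ler_norml; case: (x \in A) => /=; lra.
move/cvgrPdist_le : c => /(_ _ e0) [k _ /(_ k (leqnn k))] /=.
rewrite sub0r normrN => ck; exists (f k); split => //.
apply: le_trans ck; apply: le_trans (ler_norm _); apply: Int_le.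
- exact: iabs.
- by apply: intg_abs; apply: intgB; [exact: iabs|exact: intg0].
- by move=> x; rewrite subr0 ler_norm.
Qed.

Lemma lip_approx_measurable (A : set Rn) : measurable A -> lip_approx A.
Proof.
suff : (measurable : set (set Rn)) `<=` lip_approx by exact.
apply: smallest_sub.
  split; [exact: lip_approx0|by move=> B hB; rewrite setTD; exact: lip_approxC|].
  by move=> F hF; exact: lip_approx_bigcup.
rewrite -bigcup_seq; apply: bigcup_sub => i _ B [Y mY <-]; rewrite setTI.
pose G : set_system R := [set Y | lip_approx ((fun x : Rn => x ord0 i) @^-1` Y)].
suff : <<s @RGenOInfty.G R >> `<=` G.
  apply; have : (@ocitv R).-sigma.-measurable Y by [].
  by rewrite RGenOInfty.measurableE.
apply: smallest_sub.
  split; rewrite /G/=.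
  - by rewrite preimage_set0; exact: lip_approx0.
  - by move=> C hC; rewrite setTD -preimage_setC; exact: lip_approxC.
  - by move=> F hF; rewrite preimage_bigcup; exact: lip_approx_bigcup.
move=> _ [a ->]; rewrite /G/=.
have := lip_approx_ray i a; congr lip_approx.
by apply/seteqP; split => x /=; rewrite in_itv/= andbT.
Qed.

End lipschitz_approximation.

Section duality.
Context {R : realType} {n : nat}.
Local Notation Rn := 'rV[R]_n.
Local Notation leb := (lebesgue_row R n).
Local Notation I u := (\int[leb]_x u x).

(** The ideal test function is the sign of [u]. It is replaced by [f - g], where [f] and [g]
    approximate the indicators of [u > 0] and [u < 0] in L^1 of the weight [|u|], which is exactly
    the weight in which the error is paid. *)
Lemma L1_duality (u : Rn -> R) (m : R) : intg leb u ->
  (forall f, is_lip f -> (forall x, `|f x| <= 1) -> `|I (fun x => u x * f x)| <= m) ->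
  I (fun x => `|u x|) <= m.
Proof.
move=> iu hm; have mu_ := intg_measurable iu.
pose w x := `|u x|; have iw : intg leb w by exact: intg_abs.
have w0 x : 0 <= w x by exact: normr_ge0.
have mP : measurable [set x | 0 < u x].
  have := mu_ measurableT `]0, +oo[%classic (measurable_itv _); rewrite setTI.
  by congr measurable; apply/seteqP; split => x /=; rewrite in_itv/= andbT.
have mN : measurable [set x | u x < 0].
  have := mu_ measurableT `]-oo, 0[%classic (measurable_itv _); rewrite setTI.
  by congr measurable; apply/seteqP; split => x /=; rewrite in_itv/=.
apply/ler_addgt0Pl => e e0; have e20 : 0 < e / 2 by rewrite divr_gt0.
have [f [hf f01 fe]] := (lip_approx_measurable iw w0 mP).2 _ e20.
have [g [hg g01 ge]] := (lip_approx_measurable iw w0 mN).2 _ e20.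
have hfg : is_lip (fun x => f x - g x) by exact: is_lipB.
have fg1 x : `|f x - g x| <= 1.
  by have := f01 x; have := g01 x; rewrite ler_norml; lra.
have ifg : intg leb (fun x => u x * (f x - g x)).
  by apply: (intg_mulb iu _ fg1); exact: is_lip_measurable.
have iA (B : set Rn) h : measurable B -> is_lip h -> (forall x, 0 <= h x <= 1) ->
    intg leb (fun x => w x * `|\1_B x - h x|).
  move=> mB hh h01; apply: (@intg_mulb _ _ _ _ 1) => //.
    by apply: measurableT_comp => //; apply: measurable_funB => //; exact: is_lip_measurable.
  move=> x; rewrite normr_id indicE; have := h01 x.
  by case: (x \in B) => /=; rewrite ler_norml; lra.
have := hm _ hfg fg1; rewrite ler_norml => /andP[_ hm'].
apply: (@le_trans _ _ (I (fun x => u x * (f x - g x) +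
   (w x * `|\1_[set x | 0 < u x] x - f x| + w x * `|\1_[set x | u x < 0] x - g x|)))).
  apply: Int_le => //.
    by apply: intgD => //; apply: intgD; exact: iA.
  move=> x; rewrite -mulrDr !indicE /w.
  have /andP[a b] := f01 x; have /andP[a' b'] := g01 x.
  have [u0|u0|u0] := ltrgtP (u x) 0.
  - rewrite memNset/=; last by apply/negP; rewrite -leNgt ltW.
    rewrite mem_set//= (ltr0_norm u0) sub0r normrN (ger0_norm a) ger0_norm ?subr_ge0//.
    by nra.
  - rewrite mem_set//= memNset/=; last by apply/negP; rewrite -leNgt ltW.
    rewrite (gtr0_norm u0) sub0r normrN (ger0_norm a') ger0_norm ?subr_ge0//.
    by nra.
  - by rewrite u0 normr0 !mul0r addr0.
rewrite IntD//; last by apply: intgD; exact: iA.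
rewrite IntD; [lra|exact: iA|exact: iA].
Qed.

Lemma L1_unique (u v : Rn -> R) : intg leb u -> intg leb v ->
  (forall f, is_lip f -> (forall x, `|f x| <= 1) -> I (fun x => u x * f x) = I (fun x => v x * f x)) ->
  {ae leb, forall x, u x = v x}.
Proof.
move=> iu iv h.
have : {ae leb, forall x, u x - v x = 0}.
  apply: Int_eq0_ae; first exact: intgB.
  apply/eqP; rewrite eq_le Int_ge0 ?andbT//; apply: L1_duality; first exact: intgB.
  move=> f hf f1; rewrite (_ : (fun x => _) = fun x => u x * f x - v x * f x); last first.
    by apply/funext => x; ring.
  rewrite IntB; last 2 first.
    - exact: intg_mulb iu (is_lip_measurable hf) f1.
    - exact: intg_mulb iv (is_lip_measurable hf) f1.
  by rewrite h// subrr normr0.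
by apply: filterS => x /eqP; rewrite subr_eq0 => /eqP.
Qed.

End duality.

(** * Densities of functionals of bounded variation *)

Section dyadic_splines.
Context {R : realType}.

Lemma C11_line_lin (c : R) (a da b db : R -> R) : C11_line a da -> C11_line b db ->
  C11_line (fun t => c * a t + b t) (fun t => c * da t + db t).
Proof.
move=> [L [L0 h1 h2 h3 h4]] [K [K0 k1 k2 k3 k4]]; exists (`|c| * L + K).
have A (x y x' y' : R) : `|x| <= x' -> `|y| <= y' -> `|c * x + y| <= `|c| * x' + y'.
  by move=> hx hy; apply: le_trans (ler_normD _ _) _; rewrite normrM lerD// ler_wpM2l.
split.
- by rewrite addr_ge0// mulr_ge0.
- by move=> y; exact: A.
- move=> y z; rewrite mulrDl -mulrA.
  by rewrite (_ : _ - _ = c * (da y - da z) + (db y - db z)); [exact: A|ring].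
- move=> y z; rewrite mulrDl -mulrA.
  by rewrite (_ : _ - _ = c * (a y - a z) + (b y - b z)); [exact: A|ring].
- move=> y z; rewrite [leRHS]mulrDl -[X in _ <= X + _]mulrA.
  rewrite (_ : _ - _ = c * (a y - a z - da z * (y - z)) + (b y - b z - db z * (y - z))).
    exact: A.
  by ring.
Qed.

(** For [z - q./2 <= 0] both values are 0, and from 3 on both are 1. In between, the difference of
    clamps equals 1; it is chosen as majorant because its shifts telescope. *)
Lemma Spl_half_bound (z : R) (q : nat) :
  `|Spl (z - (q./2)%:R) - Spl (2 * z - q%:R)| <=
  clamp 0 1 (z - (q./2)%:R + 1) - clamp 0 1 (z - (q./2)%:R - 3).
Proof.
have hq : q%:R = (odd q)%:R + 2 * (q./2)%:R :> R.
  by rewrite -{1}(odd_double_half q) natrD -muln2 natrM mulrC.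
set p := (q./2)%:R; have [hb0 hb1] : (0 : R) <= (odd q)%:R /\ (odd q)%:R <= 1 :> R.
  by case: (odd q); split; rewrite /= ?lexx ?ler01.
have [h1|h1] := leP (z - p) 0.
  have cz : clamp 0 1 (z - p - 3) = 0.
    by apply/max_idPl; rewrite ge_min; apply/orP; right; lra.
  rewrite !Spl_lo// ?subrr ?normr0 ?cz ?subr0; last by rewrite hq; lra.
  by have /andP[] := @clamp_itv R 0 1 (z - p + 1) ler01.
have [h2|h2] := leP 3 (z - p).
  have cz : clamp 0 1 (z - p + 1) = 1.
    rewrite /clamp; have -> : Num.min 1 (z - p + 1) = 1 by apply/min_idPl; lra.
    exact/max_idPr.
  rewrite !Spl_hi// ?subrr ?normr0 ?cz; last by rewrite hq; lra.
  by have /andP[_ h] := @clamp_itv R 0 1 (z - p - 3) ler01; rewrite subr_ge0.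
have -> : clamp 0 1 (z - p + 1) = 1.
  rewrite /clamp; have -> : Num.min 1 (z - p + 1) = 1 by apply/min_idPl; lra.
  exact/max_idPr.
have -> : clamp 0 1 (z - p - 3) = 0.
  by apply/max_idPl; rewrite ge_min; apply/orP; right; lra.
have := Spl_itv (z - p); have := Spl_itv (2 * z - q%:R); rewrite ler_norml; lra.
Qed.

Lemma sum_half (u : nat -> R) M : \sum_(q < (2 * M)%N) u (q./2) = 2 * \sum_(p < M) u p.
Proof.
elim: M => [|M ih]; first by rewrite muln0 !big_ord0 mulr0.
rewrite (_ : 2 * M.+1 = (2 * M).+2)%N ?mulnS// !big_ord_recr/= ih.
by rewrite mul2n doubleK uphalf_double; ring.
Qed.

(** The constant is [2 * 4]: each coarse index comes from two values of [q], and the majorant splits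
    into four telescoping sums of unit shifts, each at most 1. *)
Lemma sum_Spl_half z M :
  \sum_(q < (2 * M)%N) `|Spl (z - (q./2)%:R) - Spl (2 * z - q%:R)| <= 8 :> R.
Proof.
apply: (@le_trans _ _ (\sum_(q < (2 * M)%N)
    (clamp 0 1 (z - (q./2)%:R + 1) - clamp 0 1 (z - (q./2)%:R - 3)))).
  by apply: ler_sum => q _; exact: Spl_half_bound.
rewrite (sum_half (fun p => clamp 0 1 (z - p%:R + 1) - clamp 0 1 (z - p%:R - 3))).
have S (c : R) : \sum_(p < M) (clamp 0 1 (z - p%:R + c) - clamp 0 1 (z - p%:R + c - 1)) <= 1 :> R.
  have := telescope_shift (clamp 0 1) (z + c) M.
  rewrite (eq_bigr (fun p : 'I_M => clamp 0 1 (z - p%:R + c) - clamp 0 1 (z - p%:R + c - 1))).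
    move=> ->; have := @clamp_itv R 0 1 (z + c) ler01.
    by have := @clamp_itv R 0 1 (z + c - M%:R) ler01; lra.
  by move=> p _; congr (clamp _ _ _ - clamp _ _ _); ring.
suff : \sum_(p < M) (clamp 0 1 (z - p%:R + 1) - clamp 0 1 (z - p%:R - 3)) <= 4 :> R by lra.
rewrite (eq_bigr (fun p : 'I_M =>
   ((clamp 0 1 (z - p%:R + 1) - clamp 0 1 (z - p%:R + 1 - 1)) +
   (clamp 0 1 (z - p%:R + 0) - clamp 0 1 (z - p%:R + 0 - 1))) +
   ((clamp 0 1 (z - p%:R + (-1)) - clamp 0 1 (z - p%:R + (-1) - 1)) +
   (clamp 0 1 (z - p%:R + (-2)) - clamp 0 1 (z - p%:R + (-2) - 1))) : R)); last first.
  move=> p _.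
  have -> : z - p%:R + 1 - 1 = z - p%:R + 0 by ring.
  have -> : z - p%:R + 0 - 1 = z - p%:R - 1 by ring.
  have -> : z - p%:R - 1 - 1 = z - p%:R - 2 by ring.
  have -> : z - p%:R - 2 - 1 = z - p%:R - 3 by ring.
  by ring.
rewrite !big_split/=; have := S 1; have := S 0; have := S (-1); have := S (-2).
by rewrite !big_split/=; lra.
Qed.

Lemma prod_telescope n (a b : 'I_n -> R) : \prod_j a j - \prod_j b j =
  \sum_(i < n) \prod_(j < n) (if (j < i)%N then b j else if j == i then a j - b j else a j).
Proof.
pose e (m : nat) : R := \prod_(j < n) (if (j < m)%N then b j else a j).
have -> : \prod_j a j = e 0%N by apply: eq_bigr.
have -> : \prod_j b j = e n by apply: eq_bigr => j _; rewrite ltn_ord.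
rewrite -telescope_ord; apply: eq_bigr => i _; rewrite /e.
rewrite [X in X - _](bigD1 i)//= [X in _ - X](bigD1 i)//= [RHS](bigD1 i)//=.
rewrite ltnn ltnSn eqxx mulrBl; congr (_ * _ - _ * _).
  by apply: eq_bigr => j ji; rewrite (negPf ji).
apply: eq_bigr => j ji; rewrite ltnS leq_eqVlt (negPf ji).
by rewrite (_ : (_ == _ :> nat) = false)//; exact: negPf.
Qed.

End dyadic_splines.

Section steps.
Context {R : realType} {n : nat} (N : nat).
Local Notation Rn := 'rV[R]_n.
Local Notation leb := (lebesgue_row R n).
Local Notation I u := (\int[leb]_x u x).
Local Notation grid k := (@grid n k N).

Definition cell k (p : grid k) : set Rn :=
  [set x | forall i, (p i)%:R * mesh k - N%:R <= x ord0 i < (p i)%:R * mesh k - N%:R + mesh k].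

Definition step k (c : grid k -> R) (x : Rn) : R := \sum_p c p * \1_(cell p) x.

Lemma gcoord_cell k (m : nat) (t : R) :
  (m%:R * mesh k - N%:R <= t < m%:R * mesh k - N%:R + mesh k) =
  (m%:R <= gcoord k N t < m%:R + 1).
Proof.
have h0 := @mesh_gt0 R k; have hK := @meshK R k.
have p0 := @pow2_gt0 R k.
have e : m%:R = 2 ^+ k * (m%:R * mesh k) :> R by rewrite mulrCA hK mulr1.
rewrite /gcoord [in RHS]e -[X in _ = (_ <= _ < _ + X)]hK -mulrDr ler_pM2l// ltr_pM2l//.
by congr andb; [rewrite lerBlDr|rewrite addrAC ltrBrDr].
Qed.

Lemma cellP k (p : grid k) x : cell p x <->
  forall i, (p i)%:R <= gcoord k N (x ord0 i) < (p i)%:R + 1.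
Proof. by split => h i; have := h i; rewrite gcoord_cell. Qed.

Lemma cell_inj k (p q : grid k) x : cell p x -> cell q x -> p = q.
Proof.
move=> /cellP hp /cellP hq; apply/ffunP => i; apply/val_inj/eqP; rewrite eqn_leq.
have /andP[a b] := hp i; have /andP[a' b'] := hq i.
by apply/andP; split; rewrite -ltnS -(ltr_nat R) -natr1; lra.
Qed.

Lemma measurable_cell k (p : grid k) : measurable (cell p).
Proof.
apply: measurable_forall_ord => i.
have := @measurable_row_coord R n i measurableT
  `[(p i)%:R * mesh k - N%:R, (p i)%:R * mesh k - N%:R + mesh k[%classic.
rewrite setTI => /(_ (measurable_itv _)).
by congr measurable; apply/seteqP; split => x /=; rewrite in_itv.
Qed.

Lemma lebesgue_cell k (p : grid k) : leb (cell p) = (mesh k ^+ n)%:E.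
Proof.
rewrite lebesgue_row_box; last by move=> i; rewrite lerDl ltW// mesh_gt0.
congr (_%:E); rewrite (eq_bigr (fun=> mesh k)); last by move=> i _; ring.
by rewrite prodr_const card_ord.
Qed.

Lemma integral_cell k (p : grid k) : (\int[leb]_x (\1_(cell p) x)%:E = (mesh k ^+ n)%:E)%E.
Proof.
rewrite integral_indic//; last exact: measurable_cell.
by apply: etrans (lebesgue_cell p); congr (lebesgue_row R n _); exact: setIT.
Qed.

Lemma intg_cell k (p : grid k) : intg leb (\1_(cell p) : Rn -> R).
Proof.
apply/integrableP; split.
  by apply/measurable_EFinP; apply: measurable_indic; exact: measurable_cell.
rewrite (_ : (\int[_]_x _)%E = \int[leb]_x (\1_(cell p) x)%:E)%E.
  by rewrite integral_cell ltry.
by apply: eq_integral => x _ /=; rewrite ger0_norm.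
Qed.

Lemma Int_cell k (p : grid k) : I (\1_(cell p) : Rn -> R) = mesh k ^+ n.
Proof. by rewrite /Rintegral integral_cell. Qed.

Lemma intg_step k (c : grid k -> R) : intg leb (step c).
Proof. by apply: intg_sum => p; apply: intgZ; exact: intg_cell. Qed.

Lemma Int_step k (c : grid k -> R) : I (step c) = mesh k ^+ n * \sum_p c p.
Proof.
rewrite Int_sum; last by move=> p; apply: intgZ; exact: intg_cell.
rewrite mulr_sumr; apply: eq_bigr => p _.
by rewrite IntZ ?Int_cell 1?mulrC//; exact: intg_cell.
Qed.

Lemma step_in k (c : grid k -> R) (p : grid k) x : cell p x -> step c x = c p.
Proof.
move=> hp; rewrite /step (bigD1 p)//= indicE mem_set// mulr1 big1 ?addr0// => q qp.
rewrite indicE memNset ?mulr0// => hq; move: qp.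
by rewrite (cell_inj hp hq) eqxx.
Qed.

Lemma step_out k (c : grid k -> R) x : (forall p : grid k, ~ cell p x) -> step c x = 0.
Proof. by move=> h; rewrite /step big1// => p _; rewrite indicE memNset ?mulr0//; exact: h. Qed.

Lemma step_abs k (c : grid k -> R) x : `|step c x| = step (fun p => `|c p|) x.
Proof.
have [[p hp]|h] := pselect (exists p : grid k, cell p x); first by rewrite !(step_in _ hp).
by rewrite !step_out ?normr0// => p hp; apply: h; exists p.
Qed.

Lemma gcoordS k (t : R) : gcoord k.+1 N t = 2 * gcoord k N t.
Proof. by rewrite /gcoord exprS mulrA. Qed.

Lemma gsizeS k : gsize k.+1 N = (2 * gsize k N)%N.
Proof. by rewrite /gsize expnS; ring. Qed.

Lemma half_lt k (q : grid k.+1) i : ((q i)./2 < gsize k N)%N.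
Proof. by have := ltn_ord (q i); rewrite [X in (_ < X)%N]gsizeS; lia. Qed.

Definition coarsen k (q : grid k.+1) : grid k := [ffun i => Ordinal (half_lt q i)].

Lemma coarsenE k (q : grid k.+1) i : coarsen q i = (q i)./2 :> nat.
Proof. by rewrite ffunE. Qed.

Lemma cell_half k (q : grid k.+1) x : cell q x -> cell (coarsen q) x.
Proof.
move=> /cellP h; apply/cellP => i; have := h i; rewrite gcoordS coarsenE.
have -> : (q i)%:R = (odd (q i))%:R + 2 * ((q i)./2)%:R :> R.
  by rewrite -{1}(odd_double_half (q i)) natrD -muln2 natrM mulrC.
by case: (odd (q i)) => /=; rewrite ?mulr0n ?mulr1n; lra.
Qed.

Lemma cell_sub k (p : grid k) x : cell p x -> exists q : grid k.+1, cell q x.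
Proof.
move=> /cellP h.
have lt b i : ((p i).*2 + (b : bool) < gsize k.+1 N)%N.
  by have := ltn_ord (p i); rewrite gsizeS; case: b; lia.
pose b i : bool := 2 * (p i)%:R + 1 <= gcoord k.+1 N (x ord0 i).
exists [ffun i => Ordinal (lt (b i) i)]; apply/cellP => i; rewrite ffunE/= /b.
rewrite natrD -muln2 natrM gcoordS; have := h i.
by case: (lerP (2 * (p i)%:R + 1) (2 * gcoord k N (x ord0 i))) => /= ?; rewrite ?mulr0n ?mulr1n; lra.
Qed.

Lemma step_half k (c : grid k -> R) x : step c x = step (fun q : grid k.+1 => c (coarsen q)) x.
Proof.
have [[q hq]|h] := pselect (exists q : grid k.+1, cell q x).
  by rewrite (step_in _ (cell_half hq)) (step_in _ hq).
rewrite !step_out//; first by move=> q hq; apply: h; exists q.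
by move=> p /cell_sub.
Qed.

Lemma cell_node k (p : grid k) x : cell p x -> `|x - node p| <= mesh k.
Proof.
move=> h; apply: row_norm_le => [|i]; first by rewrite ltW// mesh_gt0.
by rewrite !mxE; have := h i; rewrite ler_norml; lra.
Qed.

Lemma cell_box k (p : grid k) x : cell p x -> `|x| <= N%:R.
Proof.
move=> /cellP h; apply: row_norm_le => // i; have := h i.
have /(_ _ (ltn_ord (p i))) : forall m, (m < gsize k N)%N -> m%:R + 1 <= 2 ^+ k * (N%:R + N%:R) :> R.
  by move=> m hm; rewrite -gsizeE natr1 ler_nat.
rewrite /gcoord => h1 /andP[h2 h3].
have p0 := @pow2_gt0 R k; rewrite ler_norml; apply/andP; split.
  have : 0 <= 2 ^+ k * (x ord0 i + N%:R) by apply: le_trans h2.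
  by rewrite pmulr_rge0//; lra.
have : 2 ^+ k * (x ord0 i + N%:R) <= 2 ^+ k * (N%:R + N%:R) by lra.
by rewrite ler_pM2l//; lra.
Qed.

(* Difference of a half-size coarse spline and a fine one, as a derivative in the direction i. *)
Let prim k (i : 'I_n) (q : grid k.+1) (j : 'I_n) (t : R) : R :=
  if (j < i)%N then spl (gcoord k.+1 N t - (q j)%:R)
  else if j == i then 2^-1 * (mesh k * Spl (gcoord k N t - ((q j)./2)%:R)) +
    (- 1) * (mesh k.+1 * Spl (gcoord k.+1 N t - (q j)%:R)) + 0
  else 2^-1 * spl (gcoord k N t - ((q j)./2)%:R) + 0.

Let dprim k (i : 'I_n) (q : grid k.+1) (j : 'I_n) (t : R) : R :=
  if (j < i)%N then 2 ^+ k.+1 * dspl (gcoord k.+1 N t - (q j)%:R)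
  else if j == i then 2^-1 * spl (gcoord k N t - ((q j)./2)%:R) +
    (- 1 * spl (gcoord k.+1 N t - (q j)%:R) + 0)
  else 2^-1 * (2 ^+ k * dspl (gcoord k N t - ((q j)./2)%:R)) + 0.

Let C11_line0 : C11_line (fun _ : R => 0 : R) (fun=> 0).
Proof. by exists 0; split => // *; rewrite ?subrr ?mul0r ?subr0 ?normr0// mul0r. Qed.

Let prim_C11 k i (q : grid k.+1) j : C11_line (prim i q j) (dprim i q j).
Proof.
rewrite /prim /dprim; case: (j < i)%N; first exact: spl_gcoord_C11.
case: (j == i); last by apply: C11_line_lin => //; exact: spl_gcoord_C11.
under eq_fun do rewrite -addrA.
apply: C11_line_lin; first exact: Spl_gcoord_C11.
by apply: C11_line_lin => //; exact: Spl_gcoord_C11.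
Qed.

Let meshS k : mesh k.+1 = 2^-1 * mesh k :> R.
Proof. by rewrite /mesh exprS invfM. Qed.

Let prim_i k i (q : grid k.+1) t : prim i q i t =
  2^-1 * mesh k * (Spl (gcoord k N t - ((q i)./2)%:R) - Spl (2 * gcoord k N t - (q i)%:R)).
Proof. by rewrite /prim ltnn eqxx gcoordS meshS; ring. Qed.

Let prim_bounded k i (q : grid k.+1) j : bounded_by (1 + mesh k) (prim i q j).
Proof.
move=> t; have m0 := @mesh_gt0 R k.
have [->|ji] := eqVneq j i.
  have := Spl_itv (gcoord k N t - ((q i)./2)%:R).
  have := Spl_itv (2 * gcoord k N t - (q i)%:R).
  by rewrite prim_i => h1 h2; rewrite ler_norml; apply/andP; split; nra.
rewrite /prim (negPf ji); case: (j < i)%N.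
  have := spl_ge0 (gcoord k.+1 N t - (q j)%:R); have := spl_le1 (gcoord k.+1 N t - (q j)%:R).
  by rewrite ler_norml; lra.
have := spl_ge0 (gcoord k N t - ((q j)./2)%:R); have := spl_le1 (gcoord k N t - ((q j)./2)%:R).
by rewrite ler_norml; lra.
Qed.

(** A coarse spline has [2^n] times the integral of a fine one, so the differences have mean zero
    and are divergences: [prod_telescope] changes the factors one coordinate at a time, and the
    changed factor has a primitive of the order of the mesh. The constant 4 is [2^-1 * 8], with 8
    from [sum_Spl_half]. *)
Lemma bspline_refine k (s : grid k.+1 -> R) : (forall q, `|s q| <= 1) ->
  exists (F : 'I_n -> Rn -> R) (D : 'I_n -> 'I_n -> Rn -> R),
  [/\ forall i, C11 (F i) (D i), forall i, bounded_by (4 * mesh k) (F i) &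
    forall y, \sum_q s q * (2^-1 ^+ n * bspline (coarsen q) y - bspline q y) = \sum_i D i i y].
Proof.
move=> s1; exists (fun i y => \sum_q s q * \prod_j prim i q j (y ord0 j)).
exists (fun i l y => \sum_q s q * (dprim i q l (y ord0 l) *
   \prod_(j | j != l) prim i q j (y ord0 j))); split.
- move=> i; exact: (C11_sum (index_enum _) s (fun q => C11_tensor (prim_C11 i q) (prim_bounded i q))).
- move=> i y; apply: le_trans (ler_norm_sum _ _ _) _.
  apply: (@le_trans _ _ (\sum_(q : grid k.+1) \prod_j `|prim i q j (y ord0 j)|)).
    by apply: ler_sum => q _; rewrite normrM normr_prod ler_piMl// prodr_ge0.
  pose f (j : 'I_n) (m : nat) : R := if (j < i)%N then spl (gcoord k.+1 N (y ord0 j) - m%:R)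
    else if j == i then 2^-1 * mesh k *
      `|Spl (gcoord k N (y ord0 i) - (m./2)%:R) - Spl (2 * gcoord k N (y ord0 i) - m%:R)|
    else 2^-1 * spl (gcoord k N (y ord0 j) - (m./2)%:R).
  rewrite (eq_bigr (fun q : grid k.+1 => \prod_j f j (q j))); last first.
    move=> q _; apply: eq_bigr => j _; have [->|ji] := eqVneq j i.
      rewrite prim_i normrM ger0_norm ?mulr_ge0 ?invr_ge0 ?(ltW (mesh_gt0 _))//.
      by rewrite /f ltnn eqxx.
    rewrite /prim /f (negPf ji); case: (j < i)%N; first by rewrite ger0_norm// spl_ge0.
    by rewrite addr0 ger0_norm// mulr_ge0 ?invr_ge0// spl_ge0.
  rewrite (sum_grid_prod k.+1 N f) (bigD1 i)//=.
  have f0 j m : 0 <= f j m.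
    rewrite /f; case: (j < i)%N; first exact: spl_ge0.
    case: (j == i); last by rewrite mulr_ge0 ?invr_ge0// spl_ge0.
    by rewrite !mulr_ge0 ?invr_ge0 ?(ltW (mesh_gt0 _)).
  rewrite -[leRHS]mulr1; apply: ler_pM.
  + by apply: sumr_ge0.
  + by apply: prodr_ge0 => j _; apply: sumr_ge0.
  + rewrite /f ltnn eqxx -mulr_sumr gsizeS.
    have := sum_Spl_half (gcoord k N (y ord0 i)) (gsize k N).
    by have := @mesh_gt0 R k; nra.
  + apply: prodr_ile1 => j ji; rewrite sumr_ge0//= /f (negPf ji).
    case: (j < i)%N; first exact: sum_spl_le1.
    rewrite -mulr_sumr gsizeS (sum_half (fun m => spl (gcoord k N (y ord0 j) - m%:R))).
    by have := sum_spl_le1 (gcoord k N (y ord0 j)) (gsize k N); lra.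
- move=> y; rewrite exchange_big/=; apply: eq_bigr => q _; rewrite -mulr_sumr; congr (_ * _).
  rewrite /bspline -[n in _ ^+ n]card_ord -prodr_const -big_split/= prod_telescope.
  apply: eq_bigr => i _; rewrite prod_at; apply: eq_bigr => j _.
  have [->|ji] := eqVneq j i; first by rewrite ltnn /dprim ltnn eqxx coarsenE; ring.
  by rewrite /prim (negPf ji) coarsenE; case: (j < i)%N; rewrite ?addr0.
Qed.

End steps.

Section density.
Context {R : realType} {n : nat}.
Local Notation Rn := 'rV[R]_n.
Local Notation leb := (lebesgue_row R n).
Local Notation I u := (\int[leb]_x u x).

Variables (L : (Rn -> R) -> R) (N0 : nat) (M0 M1 : R).
Hypothesis L_lin : forall a f g, is_lip f -> is_lip g ->
  L (fun x => a * f x + g x) = a * L f + L g.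
Hypothesis M1_ge0 : 0 <= M1.
Hypothesis L_bound : forall c (f : Rn -> R), is_lip f -> (forall x : Rn, `|x| <= N0%:R -> `|f x| <= c) ->
  `|L f| <= M0 * c.
Hypothesis L_grad : forall F D c i, C11 F D -> bounded_by c F -> `|L (D i)| <= M1 * c.

(** Two units of margin, so that the splines sum to 1 on the ball of radius [N0] that governs
    [L]. *)
Let N := (N0 + 2)%N.

Let L0 : L (fun=> 0) = 0.
Proof.
have h0 : is_lip (fun _ : Rn => 0 : R) by exact: is_lip_cst.
have := L_lin (-1) h0 h0.
by rewrite (_ : (fun x => _) = fun=> 0); [lra|apply/funext => x; ring].
Qed.

Let L_sum (J : Type) (r : seq J) (a : J -> R) (F : J -> Rn -> R) : (forall j, is_lip (F j)) ->
  L (fun y => \sum_(j <- r) a j * F j y) = \sum_(j <- r) a j * L (F j).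
Proof.
move=> h; elim: r => [|j r ih].
  by rewrite big_nil -[RHS]L0; congr L; apply/funext => x; rewrite big_nil.
rewrite big_cons -ih -L_lin//; last by apply: is_lip_sum => l; exact: is_lipZ.
by congr L; apply/funext => x; rewrite big_cons.
Qed.

Let bspline_lip k (p : @grid n k N) : is_lip (@bspline R n k N p).
Proof. exact: C11_is_lip (bspline_C11 p). Qed.

Let c k (p : @grid n k N) : R := (2 ^+ k) ^+ n * L (bspline p).
Let u k : Rn -> R := step (c (k:=k)).
Let w k : Rn -> R := if k is l.+1 then fun x => u l.+1 x - u l x else u 0%N.

Let sumw k x : \sum_(l < k.+1) w l x = u k x.
Proof.
elim: k => [|k ih]; first by rewrite big_ord1.
by rewrite big_ord_recr/= ih; ring.
Qed.

Let sum_abs_c k : \sum_(p : @grid n k N) `|L (bspline p)| <= M0.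
Proof.
rewrite (eq_bigr (fun p : @grid n k N => Num.sg (L (bspline p)) * L (bspline p))); last first.
  by move=> p _; rewrite normrEsg.
rewrite -L_sum//; apply: le_trans (ler_norm _) _; rewrite -[leRHS]mulr1.
apply: L_bound => [|x _]; first by apply: is_lip_sum => p; exact: is_lipZ.
apply: le_trans (ler_norm_sum _ _ _) _; apply: le_trans (sum_bspline_le1 k N x).
apply: ler_sum => p _; rewrite normrM (ger0_norm (bspline_ge0 _ _)).
by rewrite ler_piMl ?bspline_ge0// normr_sg lern1 leq_b1.
Qed.

Let pow_mesh k : (2 ^+ k) ^+ n * mesh k ^+ n = 1 :> R.
Proof. by rewrite -exprMn meshK expr1n. Qed.

Let int_u k : I (fun x => `|u k x|) <= M0.
Proof.
rewrite (@eq_Rintegral _ _ _ _ _ (step (fun p => `|c (k:=k) p|))); last by move=> x _; exact: step_abs.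
rewrite Int_step; apply: le_trans (sum_abs_c k); rewrite mulr_sumr ler_sum// => p _.
rewrite normrM (ger0_norm (exprn_ge0 _ _)) ?exprn_ge0//.
by rewrite mulrCA mulrA pow_mesh mul1r.
Qed.

(** With the signs of the differences [e q] as coefficients, the L^1 norm becomes a single value of
    [L], at a function that [bspline_refine] writes as a divergence; the height [(2^(k+1))^n] of the
    steps cancels the volume of the cells. *)
Let int_w k : I (fun x => `|w k.+1 x|) <= n%:R * (M1 * (4 * mesh k)).
Proof.
pose e (q : @grid n k.+1 N) : R := 2^-1 ^+ n * L (bspline (coarsen q)) - L (bspline q).
have we x : `|w k.+1 x| = step (fun q : @grid n k.+1 N => `|(2 ^+ k.+1) ^+ n * e q|) x.
  rewrite /= /u (@step_half _ _ _ k) -step_abs -normrN; congr `|_|; rewrite opprB /step -sumrB.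
  apply: eq_bigr => q _; rewrite -mulrBl; congr (_ * _); rewrite /c /e.
  have -> : (2 ^+ k) ^+ n = (2 ^+ k.+1) ^+ n * 2^-1 ^+ n :> R.
    by rewrite -exprMn exprSr -mulrA mulfV// mulr1.
  by ring.
rewrite (@eq_Rintegral _ _ _ _ _ (step (fun q : @grid n k.+1 N => `|(2 ^+ k.+1) ^+ n * e q|))); last first.
  by move=> x _; exact: we.
rewrite Int_step mulr_sumr (eq_bigr (fun q => Num.sg (e q) * e q)); last first.
  move=> q _; rewrite normrM (ger0_norm (exprn_ge0 _ _)) ?exprn_ge0//.
  by rewrite mulrA [mesh _ ^+ n * _]mulrC pow_mesh mul1r normrEsg.
pose s q := Num.sg (e q).
have s1 q : `|s q| <= 1 by rewrite normr_sg lern1 leq_b1.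
have [F [D [FD Fb sumD]]] := bspline_refine s1.
have -> : \sum_q Num.sg (e q) * e q = \sum_i L (D i i).
  transitivity (L (fun y => \sum_i 1 * D i i y)); last first.
    rewrite L_sum; last by move=> i; exact: C11_grad_lip (FD i).
    by apply: eq_bigr => i _; rewrite mul1r.
  transitivity (L (fun y => \sum_q s q * (2^-1 ^+ n * bspline (coarsen q) y + (- 1 * bspline q y + 0)))).
    rewrite L_sum; last first.
      by move=> q; apply: is_lipD; [exact: is_lipZ|apply: is_lipD; [exact: is_lipZ|exact: is_lip_cst]].
    apply: eq_bigr => q _; rewrite L_lin//; last by apply: is_lipD; [exact: is_lipZ|exact: is_lip_cst].
    by rewrite L_lin ?L0//; [rewrite /e; congr (_ * _); ring|exact: is_lip_cst].
  congr L; apply/funext => y; rewrite (eq_bigr (fun i => D i i y)); last by move=> i _; rewrite mul1r.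
  by rewrite -sumD; apply: eq_bigr => q _; congr (_ * _); ring.
apply: (@le_trans _ _ (\sum_(i < n) M1 * (4 * mesh k))).
  by apply: ler_sum => i _; apply: le_trans (ler_norm _) _; exact: L_grad (FD i) (Fb i).
by rewrite sumr_const card_ord [leRHS]mulr_natl.
Qed.

(* u is the limit of step functions u_k, equal to 2^(k n) L(b_p) on the cell p of side 2^-k;
   by [bspline_refine] the difference of u_(k+1) and u_k is O(2^-k) in L^1. *)
Lemma density : exists u : Rn -> R, [/\ intg leb u,
  forall x, N%:R < `|x| -> u x = 0,
  forall f, is_lip f -> intg leb (fun x => u x * f x) &
  forall f, is_lip f -> L f = I (fun x => u x * f x)].
Proof.
have ib k : intg leb (w k).
  by case: k => [|k]; rewrite /w ?/u; [exact: intg_step|apply: intgB; exact: intg_step].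
(* [M0] bounds the norm of [u 0]; 8 is 4 times the bound 2 for the sum of the meshes. *)
have [|v [iv v0] hv] := @intg_series _ _ _ leb w (M0 + 8 * n%:R * M1) ib.
  case=> [|K].
    by rewrite big_ord0 addr_ge0 ?mulr_ge0//; apply: le_trans (sum_abs_c 0); exact: sumr_ge0.
  rewrite big_ord_recl; apply: lerD; first exact: int_u.
  have S : \sum_(k < K) mesh k <= 2 :> R.
    suff : \sum_(k < K) mesh k <= 2 - 2 * mesh K :> R by have := @mesh_gt0 R K; lra.
    elim: K => [|K ih]; first by rewrite big_ord0 /mesh expr0 invr1; lra.
    have e : mesh K = 2 * mesh K.+1 :> R by rewrite /mesh exprS invfM mulrA mulfV// mul1r.
    by rewrite big_ord_recr/= e in ih *; lra.
  apply: (@le_trans _ _ (\sum_(k < K) n%:R * (M1 * (4 * mesh k)))).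
    by apply: ler_sum => k _; exact: int_w.
  rewrite -!mulr_sumr; have nM : 0 <= n%:R * M1 by rewrite mulr_ge0.
  by nra.
have ub k x : N%:R < `|x| -> u k x = 0.
  by move=> hx; apply: step_out => p /cell_box; rewrite leNgt hx.
have vb x : N%:R < `|x| -> v x = 0.
  by move=> hx; apply: v0 => -[|k]; rewrite /w !ub// subrr.
have bf (f : Rn -> R) : is_lip f -> exists2 c, 0 <= c & forall x : Rn, `|x| <= N%:R -> `|f x| <= c.
  move=> /is_lipP[a a0 ha]; exists (`|f 0| + a * N%:R); first by rewrite addr_ge0 ?mulr_ge0.
  move=> x hx; rewrite -(subrK (f 0) (f x)) addrC; apply: le_trans (ler_normD _ _) _.
  rewrite lerD2l; apply: le_trans (ha _ _) _; rewrite mdist_rowE sub0r normrN ler_wpM2l//.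
have trunc (f : Rn -> R) : is_lip f -> exists g : Rn -> R, [/\ is_lip g, exists b, forall x, `|g x| <= b &
    forall x : Rn, `|x| <= N%:R -> g x = f x].
  move=> hf; have [b b0 hb] := bf f hf; exists (fun x => clamp (- b) b (f x)); split.
  - exact: is_lip_clamp.
  - by exists b => x; rewrite ler_norml clamp_itv//; lra.
  - by move=> x /hb; rewrite ler_norml; exact: clamp_id.
have vf (f g : Rn -> R) : (forall x : Rn, `|x| <= N%:R -> g x = f x) -> (fun x => v x * f x) = (fun x => v x * g x).
  move=> fg; apply/funext => x; have [/fg ->//|/vb ->] := leP `|x| N%:R.
  by rewrite !mul0r.
exists v; split => //.
  move=> f hf; have [g [hg [b gb] fg]] := trunc f hf; rewrite (vf f g fg).
  exact: intg_mulb iv (is_lip_measurable hg) gb.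
move=> f hf; have [g [hg [b gb] fg]] := trunc f hf; rewrite (vf f g fg).
have N0N : N0%:R <= N%:R :> R by rewrite ler_nat leq_addr.
have -> : L f = L g.
  apply/eqP; rewrite -subr_eq0 -normr_le0.
  have -> : L f - L g = L (fun x => (-1) * g x + f x) by rewrite L_lin//; ring.
  rewrite -(mulr0 M0); apply: L_bound => [|x hx].
    by apply: is_lipD => //; exact: is_lipZ.
  by rewrite fg ?(le_trans hx)//; rewrite mulN1r addNr normr0.
have mg := is_lip_measurable hg.
have [a a0 ha] := (is_lipP _).1 hg.
have M00 : 0 <= M0 by apply: le_trans (sum_abs_c 0); exact: sumr_ge0.
(* Of the constant 4, the part 3 comes from quasi-interpolating [g] and 1 from evaluating [g] at the
   node instead of inside the cell. *)
have est k : `|L g - I (fun x => u k x * g x)| <= 4 * M0 * a * mesh k.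
  have e1 : `|L g - L (interp k N g)| <= M0 * (a * (3 * mesh k)).
    have -> : L g - L (interp k N g) = L (fun x => (-1) * interp k N g x + g x).
      by rewrite L_lin//; [ring|exact: C11_is_lip (interp_C11 _ _ _)].
    apply: L_bound => [|x hx].
      by apply: is_lipD => //; apply: is_lipZ; exact: C11_is_lip (interp_C11 _ _ _).
    rewrite mulN1r addrC distrC; apply: interp_approx => //.
      by move=> y z; rewrite distrC; have := ha z y; rewrite mdist_rowE distrC.
    by rewrite /N natrD lerD2r.
  have iug : intg leb (fun x => u k x * g x) by apply: intg_mulb mg gb; exact: intg_step.
  have e2 : L (interp k N g) = I (step (fun p => c (k:=k) p * g (node p))).
    rewrite L_sum// Int_step mulr_sumr; apply: eq_bigr => p _; rewrite /c.
    by rewrite 2!mulrA [mesh k ^+ n * _]mulrC pow_mesh mul1r mulrC.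
  have e3 : `|L (interp k N g) - I (fun x => u k x * g x)| <= (a * mesh k) * M0.
    rewrite e2 -IntB//; last exact: intg_step.
    apply: le_trans (Int_abs _) _; first by apply: intgB => //; exact: intg_step.
    apply: (@le_trans _ _ (I (fun x => (a * mesh k) * `|u k x|))).
      apply: Int_le.
      - by apply: intg_abs; apply: intgB => //; exact: intg_step.
      - by apply: intgZ; apply: intg_abs; exact: intg_step.
      - move=> x; have [[p hp]|h] := pselect (exists p : @grid n k N, cell p x); last first.
          rewrite /u !step_out; first by rewrite mul0r subrr normr0 mulr0.
            by move=> p hp; apply: h; exists p.
          by move=> p hp; apply: h; exists p.
        rewrite /u !(step_in _ hp) -mulrBr normrM mulrC ler_wpM2r//.
        apply: le_trans (ha _ _) _; rewrite mdist_rowE ler_wpM2l//.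
        exact: cell_node.
    rewrite IntZ; last by apply: intg_abs; exact: intg_step.
    by rewrite ler_wpM2l ?int_u// mulr_ge0// ltW// mesh_gt0.
  apply: le_trans (ler_distD (L (interp k N g)) _ _) _.
  by apply: le_trans (lerD e1 e3) _; rewrite le_eqVlt; apply/orP; left; apply/eqP; ring.
have b0 : 0 <= b by apply: le_trans (gb 0).
have cu : (fun k => I (fun x => u k x * g x)) @ \oo --> I (fun x => v x * g x).
  apply/cvgrPdist_le => e e0; have eb : 0 < e / (b + 1) by rewrite divr_gt0// ltr_wpDl.
  have /cvgrPdist_le /(_ _ eb) [K _ hK] := hv; exists K => // k /= Kk.
  have := hK k.+1 (leqW Kk); rewrite /= sub0r normrN ger0_norm; last exact: Int_ge0.
  rewrite (@eq_Rintegral _ _ _ _ _ (fun x => `|u k x - v x|)); last by move=> x _; rewrite sumw.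
  move=> h.
  have iu : intg leb (u k) by exact: intg_step.
  rewrite distrC -IntB; [|exact: intg_mulb iu mg gb|exact: intg_mulb iv mg gb].
  rewrite (@eq_Rintegral _ _ _ _ _ (fun x => (u k x - v x) * g x)); last by move=> x _; ring.
  apply: le_trans (Int_norm_le (intgB iu iv) mg gb) _.
  apply: (@le_trans _ _ (b * (e / (b + 1)))); first by rewrite ler_wpM2l.
  rewrite mulrA ler_pdivrMr ?ltr_wpDl// mulrC ler_wpM2l ?(ltW e0)//; lra.
have cd : (fun k => `|L g - I (fun x => u k x * g x)|) @ \oo --> `|L g - I (fun x => v x * g x)|.
  by apply: cvg_norm; apply: cvgB => //; exact: cvg_cst.
apply/eqP; rewrite -subr_eq0 -normr_le0.
have cm : (fun k => 4 * M0 * a * mesh k) @ \oo --> (0 : R).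
  by rewrite -[X in _ --> X](mulr0 (4 * M0 * a)); apply: cvgMl_tmp; exact: mesh_cvg0.
by apply: ler_cvg_to cd cm _; apply: nearW => k; exact: est.
Qed.

End density.

(** * Rademacher's theorem *)

Section line_differentiability.
Context {R : realType}.
Local Notation mu := (@lebesgue_measure R).

Definition stieltjes (f : R -> R) (nd : nondecreasing f) (cf : right_continuous f) : R -> R := f.
HB.instance Definition _ f nd cf := isCumulative.Build R _ R (@stieltjes f nd cf) nd cf.

Lemma stieltjes_itv (f : cumulative R R) (a b : R) : a <= b ->
  lebesgue_stieltjes_measure f `]a, b]%classic = (f b - f a)%:E.
Proof.
move=> ab; rewrite /lebesgue_stieltjes_measure/= /measure_extension measurable_mu_extE/=; last first.
  exact: is_ocitv.
rewrite wlength_itv/= lte_fin; move: ab; rewrite le_eqVlt => /orP[/eqP ->|ab].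
  by rewrite ltxx subrr.
by rewrite ab EFinB.
Qed.

(** The two Stieltjes measures together give every half-open interval its length, so their sum is
    Lebesgue measure by uniqueness. *)
Lemma stieltjes_le_lebesgue (g h : cumulative R R) : (forall x, g x + h x = x) ->
  forall A, measurable A -> (lebesgue_stieltjes_measure g A <= mu A)%E.
Proof.
move=> gh A mA.
rewrite (@lebesgue_measure_unique R (measure_add (lebesgue_stieltjes_measure g)
  (lebesgue_stieltjes_measure h)))//; last first.
  move=> X /ocitvP[->|[[a b] /= ab ->]]; first by rewrite !measure0.
  apply: etrans (esym (measure_addE _ _ _)).
  apply: etrans (congr2 adde (esym (stieltjes_itv g (ltW ab))) (esym (stieltjes_itv h (ltW ab)))).
  rewrite lebesgue_measure_itv/= lte_fin ab -EFinD.
  congr (_%:E); have := gh a; have := gh b; lra.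
by rewrite [leRHS]measure_addE leeDl.
Qed.

Lemma derivable_near_affine (F f : R -> R) (c k x : R) : derivable F x 1 ->
  (\forall y \near x, f y = c * (2 * (F y + k) - y)) -> derivable f x 1.
Proof.
move=> dF hf.
have : derivable (fun y => (2 * c) *: F y + (c * (2 * k) - c * y)) x 1.
  apply: derivableD; first exact: derivableZ.
  by apply: derivableB; [exact: derivable_cst|apply: derivableZ; exact: derivable_id].
apply: near_eq_derivable; near=> y; rewrite [RHS](near hf)// /GRing.scale/=; ring.
Unshelve. all: by end_near. Qed.

(** The functions [(f / c + x) / 2] and [(x - f / c) / 2] are both nondecreasing and add up to [x].
    So the Stieltjes measure of the first is dominated by Lebesgue measure and has a Radon-Nikodym
    density; the primitive of this density is differentiable almost everywhere, and [f] is an affine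
    expression in it and [x]. *)
Lemma derivable_lip_ae_itv (f : R -> R) (c : R) (M : nat) : 0 < c ->
  (forall x y, `|f x - f y| <= c * `|x - y|) ->
  {ae mu, forall x, - M%:R < x < M%:R -> derivable f x 1}.
Proof.
move=> c0 hf.
pose g0 x := (f x / c + x) / 2; pose h0 x := (x - f x / c) / 2.
have fc x y : x <= y -> `|f y / c - f x / c| <= y - x.
  move=> xy; rewrite -mulrBl normrM [`|c^-1|]gtr0_norm ?invr_gt0// ler_pdivrMr// mulrC.
  by rewrite -(ger0_norm (x := y - x)) ?subr_ge0.
have ng : nondecreasing g0.
  by move=> x y xy; have := fc x y xy; rewrite ler_norml /g0; lra.
have nh : nondecreasing h0.
  by move=> x y xy; have := fc x y xy; rewrite ler_norml /h0; lra.
have cont : continuous f.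
  move=> x; apply/cvgrPdist_le => e e0; near=> y; apply: le_trans (hf _ _) _.
  rewrite -ler_pdivlMl// mulrC; near: y.
  by apply: cvgr_dist_le => //; rewrite divr_gt0.
have cg : right_continuous g0.
  apply: right_continuousW => x; apply: cvgM; last exact: cvg_cst.
  by apply: cvgD => //; apply: cvgM; [exact: cont|exact: cvg_cst].
have ch : right_continuous h0.
  apply: right_continuousW => x; apply: cvgM; last exact: cvg_cst.
  by apply: cvgB => //; apply: cvgM; [exact: cont|exact: cvg_cst].
pose g : cumulative R R := stieltjes ng cg; pose h : cumulative R R := stieltjes nh ch.
have gh x : g x + h x = x by rewrite /g /h /= /stieltjes /g0 /h0; lra.
have mE : measurable (`]- M%:R, M%:R]%classic : set (measurableTypeR R)) by exact: measurable_itv.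
pose E : set (measurableTypeR R) := `]- M%:R, M%:R]%classic.
have Eoo : (lebesgue_stieltjes_measure g E < +oo)%E.
  by rewrite stieltjes_itv ?ltry//; apply: (@le_trans _ _ 0); rewrite ?oppr_le0.
(* Restricting to a bounded interval makes the measure finite, hence its density integrable. *)
pose nu : {finite_measure set (measurableTypeR R) -> \bar R} := mfrestr mE Eoo.
have num : nu `<< mu.
  apply/null_content_dominatesP => S mS S0; apply/eqP; rewrite eq_le measure_ge0 andbT.
  rewrite -S0; apply: le_trans (stieltjes_le_lebesgue gh mS).
  rewrite /nu /= /mfrestr /mrestr; apply: le_measure.
  - by apply/mem_set; exact: measurableI.
  - exact/mem_set.
  - exact: subIsetl.
have [u [u0 ufin iu nuE]] := radon_nikodym_sigma_finite num.
pose v x := fine (u x); have vE : EFin \o v = u by apply/funext => x; rewrite /= fineK.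
have iv : mu.-integrable setT (EFin \o v) by rewrite vE.
have loc : locally_integrable setT v.
  by apply: open_integrable_locally => //; exact: openT.
have ivy y : mu.-integrable `]-oo, y] (EFin \o v).
  by apply: integrableS iv.
have := FTC1Ny ivy loc; apply: filterS; first exact: (ae_filter_ringOfSetsType mu).
move=> x hx /andP[Mx xM].
have [dF _] := hx.
pose F y : R := \int[mu]_(t in `]-oo, y]) v t.
have FE y : - M%:R < y < M%:R -> f y = c * (2 * (F y + g (- M%:R)) - y).
  move=> /andP[y1 y2].
  have : nu `]-oo, y]%classic = (\int[mu]_(t in `]-oo, y]) (v t)%:E)%E.
    by rewrite nuE//; apply: eq_integral => t _; rewrite /v fineK.
  rewrite /nu /= /mfrestr /mrestr.
  rewrite (_ : _ `&` _ = `]- M%:R, y]%classic); last first.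
    apply/seteqP; split => t /=; rewrite !in_itv/=; first by move=> [-> /andP[-> _]].
    by move=> /andP[-> ty]; rewrite ty (le_trans ty (ltW y2)).
  rewrite stieltjes_itv ?(ltW y1)// => e.
  have -> : F y = g y - g (- M%:R) by rewrite /F /Rintegral -e.
  by rewrite subrK /g /= /stieltjes /g0; field; rewrite gt_eqF.
apply: (derivable_near_affine (c := c) (k := g (- M%:R)) dF).
near=> y; apply: FE; near: y.
by apply: (near_in_itvoo (a := - M%:R)); rewrite in_itv/= Mx.
Unshelve. all: by end_near. Qed.

Lemma derivable_lip_ae (f : R -> R) (c : R) : (forall x y, `|f x - f y| <= c * `|x - y|) ->
  {ae mu, forall x, derivable f x 1}.
Proof.
move=> hf.
have [c' c'0 hf'] : exists2 c', 0 < c' & forall x y, `|f x - f y| <= c' * `|x - y|.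
  exists (`|c| + 1); first by rewrite ltr_wpDl.
  move=> x y; apply: le_trans (hf x y) _; rewrite ler_wpM2r//.
  by apply: le_trans (ler_norm c) _; rewrite lerDl.
have : {ae mu, forall x, forall M : nat, - M%:R < x < M%:R -> derivable f x 1}.
  by apply/ae_foralln => M; exact: derivable_lip_ae_itv hf'.
apply: filterS; first exact: (ae_filter_ringOfSetsType mu).
move=> x /(_ (Num.bound `|x|)); apply.
by rewrite -ltr_norml archi_boundP.
Qed.

End line_differentiability.

Section rademacher.
Context {R : realType}.
Local Notation mu := (@lebesgue_measure R).

(** Taking the slope rational costs an arbitrarily small error and leaves only countably many
    cases. *)
Lemma derivable_slope (phi : R -> R) (t e : R) : 0 < e -> derivable phi t 1 ->
  exists b : rat, exists2 r : R, 0 < r &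
    forall s, `|s| <= r -> `|phi (t + s) - phi t - ratr b * s| <= e * `|s|.
Proof.
move=> e0 /cvg_ex[/= l hl]; have e20 : 0 < e / 2 by rewrite divr_gt0.
have [b /andP[lb bl]] : exists b : rat, l - e / 2 < ratr b < l + e / 2.
  have [|b] := @rat_in_itvoo R (l - e / 2) (l + e / 2); first lra.
  by rewrite in_itv/= => hb; exists b.
exists b; move/cvgrPdist_le : hl => /(_ _ e20) [r /= r0 hr].
exists (r / 2) => [|s sr]; first by rewrite divr_gt0.
have [->|s0] := eqVneq s 0; first by rewrite addr0 mulr0 subr0 subrr normr0 mulr0.
have /= := hr s; rewrite sub0r normrN s0 => /(_ _ isT).
have -> : `|s| < r by apply: le_lt_trans sr _; lra.
move=> /(_ isT); rewrite /GRing.scale/= mulr1 [s + t]addrC => h.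
have -> : phi (t + s) - phi t - ratr b * s = (s^-1 * (phi (t + s) - phi t) - ratr b) * s.
  by field.
rewrite normrM ler_wpM2r//; move: h; rewrite !ler_norml => h; lra.
Qed.

(** If no point of [S] lay within [e * |s|] of [t + s], the ball of that radius would be missing
    from [S] in the ball of radius [2 * |s|] about [t], and the relative measure there would be at
    most [1 - e / 2]. *)
Lemma density_point_approx (S : set R) (t e : R) : measurable S -> 0 < e -> e <= 1 -> S t ->
  (mu (S `&` ball t r) * (mu (ball t r))^-1 @[r --> 0^'+] --> (\1_S t)%:E)%E ->
  exists2 r : R, 0 < r & forall s, s != 0 -> `|s| <= r ->
    exists2 s', S (t + s') & `|s' - s| < e * `|s|.
Proof.
move=> mS e0 e1 St; rewrite indicE mem_set//= => h.
have : nbhs (1%:E : \bar R) [set y | (1 - e / 2)%:E < y]%E.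
  apply: open_nbhs_nbhs; split; first exact: open_ereal_gt_ereal.
  by rewrite /= lte_fin; lra.
move=> /h [r0 /= r00 hr]; exists (r0 / 4) => [|s s0 sr]; first by rewrite divr_gt0.
have as0 : 0 < `|s| by rewrite normr_gt0.
apply: contrapT => hs; pose r := 2 * `|s|; have rr : 0 < r by rewrite mulr_gt0.
have es : 0 < e * `|s| by rewrite mulr_gt0.
have : ((1 - e / 2)%:E < mu (S `&` ball t r) * (mu (ball t r))^-1)%E.
  apply: hr => //=; rewrite sub0r normrN gtr0_norm// /r; lra.
apply/negP; rewrite -leNgt.
have mSB : measurable (S `&` ball t r) by apply: measurableI => //; exact: measurable_ball.
pose J : set R := ball (t + s) (e * `|s|).
have : (mu (S `&` ball t r) + mu J <= mu (ball t r))%E.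
  rewrite -measureU//; last 2 first.
  - exact: measurable_ball.
  - apply/seteqP; split => y //= -[[Sy _]]; rewrite /ball/= => hy; apply: hs; exists (y - t).
      by rewrite addrC subrK.
    by rewrite distrC (_ : s - (y - t) = t + s - y)//; ring.
  apply: le_measure.
  - by apply/mem_set; apply: measurableU => //; exact: measurable_ball.
  - by apply/mem_set; exact: measurable_ball.
  move=> y [[]//|]; rewrite /ball/= => hy; rewrite /r.
  rewrite (_ : t - y = (t + s - y) - s); last by ring.
  apply: le_lt_trans (ler_normB _ _) _; rewrite mulrDl mul1r ltrD2r.
  by apply: lt_le_trans hy _; rewrite ler_piMl.
rewrite /J !lebesgue_measure_ball ?(ltW rr) ?(ltW es)//.
have : (0 <= mu (S `&` ball t r))%E by exact: measure_ge0.
case: (mu (S `&` ball t r)) => [z| |]//= z0; rewrite -EFinD !lee_fin => hz.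
rewrite inver mulrn_eq0/= gt_eqF// -EFinM lee_fin ler_pdivrMr ?pmulrn_lgt0//.
rewrite (_ : (1 - e / 2) * _ = r *+ 2 - e * `|s| *+ 2); first by move: hz; lra.
rewrite mulrBl mul1r -mulrA /r; congr (_ - _); rewrite -[RHS]mulrnAr; congr (_ * _).
by rewrite -mulrnAr mulrA mulVf// mul1r.
Qed.

Context {n : nat}.
Local Notation Rn := 'rV[R]_n.
Local Notation leb := (lebesgue_row R n).

Definition lin_row (a : 'I_n -> R) (h : Rn) : R := \sum_j a j * h ord0 j.

Definition head_dir (k : nat) (h : Rn) : Prop := forall j : 'I_n, (k <= j)%N -> h ord0 j = 0.

(** With slopes and scale fixed, approximate linearity along the first [k] coordinates is a closed
    condition on [x]; this provides the measurability in the induction on [k] that proves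
    Rademacher's theorem. *)
Definition near_linear (f : Rn -> R) k (e : R) (a : 'I_n -> R) (r : R) : set Rn :=
  [set x | forall h, head_dir k h -> `|h| <= r -> `|f (x + h) - f x - lin_row a h| <= e * `|h|].

Variables (f : Rn -> R) (L : R).
Hypothesis L0 : 0 <= L.
Hypothesis fL : forall x y, `|f x - f y| <= L * `|x - y|.

Lemma near_linear_closed k e a r : closed (near_linear f k e a r).
Proof.
move=> x cx h hk hr; apply/ler_addgt0Pr => eta eta0.
have d0 : 0 < eta / (2 * L + 1) by rewrite divr_gt0// ltr_wpDl// mulr_ge0.
have [y [yA]] := cx _ (nbhsx_ballx x _ d0).
rewrite -ball_normE/= => xy; have := yA h hk hr.
have h1 := fL (x + h) (y + h); have h2 := fL x y.
rewrite (_ : x + h - (y + h) = x - y) in h1; last by rewrite opprD addrACA subrr addr0.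
have h3 : 2 * L * `|x - y| <= eta.
  apply: (@le_trans _ _ ((2 * L + 1) * `|x - y|)); first by rewrite ler_wpM2r// lerDl.
  by rewrite -ler_pdivlMl ?ltr_wpDl// ?mulr_ge0// mulrC ltW.
move: h1 h2; rewrite !ler_norml; lra.
Qed.

(** Write [h] as [s] times the new direction plus [h']. Near-linearity along [h'] is known not at
    [x + s e_k] but at a nearby point [x + s' e_k], with the same slopes and scale; the Lipschitz
    bound pays for the shift. All errors together are at most [(2 * L + 4) * e * |h|]. *)
Lemma near_linear_step (k : 'I_n) (x : Rn) (e b : R) (a : 'I_n -> R) (r r1 r2 : R) :
  0 < e -> e <= 1 -> 0 < r -> 0 < r1 -> 0 < r2 -> near_linear f k e a r x ->
  (forall s, `|s| <= r1 -> `|f (x + s *: delta_mx ord0 k) - f x - b * s| <= e * `|s|) ->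
  (forall s, s != 0 -> `|s| <= r2 ->
    exists2 s', near_linear f k e a r (x + s' *: delta_mx ord0 k) & `|s' - s| < e * `|s|) ->
  exists2 r', 0 < r' & near_linear f k.+1 ((2 * L + 4) * e)
    (fun j => if j == k then b else a j) r' x.
Proof.
move=> e0 e1 r0 r10 r20 hx hb hS.
(* Half of [r1], because [|s'|] may be as large as [2 * |s|]. *)
pose rho := Num.min (r / 1) (Num.min (r1 / 2) r2).
have rho0 : 0 < rho by rewrite /rho !lt_min !divr_gt0.
exists rho => // h hk; rewrite /rho !le_min divr1 => /and3P[hr hr1 hr2].
pose d : Rn := delta_mx ord0 k; pose s := h ord0 k; pose h' := h - s *: d.
have dk : d ord0 k = 1 by rewrite mxE !eqxx.
have dj j : j != k -> d ord0 j = 0 by move=> jk; rewrite mxE (negPf jk) andbF.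
have h'j j : h' ord0 j = if j == k then 0 else h ord0 j.
  rewrite /h' !mxE eqxx/=; have [->|_] := eqVneq j k; first by rewrite mulr1 subrr.
  by rewrite mulr0 subr0.
have sh : `|s| <= `|h| by exact: row_norm_coord.
have h'h : `|h'| <= `|h|.
  apply: row_norm_le => // j; rewrite h'j; case: eqP => _; first by rewrite normr0.
  exact: row_norm_coord.
have hk' : head_dir k h'.
  move=> j; rewrite leq_eqVlt h'j => /orP[/eqP/val_inj <-|kj]; first by rewrite eqxx.
  by case: eqP => // _; exact: hk.
have d1 : `|d| = 1.
  apply/eqP; rewrite eq_le; apply/andP; split; last by rewrite -[leLHS]normr1 -dk row_norm_coord.
  by apply: row_norm_le => // j; rewrite mxE eqxx/=; case: (j == k); rewrite ?normr1 ?normr0.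
have b1 : `|b| <= L + e.
  have := hb r1; rewrite gtr0_norm// lexx => /(_ isT).
  have := fL (x + r1 *: d) x; rewrite [x + _]addrC addrK normrZ gtr0_norm//.
  rewrite d1 mulr1 => h1 h2; rewrite -(ler_pM2r r10) -[r1 in `|b| * r1]gtr0_norm// -normrM.
  by move: h1 h2; rewrite !ler_norml; lra.
have linE : lin_row (fun j => if j == k then b else a j) h = lin_row a h' + b * s.
  rewrite /lin_row (bigD1 k)//= eqxx [in RHS](bigD1 k)//= h'j eqxx mulr0 add0r addrC.
  by congr (_ + _); apply: eq_bigr => j jk; rewrite (negPf jk) h'j (negPf jk).
have [s0|s0] := eqVneq s 0.
  have hh' : h' = h by rewrite /h' s0 scale0r subr0.
  rewrite linE s0 mulr0 addr0 hh'; apply: le_trans (hx h _ hr) _; first by rewrite -hh'.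
  rewrite -mulrA ler_peMl ?mulr_ge0 ?(ltW e0)//.
  by have := L0; lra.
have [s' xs' s's] := hS s s0 (le_trans sh hr2).
have e_s : e * `|s| <= `|s| by rewrite ler_piMl.
have s'2 : `|s'| <= 2 * `|s|.
  by move: s's e_s; case: (ger0P s') => ?; case: (ger0P s) => ?; rewrite ltr_norml; lra.
have q1 := hb s' _; have {}q1 := q1 (le_trans s'2 _); have {q1}q1 := q1 ltac:(lra).
have q2 := xs' h' hk' (le_trans h'h hr).
have q3 := fL (x + h) (x + s' *: d + h').
have q4 : `|x + h - (x + s' *: d + h')| = `|s' - s|.
  have -> : x + h - (x + s' *: d + h') = (s - s') *: d.
    by apply/rowP => j; rewrite /h' !mxE; ring.
  by rewrite normrZ d1 mulr1 distrC.
rewrite q4 in q3; rewrite linE.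
have q5 : `|b * (s' - s)| <= (L + e) * (e * `|s|).
  by rewrite normrM ler_pM// ltW.
have q6 : L * `|s' - s| <= L * (e * `|s|) by rewrite ler_wpM2l// ltW.
have q7 : e * `|s'| <= 2 * (e * `|s|) by rewrite mulrCA ler_wpM2l// ltW.
have q8 : e * `|h'| <= e * `|h| by rewrite ler_wpM2l// ltW.
have q9 : e * `|s| <= e * `|h| by rewrite ler_wpM2l// ltW.
have q10 : (2 * L + e) * (e * `|s|) <= (2 * L + 1) * (e * `|h|).
  rewrite ler_pM//; [by rewrite addr_ge0 ?mulr_ge0// ltW|by rewrite mulr_ge0// ltW|lra].
rewrite -mulrA; move: q1 q2 q3 q5; rewrite !ler_norml; lra.
Qed.

Lemma derivable_line (x : Rn) i : {ae mu, forall t, derivable (fun t => f (upd i x t)) t 1}.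
Proof.
apply: (@derivable_lip_ae _ _ L) => s t; apply: le_trans (fL _ _) _; rewrite ler_wpM2l//.
apply: row_norm_le => // j; rewrite !mxE; case: eqP => _ //.
by rewrite subrr normr0.
Qed.

(** Rational slopes and radii [1/(m+1)] make this a countable union of closed sets. *)
Definition near_linear_pt k (e : R) : set Rn :=
  \bigcup_(q : 'rV[rat]_n * nat) near_linear f k e (fun j => ratr (q.1 ord0 j)) q.2.+1%:R^-1.

Lemma near_linear_mono k e a r r' : r' <= r -> near_linear f k e a r `<=` near_linear f k e a r'.
Proof. by move=> rr x hx h hk hr; apply: hx => //; exact: le_trans hr rr. Qed.

Lemma near_linear_ptP k e (q : 'rV[rat]_n) (r : R) x : 0 < r ->
  near_linear f k e (fun j => ratr (q ord0 j)) r x -> near_linear_pt k e x.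
Proof.
move=> r0 hx; exists (q, Num.bound r^-1) => //=; apply: near_linear_mono hx.
rewrite invf_ple ?posrE//; apply: ltW; apply: (lt_trans (archi_boundP _)); last by rewrite ltr_nat.
by rewrite invr_ge0 ltW.
Qed.

Lemma measurable_near_linear_pt k e : measurable (near_linear_pt k e).
Proof.
apply: countable_bigcupT_measurable => // q.
by apply: closed_measurable_row; exact: near_linear_closed.
Qed.

Lemma measurable_upd i x : measurable_fun setT (upd i x : measurableTypeR R -> Rn).
Proof.
apply: measurable_fun_row => j; case: (eqVneq j i) => ji.
  rewrite (_ : (fun t => _) = id); first exact: measurable_id.
  by apply/funext => t; rewrite mxE ji eqxx.
rewrite (_ : (fun t => _) = fun=> x ord0 j); first exact: measurable_cst.
by apply/funext => t; rewrite mxE (negPf ji).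
Qed.

(** The points near-linear in [k] directions are covered by countably many closed sets [Dq q]. On
    each line in the next direction, almost every point of the trace of [Dq q] is a density point of
    it and a point of differentiability of [f] along the line. There [near_linear_step] applies, and
    [lebesgue_row_lines] collects the lines. *)
Lemma near_linear_ae (k : nat) (e : R) : (k <= n)%N -> 0 < e ->
  leb (~` near_linear_pt k e) = 0%E.
Proof.
elim: k e => [|k ih] e kn e0.
  rewrite (_ : ~` _ = set0) ?measure0//; apply/seteqP; split => // x; apply.
  exists (0, 0%N) => // h hk _; have -> : h = 0 by apply/rowP => j; rewrite hk// mxE.
  rewrite addr0 subrr /lin_row big1 ?subrr ?normr0 ?mulr0// => j _.
  by rewrite !mxE mulr0.
(* The inductive step multiplies the tolerance by [2 * L + 4] and works with tolerances at most
   1. *)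
pose e' := Num.min 1 (e / (2 * L + 4)).
have L4 : 0 < 2 * L + 4 by rewrite ltr_wpDl// mulr_ge0.
have e'0 : 0 < e' by rewrite lt_min ltr01 divr_gt0.
have e'1 : e' <= 1 by rewrite ge_min lexx.
have e'e : (2 * L + 4) * e' <= e.
  by rewrite mulrC -ler_pdivlMr// ge_min lexx orbT.
pose i : 'I_n := Ordinal kn.
pose Dq (q : 'rV[rat]_n * nat) := near_linear f k e' (fun j => ratr (q.1 ord0 j)) q.2.+1%:R^-1.
have mDq q : measurable (Dq q) by apply: closed_measurable_row; exact: near_linear_closed.
have mB : measurable (~` near_linear_pt k.+1 e).
  by apply: measurableC; exact: measurable_near_linear_pt.
have null q : leb (~` near_linear_pt k.+1 e `&` Dq q) = 0%E.
  apply: (@lebesgue_row_lines _ _ i); first exact: measurableI.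
  move=> x; apply: measure_negligible.
    rewrite -[X in measurable X]setTI; apply: (measurable_upd i x) => //; exact: measurableI.
  set S := [set t | Dq q (upd i x t)].
  have mS : measurable S.
    by rewrite -[X in measurable X]setTI; exact: (measurable_upd i x).
  set A := (X in mu.-negligible X).
  suff : {ae mu, forall t, ~ A t} by apply: negligibleS => t At; apply.
  apply: (@filterS2 _ _ (ae_filter_ringOfSetsType mu) _ _ _ _ (derivable_line x i)
    (lebesgue_density mS)) => t dt ht [Bt Dt]; apply: Bt.
  have [b [r1 r10 hb]] := derivable_slope e'0 dt.
  have [r2 r20 hr] := density_point_approx mS e'0 e'1 Dt ht.
  have updD s : upd i x t + s *: delta_mx ord0 i = upd i x (t + s).
    apply/rowP => j; rewrite !mxE eqxx/=; case: (j == i); first by rewrite mulr1.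
    by rewrite mulr0 addr0.
  have [|||r' r'0] := @near_linear_step i (upd i x t) e' (ratr b) _ _ r1 r2 e'0 e'1 _ r10 r20 Dt.
  - by rewrite invr_gt0.
  - by move=> s sr; rewrite updD; exact: hb.
  - by move=> s s0 sr; have [s' hs' s's] := hr s s0 sr; exists s' => //; rewrite updD.
  rewrite (_ : (fun j => _) = (fun j => ratr ((\row_j (if j == i then b else q.1 ord0 j)) ord0 j))).
    move=> hx; apply: near_linear_ptP r'0 _ => h hk hr'.
    apply: le_trans (hx h hk hr') _; by rewrite ler_wpM2r.
  by apply/funext => j; rewrite mxE; case: eqP.
apply: measure_negligible => //.
pose F m := if unpickle m is Some q then ~` near_linear_pt k.+1 e `&` Dq q else set0.
apply: (@negligibleS _ _ _ _ ((~` near_linear_pt k e') `|` \bigcup_m F m)).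
  move=> x Bx; have [[q _ qx]|] := pselect (near_linear_pt k e' x); last by left.
  by right; exists (pickle q) => //; rewrite /F pickleK.
apply: negligibleU.
  apply/negligibleP; last by apply: ih => //; exact: ltnW.
  by apply: measurableC; exact: measurable_near_linear_pt.
apply: negligible_bigcup => m; rewrite /F; case: unpickle => [q|]; last exact: negligible_set0.
by apply/negligibleP; [exact: measurableI|exact: null].
Qed.

(** To each tolerance [1/(m+1)] belong slopes [a m]; comparing two of them along a coordinate vector
    shows that they form Cauchy sequences, and their limits serve for every tolerance. *)
Theorem rademacher : {ae leb, forall x, exists a : 'I_n -> R, forall e : R, 0 < e ->
  exists2 r : R, 0 < r & forall h, `|h| <= r -> `|f (x + h) - f x - lin_row a h| <= e * `|h|}.
Proof.
have : {ae leb, forall x, forall m : nat, near_linear_pt n m.+1%:R^-1 x}.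
  apply/ae_foralln => m; apply/negligibleP.
    by apply: measurableC; exact: measurable_near_linear_pt.
  by apply: near_linear_ae => //; rewrite invr_gt0.
apply: filterS => x hx.
have /choice[q hq] : forall m, exists q : 'rV[rat]_n * nat,
    near_linear f n m.+1%:R^-1 (fun j => ratr (q.1 ord0 j)) q.2.+1%:R^-1 x.
  by move=> m; have [q _ ?] := hx m; exists q.
pose a m j : R := ratr ((q m).1 ord0 j); pose r m : R := (q m).2.+1%:R^-1.
have hr m : 0 < r m by rewrite invr_gt0.
have ha m h : `|h| <= r m -> `|f (x + h) - f x - lin_row (a m) h| <= m.+1%:R^-1 * `|h|.
  by move=> hh; apply: hq => // j nj; have := ltn_ord j; rewrite ltnNge nj.
have caux m l j : `|a m j - a l j| <= m.+1%:R^-1 + l.+1%:R^-1.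
  pose rho := Num.min (r m) (r l); have rho0 : 0 < rho by rewrite lt_min !hr.
  pose h : Rn := rho *: delta_mx ord0 j.
  have nh : `|h| = rho.
    apply/eqP; rewrite eq_le; apply/andP; split.
      apply: row_norm_le => [|i]; first exact: ltW.
      by rewrite !mxE eqxx/=; case: (i == j); rewrite ?mulr1 ?mulr0 ?normr0 ?gtr0_norm// ltW.
    by have := row_norm_coord h j; rewrite !mxE !eqxx mulr1 gtr0_norm.
  have lh (b : 'I_n -> R) : lin_row b h = b j * rho.
    rewrite /lin_row (bigD1 j)//= big1 ?addr0 => [|i ij]; first by rewrite !mxE !eqxx mulr1.
    by rewrite !mxE (negPf ij) andbF !mulr0.
  have h1 := ha m h; have h2 := ha l h; rewrite !nh !lh in h1 h2.
  have {}h1 := h1 ltac:(by rewrite ge_min lexx); have {}h2 := h2 ltac:(by rewrite ge_min lexx orbT).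
  rewrite -(ler_pM2r rho0) -[X in _ * X <= _]gtr0_norm// -normrM.
  rewrite (_ : _ * rho = (f (x + h) - f x - a l j * rho) - (f (x + h) - f x - a m j * rho)).
    by apply: le_trans (ler_normB _ _) _; rewrite mulrDl addrC lerD.
  by ring.
have harm : (fun m : nat => m.+1%:R^-1 : R) @ \oo --> (0 : R) by exact: cvg_harmonic.
have cv j : cvgn (fun m => a m j).
  apply/cauchy_cvgP; apply/cauchy_ballP => _/posnumP[e]; near_simpl.
  have e2 : 0 < e%:num / 2 :> R by [].
  have /cvgrPdist_lt/(_ _ e2)[N _ hN] := harm.
  exists ([set m | (N <= m)%N], [set m | (N <= m)%N]); first by split; exists N.
  move=> [m l] /= [Nm Nl]; rewrite -ball_normE/=; apply: le_lt_trans (caux m l j) _.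
  have := hN m Nm; have := hN l Nl; rewrite /= !sub0r !normrN !ger0_norm ?invr_ge0// => h1 h2.
  by rewrite [ltRHS]splitr ltrD.
pose A j := limn (fun m => a m j).
have hA m j : `|a m j - A j| <= m.+1%:R^-1.
  have h1 : (fun l => `|a m j - a l j|) @ \oo --> `|a m j - A j|.
    by apply: cvg_norm; apply: cvgB; [exact: cvg_cst|exact: cv].
  have h2 : (fun l : nat => m.+1%:R^-1 + l.+1%:R^-1 : R) @ \oo --> (m.+1%:R^-1 : R).
    by rewrite -[X in _ --> X]addr0; apply: cvgD => //; exact: cvg_cst.
  by apply: ler_cvg_to h1 h2 _; apply: nearW => l; exact: caux.
exists A => e e0.
have n10 : 0 < n.+1%:R :> R by [].
(* Passing from [a N] to the limit costs [1/(N+1)] for each of the [n] coordinates, on top of the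
   error of [a N] itself; hence [e / (n+1)]. *)
have /cvgrPdist_lt/(_ _ (divr_gt0 e0 n10))[N _ hN] := harm.
have := hN N (leqnn N); rewrite /= sub0r normrN ger0_norm ?invr_ge0// => eN.
exists (r N) => // h hh; have h1 := ha N h hh.
have h2 : `|lin_row (a N) h - lin_row A h| <= n%:R * (N.+1%:R^-1 * `|h|).
  rewrite /lin_row -sumrB; apply: le_trans (ler_norm_sum _ _ _) _.
  apply: (@le_trans _ _ (\sum_(j < n) (N.+1%:R^-1 * `|h|))).
    apply: ler_sum => j _; rewrite -mulrBl normrM ler_pM//; exact: row_norm_coord.
  by rewrite sumr_const card_ord [leRHS]mulr_natl.
rewrite -(subrKA (lin_row (a N) h)); apply: le_trans (ler_normD _ _) _.
apply: le_trans (lerD h1 h2) _; rewrite -{1}[_ * `|h|]mul1r -mulrDl addrC natr1 mulrA.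
by rewrite ler_wpM2r// mulrC -ler_pdivlMr// ltW.
Qed.

End rademacher.

Section gradient.
Context {R : realType} {n : nat}.
Local Notation Rn := 'rV[R]_n.
Local Notation leb := (lebesgue_row R n).

Definition grad (g : Rn -> R) (x : Rn) (a : 'I_n -> R) : Prop := forall e : R, 0 < e ->
  exists2 r : R, 0 < r & forall h, `|h| <= r -> `|g (x + h) - g x - lin_row a h| <= e * `|h|.

Lemma ae_forall_ord d (T : measurableType d) (mu : {measure set T -> \bar R}) m
  (P : 'I_m -> T -> Prop) : (forall i, {ae mu, forall x, P i x}) -> {ae mu, forall x i, P i x}.
Proof.
move=> h; have : {ae mu, forall x, forall k : nat, forall i : 'I_m, i = k :> nat -> P i x}.
  apply/ae_foralln => k; have [km|mk] := ltnP k m; last first.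
    by apply: aeW => x i ik; have := ltn_ord i; rewrite ik ltnNge mk.
  apply: filterS (h (Ordinal km)) => x hx i ik.
  by rewrite (_ : i = Ordinal km)//; exact: val_inj.
by apply: filterS => x hx i; exact: hx.
Qed.

Lemma norm_delta j (t : R) : `|t *: delta_mx ord0 j : Rn| <= `|t|.
Proof.
apply: row_norm_le => // i; rewrite !mxE eqxx/=.
by case: (i == j); rewrite ?mulr1 ?mulr0 ?normr0.
Qed.

Lemma rademacher_grad (g : Rn -> R) : is_lip g -> {ae leb, forall x, exists a, grad g x a}.
Proof.
move=> /is_lipP[L L0 hL]; apply: (rademacher L0) => x y.
by rewrite [leRHS](_ : _ = L * mdist x y)//; rewrite mdist_rowE distrC.
Qed.

Lemma grad_near (g g' : Rn -> R) x a (r0 : R) : 0 < r0 ->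
  (forall y, `|y - x| <= r0 -> g y = g' y) -> grad g x a -> grad g' x a.
Proof.
move=> r00 gg h e e0; have [r r1 hr] := h e e0.
exists (Num.min r r0) => [|y]; first by rewrite lt_min r1.
rewrite le_min => /andP[yr yr0]; rewrite -!gg ?subrr ?normr0 ?(ltW r00)//; first exact: hr.
by rewrite [x + y]addrC addrK.
Qed.

Lemma grad_quotient (g : Rn -> R) x a j : grad g x a ->
  (fun k => 2 ^+ k * (g (x + mesh k *: delta_mx ord0 j) - g x)) @ \oo --> a j.
Proof.
move=> ga; apply/cvgrPdist_le => e e0; have [r r0 hr] := ga e e0.
have /cvgrPdist_le /(_ _ r0)[N _ hN] := @mesh_cvg0 R.
exists N => // k /= Nk; have := hN k Nk; rewrite sub0r normrN gtr0_norm ?mesh_gt0// => kr.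
pose h : Rn := mesh k *: delta_mx ord0 j.
have nh : `|h| <= mesh k.
  by apply: le_trans (norm_delta _ _) _; rewrite gtr0_norm ?mesh_gt0.
have lh : lin_row a h = a j * mesh k.
  rewrite /lin_row (bigD1 j)//= big1 ?addr0 => [|i ij]; first by rewrite !mxE !eqxx mulr1.
  by rewrite !mxE (negPf ij) andbF !mulr0.
have H := hr h (le_trans nh kr); rewrite lh in H; rewrite distrC.
have -> : 2 ^+ k * (g (x + mesh k *: delta_mx ord0 j) - g x) - a j =
    2 ^+ k * (g (x + h) - g x - a j * mesh k).
  by rewrite [in RHS]mulrBr [2 ^+ k * (a j * _)]mulrCA meshK mulr1.
rewrite normrM gtr0_norm ?pow2_gt0// -ler_pdivlMl ?pow2_gt0//.
by apply: le_trans H _; rewrite mulrC ler_wpM2r// ltW.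
Qed.

(** Measurability comes from difference quotients with steps [mesh k]; on a null set [B] containing
    all exceptional points the gradient is set to 0, so that the limit exists everywhere. *)
Lemma lipschitz_gradient (g : Rn -> R) (L : R) : 0 <= L ->
  (forall x y, `|g x - g y| <= L * `|x - y|) -> exists D : 'I_n -> Rn -> R,
  [/\ forall j, measurable_fun setT (D j), forall j x, `|D j x| <= L &
    {ae leb, forall x, grad g x (D ^~ x)}].
Proof.
move=> L0 hL; have gl : is_lip g.
  by apply: (is_lip_lipc L0) => x y; rewrite mdist_rowE distrC.
have [B [mB B0 hB]] := rademacher_grad gl.
have /choice[A hA] : forall x, exists a, ~ B x -> grad g x a.
  move=> x; have [Bx|nBx] := pselect (B x); first by exists (fun=> 0).
  suff [a ha] : exists a, grad g x a by exists a.
  by apply: contrapT => h; apply: nBx; exact: hB.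
pose q k j x : R := 2 ^+ k * (g (x + mesh k *: delta_mx ord0 j) - g x).
pose D j x : R := A x j * \1_(~` B) x.
have cD j x : (fun k => q k j x * \1_(~` B) x) @ \oo --> D j x.
  have [Bx|nBx] := pselect (B x).
    rewrite /D indicE memNset /=; last by apply.
    by rewrite mulr0; under eq_fun do rewrite mulr0; exact: cvg_cst.
  by apply: cvgMr_tmp; exact: grad_quotient (hA x nBx).
have qL k j x : `|q k j x * \1_(~` B) x| <= L.
  have i1 : `|\1_(~` B) x| <= 1 :> R by rewrite indicE; case: (x \in ~` B); rewrite ?normr1 ?normr0.
  rewrite normrM -[leRHS]mulr1 ler_pM// /q normrM gtr0_norm ?pow2_gt0//.
  rewrite -ler_pdivlMl ?pow2_gt0//; apply: le_trans (hL _ _) _.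
  rewrite [x + _]addrC addrK [leRHS]mulrC ler_wpM2l//.
  by apply: le_trans (norm_delta _ _) _; rewrite gtr0_norm ?mesh_gt0.
exists D; split.
- move=> j; apply: (@measurable_fun_cvg _ _ _ _ (fun k x => q k j x * \1_(~` B) x)) => // k.
  apply: measurable_funM; last by apply: measurable_indic; exact: measurableC.
  apply: is_lip_measurable; apply: is_lipZ; apply: is_lipB => //.
  apply: (is_lip_lipc L0) => x y; rewrite mdist_rowE distrC.
  by apply: le_trans (hL _ _) _; rewrite opprD addrACA subrr addr0 distrC.
- by move=> j x; apply: cvg_le_cst (cvg_norm (cD j x)) _ => k; exact: qL.
- exists B; split => // x; apply: contra_notP => nBx.
  rewrite /= (_ : (fun j => D j x) = A x); first exact: hA.
  by apply/funext => j; rewrite /D indicE mem_set ?mulr1.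
Qed.

Lemma cvg_det (m : nat) (A : nat -> 'I_m -> 'I_m -> R) (B : 'I_m -> 'I_m -> R) :
  (forall i j, A ^~ i ^~ j @ \oo --> B i j) ->
  (fun k => \det (\matrix_(i, j) A k i j)) @ \oo --> \det (\matrix_(i, j) B i j).
Proof.
move=> h; rewrite /determinant; apply: cvg_big => [|s _]; first exact: add_continuous.
apply: cvgMl_tmp; apply: cvg_big => [|i _]; first exact: mul_continuous.
by under eq_fun do rewrite mxE; rewrite mxE; exact: h.
Qed.

Lemma det_bound (m : nat) (A : 'I_m -> 'I_m -> R) (c : R) : 0 <= c -> (forall i j, `|A i j| <= c) ->
  `|\det (\matrix_(i, j) A i j)| <= #|'S_m|%:R * c ^+ m.
Proof.
move=> c0 h; apply: le_trans (ler_norm_sum _ _ _) _.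
apply: (@le_trans _ _ (\sum_(s : 'S_m) c ^+ m)); last by rewrite sumr_const [leRHS]mulr_natl.
apply: ler_sum => s _; rewrite normrM normrX normrN1 expr1n mul1r normr_prod.
rewrite -[m in leRHS]card_ord -prodr_const; apply: ler_prod => i _.
by rewrite normr_ge0 mxE h.
Qed.

Lemma measurable_det d (T : measurableType d) (m : nat) (A : 'I_m -> 'I_m -> T -> R) :
  (forall i j, measurable_fun setT (A i j)) ->
  measurable_fun setT (fun x => \det (\matrix_(i, j) A i j x)).
Proof.
move=> h; rewrite /determinant; apply: measurable_sum => s.
apply: measurable_funM; first exact: measurable_cst.
apply: measurable_prod => i _; under eq_fun do rewrite mxE; exact: h.
Qed.

Lemma jacobian_grad (g : 'I_n -> Rn -> R) x (a : 'I_n -> 'I_n -> R) :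
  (forall i, grad (g i) x (a i)) ->
  \det (jacobian (fun y : Rn => \row_(i < n) g i y) x) = \det (\matrix_(i, j) a i j).
Proof.
move=> ha; pose A : 'M[R]_n := \matrix_(j, i) a i j.
pose G (y : Rn) : Rn := \row_i g i y.
suff -> : jacobian G x = A.
  rewrite -det_tr; congr (\det _); apply/matrixP => i j; by rewrite !mxE.
suff e : 'd G x = mulmxr A :> (Rn -> Rn).
  apply/matrixP => j i; rewrite /jacobian mxE e.
  by rewrite /= -rowE !mxE.
apply: diff_unique.
  move=> y; pose S := \sum_j \sum_i `|A j i|.
  have S0 : 0 <= S by apply: sumr_ge0 => j _; apply: sumr_ge0.
  have hS z : `|y *m A - z *m A| <= S * `|y - z|.
    rewrite -mulmxBl; apply: row_norm_le => [|i]; first exact: mulr_ge0.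
    rewrite mxE; apply: le_trans (ler_norm_sum _ _ _) _; rewrite mulr_suml; apply: ler_sum => j _.
    rewrite normrM mulrC ler_pM ?row_norm_coord// (bigD1 i)//= lerDl; exact: sumr_ge0.
  move=> P /nbhs_ballP[e /= e0 hP]; apply/nbhs_ballP.
  have S1 : 0 < S + 1 by rewrite ltr_wpDl.
  exists (e / (S + 1)) => [|z]; first by rewrite /= divr_gt0.
  rewrite -ball_normE/= => yz; apply: hP; rewrite -ball_normE/=; apply: le_lt_trans (hS z) _.
  apply: (@le_lt_trans _ _ ((S + 1) * `|y - z|)); first by rewrite ler_wpM2r// lerDl.
  by rewrite mulrC -ltr_pdivlMr.
apply/eqaddoP => e e0.
have /choice[r hr] : forall i, exists r, 0 < r /\
    forall h, `|h| <= r -> `|g i (x + h) - g i x - lin_row (a i) h| <= e * `|h|.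
  by move=> i; have [r r0 hr] := ha i e e0; exists r.
(* [s^-1] is a radius below all the [r i]; the summand 1 keeps it meaningful for an empty sum. *)
pose s := 1 + \sum_i (r i)^-1.
have s0 : 0 < s by rewrite ltr_pwDl// sumr_ge0// => i _; rewrite invr_ge0 ltW//; case: (hr i).
have sr i : s^-1 <= r i.
  have [ri _] := hr i; rewrite invf_ple ?posrE// /s (bigD1 i)//= addrCA lerDl addr_ge0//.
  by apply: sumr_ge0 => j _; rewrite invr_ge0 ltW//; case: (hr j).
apply/nbhs_ballP; exists s^-1 => [|h]; first by rewrite /= invr_gt0.
rewrite -ball_normE/= sub0r normrN => hs.
apply: row_norm_le => [|i]; first by rewrite mulr_ge0// ltW.
have := (hr i).2 h (le_trans (ltW hs) (sr i)); congr (`|_| <= _).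
rewrite -[RHS]/((G (h + x) - (G x + h *m A)) ord0 i) [h + x]addrC.
have -> : lin_row (a i) h = (h *m A) ord0 i.
  by rewrite mxE; apply: eq_bigr => j _; rewrite mxE mulrC.
by rewrite /G !mxE; ring.
Qed.

(** Gradients are asked for only where [u] is nonzero, so the slots may be altered away from
    there. *)
Lemma current_of_grad (u f : Rn -> R) (g : 'I_n -> Rn -> R) (a : 'I_n -> 'I_n -> Rn -> R) :
  {ae leb, forall x, u x != 0 -> forall i, grad (g i) x (fun j => a i j x)} ->
  current_of u f g = \int[leb]_x (u x * f x * \det (\matrix_(i, j) a i j x)).
Proof.
move=> h; apply: Int_ae_eq; apply: filterS h => x hx.
have [->|u0] := eqVneq (u x) 0; first by rewrite !mul0r.
by rewrite (jacobian_grad (hx u0)).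
Qed.

Lemma lipschitz_jacobian (g : 'I_n -> Rn -> R) : (forall i, is_lip (g i)) ->
  exists (L : R) (D : 'I_n -> 'I_n -> Rn -> R), [/\ 0 <= L,
    forall i j, measurable_fun setT (D i j), forall i j x, `|D i j x| <= L &
    {ae leb, forall x i, grad (g i) x (fun j => D i j x)}].
Proof.
move=> hg; have /choice[L hL] : forall i, exists L, 0 <= L /\ lipc L (g i).
  by move=> i; have /is_lipP[L ? ?] := hg i; exists L.
pose M := \sum_i L i; have M0 : 0 <= M by apply: sumr_ge0 => i _; case: (hL i).
have hM i x y : `|g i x - g i y| <= M * `|x - y|.
  apply: le_trans ((hL i).2 x y) _; rewrite mdist_rowE distrC ler_wpM2r//.
  by rewrite /M (bigD1 i)//= lerDl sumr_ge0// => j _; case: (hL j).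
have /choice[D hD] := fun i => lipschitz_gradient M0 (hM i).
exists M, D; split => //.
- by move=> i; case: (hD i).
- by move=> i; case: (hD i).
by apply: ae_forall_ord => i; case: (hD i).
Qed.

End gradient.

Lemma Int_cvg d (T : measurableType d) (R : realType) (mu : {measure set T -> \bar R})
    (f_ : nat -> T -> R) (f : T -> R) : (forall k, intg mu (f_ k)) -> intg mu f ->
  (fun k => \int[mu]_x `|f_ k x - f x|) @ \oo --> (0 : R) ->
  (fun k => \int[mu]_x f_ k x) @ \oo --> \int[mu]_x f x.
Proof.
move=> h_ h /cvgrPdist_le H; apply/cvgrPdist_le => e /H; apply: filterS => k.
rewrite sub0r normrN => hk; rewrite distrC -IntB//; apply: le_trans (Int_abs _) _.
  exact: intgB.
by apply: le_trans hk; exact: ler_norm.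
Qed.

(** * Pushforwards of normal currents are densities *)

Section quasi_interpolation.
Context {R : realType} {n : nat}.
Local Notation Rn := 'rV[R]_n.

Lemma C11_mean_value (F : Rn -> R) D (y z : Rn) : C11 F D ->
  exists c, F y - F z = \sum_j D j c * (y ord0 j - z ord0 j).
Proof.
move=> [L [L0 h1 h2 h3 h4]]; pose p t : Rn := z + t *: (y - z).
have pd s t : p s - p t = (s - t) *: (y - z) by rewrite opprD addrACA subrr add0r -scalerBl.
pose dp t := \sum_j D j (p t) * (y ord0 j - z ord0 j).
have hp t : is_derive t (1 : R) (F \o p) (dp t).
  apply: (@is_derive_quadratic _ _ _ _ (L * `|y - z| ^+ 2)) => [|s _].
    by rewrite mulr_ge0// exprn_ge0.
  have := h4 (p s) (p t); rewrite pd normrZ exprMn => h.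
  rewrite [leRHS](_ : _ = L * (`|s - t| ^+ 2 * `|y - z| ^+ 2)); last by ring.
  apply: le_trans h; rewrite le_eqVlt; apply/orP; left; apply/eqP.
  congr (`|_ - _|); rewrite /dp mulr_suml; apply: eq_bigr => j _.
  by rewrite -mulrA; congr (_ * _); rewrite !mxE; ring.
have [c _] := mean_value 1 0 hp; rewrite subr0 mulr1 /= /p scale1r scale0r addr0.
by rewrite [z + _]addrC subrK => ->; exists (p c).
Qed.

Variables (N : nat) (G : Rn -> R) (a : R).
Hypothesis a0 : 0 <= a.
Hypothesis Ga : forall y z, `|G y - G z| <= a * `|y - z|.
Hypothesis G0 : forall y, N%:R < `|y| + 6 -> G y = 0.

Lemma mesh_le1 k : mesh k <= 1 :> R.
Proof. by rewrite invf_le1 ?exprn_gt0// exprn_ege1// ler1n. Qed.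

(** A spline reaching [y] has its node within [3 * mesh k <= 3]; the margin 6 imposed on [G] covers
    this and the margin 2 of the box. *)
Let node_off k (p : @grid n k N) (y : Rn) : N%:R < `|y| + 2 -> `|y - node p| <= 3 * mesh k ->
  G (node p) = 0.
Proof.
move=> hy hp; apply: G0; have := mesh_le1 k; have := lerB_dist y (node p); lra.
Qed.

Lemma interp_cutoff k y : `|interp k N G y - G y| <= a * (3 * mesh k).
Proof.
have [hy|hy] := leP (`|y| + 2) N%:R; first exact: interp_approx.
rewrite (G0 (y := y)); last by lra.
rewrite subr0 /interp big1 ?normr0 ?mulr_ge0 ?(ltW (mesh_gt0 _))// => p _.
have [->|/bspline_supp h] := eqVneq (bspline p y) 0; first by rewrite mulr0.
by rewrite (node_off hy h) mul0r.
Qed.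

(** Affine functions keep their gradient, so only the remainder of [G] at [x] is seen by the
    splines. The constant 6 is the radius factor 3 times the factor 2 of [sum_abs_dbspline]; the
    powers of 2 cancel against the mesh. *)
Lemma dinterp_error k j (x : Rn) (b : R) (l : 'I_n -> R) : `|x| + 2 <= N%:R ->
  (forall y, `|y - x| <= 3 * mesh k -> `|G y - G x - lin_row l (y - x)| <= b * `|y - x|) ->
  0 <= b -> `|dinterp k N G j x - l j| <= 6 * b.
Proof.
move=> hx hl b0; have m0 := @mesh_gt0 R k.
have e : dinterp k N G j x - l j =
    \sum_(p : grid k N) (G (node p) - G x - lin_row l (node p - x)) * dbspline p j x.
  transitivity (dinterp k N G j x - G x * (\sum_(p : grid k N) dbspline p j x) -
     \sum_i l i * (\sum_(p : grid k N) node p ord0 i * dbspline p j x -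
       x ord0 i * \sum_(p : grid k N) dbspline p j x)).
    rewrite sum_dbspline// mulr0 subr0; congr (_ - _).
    rewrite (eq_bigr (fun i => l i * (j == i)%:R)) => [|i _]; last first.
      by rewrite sum_node_dbspline// mulr0 subr0.
    rewrite (bigD1 j)//= eqxx mulr1 big1 ?addr0// => i ij.
    by rewrite eq_sym (negPf ij) mulr0.
  rewrite /dinterp mulr_sumr -sumrB.
  rewrite [X in _ - X](eq_bigr (fun i => \sum_(p : grid k N) l i * (node p ord0 i - x ord0 i) * dbspline p j x)).
    rewrite exchange_big -sumrB; apply: eq_bigr => p _.
    rewrite !mulrBl /lin_row mulr_suml; congr (_ - _); apply: eq_bigr => i _.
    by rewrite !mxE.
  move=> i _; rewrite mulr_sumr -sumrB mulr_sumr; apply: eq_bigr => p _; ring.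
rewrite e; apply: le_trans (ler_norm_sum _ _ _) _.
apply: (@le_trans _ _ (\sum_(p : grid k N) b * (3 * mesh k) * `|dbspline p j x|)).
  apply: ler_sum => p _; rewrite normrM.
  have [->|/dbspline_supp h] := eqVneq (dbspline p j x) 0; first by rewrite normr0 !mulr0.
  rewrite distrC in h; rewrite ler_wpM2r//; apply: le_trans (hl _ h) _.
  by rewrite ler_wpM2l.
rewrite -mulr_sumr; apply: (@le_trans _ _ (b * (3 * mesh k) * (2 * 2 ^+ k))).
  by rewrite ler_wpM2l ?sum_abs_dbspline// !mulr_ge0// ltW.
rewrite [leLHS](_ : _ = 6 * b * (2 ^+ k * mesh k)); last by ring.
by rewrite meshK mulr1.
Qed.

(** Inside the box this is [dinterp_error] with zero slopes. It makes the Lipschitz constants of the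
    quasi-interpolants uniform in [k]. *)
Lemma dinterp_bounded k j (x : Rn) : `|dinterp k N G j x| <= 6 * a.
Proof.
have [hx|hx] := leP (`|x| + 2) N%:R.
  rewrite -(subr0 (dinterp _ _ _ _ _)).
  apply: (@dinterp_error _ j x a (fun=> 0)) => // y _.
  rewrite /lin_row big1 ?subr0; first exact: Ga.
  by move=> i _; rewrite mul0r.
rewrite /dinterp big1 ?normr0 ?mulr_ge0// => p _.
have [->|/dbspline_supp h] := eqVneq (dbspline p j x) 0; first by rewrite mulr0.
by rewrite (node_off hx h) mul0r.
Qed.

Lemma dinterp_cvg j (x : Rn) (l : 'I_n -> R) : `|x| + 2 <= N%:R -> grad G x l ->
  (fun k => dinterp k N G j x) @ \oo --> l j.
Proof.
move=> hx hl; apply/cvgrPdist_le => e e0; have e6 : 0 < e / 6 by rewrite divr_gt0.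
have [r r0 hr] := hl _ e6; have r3 : 0 < r / 3 by rewrite divr_gt0.
have /cvgrPdist_le /(_ _ r3)[K _ hK] := @mesh_cvg0 R.
exists K => // k /= Kk; have := hK k Kk; rewrite sub0r normrN gtr0_norm ?mesh_gt0// => kr.
rewrite distrC; apply: le_trans (@dinterp_error k j x (e / 6) l hx _ _) _.
- move=> y yx; have := hr (y - x); rewrite [x + _]addrC subrK; apply.
  by apply: le_trans yx _; lra.
- exact: ltW.
- by rewrite mulrC divfK.
Qed.

Lemma interp_cutoff_lip k y z : `|interp k N G y - interp k N G z| <= n%:R * (6 * a) * `|y - z|.
Proof.
have [c ->] := C11_mean_value y z (interp_C11 k N G).
apply: le_trans (ler_norm_sum _ _ _) _.
apply: (@le_trans _ _ (\sum_(j < n) 6 * a * `|y - z|)).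
  by apply: ler_sum => j _; rewrite normrM ler_pM ?dinterp_bounded// coord_sub_le.
by rewrite sumr_const card_ord -[leLHS]mulr_natl mulrA.
Qed.

End quasi_interpolation.

Section cutoff.
Context {R : realType} {n : nat}.
Local Notation Rn := 'rV[R]_n.

Lemma lip_cutoff (g : Rn -> R) (r : R) : 0 <= r -> is_lip g -> exists g' : Rn -> R,
  [/\ is_lip g', exists b, bounded_by b g', forall y, `|y| <= r -> g' y = g y &
      forall y, r + 1 <= `|y| -> g' y = 0].
Proof.
move=> r0 hg; have /is_lipP[a a0 ha] := hg.
pose b := `|g 0| + a * (r + 1).
have b0 : 0 <= b by rewrite addr_ge0// mulr_ge0// addr_ge0.
pose chi (y : Rn) : R := clamp 0 1 (r + 1 - `|y|).
have chi1 : bounded_by 1 chi.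
  by move=> y; have /andP[h1 h2] := @clamp_itv R 0 1 (r + 1 - `|y|) ler01; rewrite ger0_norm.
have hchi : is_lip chi.
  apply: is_lip_clamp; apply: is_lipB; first exact: is_lip_cst.
  apply: (@is_lip_lipc _ _ 1) => // x y; rewrite mul1r mdist_rowE distrC; exact: ler_dist_dist.
pose h y := clamp (- b) b (g y).
have hb : bounded_by b h by move=> y; rewrite ler_norml clamp_itv//; lra.
have hh : is_lip h by exact: is_lip_clamp.
exists (fun y => chi y * h y); split.
- exact: is_lipM chi1 hb hchi hh.
- by exists (1 * b) => y; rewrite normrM ler_pM.
- move=> y yr; have -> : chi y = 1.
    rewrite /chi /clamp; have -> : Num.min 1 (r + 1 - `|y|) = 1 by apply/min_idPl; lra.
    exact/max_idPr.
  rewrite mul1r /h clamp_id// -ler_norml -(subrK (g 0) (g y)) /b addrC.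
  apply: le_trans (ler_normD _ _) _; rewrite lerD2l; apply: le_trans (ha _ _) _.
  by rewrite mdist_rowE sub0r normrN ler_wpM2l//; lra.
- move=> y yr; have -> : chi y = 0; last by rewrite mul0r.
  by apply/max_idPl; rewrite ge_min; apply/orP; right; lra.
Qed.

End cutoff.

Section representation.
Context {R : realType}.
Variables (X : metricType R) (n : nat) (T : functional X n.+1) (M B : R) (K : set X).
Hypothesis hT : is_current T.
Hypothesis hM : (mass T <= M%:E)%E.
Hypothesis hB : (mass (boundary T) <= B%:E)%E.
Hypothesis hK : vanishes_off T K.
Variable phi : X -> 'rV[R]_n.+1.
Variable c : 'I_n.+1 -> R.
Hypothesis c0 : forall i, 0 <= c i.
Hypothesis phi_lip : forall i, lipc (c i) (coords phi i).
Variable N0 : nat.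
Hypothesis KN0 : forall x, K x -> `|phi x| + 2 < N0%:R.
Local Notation Rn := 'rV[R]_n.+1.
Local Notation leb := (lebesgue_row R n.+1).

Lemma norm_map_continuous : continuous (fun x => `|phi x|).
Proof.
have [L L0 hL] := coords_lip c0 phi_lip; apply: (@lipc_continuous _ _ L) => x y.
exact: le_trans (ler_dist_dist _ _) (hL x y).
Qed.

Lemma open_map_lt (r : R) : open [set x | `|phi x| < r].
Proof.
apply: (@open_comp _ _ (fun x => `|phi x|) [set y | y < r]); last exact: open_lt.
by move=> x _; exact: norm_map_continuous.
Qed.

Lemma closed_map_le (r : R) : closed [set x | `|phi x| <= r].
Proof.
apply: (@closed_comp _ _ (fun x => `|phi x|) [set y | y <= r]); last exact: closed_le.
by move=> x _; exact: norm_map_continuous.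
Qed.

Let U := [set x | `|phi x| < N0%:R].
Let KU : K `<=` U.
Proof. by move=> x /KN0; rewrite /U/=; lra. Qed.

Let clip := comp_is_lip c0 phi_lip.

(** An instance of [density]: [grad_boundary] turns values at [D i] into values of the boundary at
    [F], which gives the required bound by the sup norm of [F]. *)
Lemma push_density : exists u : Rn -> R, [/\ intg leb u,
  forall x, (N0 + 2)%:R < `|x| -> u x = 0,
  forall f, is_lip f -> intg leb (fun x => u x * f x) &
  forall f, is_lip f -> T (f \o phi) (coords phi) = \int[leb]_x (u x * f x)].
Proof.
have B0 : 0 <= B.
  have h1 (i : 'I_n) : lipc 1 (fun _ : X => 0 : R).
    by apply: lipc_le (lipc_cst _); exact: ler01.
  have := mass_bound1 (boundary_mlin hT) hB (g := fun _ _ => 0) (c := fun=> 1)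
    ler01 (fun=> ler01) (is_lip_cst X 0) h1.
  by rewrite big1// !mulr1 => h; apply: le_trans (h _) => // x; rewrite normr0.
apply: (@density _ _ (fun f => T (f \o phi) (coords phi)) N0 (M * \prod_i c i)
  (B * \sum_i \prod_(j | j != i) c j)).
- move=> a f g hf hg; apply: (current_linear hT); [exact: clip|exact: clip|].
  exact: coords_is_lip phi_lip.
- by rewrite mulr_ge0// sumr_ge0// => i _; exact: prodr_ge0.
- move=> b f hf fb; have b0 : 0 <= b.
    by apply: le_trans (fb 0 _) => //; rewrite normr0.
  rewrite mulrAC; apply: (current_bound_near hT hM hK (open_map_lt N0%:R) KU) => //.
    exact: clip.
  by move=> x Ux; apply: fb; exact: ltW.
- move=> F D b i hF Fb; rewrite (grad_boundary hT hM c0 phi_lip i hF) normrM normrX normrN1 expr1n mul1r.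
  have b0 : 0 <= b by apply: le_trans (Fb 0).
  apply: le_trans (mass_bound1 (boundary_mlin hT) hB (c := fun l => c (lift i l)) b0 _ _ _ _) _ => //.
  - by apply: clip; exact: C11_is_lip hF.
  - by move=> x; exact: Fb.
  - rewrite -prod_lift mulrAC ler_wpM2r// ler_wpM2l//.
    by rewrite [leRHS](bigD1 i)//= lerDl sumr_ge0// => l _; exact: prodr_ge0.
Qed.

(** The slots are replaced by quasi-interpolants, for which [det_chain] reduces the value to
    coordinate slots and thus to [u]. On the side of the current they converge uniformly with
    bounded Lipschitz constants; on the side of the integral their gradients converge boundedly,
    almost everywhere by Rademacher's theorem, so dominated convergence applies. *)
Lemma push_representation (u : Rn -> R) : intg leb u ->
  (forall x, (N0 + 2)%:R < `|x| -> u x = 0) ->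
  (forall f, is_lip f -> T (f \o phi) (coords phi) = \int[leb]_x (u x * f x)) ->
  eq_current (pushforward_current phi T) (current_of u).
Proof.
move=> iu u0 hu f g hf hg; rewrite /pushforward_current.
(* Nested radii: [u] lives up to [N0 + 2] and [f'] up to [N0 + 3]; [G i] agrees with [g i] up to
   [N0 + 5] and vanishes from [N0 + 6] on; the grid box [N0 + 12] adds the margin 6. *)
have r0 : 0 <= (N0 + 2)%:R :> R by [].
have [f' [hf' [b fb] ff' f'0]] := lip_cutoff r0 hf.
have r5 : 0 <= (N0 + 5)%:R :> R by [].
have /choice[G hG] := fun i => lip_cutoff r5 (hg i).
have Gl i : is_lip (G i) by case: (hG i).
have Gg i y : `|y| <= (N0 + 5)%:R -> G i y = g i y by case: (hG i) => _ _ + _; exact.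
have G0 i y : (N0 + 12)%:R < `|y| + 6 -> G i y = 0.
  by case: (hG i) => _ _ _ h hy; apply: h; move: hy; rewrite !natrD; lra.
have -> : T (f \o phi) (fun i => g i \o phi) = T (f' \o phi) (fun i => g i \o phi).
  apply: (current_eq_near hT hK (open_map_lt N0%:R) KU); [exact: clip|exact: clip| |].
    by move=> i; exact: clip.
  by move=> x Ux; rewrite /= ff'//; move: Ux; rewrite /= natrD; lra.
have -> : T (f' \o phi) (fun i => g i \o phi) = T (f' \o phi) (fun i => G i \o phi).
  apply: (current_slots_eq hT (open_map_lt (N0 + 4)%:R)); [|exact: clip| | |].
  - apply: (@subset_trans _ [set x | `|phi x| <= (N0 + 3)%:R]).
      have cl := @closed_map_le (N0 + 3)%:R.
      rewrite [X in _ `<=` X](closure_id _).1//; apply: closure_subset.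
      move=> x /= fx; rewrite leNgt; apply/negP => h; move: fx; rewrite f'0 ?eqxx//.
      by move: h; rewrite !natrD; lra.
    by move=> x /=; rewrite !natrD; lra.
  - by move=> i; exact: clip.
  - by move=> i; exact: clip.
  - by move=> i x /=; rewrite !natrD => h; rewrite /= Gg// natrD; lra.
have [a [D [a0 mD Da gD]]] := lipschitz_jacobian Gl.
pose N := (N0 + 12)%N.
have /choice[l hl] : forall i, exists l, 0 <= l /\ forall y z, `|G i y - G i z| <= l * `|y - z|.
  move=> i; have /is_lipP[l l0 hl] := Gl i; exists l; split => // y z.
  by apply: le_trans (hl y z) _; rewrite mdist_rowE distrC.
pose lM := \sum_i l i; have lM0 : 0 <= lM by apply: sumr_ge0 => i _; case: (hl i).
have GM i y z : `|G i y - G i z| <= lM * `|y - z|.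
  apply: le_trans ((hl i).2 y z) _; rewrite ler_wpM2r// /lM (bigD1 i)//= lerDl.
  by apply: sumr_ge0 => j _; case: (hl j).
pose F k i := interp k N (G i).
pose Jk k x : R := \det (\matrix_(i, j) dinterp k N (G i) j x).
pose J x : R := \det (\matrix_(i, j) D i j x).
have [Lp Lp0 hLp] := coords_lip c0 phi_lip.
have lim1 : (fun k => T (f' \o phi) (fun i => F k i \o phi)) @ \oo -->
    T (f' \o phi) (fun i => G i \o phi).
  apply: (current_slot_cvg hT (c := n.+1%:R * (6 * lM) * Lp) (u := fun k => lM * (3 * mesh k))).
  - exact: clip.
  - by move=> i; exact: clip.
  - by rewrite !mulr_ge0.
  - move=> k i x y; apply: le_trans (interp_cutoff_lip lM0 (GM i) (G0 i) k _ _) _.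
    by rewrite -[leRHS]mulrA; apply: ler_wpM2l; [rewrite !mulr_ge0|exact: hLp].
  - rewrite -[X in _ --> X](mulr0 (lM * 3)); under eq_fun do rewrite mulrA.
    by apply: cvgMl_tmp; exact: mesh_cvg0.
  - by move=> k i x; apply: (interp_cutoff lM0 (GM i)) => // y; exact: G0.
have Jblip k : blip (Jk k).
  apply: blip_det => i j; split; first exact: C11_grad_lip (interp_C11 k N (G i)).
  by exists (6 * lM) => y; apply: (dinterp_bounded lM0 (GM i)) => // z; exact: G0.
have fJ k : is_lip (fun y => f' y * Jk k y).
  by have [h _] : blip (fun y => f' y * Jk k y) by apply: blipM => //; split => //; exists b.
have e1 k : T (f' \o phi) (fun i => F k i \o phi) = \int[leb]_x (u x * (f' x * Jk k x)).
  rewrite -hu//.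
  by rewrite (det_chain hT hM Lp0 hLp (clip hf') _ (fun i => interp_C11 k N (G i)))//; exists b => x; exact: fb.
have CJ k x : `|Jk k x| <= #|'S_n.+1|%:R * (6 * lM) ^+ n.+1.
  by apply: det_bound => [|i j]; [rewrite mulr_ge0|apply: (dinterp_bounded lM0 (GM i)) => // z; exact: G0].
have mJ : measurable_fun setT J by exact: measurable_det.
have b0 : 0 <= b by apply: le_trans (fb 0).
set CC := #|_|%:R * _ in CJ; have CC0 : 0 <= CC by apply: le_trans (CJ 0%N 0).
have [|||||iuJ lim2] := @Int_dct _ _ _ leb (fun k x => u x * (f' x * Jk k x))
    (fun x => u x * (f' x * J x)) (fun x => b * CC * `|u x|).
- move=> k; apply: measurable_funM; [exact: intg_measurable iu|exact: is_lip_measurable].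
- apply: measurable_funM; first exact: intg_measurable iu.
  by apply: measurable_funM => //; exact: is_lip_measurable.
- by apply: intgZ; exact: intg_abs.
- apply: filterS gD => x hx.
  have [xN|Nx] := leP `|x| (N0 + 2)%:R; last first.
    by rewrite (u0 _ Nx) mul0r; under eq_fun do rewrite mul0r; exact: cvg_cst.
  apply: cvgMl_tmp; apply: cvgMl_tmp; apply: cvg_det => i j.
  apply: (dinterp_cvg (l := fun j => D i j x)) (hx i).
  by move: xN; rewrite /N !natrD; lra.
- move=> k x; rewrite normrM mulrC ler_wpM2r// normrM ler_pM//; exact: fb.
have lim3 : (fun k => T (f' \o phi) (fun i => F k i \o phi)) @ \oo -->
    \int[leb]_x (u x * (f' x * J x)).
  under eq_fun do rewrite e1; apply: Int_cvg lim2 => // k.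
  have [h [C hC]] : blip (fun y => f' y * Jk k y) by apply: blipM => //; split => //; exists b.
  exact: intg_mulb iu (is_lip_measurable h) hC.
have -> : T (f' \o phi) (fun i => G i \o phi) = \int[leb]_x (u x * (f' x * J x)).
  by apply: cvg_unique lim1 lim3; exact: Rhausdorff.
rewrite (current_of_grad f (a := D)); last first.
  apply: filterS gD => x hx ux i; have [xN|/u0 e] := leP `|x| (N0 + 2)%:R; last by rewrite e eqxx in ux.
  apply: (grad_near (r0 := 1) ltr01 _ (hx i)) => y yx; apply: Gg.
  have := lerB_dist y x; move: xN; rewrite !natrD; lra.
apply: eq_Rintegral => x _; have [xN|/u0 ->] := leP `|x| (N0 + 2)%:R; last by rewrite !mul0r.
by rewrite ff'// mulrA.
Qed.

End representation.

(** * Hoelder maps and inf-convolutions *)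

Section powers.
Context {R : realType}.
Implicit Types (t a b : R).

Lemma powR_add t a b : 0 < t -> t `^ (a + b) = t `^ a * t `^ b.
Proof. by move=> t0; rewrite powRD//; apply/implyP => _; rewrite gt_eqF. Qed.

Lemma powR_homo a t t' : 0 <= a -> 0 <= t -> t <= t' -> t `^ a <= t' `^ a.
Proof.
by move=> a0 h tt; apply: ge0_ler_powR; rewrite ?nnegrE//; exact: le_trans tt.
Qed.

Lemma powR_pred t a : 0 < t -> t `^ a = t `^ (a - 1) * t.
Proof. by move=> t0; rewrite -{3}(powRr1 (ltW t0)) -powR_add// subrK. Qed.

Lemma prod_powR (J : Type) (r : seq J) (P : pred J) (a : J -> R) t : 0 < t ->
  \prod_(i <- r | P i) t `^ a i = t `^ (\sum_(i <- r | P i) a i).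
Proof.
move=> t0; elim: r => [|i r ih]; first by rewrite !big_nil powRr0.
by rewrite !big_cons; case: ifP => _ //; rewrite ih powR_add.
Qed.

Lemma powR_decr t a b : 0 < t -> t <= 1 -> a <= b -> t `^ b <= t `^ a.
Proof.
by move=> t0 t1 ab; apply: ger_powR => //; rewrite t0.
Qed.

Lemma powR_ge1 t a : 0 < t -> t <= 1 -> a <= 0 -> 1 <= t `^ a.
Proof. by move=> t0 t1 a0; rewrite -(powRr0 t); exact: powR_decr. Qed.

Lemma powR_le1 t a : 0 <= t -> t <= 1 -> 0 <= a -> t `^ a <= 1.
Proof.
move=> t0 t1 a0; have e : (1 : R) `^ a = 1 by rewrite powR1.
by rewrite -[leRHS]e; exact: powR_homo.
Qed.

Lemma powR_linear t a x : 0 < t -> a <= 1 -> t <= x -> x `^ a <= t `^ (a - 1) * x.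
Proof.
move=> t0 a1 tx; have x0 : 0 < x by exact: lt_le_trans tx.
rewrite powR_pred// ler_wpM2r ?(ltW x0)//.
have e (y : R) : 0 < y -> y `^ (a - 1) = (y `^ (1 - a))^-1 by move=> y0; rewrite -powRN opprB.
rewrite !e// lef_pV2 ?posrE ?powR_gt0//.
by apply: powR_homo; rewrite ?subr_ge0// ltW.
Qed.

End powers.

Section hoelder_functions.
Context {R : realType} {X : metricType R}.
Implicit Types (p : X -> R).

Definition hoelderc (a H : R) p : Prop := forall x y, `|p x - p y| <= H * mdist x y `^ a.

Lemma HolderP a H p : 0 < a -> (Lip a p <= H%:E)%E <-> 0 <= H /\ hoelderc a H p.
Proof.
move=> a0; rewrite /Lip; split.
  rewrite ge_max lee_fin => /andP[H0 h]; split => // x y.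
  have [->|xy] := eqVneq x y; first by rewrite subrr normr0 mulr_ge0// powR_ge0.
  have d0 : 0 < mdist x y `^ a by rewrite powR_gt0// mdist_gt0.
  rewrite -ler_pdivrMr// -lee_fin; apply: le_trans h; apply: ereal_sup_ubound.
  by exists x, y.
move=> [H0 h]; rewrite ge_max lee_fin H0/=; apply: ge_ereal_sup => _ [x [y [xy ->]]].
by rewrite lee_fin ler_pdivrMr ?powR_gt0 ?mdist_gt0.
Qed.

Lemma hoelder_le a H H' p : H <= H' -> hoelderc a H p -> hoelderc a H' p.
Proof. by move=> HH h x y; apply: le_trans (h x y) _; rewrite ler_wpM2r// powR_ge0. Qed.

Variables (a H : R) (p : X -> R) (t : R).
Hypothesis a0 : 0 < a.
Hypothesis a1 : a <= 1.
Hypothesis H0 : 0 <= H.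
Hypothesis hp : hoelderc a H p.
Hypothesis t0 : 0 < t.

Let q x := inf (range (fun y => p y + H * t `^ (a - 1) * mdist x y)).

(** Up to distance [t] the Hoelder bound is at most [H * t^a]; beyond, it is at most the linear
    term, by [powR_linear]. *)
Let lower x y : p x - H * t `^ a <= p y + H * t `^ (a - 1) * mdist x y.
Proof.
have h := hp x y; have d0 : 0 <= mdist x y by exact: mdist_ge0.
have [dt|td] := leP (mdist x y) t.
  have h2 : H * mdist x y `^ a <= H * t `^ a.
    by rewrite ler_wpM2l// powR_homo// ltW.
  have h3 : 0 <= H * t `^ (a - 1) * mdist x y by rewrite !mulr_ge0// powR_ge0.
  by move: h; rewrite ler_norml; lra.
have h2 : H * mdist x y `^ a <= H * t `^ (a - 1) * mdist x y.
  by rewrite -mulrA ler_wpM2l// powR_linear// ltW.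
have h3 : 0 <= H * t `^ a by rewrite mulr_ge0// powR_ge0.
by move: h; rewrite ler_norml; lra.
Qed.

Let hasinf x : has_inf (range (fun y => p y + H * t `^ (a - 1) * mdist x y)).
Proof.
split; first by exists (p x + H * t `^ (a - 1) * mdist x x); exists x.
by exists (p x - H * t `^ a) => _ [y _ <-]; exact: lower.
Qed.

Lemma infconv_le x : q x <= p x.
Proof.
by apply: ge_inf; [case: (hasinf x)|exists x => //; rewrite mdistxx mulr0 addr0].
Qed.

Lemma infconv_near x : `|q x - p x| <= H * t `^ a.
Proof.
have h : p x - H * t `^ a <= q x.
  by apply: lb_le_inf; [case: (hasinf x)|move=> _ [y _ <-]; exact: lower].
by have := infconv_le x; have : 0 <= H * t `^ a; [rewrite mulr_ge0// powR_ge0|rewrite ler_norml; lra].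
Qed.

Lemma infconv_lip : lipc (H * t `^ (a - 1)) q.
Proof.
have half x y : q x <= q y + H * t `^ (a - 1) * mdist x y.
  rewrite -lerBlDr; apply: lb_le_inf; first by case: (hasinf y).
  move=> _ [z _ <-]; rewrite lerBlDr.
  apply: le_trans (_ : p z + H * t `^ (a - 1) * mdist x z <= _).
    by apply: ge_inf; [case: (hasinf x)|exists z].
  by rewrite -addrA lerD2l -mulrDr ler_wpM2l ?mulr_ge0 ?powR_ge0// addrC metric_triangle.
by move=> x y; have := half x y; have := half y x; rewrite [mdist y x]metric_sym ler_norml; lra.
Qed.

(** Up to distance [t] the Lipschitz bound already implies the Hoelder bound; beyond, passing from
    [q] to [p] at both ends costs [H * t^a] each, whence the factor 3, uniformly in [t]. *)
Lemma infconv_hoelder : hoelderc a (3 * H) q.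
Proof.
move=> x y; have d0 : 0 <= mdist x y by exact: mdist_ge0.
have [->|xy] := eqVneq x y; first by rewrite subrr normr0 !mulr_ge0// powR_ge0.
have dp : 0 < mdist x y by rewrite mdist_gt0.
have [dt|td] := leP (mdist x y) t.
  apply: le_trans (infconv_lip x y) _; rewrite -mulrA.
  have h : t `^ (a - 1) * mdist x y <= mdist x y `^ a.
    rewrite [leRHS]powR_pred// ler_wpM2r//.
    have e (z : R) : 0 < z -> z `^ (a - 1) = (z `^ (1 - a))^-1 by move=> z0; rewrite -powRN opprB.
    rewrite !e// lef_pV2 ?posrE ?powR_gt0//.
    by apply: powR_homo; rewrite ?subr_ge0// ltW.
  have := ler_wpM2l H0 h; have : 0 <= H * mdist x y `^ a by rewrite mulr_ge0// powR_ge0.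
  lra.
have h1 := infconv_near x; have h2 := infconv_near y; have h3 := hp x y.
have h4 : H * t `^ a <= H * mdist x y `^ a.
  by rewrite ler_wpM2l// powR_homo// ltW.
by move: h1 h2 h3; rewrite !ler_norml; lra.
Qed.

End hoelder_functions.

Section scale_estimates.
Context {R : realType}.
Variables (X : metricType R) (n : nat) (T : functional X n.+1) (M B : R).
Hypothesis hT : is_current T.
Hypothesis hM : (mass T <= M%:E)%E.
Hypothesis hB : (mass (boundary T) <= B%:E)%E.
Hypothesis B0 : 0 <= B.
Variable alpha : 'I_n.+1 -> R.
Hypothesis alpha01 : forall i, 0 < alpha i <= 1.
Local Notation Rn := 'rV[R]_n.+1.

Let tau := \sum_i alpha i.
Let sg := tau - n%:R.
Let a0 i : 0 < alpha i. Proof. by case/andP: (alpha01 i). Qed.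
Let a1 i : alpha i <= 1. Proof. by case/andP: (alpha01 i). Qed.

Lemma sum_pred_off i : \sum_(j | j != i) (alpha j - 1) = tau - alpha i - n%:R.
Proof.
rewrite sumrB /tau [in RHS](bigD1 i)//= [alpha i + _]addrC addrK; congr (_ - _).
by rewrite sumr_const cardC1 card_ord.
Qed.

Lemma sum_pred_all : \sum_j (alpha j - 1) = tau - n.+1%:R.
Proof. by rewrite sumrB sumr_const card_ord. Qed.

Lemma prod_scale (P : pred 'I_n.+1) (L t : R) : 0 < t ->
  \prod_(j | P j) (L * t `^ (alpha j - 1)) = L ^+ #|P| * t `^ (\sum_(j | P j) (alpha j - 1)).
Proof. by move=> t0; rewrite big_split prodr_const prod_powR. Qed.

(** In each term of [push_move] the displacement [t^(alpha i)] meets the Lipschitz constants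
    [t^(alpha j - 1)] with [j != i], so every term has the same exponent [sg]. *)
Lemma push_compare (psi chi : X -> Rn) (E A t : R) f : 0 <= E -> 0 <= A -> 0 < t ->
  (forall j, lipc (A * t `^ (alpha j - 1)) (coords psi j)) ->
  (forall j, lipc (A * t `^ (alpha j - 1)) (coords chi j)) ->
  (forall j x, `|coords psi j x - coords chi j x| <= E * t `^ alpha j) ->
  is_lip f -> (forall y, `|f y| <= 1) ->
  `|T (f \o psi) (coords psi) - T (f \o chi) (coords chi)| <= B * (n.+1%:R * (E * A ^+ n)) * t `^ sg.
Proof.
move=> E0 A0 t0 hpsi hchi he hf f1.
have p0 (L u v : R) : 0 <= L -> 0 <= L * u `^ v by move=> L0; rewrite mulr_ge0// powR_ge0.
apply: le_trans (push_move hT hM hB (c := fun j => A * t `^ (alpha j - 1))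
  (e := fun j => E * t `^ alpha j) _ _ hpsi hchi he hf f1) _ => [j|j|]; [exact: p0|exact: p0|].
rewrite -mulrA ler_wpM2l// mulrAC (eq_bigr (fun=> E * A ^+ n * t `^ sg)) => [|i _].
  by rewrite sumr_const card_ord -[leLHS]mulr_natl mulrAC mulrA.
rewrite prod_scale// cardC1 card_ord sum_pred_off mulrACA; congr (_ * _).
by rewrite -powR_add//; congr (_ `^ _); rewrite /sg; ring.
Qed.

Section one_map.
Variables (psi : X -> Rn) (c L : R).
Hypothesis c0 : 0 <= c.
Hypothesis L0 : 0 <= L.
Hypothesis psi_lip : forall j, lipc c (coords psi j).
Hypothesis psi_h : forall j, hoelderc (alpha j) L (coords psi j).

Let conv t := inf_convolution alpha L psi t.

Lemma conv_near t j x : 0 < t -> `|coords (conv t) j x - coords psi j x| <= L * t `^ alpha j.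
Proof. by move=> t0; rewrite /coords mxE; exact: (infconv_near (a0 j) (a1 j) L0 (psi_h j) t0). Qed.

Lemma conv_lip t j : 0 < t -> lipc (L * t `^ (alpha j - 1)) (coords (conv t) j).
Proof.
move=> t0; rewrite (_ : coords (conv t) j = fun x => inf (range (fun y => psi y ord0 j +
    L * t `^ (alpha j - 1) * mdist x y))).
  exact: (infconv_lip (a0 j) (a1 j) L0 (psi_h j) t0).
by apply/funext => x; rewrite /coords mxE.
Qed.

Lemma conv_hoelder t j : 0 < t -> hoelderc (alpha j) (3 * L) (coords (conv t) j).
Proof.
move=> t0; rewrite (_ : coords (conv t) j = fun x => inf (range (fun y => psi y ord0 j +
    L * t `^ (alpha j - 1) * mdist x y))).
  exact: (infconv_hoelder (a0 j) (a1 j) L0 (psi_h j) t0).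
by apply/funext => x; rewrite /coords mxE.
Qed.
End one_map.

Hypothesis sg0 : 0 < sg.

Let r := 2^-1 `^ sg.
Let r0 : 0 < r. Proof. by rewrite powR_gt0. Qed.
Let r1 : r < 1.
Proof.
have e : (1 : R) `^ sg = 1 by rewrite powR1.
rewrite -e; apply: gt0_ltr_powR; rewrite ?nnegrE ?invr_ge0//.
by rewrite invf_lt1// ltr1n.
Qed.

(** The cost [(n+1) 2^(n+1)] of halving the scale once, summed over the geometric series of ratio
    [2^-sg]. *)
Definition scale_const : R := n.+1%:R * 2 ^+ n.+1 / (1 - r).

Lemma scale_const_ge0 : 0 <= scale_const.
Proof. by rewrite divr_ge0// ?mulr_ge0// subr_ge0 ltW. Qed.

Variables (psi : X -> Rn) (c L : R).
Hypothesis c0 : 0 <= c.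
Hypothesis L0 : 0 <= L.
Hypothesis psi_lip : forall j, lipc c (coords psi j).
Hypothesis psi_h : forall j, hoelderc (alpha j) L (coords psi j).
Variable f : Rn -> R.
Hypothesis hf : is_lip f.
Hypothesis f1 : forall y, `|f y| <= 1.

Let conv t := inf_convolution alpha L psi t.
Let pw (chi : X -> Rn) := T (f \o chi) (coords chi).

Let halfpow a : a <= 1 -> 2^-1 `^ (a - 1) <= 2 * 2^-1 `^ a :> R.
Proof. by move=> h; rewrite (@powR_pred _ _ a)// mulrCA mulfV// mulr1. Qed.

(** At scale [s / 2] the Lipschitz constants are at most [2 L s^(alpha j - 1)], and the two
    regularizations are at most [2 L s^(alpha j)] apart; hence [2 * L] in all [n+1] factors. *)
Let step s : 0 < s -> s <= 1 ->
  `|pw (conv s) - pw (conv (s * 2^-1))| <= B * (n.+1%:R * (2 * L) ^+ n.+1) * s `^ sg.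
Proof.
move=> s0 s1; have h0 : 0 < s * 2^-1 :> R by rewrite mulr_gt0.
have hp j : (s * 2^-1) `^ alpha j <= s `^ alpha j.
  by apply: powR_homo; [exact: ltW|exact: ltW|rewrite ler_piMr ?(ltW s0)// invf_le1// ler1n].
rewrite exprS; apply: push_compare => //.
- by rewrite mulr_ge0.
- by rewrite mulr_ge0.
- move=> j; apply: lipc_le (conv_lip L0 psi_h j s0).
  by rewrite -mulrA ler_peMl ?ler1n// mulr_ge0// powR_ge0.
- move=> j; apply: lipc_le (conv_lip L0 psi_h j h0).
  rewrite powRM ?(ltW s0)// mulrA -mulrA [2 * L]mulrC -mulrA ler_wpM2l//.
  rewrite mulrC ler_wpM2r ?powR_ge0//; apply: le_trans (halfpow (a1 j)) _.
  by rewrite ler_piMr// powR_le1 ?(ltW (a0 j))// invf_le1// ler1n.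
- move=> j x; rewrite -(subrKA (coords psi j x)); apply: le_trans (ler_normD _ _) _.
  rewrite -mulrA mulr_natl mulr2n; apply: lerD; first exact: conv_near.
  rewrite distrC; apply: le_trans (conv_near L0 psi_h j x h0) _.
  by rewrite ler_wpM2l.
Qed.

Lemma powRX (a b : R) k : 0 <= a -> (a ^+ k) `^ b = (a `^ b) ^+ k.
Proof.
move=> h; elim: k => [|k ih]; first by rewrite !expr0 powR1.
by rewrite !exprS powRM ?exprn_ge0// ih.
Qed.

(* Telescoping over the scales t 2^-k. *)
Lemma push_regularize t : 0 < t -> t <= 1 ->
  `|pw psi - pw (conv t)| <= B * (scale_const * L ^+ n.+1) * t `^ sg.
Proof.
move=> t0 t1; pose s k := t * 2^-1 ^+ k.
have s0 k : 0 < s k by rewrite mulr_gt0// exprn_gt0// invr_gt0.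
have h21 : 2^-1 <= 1 :> R by rewrite invf_le1// ler1n.
have s1 k : s k <= 1.
  by rewrite -[leRHS]mulr1 ler_pM ?exprn_ge0 ?(ltW t0)// exprn_ile1.
have ss k : s k `^ sg = t `^ sg * r ^+ k by rewrite powRM ?(ltW t0) ?exprn_ge0// powRX.
pose D := B * (n.+1%:R * (2 * L) ^+ n.+1) * t `^ sg.
have D0 : 0 <= D by rewrite !mulr_ge0 ?exprn_ge0 ?powR_ge0// mulr_ge0.
have tele J : `|pw (conv t) - pw (conv (s J))| <= D / (1 - r).
  have -> : pw (conv t) - pw (conv (s J)) = \sum_(k < J) (pw (conv (s k)) - pw (conv (s k.+1))).
    by rewrite (telescope_ord (fun k => pw (conv (s k)))) /s expr0 mulr1.
  apply: le_trans (ler_norm_sum _ _ _) _.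
  apply: (@le_trans _ _ (\sum_(k < J) D * r ^+ k)).
    apply: ler_sum => k _; rewrite {2}/s exprSr mulrA -/(s k).
    apply: le_trans (step (s0 k) (s1 k)) _; by rewrite ss /D !mulrA.
  rewrite -mulr_sumr ler_wpM2l//.
  have := subrX1 r J; have rJ : 0 <= r ^+ J by rewrite exprn_ge0// ltW.
  rewrite -[(1 - r)^-1]mul1r ler_pdivlMr ?subr_gt0//; set q := \sum_(_ < _) _ => e; nra.
(* The Lipschitz constant [c] of [psi] enters only here, against the factor [r ^+ J], and disappears
   in the limit. *)
pose E := B * (n.+1%:R * (L * (c + L) ^+ n)) * t `^ sg.
have tail J : `|pw psi - pw (conv (s J))| <= E * r ^+ J.
  rewrite /E -mulrA -ss; apply: push_compare => //.
  - exact: addr_ge0.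
  - move=> j; apply: lipc_le (psi_lip j).
    apply: (@le_trans _ _ (c + L)); first by rewrite lerDl.
    by rewrite ler_peMr ?addr_ge0// powR_ge1// subr_le0.
  - move=> j; apply: lipc_le (conv_lip L0 psi_h j (s0 J)).
    by rewrite ler_wpM2r ?powR_ge0// lerDr.
  - by move=> j x; rewrite distrC; exact: conv_near.
have bound J : `|pw psi - pw (conv t)| <= D / (1 - r) + E * r ^+ J.
  rewrite -(subrKA (pw (conv (s J)))) addrC; apply: le_trans (ler_normD _ _) _.
  by rewrite lerD// distrC.
have -> : B * (scale_const * L ^+ n.+1) * t `^ sg = D / (1 - r).
  by rewrite /D /scale_const exprMn; ring.
have c1 : (fun J => D / (1 - r) + E * r ^+ J) @ \oo --> D / (1 - r).
  rewrite -[X in _ --> X]addr0; apply: cvgD; first exact: cvg_cst.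
  by rewrite -[X in _ --> X](mulr0 E); apply: cvgMl_tmp; apply: cvg_expr; rewrite ger0_norm// ltW.
exact: cvg_ge_cst c1 bound.
Qed.

(** The regularized map is estimated by the mass, the passage to it by the boundary; [t] is left
    free to balance the two. *)
Lemma push_scale_bound t : 0 <= M -> 0 < t -> t <= 1 ->
  `|pw psi| <= (M * t `^ (tau - n.+1%:R) + scale_const * B * t `^ sg) * L ^+ n.+1.
Proof.
move=> M0 t0 t1; rewrite -(subrK (pw (conv t)) (pw psi)); apply: le_trans (ler_normD _ _) _.
have := push_bound hT hM (c := fun j => L * t `^ (alpha j - 1)) _
  (fun j => conv_lip L0 psi_h j t0) hf f1.
rewrite prod_scale// sum_pred_all card_ord => /(_ _) h.
have := push_regularize t0 t1.
have := h (fun j => mulr_ge0 L0 (powR_ge0 _ _)).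
set A := t `^ _; set A' := t `^ _; rewrite /pw /conv; lra.
Qed.

End scale_estimates.

Section close_maps.
Context {R : realType}.
Variables (X : metricType R) (n : nat) (T : functional X n.+1) (M B : R).
Hypothesis hT : is_current T.
Hypothesis hM : (mass T <= M%:E)%E.
Hypothesis hB : (mass (boundary T) <= B%:E)%E.
Hypothesis B0 : 0 <= B.
Variable alpha : 'I_n.+1 -> R.
Hypothesis alpha01 : forall i, 0 < alpha i <= 1.
Local Notation Rn := 'rV[R]_n.+1.
Let tau := \sum_i alpha i.
Let sg := tau - n%:R.
Hypothesis sg0 : 0 < sg.

(** Both maps are regularized at scale [e], which costs [scale_const] twice; the regularizations
    differ by at most three errors [L * e^(alpha j)], which gives [3 (n+1)]. *)
Lemma push_close (psi chi : X -> Rn) (c L e : R) f : 0 <= c -> 0 <= L -> 0 < e -> e <= 1 ->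
  (forall j, lipc c (coords psi j)) -> (forall j, lipc c (coords chi j)) ->
  (forall j, hoelderc (alpha j) L (coords psi j)) -> (forall j, hoelderc (alpha j) L (coords chi j)) ->
  (forall j x, `|coords psi j x - coords chi j x| <= L * e `^ alpha j) ->
  is_lip f -> (forall y, `|f y| <= 1) ->
  `|T (f \o psi) (coords psi) - T (f \o chi) (coords chi)| <=
    B * ((2 * scale_const alpha + 3 * n.+1%:R) * L ^+ n.+1) * e `^ sg.
Proof.
move=> c0 L0 e0 e1 lpsi lchi hpsi hchi close hf f1.
have r1 := push_regularize hT hM hB B0 alpha01 sg0 c0 L0 lpsi hpsi hf f1 e0 e1.
have r2 := push_regularize hT hM hB B0 alpha01 sg0 c0 L0 lchi hchi hf f1 e0 e1.
have r3 := push_compare hT hM hB B0 (alpha := alpha) (mulr_ge0 (ler0n R 3) L0) L0 e0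
  (fun j => conv_lip alpha01 L0 hpsi j e0) (fun j => conv_lip alpha01 L0 hchi j e0) _ hf f1.
have {r3}r3 := r3 _; have {}r3 : `|T (f \o inf_convolution alpha L psi e) (coords (inf_convolution alpha L psi e)) -
   T (f \o inf_convolution alpha L chi e) (coords (inf_convolution alpha L chi e))| <=
   B * (n.+1%:R * (3 * L * L ^+ n)) * e `^ sg.
  apply: r3 => j x; have h1 := conv_near alpha01 L0 hpsi j x e0.
  have h2 := conv_near alpha01 L0 hchi j x e0; have h3 := close j x.
  by move: h1 h2 h3; rewrite !ler_norml -!mulrA; lra.
have eL : 3 * L * L ^+ n = 3 * L ^+ n.+1 by rewrite exprS mulrA.
rewrite eL in r3; move: r1 r2 r3; rewrite -/tau -/sg.
set s := e `^ sg; set P := L ^+ _; set C := scale_const _.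
set A1 := T (f \o psi) _; set A2 := T (f \o chi) _; set A3 := T _ _; set A4 := T _ _ => r1 r2 r3.
rewrite (_ : A1 - A2 = (A1 - A3) + (A3 - A4) - (A2 - A4)); last by ring.
apply: le_trans (ler_normB _ _) _.
have := ler_normD (A1 - A3) (A3 - A4); lra.
Qed.

End close_maps.

(* The library's finite-subcover lemma is for pointed spaces only. *)
Lemma compact_finite_cover (X : topologicalType) (K : set X) (U : X -> set X) : compact K ->
  (forall x, K x -> nbhs x (U x)) -> exists s : seq X,
    (forall x, x \in s -> K x) /\ K `<=` [set y | exists2 x, x \in s & U x y].
Proof.
move=> /compact_near_coveringP cK KU.
pose F : set_system (seq X) := [set A | exists s : seq X, forall s' : seq X, {subset s <= s'} -> A s'].
have FF : Filter F.
  split; first by exists [::].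
    move=> P Q [s hs] [t ht]; exists (s ++ t) => s' ss'; split.
      by apply: hs => x xs; apply: ss'; rewrite mem_cat xs.
    by apply: ht => x xs; apply: ss'; rewrite mem_cat xs orbT.
  by move=> P Q PQ [s hs]; exists s => s' /hs; exact: PQ.
have [|s hs] := cK _ F (fun s y => exists2 x, x \in [seq x <- s | `[<K x>]] & U x y) FF.
  move=> x Kx; exists (U x, [set s : seq X | x \in s]).
    by split => /=; [exact: KU|exists [:: x] => s' h; apply: h; rewrite mem_head].
  by move=> [y s] /= [Uy xs]; exists x => //; rewrite mem_filter xs andbT; apply/asboolP.
exists [seq x <- s | `[<K x>]]; split; last by have := hs s; apply.
by move=> x; rewrite mem_filter => /andP[/asboolP].
Qed.

(** * Vanishing off the support of a current *)

Section supports.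
Context {R : realType} {X : metricType R} {n : nat}.
Implicit Types (T : functional X n) (K A : set X).

Lemma spt_sub (f f' : X -> R) : (forall x, f x = 0 -> f' x = 0) -> spt f' `<=` spt f.
Proof. by move=> h; apply: closure_subset => x /=; apply: contra_neq; exact: h. Qed.

Lemma spt_compact_sub (f : X -> R) K : compact K -> compact (spt f `&` K).
Proof.
by move=> cK; rewrite setIC; apply: compact_closedI => //; exact: closed_closure.
Qed.

(** Passing from the closed sets off which [T] vanishes to their intersection needs a partition.
    Each point of [spt f] has a ball avoiding one of these sets; finitely many such balls cover the
    part of [spt f] in a compact carrier, and [f] is stripped of its part in each of them in
    turn. *)
Lemma vanishes_off_support T K : is_current T -> current_support T `<=` K -> vanishes_off T K.
Proof.
move=> hT TK f g hf hg fK; have mT := current_mlin hT.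
have [K0 [cK0 hK0]] := current_compact hT.
have [f' [a [hf' fa' Tf]]] : exists (f' : X -> R) (a : R), [/\ is_lip f', bounded_by a f' &
    spt f' `<=` spt f /\ T f g = T f' g].
  have [a [a0 oU KU]] := current_trunc cK0 hf.
  exists (fun x => clamp (- a) a (f x)), a; split; first exact: is_lip_clamp.
    by move=> x; rewrite ler_norml clamp_itv//; lra.
  split.
    by apply: spt_sub => x ->; rewrite clamp_id// oppr_le0 a0.
  apply: (current_eq_near hT hK0 oU KU) => //; first exact: is_lip_clamp.
  by move=> x /= fx; rewrite clamp_id// -ler_norml ltW.
case: Tf => sf' ->.
have {fK} fK : spt f' `&` K = set0 by rewrite -subset0 => x [/sf' fx Kx]; rewrite -fK.
move: f' hf' fa' {sf' hf} fK => {}f hf fa fK.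
have loc x : spt f x -> exists2 r : R, 0 < r & forall h, is_lip h ->
    (forall y, h y != 0 -> mdist x y < r + r) -> T h g = 0.
  move=> fx; have : ~ current_support T x by move=> /TK Kx; have : set0 x by rewrite -fK.
  rewrite /current_support => /existsNP[A] /not_implyP[[cA vA] nAx].
  have oA : open (~` A) by exact: closed_openC.
  have : nbhs x (~` A) by exact: open_nbhs_nbhs.
  move=> /nbhs_ballP[e /= e0 eA]; exists (e / 3); first by rewrite divr_gt0.
  move=> h hh hs; apply: vA => //; rewrite -subset0 => y [hy Ay].
  have e30 : 0 < e / 3 by rewrite divr_gt0.
  have [z [/= hz]] := hy _ (nbhsx_ballx y _ e30); rewrite ballEmdist/= => yz.
  have := eA y; rewrite ballEmdist/= => /(_ _) nAy; apply: nAy => //.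
  have := hs z hz; have := metric_triangle x z y; rewrite [mdist z y]metric_sym; lra.
(* The value 1 off [spt f] is a placeholder that keeps [r] positive. *)
pose r x := if pselect (spt f x) is left h then sval (cid2 (loc x h)) else 1.
have r0 x : 0 < r x by rewrite /r; case: pselect => // h; case: cid2.
have hr x h : spt f x -> is_lip h -> (forall y, h y != 0 -> mdist x y < r x + r x) -> T h g = 0.
  by move=> fx; rewrite /r; case: pselect => // fx'; case: cid2 => /= s s0; exact.
have [|D [Dsub Dcov]] := compact_finite_cover (U := fun x => (ball x (r x))^°) (spt_compact_sub (f := f) cK0).
  by move=> x _; apply: nbhs_interior; exact: nbhsx_ballx.
pose chi x y := clamp 0 1 (2 - mdist x y / r x).
have chil x : is_lip (chi x).
  apply: is_lip_clamp; apply: is_lipB; first exact: is_lip_cst.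
  apply: (@is_lip_lipc _ _ ((r x)^-1)); first by rewrite invr_ge0 ltW.
  move=> y z; rewrite -mulrBl normrM mulrC [`|(r x)^-1|]gtr0_norm ?invr_gt0//.
  rewrite ler_wpM2l ?invr_ge0 ?(ltW (r0 x))//.
  have := metric_triangle x y z; have := metric_triangle x z y; rewrite [mdist z y]metric_sym.
  by rewrite ler_norml; lra.
have chi01 x y : 0 <= chi x y <= 1 by exact: clamp_itv.
have chi1 x y : ball x (r x) y -> chi x y = 1.
  rewrite ballEmdist/= => xy; rewrite /chi /clamp.
  have : 1 <= 2 - mdist x y / r x.
    have : mdist x y / r x <= 1 by rewrite ler_pdivrMr// mul1r ltW.
    lra.
  by move=> h; rewrite (min_idPl h); apply/max_idPr.
have chi0 x y : r x + r x <= mdist x y -> chi x y = 0.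
  move=> xy; apply/max_idPl; rewrite ge_min; apply/orP; right.
  have : 2 <= mdist x y / r x by rewrite ler_pdivlMr//; lra.
  lra.
(* [h'] is [h] times the product of the [1 - chi x]; the parts split off are concentrated near one
   [x] and annihilated by [loc]. *)
have key (s : seq X) : {in s, forall x, spt f x} -> forall h, is_lip h -> bounded_by a h ->
    exists h', [/\ is_lip h', T h g = T h' g,
      forall y, h y = 0 -> h' y = 0 & forall x y, x \in s -> ball x (r x) y -> h' y = 0].
  elim: s => [_ h hh _|x s ih xs h hh ha]; first by exists h.
  have c1 : bounded_by 1 (fun y => 1 - chi x y).
    by move=> y; have := chi01 x y; rewrite ler_norml; lra.
  have lc : is_lip (fun y => 1 - chi x y) by apply: is_lipB; [exact: is_lip_cst|exact: chil].
  have lh1 : is_lip (fun y => h y * (1 - chi x y)) by exact: is_lipM ha c1 hh lc.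
  have c2 : bounded_by 1 (chi x) by move=> y; have := chi01 x y; rewrite ler_norml; lra.
  have lh2 : is_lip (fun y => h y * chi x y) by exact: is_lipM ha c2 hh (chil x).
  have [||h' [lh' Th' h'h h's]] := ih _ (fun y => h y * (1 - chi x y)) lh1.
  - by move=> y ys; apply: xs; rewrite inE ys orbT.
  - by move=> y; rewrite normrM -[leRHS]mulr1; exact: ler_pM.
  exists h'; split => //.
  - have -> : h = fun y => h y * chi x y + h y * (1 - chi x y).
      by apply/funext => y; ring.
    rewrite (mlinD mT)// Th' (hr x) ?add0r//; first by apply: xs; rewrite mem_head.
    move=> y; apply: contra_neqT; rewrite -leNgt => /chi0 ->; exact: mulr0.
  - by move=> y hy; apply: h'h; rewrite hy mul0r.
  - move=> z y; rewrite inE => /orP[/eqP ->|zs]; last exact: h's.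
    by move=> /chi1 e; apply: h'h; rewrite e subrr mulr0.
have [|h' [lh' -> h'f h'D]] := key D _ f hf fa.
  by move=> x /Dsub[].
apply: (current_off hK0 (U := ~` (spt f `&` ~` \bigcup_(x in [set` D]) (ball x (r x))^°))) => //.
- apply: closed_openC; apply: closedI; first exact: closed_closure.
  by apply: open_closedC; apply: bigcup_open => x _; exact: open_interior.
- by move=> x Kx [fx]; apply; have [y yD xy] := Dcov x (conj fx Kx); exists y.
- move=> x Ux; apply: contrapT => h'x; apply: Ux; split.
    by apply: subset_closure => /=; apply/eqP => fx; apply: h'x; exact: h'f.
  by move=> [y yD /interior_subset xy]; apply: h'x; exact: h'D yD xy.
Qed.

End supports.

(** * Divergences and supports *)

Section gradient_calculus.
Context {R : realType} {n : nat}.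
Local Notation Rn := 'rV[R]_n.
Local Notation leb := (lebesgue_row R n).

Lemma lin_rowZ (a : 'I_n -> R) t (h : Rn) : lin_row a (t *: h) = t * lin_row a h.
Proof. by rewrite /lin_row mulr_sumr; apply: eq_bigr => j _; rewrite !mxE mulrCA. Qed.

Lemma grad_directional (F : Rn -> R) x a (v : Rn) : grad F x a ->
  (fun t => t^-1 *: (F (t *: v + x) - F x)) @ 0^' --> lin_row a v.
Proof.
move=> ga; apply/cvgrPdist_le => e e0.
have v1 : 0 < `|v| + 1 by rewrite ltr_wpDl.
have [r r0 hr] := ga _ (divr_gt0 e0 v1).
exists (r / (`|v| + 1)) => [|t /= tr t0]; first by rewrite /= divr_gt0.
rewrite sub0r normrN in tr.
have tv : `|t *: v| <= r.
  rewrite normrZ; apply: (@le_trans _ _ (`|t| * (`|v| + 1))); first by rewrite ler_wpM2l// lerDl.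
  by rewrite -ler_pdivlMr// ltW.
have := hr _ tv; rewrite [x + _]addrC lin_rowZ => h.
have -> : lin_row a v - t^-1 *: (F (t *: v + x) - F x) =
    - (t^-1 * (F (t *: v + x) - F x - t * lin_row a v)).
  by rewrite /GRing.scale/=; field.
rewrite normrN normrM normfV ler_pdivrMl ?normr_gt0//; apply: le_trans h _.
rewrite normrZ mulrCA ler_wpM2l// mulrAC ler_pdivrMr// ler_wpM2l ?(ltW e0)//.
by rewrite lerDl.
Qed.

Lemma grad_derive (F : Rn -> R) x a i : grad F x a -> 'D_(delta_mx ord0 i) F x = a i.
Proof.
move=> ga; have h := grad_directional (v := delta_mx ord0 i) ga.
have -> : a i = lin_row a (delta_mx ord0 i).
  rewrite /lin_row (bigD1 i)//= big1 ?addr0 => [|j ij]; first by rewrite mxE !eqxx mulr1.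
  by rewrite mxE (negPf ij) andbF mulr0.
by apply: cvg_lim => //; exact: Rhausdorff.
Qed.

Lemma grad_mean_value (F : Rn -> R) (D : 'I_n -> Rn -> R) (y z : Rn) :
  (forall x, grad F x (fun j => D j x)) -> exists c, F y - F z = lin_row (fun j => D j c) (y - z).
Proof.
move=> hF; pose p t : Rn := z + t *: (y - z).
have hp t : is_derive t (1 : R) (F \o p) (lin_row (fun j => D j (p t)) (y - z)).
  have H := grad_directional (v := y - z) (hF (p t)).
  have E : (fun s => s^-1 *: (((F \o p) \o shift t) (s *: (1 : R)) - (F \o p) t)) =
      (fun s => s^-1 *: (F (s *: (y - z) + p t) - F (p t))).
    apply/funext => s; congr (_ *: (F _ - _)).
    have -> : shift t s%:A = s + t by rewrite /GRing.scale/= mulr1.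
    by rewrite /p scalerDl addrCA.
  apply: DeriveDef; first by apply/cvg_ex; exists (lin_row (fun j => D j (p t)) (y - z)); rewrite E.
  by rewrite /derive E; apply: cvg_lim => //; exact: Rhausdorff.
have [c _] := mean_value 1 0 hp; rewrite subr0 mulr1 /= /p scale1r scale0r addr0.
by rewrite [z + _]addrC subrK => ->; exists (p c).
Qed.

Lemma grad_coord j (x : Rn) : grad (fun y => y ord0 j) x (fun k => (j == k)%:R).
Proof.
move=> e e0; exists 1 => // h _; rewrite mxE [x ord0 j + _]addrC addrK.
have -> : lin_row (fun k => (j == k)%:R) h = h ord0 j.
  rewrite /lin_row (bigD1 j)//= eqxx mul1r big1 ?addr0// => k kj.
  by rewrite eq_sym (negPf kj) mul0r.
by rewrite subrr normr0 mulr_ge0// ltW.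
Qed.

Lemma differentiable_grad (phi : Rn -> Rn) x j : differentiable phi x ->
  grad (fun y => phi y ord0 j) x (fun k => ('D_(delta_mx ord0 k) phi x) ord0 j).
Proof.
move=> dphi e e0; have /eqaddoP /(_ _ e0) := diff_locally dphi.
move=> /nbhs_ballP[r /= r0 hr]; exists (r / 2) => [|h hh]; first by rewrite divr_gt0.
have /= := hr h; rewrite -ball_normE/= sub0r normrN => /(_ _) H.
have {}H := H (le_lt_trans hh _); have {}H := H ltac:(lra).
apply: le_trans H; apply: le_trans (row_norm_coord _ j).
rewrite le_eqVlt; apply/orP; left; apply/eqP; congr `|_|.
have -> : lin_row (fun k => ('D_(delta_mx ord0 k) phi x) ord0 j) h = ('d phi x h) ord0 j.
  rewrite {2}(row_sum_delta h) linear_sum summxE /lin_row; apply: eq_bigr => k _.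
  by rewrite linearZ/= mxE mulrC deriveE.
rewrite -[RHS]/((phi (h + x) - (phi x + 'd phi x h)) ord0 j) [h + x]addrC.
by rewrite !mxE opprD addrA.
Qed.

(** The partial derivatives are continuous and vanish off the compact support, hence are bounded. *)
Lemma C1c_component_lip (phi : Rn -> Rn) j : C1c phi -> is_lip (fun y => phi y ord0 j).
Proof.
move=> [dphi cD cK]; set K := closure _ in cK.
have off k x : ~ K x -> 'D_(delta_mx ord0 k) phi x = 0.
  move=> Kx; have oK : open (~` K) by apply: closed_openC; exact: closed_closure.
  have : nbhs x (~` K) by exact: open_nbhs_nbhs.
  move=> /nbhs_ballP[r /= r0 hr].
  apply/rowP => i; rewrite [RHS]mxE.
  have h1 := differentiable_grad i (dphi x).
  have h2 : grad (fun y => phi y ord0 i) x (fun=> 0).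
    move=> e e0; exists (r / 2) => [|h hh]; first by rewrite divr_gt0.
    have z y : `|y - x| < r -> phi y ord0 i = 0.
      move=> yx; have : (~` K) y by apply: hr; rewrite -ball_normE/= distrC.
      move=> Ky; suff -> : phi y = 0 by rewrite mxE.
      by apply/eqP/negPn/negP => py; apply: Ky; exact: subset_closure.
    rewrite z; last by rewrite [x + h]addrC addrK; apply: le_lt_trans hh _; lra.
    rewrite z ?subrr ?normr0// sub0r normrN /lin_row big1 => [|k' _]; last by rewrite mul0r.
    by rewrite normr0 mulr_ge0// ltW.
  by rewrite -(grad_derive k h1) (grad_derive k h2).
have bd k : exists2 L, 0 <= L & forall x, `|('D_(delta_mx ord0 k) phi x) ord0 j| <= L.
  have : compact ((fun x => 'D_(delta_mx ord0 k) phi x) @` K).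
    by apply: continuous_compact => //; exact: continuous_subspaceT (cD k).
  move=> /compact_bounded[M [_ hM]]; exists (`|M| + 1) => [|x]; first by rewrite addr_ge0.
  have [Kx|Kx] := pselect (K x); last by rewrite off// mxE normr0 addr_ge0.
  apply: le_trans (row_norm_coord _ _) _; apply: hM; last by exists x.
  by rewrite (le_lt_trans (ler_norm M))// ltrDl.
have /choice[L hL] : forall k, exists L, 0 <= L /\ forall x, `|('D_(delta_mx ord0 k) phi x) ord0 j| <= L.
  by move=> k; have [L L0 hL] := bd k; exists L.
apply: (@is_lip_lipc _ _ (\sum_k L k)); first by apply: sumr_ge0 => k _; case: (hL k).
move=> y z; rewrite mdist_rowE distrC.
have [c ->] := grad_mean_value z y (fun x => differentiable_grad j (dphi x)).
rewrite distrC /lin_row mulr_suml; apply: le_trans (ler_norm_sum _ _ _) _.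
apply: ler_sum => k _; rewrite normrM; apply: ler_pM => //; first exact: (hL k).2.
by rewrite distrC row_norm_coord.
Qed.

Lemma det_row_replaced (m : nat) (i : 'I_m) (v : 'I_m -> R) :
  \det (\matrix_(j, k) (if j == i then v k else (j == k)%:R)) = v i.
Proof.
rewrite (expand_det_col _ i) (bigD1 i)//= big1 ?addr0 => [|j ji]; last first.
  by rewrite mxE (negPf ji) mul0r.
rewrite mxE eqxx /cofactor -signr_odd oddD addbb expr0 mul1r.
rewrite (_ : row' i (col' i _) = 1%:M) ?det1 ?mulr1//.
apply/matrixP => j k; rewrite !mxE eq_sym (negPf (neq_lift _ _)).
by rewrite (inj_eq lift_inj).
Qed.

Lemma current_of_coords (u f : Rn -> R) :
  current_of u f (fun i y => y ord0 i) = \int[leb]_x (u x * f x).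
Proof.
rewrite (current_of_grad f (a := fun j k _ => (j == k)%:R)); last first.
  by apply: aeW => x _ i; exact: grad_coord.
apply: eq_Rintegral => x _; rewrite (_ : \matrix_(j, k) _ = 1%:M) ?det1 ?mulr1//.
by apply/matrixP => j k; rewrite !mxE.
Qed.

Lemma current_of_derive (u : Rn -> R) (F : Rn -> R) i (D : 'I_n -> Rn -> R) :
  (forall x, grad F x (fun k => D k x)) ->
  current_of u (fun=> 1) (subst_at (fun j (y : Rn) => y ord0 j) i F) = \int[leb]_x (u x * D i x).
Proof.
move=> hF; rewrite (current_of_grad (fun=> 1) (a := fun j k x => if j == i then D k x else (j == k)%:R)).
  by apply: eq_Rintegral => x _; rewrite mulr1 det_row_replaced.
apply: aeW => x _ j; rewrite /subst_at; case: eqP => _; [exact: hF|exact: grad_coord].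
Qed.

(** By Rademacher's theorem the slots contribute a bounded measurable determinant, and on the common
    ball [f] is bounded too; so the value is L^1-continuous in the density. *)
Lemma current_of_L1 (f : Rn -> R) (g : 'I_n -> Rn -> R) (r : R) : 0 <= r -> is_lip f ->
  (forall i, is_lip (g i)) -> exists2 C, 0 <= C & forall u w, intg leb u -> intg leb w ->
    (forall x, r < `|x| -> u x = 0) -> (forall x, r < `|x| -> w x = 0) ->
    `|current_of u f g - current_of w f g| <= C * \int[leb]_x `|u x - w x|.
Proof.
move=> r0 hf hg; have [f' [hf' [b fb] ff' _]] := lip_cutoff r0 hf.
have [L [D [L0 mD DL gD]]] := lipschitz_jacobian hg.
pose J x := \det (\matrix_(i, j) D i j x).
have mJ : measurable_fun setT J by exact: measurable_det.
have JL x : `|J x| <= #|'S_n|%:R * L ^+ n by exact: det_bound.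
set CJ := #|_|%:R * _ in JL.
have b0 : 0 <= b by apply: le_trans (fb 0).
have C0 : 0 <= CJ by rewrite mulr_ge0// exprn_ge0.
exists (b * CJ) => [|u w iu iw u0 w0]; first exact: mulr_ge0.
have mh : measurable_fun setT (fun x => f' x * J x) by apply: measurable_funM => //; exact: is_lip_measurable.
have hb x : `|f' x * J x| <= b * CJ by rewrite normrM ler_pM.
have E z : (forall x, r < `|x| -> z x = 0) -> current_of z f g = \int[leb]_x (z x * (f' x * J x)).
  move=> z0; rewrite (current_of_grad f (a := D)); last by apply: filterS gD => x h _ i; exact: h.
  apply: eq_Rintegral => x _; have [xr|/z0 ->] := leP `|x| r; last by rewrite !mul0r.
  by rewrite ff'// mulrA.
rewrite !E// -IntB; [|exact: intg_mulb iu mh hb|exact: intg_mulb iw mh hb].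
rewrite (@eq_Rintegral _ _ _ _ _ (fun x => (u x - w x) * (f' x * J x))); last first.
  by move=> x _; ring.
by apply: Int_norm_le => //; exact: intgB.
Qed.

End gradient_calculus.

(** * Integrality of L^1 limits; divergences and supports of pushforwards *)

Section integer_limits.
Context d (T : measurableType d) (R : realType) (mu : {measure set T -> \bar R}).

(** Chebyshev's inequality: on [E q] the integer [w k x] differs from [v x] by at least [1/(q+1)],
    so the measure of [E q] is at most [q+1] times a null sequence. *)
Lemma ae_int_limit (w : nat -> T -> R) (v : T -> R) : (forall k, intg mu (w k)) -> intg mu v ->
  (forall k, {ae mu, forall x, w k x \is a Num.int}) ->
  (fun k => \int[mu]_x `|w k x - v x|) @ \oo --> (0 : R) -> {ae mu, forall x, v x \is a Num.int}.
Proof.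
move=> iw iv wint cv; have mv := intg_measurable iv.
pose E (q : nat) := [set x | forall m : int, q.+1%:R^-1 <= `|v x - m%:~R|].
have mE q : measurable (E q).
  rewrite (_ : E q = ~` \bigcup_(m : int) ~` [set x | q.+1%:R^-1 <= `|v x - m%:~R|]).
    apply: measurableC; apply: countable_bigcupT_measurable => // m; apply: measurableC.
    have mf : measurable_fun setT (fun x => `|v x - m%:~R| : R).
      by apply: measurableT_comp => //; apply: measurable_funB.
    have := mf measurableT `[q.+1%:R^-1, +oo[%classic (measurable_itv _); rewrite setTI.
    by congr measurable; apply/seteqP; split => x /=; rewrite in_itv/= andbT.
  apply/seteqP; split => x /=; first by move=> h [m _]; apply; exact: h.
  by move=> h m; apply: contrapT => h'; apply: h; exists m.
have null q : mu (E q) = 0%E.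
  have le k : (mu (E q) * (q.+1%:R^-1)%:E <= (\int[mu]_x `|w k x - v x|)%:E)%E.
    rewrite EFin_Int; last by apply: intg_abs; exact: intgB.
    apply: (@le_trans _ _ (\int[mu]_x (q.+1%:R^-1 * \1_(E q) x)%:E)%E).
      under eq_integral do rewrite EFinM.
      rewrite ge0_integralZl//; last by apply/measurable_EFinP; exact: measurable_indic.
      by rewrite integral_indic// setIT muleC.
    apply: ae_ge0_le_integral => //.
    - by apply/measurable_EFinP; apply: measurable_funM => //; exact: measurable_indic.
    - by apply/measurable_EFinP; apply: measurableT_comp => //; apply: measurable_funB => //; exact: intg_measurable.
    - apply: filterS (wint k) => x /intrP[m wm] _; rewrite lee_fin wm indicE.
      have [Ex|nEx] := pselect (E q x); last by rewrite memNset// mulr0.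
      by rewrite mem_set// mulr1 distrC; exact: Ex.
  have : (mu (E q) * (q.+1%:R^-1)%:E <= 0)%E.
    move: le; case: (mu (E q)) (measure_ge0 mu (E q)) => [z| |]//= z0 le; last first.
      by have := le 0%N; rewrite mulyr gtr0_sg ?invr_gt0// mul1e leye_eq.
    rewrite -EFinM lee_fin; apply: cvg_ge_cst cv _ => k.
    by rewrite -lee_fin EFinM; exact: le.
  have : (0 <= mu (E q))%E by exact: measure_ge0.
  move: (mu (E q)) => [z| |] z0.
    rewrite -EFinM lee_fin pmulr_lle0 ?invr_gt0// => z1.
    by congr (_%:E); apply/eqP; rewrite eq_le z1 -lee_fin.
  - by rewrite mulyr gtr0_sg ?invr_gt0// mul1e leye_eq.
  - by move: z0; rewrite leeNy_eq.
have : {ae mu, forall x, forall q, ~ E q x}.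
  apply/ae_foralln => q; exists (E q); split => // x /=.
  by move=> /contrapT.
apply: filterS => x hx; apply: contrapT => nint.
pose m := Num.floor (v x).
have /andP[h1 h2] := floor_itv (v x); rewrite -/m intrD in h1 h2.
have h3 : 0 < v x - m%:~R.
  rewrite subr_gt0 lt_neqAle h1 andbT; apply/eqP => e; apply: nint; rewrite -e; exact: intr_int.
pose e := Num.min (v x - m%:~R) (m%:~R + 1 - v x).
have e0 : 0 < e by rewrite lt_min h3 subr_gt0.
apply: (hx (Num.bound e^-1)) => l.
have qe : (Num.bound e^-1).+1%:R^-1 <= e.
  rewrite invf_ple ?posrE//; apply: ltW; apply: lt_trans (archi_boundP _) _.
    by rewrite invr_ge0 ltW.
  by rewrite ltr_nat.
apply: le_trans qe _; have [lm|ml] := leP l m.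
  have : l%:~R <= m%:~R :> R by rewrite ler_int.
  rewrite /e ge_min => lm'; apply/orP; left; have := ler_norm (v x - l%:~R); lra.
have : m%:~R + 1 <= l%:~R :> R by rewrite -[1]/(1%:~R) -intrD ler_int lezD1.
rewrite /e ge_min => lm'; apply/orP; right; have := ler_norm (- (v x - l%:~R)); rewrite normrN; lra.
Qed.

End integer_limits.

Section push_tools.
Context {R : realType}.
Variables (X : metricType R) (n : nat) (T : functional X n.+1) (M B : R).
Hypothesis hT : is_current T.
Hypothesis hM : (mass T <= M%:E)%E.
Hypothesis hB : (mass (boundary T) <= B%:E)%E.
Variable phi : X -> 'rV[R]_n.+1.
Variable c : 'I_n.+1 -> R.
Hypothesis c0 : forall i, 0 <= c i.
Hypothesis phi_lip : forall i, lipc (c i) (coords phi i).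
Local Notation Rn := 'rV[R]_n.+1.
Local Notation leb := (lebesgue_row R n.+1).

(** With [F] in slot [i] and coordinates elsewhere the determinant is [D i], and [boundary_slot]
    makes the integral a value of the boundary, in which the i-th component of [phi] no longer
    occurs as a slot. *)
Lemma push_divergence (u : Rn -> R) (F : Rn -> R) i (D : 'I_n.+1 -> Rn -> R) :
  eq_current (pushforward_current phi T) (current_of u) -> is_lip F ->
  (forall x, grad F x (fun k => D k x)) -> (forall x, `|F x| <= 1) ->
  `|\int[leb]_x (u x * D i x)| <= B * \prod_(j | j != i) c j.
Proof.
move=> hu hF gF F1; have cl := coords_is_lip c0 phi_lip.
rewrite -(current_of_derive u i gF) -hu; last 2 first.
- exact: is_lip_cst.
- by apply: is_lip_subst => // j; exact: C11_is_lip (C11_coord j).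
rewrite /pushforward_current (_ : (fun j => _) = subst_at (coords phi) i (F \o phi)); last first.
  by apply/funext => j; rewrite /subst_at; case: eqP.
rewrite (_ : _ \o phi = fun=> 1)//.
rewrite (boundary_slot hT hM)//; last exact: (comp_is_lip c0 phi_lip).
rewrite normrM normrX normrN1 expr1n mul1r prod_lift -[B]mulr1.
apply: (mass_bound1 (boundary_mlin hT) hB) => //; first exact: (comp_is_lip c0 phi_lip).
by move=> x; exact: F1.
Qed.

Lemma push_vanishes (K : set X) (r : R) : vanishes_off T K -> (forall x, K x -> `|phi x| <= r) ->
  vanishes_off (pushforward_current phi T) [set y | `|y| <= r].
Proof.
move=> hK Kr f g hf hg fr; apply: hK => //.
- exact: (comp_is_lip c0 phi_lip).
- by move=> i; exact: (comp_is_lip c0 phi_lip).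
rewrite -subset0 => x [fx Kx].
suff : (spt f `&` [set y | `|y| <= r]) (phi x) by rewrite fr.
split; last exact: Kr.
have cphi : continuous phi.
  have [L L0 hL] := coords_lip c0 phi_lip.
  move=> y P /nbhs_ballP[e /= e0 he]; have L1 : 0 < L + 1 by rewrite ltr_wpDl.
  apply/nbhs_ballP; exists (e / (L + 1)) => [|z]; first by rewrite /= divr_gt0.
  rewrite ballEmdist/= => yz; apply: he; rewrite -ball_normE/=; apply: le_lt_trans (hL y z) _.
  apply: (@le_lt_trans _ _ ((L + 1) * mdist y z)); first by rewrite ler_wpM2r ?mdist_ge0// lerDl.
  by rewrite mulrC -ltr_pdivlMr.
move=> U /cphi /fx [y [fy Uy]]; by exists (phi y).
Qed.

End push_tools.

Section boxes.
Context {R : realType} {X : metricType R}.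

Lemma compact_diameter (K : set X) : compact K ->
  exists2 D : R, 0 <= D & forall x y, K x -> K y -> mdist x y <= D.
Proof.
move=> cK; have [[x0 Kx0]|K0] := pselect (exists x, K x); last first.
  by exists 0 => // x y Kx; exfalso; apply: K0; exists x.
have hd : is_lip (fun x => mdist x0 x).
  apply: (@is_lip_lipc _ _ 1) => // x y; rewrite mul1r.
  have := metric_triangle x0 x y; have := metric_triangle x0 y x.
  by rewrite [mdist y x]metric_sym ler_norml; lra.
have [a [a0 _ Ka]] := current_trunc cK hd; exists (a + a) => [|x y Kx Ky]; first exact: addr_ge0.
apply: le_trans (metric_triangle x x0 y) _; rewrite [mdist x x0]metric_sym.
by have := Ka x Kx; have := Ka y Ky; rewrite /= !ger0_norm ?mdist_ge0//; lra.
Qed.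

Lemma hoelder_diameter n (alpha : 'I_n -> R) (L D : R) (psi : X -> 'rV[R]_n) x y :
  (forall i, 0 < alpha i <= 1) -> 0 <= L -> 0 <= D ->
  (forall j, hoelderc (alpha j) L (fun x => psi x ord0 j)) -> mdist x y <= D ->
  `|psi x - psi y| <= L * (1 + D).
Proof.
move=> a01 L0 D0 h xy; apply: row_norm_le => [|j]; first by rewrite mulr_ge0// addr_ge0.
rewrite !mxE; apply: le_trans (h j x y) _; rewrite ler_wpM2l//.
have /andP[a0 a1] := a01 j; have d0 : 0 <= mdist x y by exact: mdist_ge0.
have [d1|d1] := leP 1 (mdist x y).
  by have := powR_linear ltr01 a1 d1; rewrite powR1 mul1r; lra.
by have := powR_le1 d0 (ltW d1) (ltW a0); lra.
Qed.

Lemma closed_norm_le_row n (r : R) : closed [set y : 'rV[R]_n | `|y| <= r].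
Proof.
apply: (@closed_comp _ _ (fun y : 'rV[R]_n => `|y|) [set z | z <= r]); last exact: closed_le.
by move=> y _; exact: norm_continuous.
Qed.

Lemma support_in_ball n m (S : functional 'rV[R]_n m) (r : R) :
  vanishes_off S [set y : 'rV[R]_n | `|y| <= r] -> current_support S `<=` [set y | `|y| <= r].
Proof.
move=> h x; apply; split => //; exact: closed_norm_le_row.
Qed.

Lemma compact_norm_le n (r : R) : compact [set y : 'rV[R]_n | `|y| <= r].
Proof.
apply: bounded_closed_compact; last exact: closed_norm_le_row.
by exists r; split; [exact: num_real|] => M rM y yr; exact: le_trans yr (ltW rM).
Qed.

End boxes.

(** * Series of currents *)

Section partial_sums.
Context {R : realType}.
Variables (X : metricType R) (n : nat) (R_ : nat -> functional X n.+1).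
Variables (V d rho C2 : R) (b : nat -> R).
Hypothesis hR : forall l, is_current (R_ l).
Hypothesis rho1 : 1 < rho.
Hypothesis V0 : 0 <= V.
Hypothesis dn : n%:R <= d.
Hypothesis hM : forall l : nat, (mass (R_ l) <= (V * rho `^ (l%:R * (d - n.+1%:R)))%:E)%E.
Hypothesis hB : forall l : nat, (mass (boundary (R_ l)) <= (V * b l)%:E)%E.
Hypothesis b0 : forall l, 0 <= b l.
Hypothesis bd : forall l : nat, b l <= rho `^ (l%:R * (d - n%:R)).
Hypothesis C20 : 0 <= C2.
Hypothesis bsum : forall k : nat, \sum_(l < k) b l <= C2 * rho `^ (k%:R * (d - n%:R)).
Variable alpha : 'I_n.+1 -> R.
Hypothesis alpha01 : forall i, 0 < alpha i <= 1.
Local Notation Rn := 'rV[R]_n.+1.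
Let tau := \sum_i alpha i.
Hypothesis dtau : d < tau.
Let sg := tau - n%:R.

Let rho0 : 0 < rho. Proof. exact: lt_trans ltr01 rho1. Qed.
Let sg0 : 0 < sg. Proof. by rewrite subr_gt0; exact: le_lt_trans dn dtau. Qed.
Let Vb0 l : 0 <= V * b l. Proof. exact: mulr_ge0. Qed.
Let sc := scale_const alpha.
Let sc0 : 0 <= sc. Proof. exact: scale_const_ge0. Qed.

(** The common ratio of the mass and boundary contributions at the scales [rho^-k]; see [mass_scale]
    and [boundary_scale]. *)
Definition decay : R := rho `^ (d - tau).
Let q := decay.
Lemma decay_gt0 : 0 < q. Proof. exact: powR_gt0. Qed.
Lemma decay_lt1 : q < 1.
Proof.
by rewrite /q /decay /powR (gt_eqF rho0) -expR0 ltr_expR nmulr_rlt0 ?subr_lt0// ln_gt0.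
Qed.

Lemma decayX (k : nat) : rho `^ (k%:R * (d - tau)) = q ^+ k.
Proof. by rewrite mulrC powRrM powR_mulrn// ltW// powR_gt0. Qed.

Definition scale (k : nat) : R := rho `^ (- k%:R).
Lemma scale_gt0 k : 0 < scale k. Proof. exact: powR_gt0. Qed.
Lemma scale_le1 k : scale k <= 1.
Proof. by rewrite -(powRr0 rho) ler_powR ?oppr_le0// ltW. Qed.

Lemma scale_pow k x : scale k `^ x = rho `^ (- k%:R * x).
Proof. by rewrite powRrM. Qed.

Lemma mass_scale (k : nat) : rho `^ (k%:R * (d - n.+1%:R)) * scale k `^ (tau - n.+1%:R) = q ^+ k.
Proof. by rewrite scale_pow -powR_add// -decayX; congr (_ `^ _); ring. Qed.

Lemma boundary_scale (k : nat) : rho `^ (k%:R * (d - n%:R)) * scale k `^ sg = q ^+ k.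
Proof. by rewrite scale_pow -powR_add// -decayX; congr (_ `^ _); rewrite /sg; ring. Qed.

(** Only the Hoelder constant is recorded; the Lipschitz constant is merely required to exist, since
    it must not enter the estimates. *)
Definition regular (psi : X -> Rn) (L : R) : Prop :=
  (exists2 c : R, 0 <= c & forall j, lipc c (coords psi j)) /\
  forall j, hoelderc (alpha j) L (coords psi j).

Let pw l (psi : X -> Rn) (f : Rn -> R) := R_ l (f \o psi) (coords psi).
Let S k (psi : X -> Rn) (f : Rn -> R) := partial_sum R_ k (f \o psi) (coords psi).

Lemma regular_le psi L L' : L <= L' -> regular psi L -> regular psi L'.
Proof. by move=> LL [h1 h2]; split => // j; exact: hoelder_le LL (h2 j). Qed.

Lemma single_bound l psi L f : 0 <= L -> regular psi L -> is_lip f -> (forall y, `|f y| <= 1) ->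
  `|pw l psi f| <= (1 + sc) * V * L ^+ n.+1 * q ^+ l.
Proof.
move=> L0 [[c c0 lc] hc] hf f1.
apply: le_trans (push_scale_bound (hR l) (hM l) (hB l) (Vb0 l) alpha01 sg0 c0 L0 lc hc hf f1
  (mulr_ge0 V0 (powR_ge0 _ _)) (scale_gt0 l) (scale_le1 l)) _.
rewrite -/tau -/sg -[V * _ * _]mulrA mass_scale [leRHS]mulrAC ler_wpM2r ?exprn_ge0//.
rewrite [leRHS](_ : _ = V * q ^+ l + sc * V * q ^+ l); last by ring.
rewrite lerD2l -(boundary_scale l) -/sc !mulrA ler_wpM2r ?powR_ge0//.
by rewrite ler_wpM2l// mulr_ge0.
Qed.

Definition close_const : R := 2 * sc + 3 * n.+1%:R.
Lemma close_const_ge0 : 0 <= close_const.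
Proof. by rewrite addr_ge0// mulr_ge0. Qed.

Lemma single_close l psi chi L e f : 0 <= L -> 0 < e -> e <= 1 -> regular psi L -> regular chi L ->
  (forall j x, `|coords psi j x - coords chi j x| <= L * e `^ alpha j) ->
  is_lip f -> (forall y, `|f y| <= 1) ->
  `|pw l psi f - pw l chi f| <= b l * (V * (close_const * L ^+ n.+1) * e `^ sg).
Proof.
move=> L0 e0 e1 [[c c0 lc] hc] [[c' c'0 lc'] hc'] close hf f1.
have l1 j : lipc (c + c') (coords psi j) by apply: lipc_le (lc j); rewrite lerDl.
have l2 j : lipc (c + c') (coords chi j) by apply: lipc_le (lc' j); rewrite lerDr.
apply: le_trans (push_close (hR l) (hM l) (hB l) (Vb0 l) alpha01 sg0 (addr_ge0 c0 c'0) L0 e0 e1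
  l1 l2 hc hc' close hf f1) _.
by rewrite -/tau -/sg -/sc /close_const; set P := e `^ sg; rewrite le_eqVlt; apply/orP; left; apply/eqP; ring.
Qed.

Lemma sum_head k l0 : \sum_(l < k) (if (l < l0)%N then b l else 0) <= C2 * rho `^ (l0%:R * (d - n%:R)).
Proof.
have mono (k' l' : nat) : (k' <= l')%N ->
    C2 * rho `^ (k'%:R * (d - n%:R)) <= C2 * rho `^ (l'%:R * (d - n%:R)).
  by move=> kl; rewrite ler_wpM2l// ler_powR ?(ltW rho1)// ler_wpM2r ?subr_ge0// ler_nat.
have [kl|lk] := leqP k l0.
  apply: le_trans (mono _ _ kl); apply: le_trans (bsum k); apply: ler_sum => l _.
  by rewrite (leq_trans (ltn_ord l) kl).
apply: le_trans (bsum l0).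
rewrite -(big_mkord xpredT (fun l => if (l < l0)%N then b l else 0)).
rewrite (big_cat_nat (n := l0))//=; last exact: ltnW.
rewrite [X in _ + X]big_nat [X in _ + X]big1 ?addr0 => [|l /andP[h _]]; last by rewrite ltnNge h.
by rewrite big_mkord; apply: ler_sum => l _; rewrite ltn_ord.
Qed.

Lemma sum_geometric_tail k l0 :
  \sum_(l < k) (if (l < l0)%N then 0 else q ^+ l) <= q ^+ l0 / (1 - q).
Proof.
have q1 := decay_lt1; have q0 := decay_gt0.
rewrite ler_pdivlMr ?subr_gt0//.
(* The exact remainder is kept, as the plain bound is not inductive. *)
suff H : (\sum_(l < k) (if (l < l0)%N then 0 else q ^+ l)) * (1 - q) <=
    q ^+ l0 - (if (k < l0)%N then q ^+ l0 else q ^+ k).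
  apply: le_trans H _; rewrite gerBl; case: ifP => _; exact: exprn_ge0 (ltW q0).
elim: k => [|k ih].
  by rewrite big_ord0 mul0r; case: l0 => [|l0] /=; rewrite subrr.
rewrite big_ord_recr/= mulrDl; move: ih; case: (ltnP k l0) => kl ih.
  rewrite mul0r addr0; apply: le_trans ih _; rewrite subrr subr_ge0.
  have [_|lk] := ltnP k.+1 l0; first exact: lexx.
  by have -> : l0 = k.+1 by apply/eqP; rewrite eqn_leq lk kl.
rewrite ltnNge (leqW kl)/= exprS; move: ih; set A := (\sum_(_ < _) _) * _; nra.
Qed.

(** The first summand belongs to the terms estimated by the boundary, the second to those estimated
    by the mass, once for each of two maps. *)
Definition sum_const : R := close_const * C2 * rho `^ (d - n%:R) + 2 * (1 + sc) / (1 - q).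

Lemma sum_const_ge0 : 0 <= sum_const.
Proof.
have h : 0 <= 1 - q by rewrite subr_ge0 (ltW decay_lt1).
rewrite /sum_const; apply: addr_ge0; last first.
  by apply: divr_ge0 => //; apply: mulr_ge0 => //; apply: addr_ge0.
by apply: mulr_ge0 (powR_ge0 _ _); apply: mulr_ge0 => //; exact: close_const_ge0.
Qed.

(** [l0] is the least exponent with [rho^l0 >= 1 / e]. This inequality controls the tail; minimality
    bounds [rho^(l0 - 1)] by [1 / e] and so controls the head, at the price of a factor
    [rho^(d - n)]. For [l0 = 0] the head is empty. *)
Lemma exists_scale e : 0 < e -> e <= 1 -> exists l0 : nat,
  q ^+ l0 <= e `^ (tau - d) /\
  ((0 < l0)%N -> rho `^ (l0%:R * (d - n%:R)) * e `^ sg <= rho `^ (d - n%:R) * e `^ (tau - d)).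
Proof.
move=> e0 e1; have ex : exists l : nat, e^-1 <= rho ^+ l.
  have h : (fun l : nat => (rho^-1) ^+ l) @ \oo --> (0 : R).
    by apply: cvg_expr; rewrite ger0_norm ?invr_ge0 ?(ltW rho0)// invf_lt1.
  have /cvgrPdist_le /(_ _ e0)[l _ /(_ l (leqnn l))] := h.
  rewrite /= sub0r normrN ger0_norm ?exprn_ge0 ?invr_ge0 ?(ltW rho0)// exprVn => le.
  by exists l; rewrite -[leRHS]invrK lef_pV2 ?posrE// invr_gt0 exprn_gt0.
have [l0 h0 hmin] := ex_minnP ex; exists l0; split.
  have -> : q ^+ l0 = (rho ^+ l0)^-1 `^ (tau - d).
    by rewrite -decayX -powR_mulrn ?(ltW rho0)// -powRN -powRrM; congr (_ `^ _); ring.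
  apply: powR_homo; [by rewrite subr_ge0 (ltW dtau)|by rewrite invr_ge0 exprn_ge0 // (ltW rho0)|].
  by rewrite -[leRHS]invrK lef_pV2 ?posrE ?invr_gt0// exprn_gt0.
case: l0 h0 hmin => [//|m] h0 hmin _.
have hm : rho ^+ m <= e^-1.
  by rewrite leNgt; apply/negP => /ltW /hmin; rewrite ltnn.
have -> : rho `^ (m.+1%:R * (d - n%:R)) = rho `^ (d - n%:R) * (rho ^+ m) `^ (d - n%:R).
  by rewrite -powR_mulrn ?(ltW rho0)// -powRrM -powR_add//; congr (_ `^ _); rewrite -natr1; ring.
rewrite -mulrA ler_wpM2l ?powR_ge0//.
apply: (@le_trans _ _ (e^-1 `^ (d - n%:R) * e `^ sg)).
  by rewrite ler_wpM2r ?powR_ge0// powR_homo ?subr_ge0// exprn_ge0// (ltW rho0).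
have -> : e^-1 `^ (d - n%:R) = e `^ (- (d - n%:R)).
  by rewrite -[e^-1]powR_inv1 ?(ltW e0)// -powRrM mulN1r.
by rewrite -powR_add//; apply: powR_decr => //; rewrite /sg; lra.
Qed.

(** Terms of index below [l0] are compared by [single_close], where the boundary masses may grow;
    the others are bounded for each map separately by [single_bound], which decays. The crossover is
    where [rho^-l0] is of the order of [e]. *)
Lemma sum_close k psi chi L e f : 0 <= L -> 0 < e -> e <= 1 -> regular psi L -> regular chi L ->
  (forall j x, `|coords psi j x - coords chi j x| <= L * e `^ alpha j) ->
  is_lip f -> (forall y, `|f y| <= 1) ->
  `|S k psi f - S k chi f| <= sum_const * V * L ^+ n.+1 * e `^ (tau - d).
Proof.
move=> L0 e0 e1 rp rc close hf f1; have [l0 [h1 h2]] := exists_scale e0 e1.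
have q1 := decay_lt1; have q0 := decay_gt0.
have LN : 0 <= L ^+ n.+1 by exact: exprn_ge0.
have eN : 0 <= e `^ (tau - d) by exact: powR_ge0.
pose P := V * (close_const * L ^+ n.+1) * e `^ sg.
have P0 : 0 <= P by rewrite /P !mulr_ge0 ?powR_ge0// close_const_ge0.
pose Q := 2 * (1 + sc) * V * L ^+ n.+1; have Q0 : 0 <= Q by rewrite /Q !mulr_ge0// addr_ge0.
rewrite /S /partial_sum -sumrB; apply: le_trans (ler_norm_sum _ _ _) _.
apply: (@le_trans _ _ (\sum_(l < k.+1) ((if (l < l0)%N then b l else 0) * P +
   Q * (if (l < l0)%N then 0 else q ^+ l)))).
  apply: ler_sum => l _; case: ifP => _; first by rewrite mulr0 addr0; exact: single_close.
  rewrite mul0r add0r; apply: le_trans (ler_normB _ _) _.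
  have := single_bound l L0 rp hf f1; have := single_bound l L0 rc hf f1.
  by rewrite /Q /pw; lra.
rewrite big_split/= -mulr_suml -mulr_sumr.
have H2 : Q * \sum_(l < k.+1) (if (l < l0)%N then 0 else q ^+ l) <= Q * (e `^ (tau - d) / (1 - q)).
  rewrite ler_wpM2l//; apply: le_trans (sum_geometric_tail _ _) _.
  by rewrite ler_wpM2r// invr_ge0 subr_ge0 ltW.
have H1 : (\sum_(l < k.+1) (if (l < l0)%N then b l else 0)) * P <=
    C2 * V * (close_const * L ^+ n.+1) * (rho `^ (d - n%:R) * e `^ (tau - d)).
  have [l00|l00] := posnP l0.
    rewrite big1 ?mul0r => [|l _]; last by rewrite l00.
    by rewrite !mulr_ge0 ?powR_ge0// close_const_ge0.
  apply: (@le_trans _ _ (C2 * rho `^ (l0%:R * (d - n%:R)) * P)).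
    by rewrite ler_wpM2r// sum_head.
  rewrite /P [leLHS](_ : _ = C2 * V * (close_const * L ^+ n.+1) *
    (rho `^ (l0%:R * (d - n%:R)) * e `^ sg)); last by ring.
  by rewrite ler_wpM2l ?h2// !mulr_ge0// close_const_ge0.
apply: le_trans (lerD H1 H2) _.
by rewrite le_eqVlt; apply/orP; left; apply/eqP; rewrite /sum_const /Q; ring.
Qed.

Lemma sum_tail k m psi L f : (k <= m)%N -> 0 <= L -> regular psi L -> is_lip f ->
  (forall y, `|f y| <= 1) ->
  `|S m psi f - S k psi f| <= (1 + sc) * V * L ^+ n.+1 * (q ^+ k.+1 / (1 - q)).
Proof.
move=> km L0 rp hf f1.
have Q0 : 0 <= (1 + sc) * V * L ^+ n.+1 by rewrite !mulr_ge0 ?exprn_ge0// addr_ge0.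
have -> : S m psi f - S k psi f = \sum_(l < m.+1) (if (l < k.+1)%N then 0 else pw l psi f).
  rewrite /S /partial_sum -!(big_mkord xpredT (fun l => R_ l (f \o psi) (coords psi))).
  rewrite (big_cat_nat (n := k.+1))//= [X in X - _]addrC addrK.
  rewrite -(big_mkord xpredT (fun l => if (l < k.+1)%N then 0 else pw l psi f)).
  rewrite [RHS](big_cat_nat (n := k.+1))//= [X in X + _]big_nat [X in X + _]big1 ?add0r; last first.
    by move=> l /andP[_ h]; rewrite h.
  by rewrite !big_nat; apply: eq_bigr => l /andP[h _]; rewrite ltnNge h.
apply: le_trans (ler_norm_sum _ _ _) _.
apply: (@le_trans _ _ (\sum_(l < m.+1) ((1 + sc) * V * L ^+ n.+1 *
    (if (l < k.+1)%N then 0 else q ^+ l)))).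
  apply: ler_sum => l _; case: ifP => _; first by rewrite normr0 mulr0.
  exact: single_bound.
by rewrite -mulr_sumr ler_wpM2l// sum_geometric_tail.
Qed.

End partial_sums.

Section sums_of_currents.
Context {R : realType} {X : metricType R} {n : nat}.
Implicit Types S T : functional X n.

Lemma vanishes_off_sub T (K K' : set X) : K `<=` K' -> vanishes_off T K -> vanishes_off T K'.
Proof.
move=> KK h f g hf hg e; apply: h => //; rewrite -subset0 => x [fx /KK Kx].
by have : (spt f `&` K') x by []; rewrite e.
Qed.

Lemma current_zero : is_current (fun _ _ => 0 : R) (X := X) (m := n).
Proof.
split=> //.
- by move=> *; rewrite mulr0 addr0.
- by move=> *; rewrite mulr0 addr0.
- by exists set0; split; [exact: compact0|].
- by move=> *; exact: cvg_cst.
Qed.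

Lemma current_add S T : is_current S -> is_current T -> is_current (fun f g => S f g + T f g).
Proof.
move=> hS hT; split.
- by move=> a f1 f2 g h1 h2 hg; rewrite (current_linear hS)// (current_linear hT)//; ring.
- by move=> a f g i h1 h2 hf hg k1 k2; rewrite (current_multilinear hS)// (current_multilinear hT)//; ring.
- by move=> f g hf hg h; rewrite (current_local hS)// (current_local hT)// addr0.
- have [K [cK hK]] := current_compact hS; have [K' [cK' hK']] := current_compact hT.
  exists (K `|` K'); split; first exact: compactU.
  move=> f g hf hg e.
  rewrite (vanishes_off_sub (@subsetUl _ K K') hK)// (vanishes_off_sub (@subsetUr _ K K') hK')//.
  exact: addr0.
- move=> f_ g_ f g hL hf hg cf cg.
  exact: (cvgD (current_continuous hS hL hf hg cf cg) (current_continuous hT hL hf hg cf cg)).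
Qed.

Lemma partial_sumS (R_ : nat -> functional X n) k :
  partial_sum R_ k.+1 = fun f g => partial_sum R_ k f g + R_ k.+1 f g.
Proof. by apply/funext => f; apply/funext => g; rewrite /partial_sum big_ord_recr. Qed.

Lemma partial_sum0 (R_ : nat -> functional X n) : partial_sum R_ 0 = R_ 0%N.
Proof. by apply/funext => f; apply/funext => g; rewrite /partial_sum big_ord1. Qed.

Lemma current_partial_sum (R_ : nat -> functional X n) k :
  (forall l, is_current (R_ l)) -> is_current (partial_sum R_ k).
Proof.
move=> h; elim: k => [|k ih]; first by rewrite partial_sum0.
by rewrite partial_sumS; exact: current_add.
Qed.

Lemma mass_partial_sum (R_ : nat -> functional X n) (M : nat -> R) k :
  (forall l, mass (R_ l) <= (M l)%:E)%E -> (mass (partial_sum R_ k) <= (\sum_(l < k.+1) M l)%:E)%E.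
Proof.
move=> h; apply: ge_ereal_sup => _ [N [f [g [hf hg f1 ->]]]].
rewrite lee_fin /partial_sum exchange_big/=; apply: ler_sum => l _.
rewrite -lee_fin; apply: le_trans (h l); apply: ereal_sup_ubound.
by exists N, f, g.
Qed.

Lemma mass_zero : mass (fun _ _ => 0 : R) (X := X) (m := n) = 0%E.
Proof.
apply/eqP; rewrite eq_le; apply/andP; split.
  by apply: ge_ereal_sup => _ [N [f [g [_ _ _ ->]]]]; rewrite big1.
apply: ereal_sup_ubound; exists 0%N, (fun _ _ => 0), (fun _ _ _ => 0); split => //.
- by case.
- by case.
- by move=> x; rewrite big_ord0.
- by rewrite big_ord0.
Qed.

End sums_of_currents.

Lemma boundary_zero {R : realType} {X : metricType R} n :
  boundary (fun _ _ => 0 : R) = (fun _ _ => 0 : R) :> functional X n.-1.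
Proof. by case: n. Qed.

Section boundary_of_densities.
Context {R : realType} {n : nat}.
Local Notation Rn := 'rV[R]_n.+1.
Local Notation leb := (lebesgue_row R n.+1).

Lemma grad_zero_off_spt (f : Rn -> R) x : ~ spt f x -> grad f x (fun=> 0).
Proof.
move=> fx; have oA : open (~` spt f) by apply: closed_openC; exact: closed_closure.
have /nbhs_ballP[e /= e0 eA] : nbhs x (~` spt f) by exact: open_nbhs_nbhs.
have f0 y : `|y - x| < e -> f y = 0.
  move=> yx; apply: contrapT => /eqP fy; apply: (eA y); last exact: subset_closure.
  by rewrite -ball_normE /= distrC.
apply: (grad_near (g := fun=> 0) (r0 := e / 2)) => [|y yx|].
- by rewrite divr_gt0.
- by rewrite f0//; apply: le_lt_trans yx _; rewrite ltr_pdivrMr// ltr_pMr// ltr1n.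
- move=> e' e'0; exists 1 => // h _; rewrite /lin_row big1 => [|i _]; last by rewrite ?mulr0 ?mul0r.
  by rewrite !subrr normr0 mulr_ge0// ltW.
Qed.

(** In the ball where [u] lives, each point has a neighbourhood on which [f] vanishes, so the row of
    [f] in the determinant is zero. *)
Lemma boundary_current_of_vanishes (u : Rn -> R) (r : R) : (forall x, r < `|x| -> u x = 0) ->
  vanishes_off (boundary (current_of u)) [set y : Rn | `|y| <= r].
Proof.
move=> u0 f g hf hg fr.
have [L [D [_ _ _ gD]]] := lipschitz_jacobian (extend_head_lip hf hg).
rewrite /boundary /= (current_of_grad (fun=> 1)
  (a := fun i j x => if i == ord0 then 0 else D i j x)); last first.
  apply: filterS gD => x hx ux i; have xr : `|x| <= r.
    by rewrite leNgt; apply/negP => /u0 e; rewrite e eqxx in ux.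
  have [->|i0] := eqVneq i ord0; last exact: hx.
  rewrite /extend_head unlift_none; apply: grad_zero_off_spt => fx.
  by have : (spt f `&` [set y : Rn | `|y| <= r]) x by []; rewrite fr.
rewrite (@eq_Rintegral _ _ _ _ _ (fun=> 0)) ?Rintegral_cst ?mul0r// => x _.
rewrite (expand_det_row _ ord0) big1 ?mulr0// => j _.
by rewrite mxE eqxx mul0r.
Qed.

End boundary_of_densities.

Section variation_bounds.
Context {R : realType} {n : nat}.
Local Notation Rn := 'rV[R]_n.
Local Notation leb := (lebesgue_row R n).

(** Each coordinate derivative is tested separately, with everywhere differentiable Lipschitz
    functions; this is what [push_divergence] delivers. *)
Definition divergence_bound (u : Rn -> R) (A : R) : Prop :=
  forall (F : Rn -> R) (D : 'I_n -> Rn -> R) i, is_lip F -> (forall x, grad F x (D ^~ x)) ->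
    (forall x, `|F x| <= 1) -> `|\int[leb]_x (u x * D i x)| <= A.

Lemma divergence_bound0 : divergence_bound (fun=> 0) 0.
Proof.
move=> F D i _ _ _; rewrite (@eq_Rintegral _ _ _ _ _ (fun=> 0)) => [|x _]; last by rewrite mul0r.
by rewrite Rintegral_cst// mul0r normr0.
Qed.

(** A field of Euclidean norm at most 1 has components at most 1, which are tested one by one,
    whence the factor [n]. Their derivatives are replaced by almost everywhere equal bounded
    measurable ones, so that the integral can be split. *)
Lemma variation_sub (u w : Rn -> R) A B : intg leb u -> intg leb w ->
  divergence_bound u A -> divergence_bound w B ->
  (variation_Rn (fun x => (u x - w x)%R) <= (n%:R * (A + B))%:E)%E.
Proof.
move=> iu iw hu hw; apply: ge_ereal_sup => _ [F [cF F1 ->]]; rewrite lee_fin.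
have Fl i := C1c_component_lip i cF.
have [L [D [L0 mD DL gD]]] := lipschitz_jacobian Fl.
pose E i k x := ('D_(delta_mx ord0 k) F x) ord0 i.
have gE i x : grad (fun y => F y ord0 i) x ((E i) ^~ x).
  by apply: differentiable_grad; case: cF => h _ _; exact: h.
have DE : {ae leb, forall x i, E i i x = D i i x}.
  by apply: filterS gD => x h i; rewrite -(grad_derive i (gE i x)) -(grad_derive i (h i)).
have FF i x : `|F x ord0 i| <= 1.
  rewrite -(@ler_sqr _ `|_|) ?nnegrE// expr1n real_normK ?num_real//; apply: le_trans (F1 x).
  by rewrite (bigD1 i)//= lerDl; apply: sumr_ge0 => j _; exact: sqr_ge0.
have iD z i : intg leb z -> intg leb (fun x => z x * D i i x).
  by move=> iz; exact: intg_mulb iz (mD i i) (DL i i).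
have key i : `|\int[leb]_x ((u x - w x) * D i i x)| <= A + B.
  rewrite (@eq_Rintegral _ _ _ _ _ (fun x => u x * D i i x - w x * D i i x)) => [|x _]; last by rewrite mulrBl.
  rewrite IntB; [|exact: iD|exact: iD]; apply: le_trans (ler_normB _ _) _; apply: lerD.
    rewrite (@Int_ae_eq _ _ _ leb _ (fun x => u x * E i i x)); first exact: hu (Fl i) (gE i) (FF i).
    by apply: filterS DE => x ->.
  rewrite (@Int_ae_eq _ _ _ leb _ (fun x => w x * E i i x)); first exact: hw (Fl i) (gE i) (FF i).
  by apply: filterS DE => x ->.
rewrite (@Int_ae_eq _ _ _ leb _ (fun x => \sum_i (u x - w x) * D i i x)); last first.
  apply: filterS gD => x h; rewrite -mulr_sumr; congr (_ * _); apply: eq_bigr => i _.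
  exact: grad_derive (h i).
rewrite Int_sum => [|i]; last by apply: iD; exact: intgB.
apply: le_trans (ler_norm _) _; apply: le_trans (ler_norm_sum _ _ _) _.
by apply: le_trans (ler_sum _ (fun i _ => key i)) _; rewrite sumr_const card_ord mulr_natl.
Qed.

Lemma ess_support_ball (u : Rn -> R) (r : R) : (forall x, r < `|x| -> u x = 0) ->
  ess_support u `<=` [set x | `|x| <= r].
Proof.
move=> u0 x hx /=; rewrite leNgt; apply/negP => rx.
apply: (hx (~` [set y | `|y| <= r])) => [|/=|].
- by apply: closed_openC; exact: closed_norm_le_row.
- by apply/negP; rewrite -ltNge.
- rewrite (_ : _ `&` _ = set0); first exact: negligible_set0.
  rewrite -subset0 => y [/= /negP]; rewrite -ltNge => /u0 ->; by rewrite eqxx.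
Qed.

Lemma L1c_ball (u : Rn -> R) (r : R) : intg leb u -> (forall x, r < `|x| -> u x = 0) -> L1c u.
Proof.
move=> iu u0; split => //; exists [set x | `|x| <= r]; split; first exact: compact_norm_le.
by apply: aeW => x /= /negP; rewrite -ltNge; exact: u0.
Qed.

End variation_bounds.

Lemma boundary_partial_sum {R : realType} {X : metricType R} n (R_ : nat -> functional X n.+1) k :
  boundary (partial_sum R_ k) = partial_sum (fun l => boundary (R_ l)) k.
Proof. by []. Qed.

Lemma hoelder_bounded {R : realType} {X : metricType R} n (alpha : 'I_n -> R) H (phi : X -> 'rV[R]_n)
  (K : set X) : compact K -> (forall i, 0 < alpha i <= 1) -> 0 <= H ->
  (forall j, hoelderc (alpha j) H (fun x => phi x ord0 j)) ->
  exists2 r : R, 0 <= r & forall x, K x -> `|phi x| <= r.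
Proof.
move=> cK a01 H0 h; have [D D0 hD] := compact_diameter cK.
have [[x0 Kx0]|K0] := pselect (exists x, K x); last first.
  by exists 0 => // x Kx; exfalso; apply: K0; exists x.
exists (`|phi x0| + H * (1 + D)) => [|x Kx]; first by rewrite addr_ge0// mulr_ge0// addr_ge0.
have := hoelder_diameter a01 H0 D0 h (hD x x0 Kx Kx0); have := lerB_dist (phi x) (phi x0); lra.
Qed.

Lemma powR_dilate {R : realType} (rho t a : R) : 1 <= rho -> 0 <= t -> a <= 1 ->
  (rho * t) `^ a <= rho * t `^ a.
Proof.
move=> r1 t0 a1; have r0 : 0 <= rho by exact: le_trans ler01 r1.
rewrite powRM//; apply: ler_wpM2r; first exact: powR_ge0.
by rewrite -[leRHS](powRr1 r0); exact: ler_powR.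
Qed.

Lemma powR_pred_le {R : realType} (t s a : R) : 0 < t -> t <= s -> a <= 1 ->
  s `^ (a - 1) <= t `^ (a - 1).
Proof.
move=> t0 ts a1; have e (y : R) : y `^ (a - 1) = (y `^ (1 - a))^-1 by rewrite -powRN opprB.
have s0 : 0 < s by exact: lt_le_trans ts.
rewrite !e lef_pV2 ?posrE ?powR_gt0//; apply: powR_homo ts; last exact: ltW.
by rewrite subr_ge0.
Qed.

(** * The densities of the regularized partial sums and their limit *)

Section core.
Context {R : realType}.
Variables (X : metricType R) (n : nat) (R_ : nat -> functional X n.+1) (T : functional X n.+1).
Variables (V d rho C2 : R) (b : nat -> R) (K : set X).
Hypothesis hR : forall l, is_current (R_ l).
Hypothesis rho1 : 1 < rho.
Hypothesis V0 : 0 <= V.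
Hypothesis dn : n%:R <= d.
Hypothesis hM : forall l : nat, (mass (R_ l) <= (V * rho `^ (l%:R * (d - n.+1%:R)))%:E)%E.
Hypothesis hB : forall l : nat, (mass (boundary (R_ l)) <= (V * b l)%:E)%E.
Hypothesis b0 : forall l, 0 <= b l.
Hypothesis bd : forall l : nat, b l <= rho `^ (l%:R * (d - n%:R)).
Hypothesis C20 : 0 <= C2.
Hypothesis bsum : forall k : nat, \sum_(l < k) b l <= C2 * rho `^ (k%:R * (d - n%:R)).
Hypothesis hK : forall k, vanishes_off (partial_sum R_ k) K.
Hypothesis limT : forall f g, is_lip f -> (forall i, is_lip (g i)) ->
  (fun k => partial_sum R_ k f g) @ \oo --> T f g.
Variable alpha : 'I_n.+1 -> R.
Hypothesis alpha01 : forall i, 0 < alpha i <= 1.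
Local Notation Rn := 'rV[R]_n.+1.
Local Notation leb := (lebesgue_row R n.+1).
Let tau := \sum_i alpha i.
Hypothesis dtau : d < tau.
Variables (phi : X -> Rn) (H r0 : R).
Hypothesis H0 : 0 <= H.
Hypothesis hphi : forall j, hoelderc (alpha j) H (coords phi j).
Hypothesis r00 : 0 <= r0.
Hypothesis phiK : forall x, K x -> `|phi x| <= r0.

Let rho0 : 0 < rho. Proof. exact: lt_trans ltr01 rho1. Qed.
Let q := decay d rho alpha.
Let tk := scale rho.
Let tk0 k : 0 < tk k. Proof. exact: scale_gt0. Qed.
Let tk1 k : tk k <= 1. Proof. exact: scale_le1. Qed.
Let S k := partial_sum R_ k.
Let hS k : is_current (S k). Proof. exact: current_partial_sum. Qed.
Let MS k : R := \sum_(l < k.+1) V * rho `^ (l%:R * (d - n.+1%:R)).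
Let hMS k : (mass (S k) <= (MS k)%:E)%E. Proof. exact: (mass_partial_sum k hM). Qed.
(** [partial_sum R_ k] has [k.+1] terms, so [bsum] is used at [k.+1]; this is the origin of the
    factor [rho^(d - n)] in the variation bound. *)
Let BS (k : nat) : R := V * (C2 * rho `^ (k.+1%:R * (d - n%:R))).
Let hBS k : (mass (boundary (S k)) <= (BS k)%:E)%E.
Proof.
rewrite boundary_partial_sum; apply: le_trans (mass_partial_sum _ hB) _.
by rewrite lee_fin -mulr_sumr ler_wpM2l// bsum.
Qed.
Let BS0 k : 0 <= BS k. Proof. by rewrite !mulr_ge0// powR_ge0. Qed.

Let phit t := inf_convolution alpha H phi t.

Lemma conv_regular t : 0 < t -> regular alpha (phit t) (3 * H).
Proof.
move=> t0; split=> [|j]; last exact: (conv_hoelder alpha01 H0 hphi).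
exists (\sum_j H * t `^ (alpha j - 1)) => [|j]; first by apply: sumr_ge0 => j _; rewrite mulr_ge0// powR_ge0.
apply: lipc_le (conv_lip alpha01 H0 hphi j t0).
by rewrite (bigD1 j)//= lerDl; apply: sumr_ge0 => i _; rewrite mulr_ge0// powR_ge0.
Qed.

Let bound_pos L : 0 <= L -> r0 + L + 2 < (Num.bound (r0 + L + 2))%:R.
Proof. by move=> L0; apply: archi_boundP; rewrite addr_ge0// addr_ge0. Qed.

Let near_norm L psi x : 0 <= L -> (forall j x, `|coords psi j x - coords phi j x| <= L) ->
  K x -> `|psi x| <= r0 + L.
Proof.
move=> L0 h Kx; have hx : `|psi x - phi x| <= L.
  by apply: row_norm_le => // j; have := h j x; rewrite /coords !mxE.
by have := lerB_dist (psi x) (phi x); have := phiK Kx; lra.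
Qed.

(** The inner 2 is the margin that [push_density] asks of the image of [K], the outer 2 the one it
    adds to the support of the density. *)
Definition box (L : R) : R := (Num.bound (r0 + L + 2) + 2)%:R.

Lemma box_ge L : 0 <= L -> r0 + L <= box L.
Proof. by move=> L0; have := bound_pos L0; rewrite /box natrD; lra. Qed.

Lemma partial_density psi L k : 0 <= L -> regular alpha psi L ->
  (forall j x, `|coords psi j x - coords phi j x| <= L) -> exists u : Rn -> R,
  [/\ intg leb u, forall x, box L < `|x| -> u x = 0,
      forall f, is_lip f -> S k (f \o psi) (coords psi) = \int[leb]_x (u x * f x) &
      eq_current (pushforward_current psi (S k)) (current_of u)].
Proof.
move=> L0 [[c c0 lc] hc] close.
have N0 x : K x -> `|psi x| + 2 < (Num.bound (r0 + L + 2))%:R.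
  by move=> Kx; have := near_norm L0 close Kx; have := bound_pos L0; lra.
have [u [iu u0 iuf uf]] := push_density (hS k) (hMS k) (hBS k) (hK k) (fun=> c0) lc N0.
exists u; split => //; exact: (push_representation (hS k) (hMS k) (hK k) (fun=> c0) lc N0 iu u0 uf).
Qed.

Lemma partial_L1_close psi chi L A k (u w : Rn -> R) : intg leb u -> intg leb w ->
  (forall f, is_lip f -> S k (f \o psi) (coords psi) = \int[leb]_x (u x * f x)) ->
  (forall f, is_lip f -> S L (f \o chi) (coords chi) = \int[leb]_x (w x * f x)) ->
  (forall f, is_lip f -> (forall y, `|f y| <= 1) ->
    `|S k (f \o psi) (coords psi) - S L (f \o chi) (coords chi)| <= A) ->
  \int[leb]_x `|u x - w x| <= A.
Proof.
move=> iu iw hu hw h; apply: L1_duality => [|f hf f1]; first exact: intgB.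
rewrite (@eq_Rintegral _ _ _ _ _ (fun x => u x * f x - w x * f x)) => [|x _]; last by rewrite mulrBl.
have mf := is_lip_measurable hf.
rewrite IntB; [|exact: intg_mulb iu mf f1|exact: intg_mulb iw mf f1].
by rewrite -hu// -hw//; exact: h.
Qed.

(** The 1 is for the new term, estimated by its mass; the rest is for moving the scale from [rho^-k]
    to [rho^-(k+1)], where [1 + rho] bounds the joint displacement. *)
Definition incr_const : R := 1 + C2 * n.+1%:R * (1 + rho).

Lemma incr_const_ge0 : 0 <= incr_const.
Proof. by rewrite addr_ge0// !mulr_ge0// addr_ge0// ltW. Qed.

Lemma first_bound f : is_lip f -> (forall y, `|f y| <= 1) ->
  `|S 0 (f \o phit (tk 0)) (coords (phit (tk 0)))| <= incr_const * V * H ^+ n.+1.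
Proof.
move=> hf f1; rewrite /S partial_sum0.
have cj j : 0 <= H * tk 0 `^ (alpha j - 1) by rewrite mulr_ge0// powR_ge0.
apply: le_trans (push_bound (hR 0%N) (hM 0%N) cj (fun j => conv_lip alpha01 H0 hphi j (tk0 0)) hf f1) _.
rewrite mul0r powRr0 mulr1 (eq_bigr (fun=> H)) => [|j _]; last by rewrite /tk /scale oppr0 powRr0 powR1 mulr1.
rewrite prodr_const card_ord ler_wpM2r ?exprn_ge0// -[leLHS]mul1r ler_wpM2r//.
by rewrite lerDl !mulr_ge0// addr_ge0// ltW.
Qed.

Lemma dilation_bound k t f : 0 < t -> is_lip f -> (forall y, `|f y| <= 1) ->
  `|S k (f \o phit t) (coords (phit t)) - S k (f \o phit (rho * t)) (coords (phit (rho * t)))| <=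
    BS k * (n.+1%:R * (H * (1 + rho) * H ^+ n)) * t `^ (tau - n%:R).
Proof.
move=> t0 hf f1; have s0 : 0 < rho * t by exact: mulr_gt0.
have ts : t <= rho * t by rewrite ler_peMl// ltW.
have E0 : 0 <= H * (1 + rho) by rewrite mulr_ge0// addr_ge0// ltW.
apply: (push_compare (hS k) (hMS k) (hBS k) (BS0 k) E0 H0 t0 _ _ _ hf f1).
- by move=> j; exact: conv_lip.
- move=> j; apply: lipc_le (conv_lip alpha01 H0 hphi j s0); apply: ler_wpM2l => //.
  by apply: powR_pred_le => //; case/andP: (alpha01 j).
- move=> j x; have /andP[a0 a1] := alpha01 j.
  have k1 := conv_near alpha01 H0 hphi j x t0; have k2 := conv_near alpha01 H0 hphi j x s0.
  have k4 : H * (rho * t) `^ alpha j <= H * (rho * t `^ alpha j).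
    by apply: ler_wpM2l => //; apply: powR_dilate => //; exact: ltW.
  move: k1 k2; rewrite -/(phit t) -/(phit _) => k1 k2.
  rewrite [leRHS](_ : _ = H * t `^ alpha j + H * (rho * t `^ alpha j)); last by ring.
  apply: le_trans (ler_distD (coords phi j x) _ _) _; apply: lerD => //.
  by rewrite distrC; exact: le_trans k2 k4.
Qed.

Let tkS k : tk k = rho * tk k.+1.
Proof.
by rewrite /tk /scale -{2}(powRr1 (ltW rho0)) -powR_add//; congr (_ `^ _); rewrite -natr1; ring.
Qed.

(** The increment is the new term at the new scale plus the change of the old partial sum between
    the two scales. As [BS k] carries the exponent of index [k.+1], both parts are of order
    [q ^+ k.+1]. *)
Lemma increment_bound k f : is_lip f -> (forall y, `|f y| <= 1) ->
  `|S k.+1 (f \o phit (tk k.+1)) (coords (phit (tk k.+1))) -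
    S k (f \o phit (tk k)) (coords (phit (tk k)))| <= incr_const * V * H ^+ n.+1 * q ^+ k.+1.
Proof.
move=> hf f1; have h2 := dilation_bound k (tk0 k.+1) hf f1; rewrite -tkS in h2.
have cj j : 0 <= H * tk k.+1 `^ (alpha j - 1) by rewrite mulr_ge0// powR_ge0.
have h1 := push_bound (hR k.+1) (hM k.+1) cj (fun j => conv_lip alpha01 H0 hphi j (tk0 k.+1)) hf f1.
have e1 : rho `^ (k.+1%:R * (d - n%:R)) * tk k.+1 `^ (tau - n%:R) = q ^+ k.+1 by exact: boundary_scale.
have e2 : rho `^ (k.+1%:R * (d - n.+1%:R)) * tk k.+1 `^ (tau - n.+1%:R) = q ^+ k.+1 by exact: mass_scale.
have -> : S k.+1 (f \o phit (tk k.+1)) (coords (phit (tk k.+1))) =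
   S k (f \o phit (tk k.+1)) (coords (phit (tk k.+1))) +
   R_ k.+1 (f \o phit (tk k.+1)) (coords (phit (tk k.+1))) by rewrite /S partial_sumS.
have F (P Q W x y : R) : `|Q| <= x -> `|P - W| <= y -> `|P + Q - W| <= y + x.
  by move=> hx hy; rewrite addrAC; apply: le_trans (ler_normD _ _) (lerD hy hx).
apply: le_trans (F _ _ _ _ _ h1 h2) _.
rewrite prod_scale; last exact: tk0.
rewrite sum_pred_all card_ord -/tau /BS /incr_const; move: e1 e2.
set A := rho `^ _; set B := _ `^ (tau - n%:R); set A' := rho `^ _; set B' := _ `^ (tau - n.+1%:R) => e1 e2.
rewrite [leLHS](_ : _ = V * C2 * n.+1%:R * (1 + rho) * H ^+ n.+1 * (A * B) + V * H ^+ n.+1 * (A' * B')).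
  by rewrite e1 e2 le_eqVlt; apply/orP; left; apply/eqP; ring.
by rewrite exprS; ring.
Qed.

Lemma densities : exists w : nat -> Rn -> R, forall k,
  [/\ intg leb (w k), forall x, box (3 * H) < `|x| -> w k x = 0,
      forall f, is_lip f -> S k (f \o phit (tk k)) (coords (phit (tk k))) = \int[leb]_x (w k x * f x) &
      eq_current (pushforward_current (phit (tk k)) (S k)) (current_of (w k))].
Proof.
have H3 : 0 <= 3 * H by rewrite mulr_ge0.
suff h k : exists u : Rn -> R, [/\ intg leb u, forall x, box (3 * H) < `|x| -> u x = 0,
      forall f, is_lip f -> S k (f \o phit (tk k)) (coords (phit (tk k))) = \int[leb]_x (u x * f x) &
      eq_current (pushforward_current (phit (tk k)) (S k)) (current_of u)].
  by have [w hw] := choice h; exists w.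
apply: (partial_density k H3 (conv_regular (tk0 k))) => j x.
apply: le_trans (conv_near alpha01 H0 hphi j x (tk0 k)) _.
have /andP[a0 _] := alpha01 j; have := powR_le1 (ltW (tk0 k)) (tk1 k) (ltW a0).
by move=> h; rewrite mulrC; apply: ler_wpM2r => //; lra.
Qed.

Section weights.
Variable w : nat -> Rn -> R.
Hypothesis iw : forall k, intg leb (w k).
Hypothesis w0 : forall k x, box (3 * H) < `|x| -> w k x = 0.
Hypothesis Sw : forall k f, is_lip f ->
  S k (f \o phit (tk k)) (coords (phit (tk k))) = \int[leb]_x (w k x * f x).
Hypothesis pw : forall k, eq_current (pushforward_current (phit (tk k)) (S k)) (current_of (w k)).

Let wp k : Rn -> R := if k is l.+1 then w l else fun=> 0.
Definition increment k : Rn -> R := fun x => w k x - wp k x.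

Let iwp k : intg leb (wp k).
Proof. by case: k => [|k] /=; [exact: intg0|exact: iw]. Qed.

Lemma intg_increment k : intg leb (increment k).
Proof. exact: intgB. Qed.

Lemma increment_off k x : box (3 * H) < `|x| -> increment k x = 0.
Proof. by move=> hx; rewrite /increment w0//; case: k => [|k]/=; rewrite ?subrr// w0// subrr. Qed.

Lemma sum_increment k x : \sum_(l < k.+1) increment l x = w k x.
Proof.
elim: k => [|k ih]; first by rewrite big_ord1 /increment/= subr0.
by rewrite big_ord_recr/= ih /increment/= addrC subrK.
Qed.

Lemma increment_L1 k : \int[leb]_x `|increment k x| <= incr_const * V * H ^+ n.+1 * q ^+ k.
Proof.
apply: L1_duality => [|f hf f1]; first exact: intg_increment.
have mf := is_lip_measurable hf.
rewrite (@eq_Rintegral _ _ _ _ _ (fun x => w k x * f x - wp k x * f x)) => [|x _]; last by rewrite mulrBl.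
rewrite IntB; [|exact: intg_mulb (iw k) mf f1|exact: intg_mulb (iwp k) mf f1].
rewrite -Sw//; case: k => [|k].
  rewrite (@eq_Rintegral _ _ _ _ _ (fun=> 0)) => [|x _]; last by rewrite mul0r.
  by rewrite Rintegral_cst// mul0r subr0 expr0 mulr1; exact: first_bound.
by rewrite -Sw//; exact: increment_bound.
Qed.

Lemma weights_limit : exists v : Rn -> R, [/\ intg leb v, forall x, box (3 * H) < `|x| -> v x = 0 &
  (fun k => \int[leb]_x `|w k x - v x|) @ \oo --> (0 : R)].
Proof.
have A0 : 0 <= incr_const * V * H ^+ n.+1 by rewrite !mulr_ge0 ?exprn_ge0// incr_const_ge0.
have h N : \sum_(k < N) \int[leb]_x `|increment k x| <= incr_const * V * H ^+ n.+1 * (q ^+ 0 / (1 - q)).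
  apply: (@le_trans _ _ (\sum_(k < N) incr_const * V * H ^+ n.+1 * q ^+ k)).
    by apply: ler_sum => k _; exact: increment_L1.
  rewrite -mulr_sumr ler_wpM2l//.
  by have := sum_geometric_tail rho1 dtau N 0; rewrite (eq_bigr (fun l : 'I_N => q ^+ l)).
have [v [iv v0] cv] := intg_series intg_increment h.
exists v; split => // [x hx|]; first by apply: v0 => k; exact: increment_off.
rewrite -cvg_shiftS in cv; apply: cvg_trans cv; apply: near_eq_cvg; apply: nearW => k /=.
by apply: eq_Rintegral => x _; rewrite sum_increment.
Qed.

Let tau1 := tau - \big[Num.max/0]_i alpha i.

(** For direction [i] the Lipschitz constants leave the power [tau - alpha i - n] of the scale.
    Scales being at most 1, the largest [alpha i] is the worst, which produces [tau1]. *)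
Lemma weight_divergence k :
  divergence_bound (w k) (C2 * V * H ^+ n * rho `^ (d - n%:R) * rho `^ (k%:R * (d - tau1))).
Proof.
move=> F D i hF gF F1.
have cj j : 0 <= H * tk k `^ (alpha j - 1) by rewrite mulr_ge0// powR_ge0.
have := push_divergence (hS k) (hMS k) (hBS k) cj
  (fun j => conv_lip alpha01 H0 hphi j (tk0 k)) i (@pw k) hF gF F1.
move/le_trans; apply.
rewrite prod_scale; last exact: tk0.
rewrite cardC1 card_ord sum_pred_off -/tau.
have h : tk k `^ (tau - alpha i - n%:R) <= tk k `^ (tau1 - n%:R).
  apply: powR_decr => //; rewrite lerD2r /tau1 lerD2l lerN2.
  exact: le_bigmax.
have e : rho `^ (k.+1%:R * (d - n%:R)) * tk k `^ (tau1 - n%:R) =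
    rho `^ (d - n%:R) * rho `^ (k%:R * (d - tau1)).
  by rewrite /tk scale_pow -!powR_add//; congr (_ `^ _); rewrite -natr1; ring.
rewrite -[leRHS]mulrA -e /BS.
rewrite [leRHS](_ : _ = C2 * V * H ^+ n * rho `^ (k.+1%:R * (d - n%:R)) * tk k `^ (tau1 - n%:R)); last by rewrite mulrA.
rewrite [leLHS](_ : _ = C2 * V * H ^+ n * rho `^ (k.+1%:R * (d - n%:R)) * tk k `^ (tau - alpha i - n%:R)); last by rewrite /=; ring.
by apply: ler_wpM2l h; rewrite !mulr_ge0// ?exprn_ge0// powR_ge0.
Qed.

(** Consequently [d - tau1] is nonnegative, and the variation bound of one index also covers the
    preceding one. *)
Lemma tau1_le : tau1 <= n%:R.
Proof.
have [i0 _ hi0] := eq_bigmax ord0 xpredT alpha isT (fun i _ => ltW (proj1 (andP (alpha01 i)))).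
rewrite /tau1 hi0 /tau (bigD1 i0)//= addrAC subrr add0r.
apply: (@le_trans _ _ (\sum_(i < n.+1 | i != i0) 1)).
  by apply: ler_sum => j _; case/andP: (alpha01 j).
by rewrite sumr_const cardC1 card_ord.
Qed.

Lemma increment_variation k : (variation_Rn (increment k) <=
  (n.+1%:R * (2 * (C2 * V * H ^+ n * rho `^ (d - n%:R))) * rho `^ (k%:R * (d - tau1)))%:E)%E.
Proof.
set A := C2 * V * H ^+ n * rho `^ (d - n%:R).
have A0 : 0 <= A by rewrite !mulr_ge0 ?exprn_ge0 ?powR_ge0.
have hp : divergence_bound (wp k) (A * rho `^ (k%:R * (d - tau1))).
  case: k => [|k] F D i hF gF F1.
    rewrite (_ : wp 0 = fun=> 0)//; have := divergence_bound0 i hF gF F1.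
    by move/le_trans; apply; rewrite mulr_ge0// powR_ge0.
  apply: (le_trans (weight_divergence k i hF gF F1)); rewrite ler_wpM2l// ler_powR ?(ltW rho1)//.
  by rewrite ler_wpM2r ?ler_nat// subr_ge0; exact: le_trans tau1_le dn.
apply: le_trans (variation_sub (iw k) (iwp k) (weight_divergence k) hp) _.
by rewrite lee_fin le_eqVlt; apply/orP; left; apply/eqP; rewrite -/A; ring.
Qed.

Lemma scale_eventually e : 0 < e -> exists k0, forall k, (k0 <= k)%N -> tk k <= e.
Proof.
move=> e0; have h : (fun k : nat => rho^-1 ^+ k) @ \oo --> (0 : R).
  by apply: cvg_expr; rewrite ger0_norm ?invr_ge0 ?(ltW rho0)// invf_lt1.
have /cvgrPdist_le /(_ _ e0)[k0 _ hk] := h.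
exists k0 => k kk; have := hk k kk; rewrite /= sub0r normrN ger0_norm ?exprn_ge0 ?invr_ge0 ?(ltW rho0)//.
by rewrite /tk /scale powRN powR_mulrn ?(ltW rho0)// exprVn.
Qed.

(** [w k] and the sum of the integer densities of the images of the [R_ l] have the same integrals
    against Lipschitz functions, so they agree almost everywhere. *)
Lemma weights_integer : (forall l psi, lipschitz_map_on setT psi -> exists2 u, L1cZ u &
    eq_current (pushforward_current psi (R_ l)) (current_of u)) ->
  forall k, {ae leb, forall x, w k x \is a Num.int}.
Proof.
move=> hint k; have lpsi : lipschitz_map_on setT (phit (tk k)).
  have cj j : 0 <= H * tk k `^ (alpha j - 1) by rewrite mulr_ge0// powR_ge0.
  have [L _ hL] := coords_lip cj (fun j => conv_lip alpha01 H0 hphi j (tk0 k)).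
  by exists L => x y _ _; rewrite mdist_rowE distrC.
have [u hu] := choice (fun l => let: ex_intro2 u h1 h2 := hint l _ lpsi in
  ex_intro (fun u => L1cZ u /\ eq_current (pushforward_current (phit (tk k)) (R_ l)) (current_of u)) u
    (conj h1 h2)).
have iu l : intg leb (u l) by case: (hu l) => -[[]].
have e : {ae leb, forall x, w k x = \sum_(l < k.+1) u l x}.
  apply: L1_unique => [//||f hf f1]; first exact: intg_sum.
  have mf := is_lip_measurable hf.
  rewrite [RHS](@eq_Rintegral _ _ _ _ _ (fun x => \sum_(l < k.+1) u l x * f x)) => [|x _]; last by rewrite mulr_suml.
  rewrite Int_sum => [|l]; last exact: intg_mulb (iu l) mf f1.
  rewrite -Sw// /S /partial_sum; apply: eq_bigr => l _.
  rewrite -current_of_coords -(hu l).2//.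
  by move=> i; exact: C11_is_lip (C11_coord i).
have hl : {ae leb, forall x (l : 'I_k.+1), u l x \is a Num.int}.
  by apply: ae_forall_ord => l; case: (hu l) => -[].
by apply: filterS2 e hl => x -> h; apply: rpred_sum => l _; exact: h.
Qed.

Variable v : Rn -> R.
Hypothesis iv : intg leb v.
Hypothesis v0 : forall x, box (3 * H) < `|x| -> v x = 0.
Hypothesis cv : (fun k => \int[leb]_x `|w k x - v x|) @ \oo --> (0 : R).

(** [psi] is compared with the regularizations of [phi] at scales [rho^-l <= e]: by [sum_close] and
    duality the densities of the partial sums are close in L^1, [current_of_L1] transfers this to
    general slots, and [l] tends to infinity. Writing [L - H] leaves room for the distance from
    [phi] to its regularization. *)
Lemma push_estimate (L : R) f g : 3 * H <= L -> is_lip f -> (forall i, is_lip (g i)) ->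
  exists2 C, 0 <= C & forall psi (e : R), 0 < e -> e <= 1 -> regular alpha psi L ->
    (forall j x, `|coords psi j x - coords phi j x| <= (L - H) * e `^ alpha j) ->
    `|T (f \o psi) (fun i => g i \o psi) - current_of v f g| <= C * e `^ (tau - d).
Proof.
move=> HL hf hg; have HL' : H <= L by apply: le_trans HL; rewrite ler_peMl// ler1n.
have L0 : 0 <= L by exact: le_trans HL'.
have H3 : 0 <= 3 * H by rewrite mulr_ge0.
have b3 : 0 <= box (3 * H) by apply: le_trans (box_ge H3); rewrite addr_ge0.
pose r := Num.max (box (3 * H)) (box L).
have r1 : 0 <= r by rewrite /r le_max b3.
have [C C0 hC] := current_of_L1 r1 hf hg.
have A0 : 0 <= sum_const d rho C2 alpha * V * L ^+ n.+1.
  by rewrite !mulr_ge0 ?exprn_ge0// sum_const_ge0.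
exists (C * (sum_const d rho C2 alpha * V * L ^+ n.+1)) => [|psi e e0 e1 rp close]; first exact: mulr_ge0.
have [k0 hk0] := scale_eventually e0.
have close1 j x : `|coords psi j x - coords phi j x| <= L.
  apply: le_trans (close j x) _; have /andP[a0 _] := alpha01 j.
  have := powR_le1 (ltW e0) e1 (ltW a0) => h.
  by apply: (@le_trans _ _ ((L - H) * 1)); [apply: ler_wpM2l => //; lra|lra].
have wv : (fun k => current_of (w k) f g) @ \oo --> current_of v f g.
  apply/cvgrPdist_le => z z0; have C1 : 0 < C + 1 by rewrite ltr_wpDl.
  have /cvgrPdist_le /(_ _ (divr_gt0 z0 C1)) := cv.
  apply: filterS => k; rewrite sub0r normrN => hk; rewrite distrC.
  apply: le_trans (hC _ _ (iw k) iv _ _) _.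
  - by move=> x hx; apply: w0; apply: le_lt_trans hx; rewrite /r le_max lexx.
  - by move=> x hx; apply: v0; apply: le_lt_trans hx; rewrite /r le_max lexx.
  - move: hk; rewrite ger0_norm ?Int_ge0// ler_pdivlMr//.
    by have : 0 <= \int[leb]_x `|w k x - v x| by [exact: Int_ge0]; set m := \int[leb]_x _; lra.
have [c c0 lc] := rp.1.
have cT : (fun k => S k (f \o psi) (fun i => g i \o psi) - current_of (w k) f g) @ \oo -->
    T (f \o psi) (fun i => g i \o psi) - current_of v f g.
  apply: cvgB wv; apply: limT; first exact: (comp_is_lip (fun=> c0) lc).
  by move=> i; exact: (comp_is_lip (fun=> c0) lc).
have cT' : (fun k => `|S (k + k0)%N (f \o psi) (fun i => g i \o psi) - current_of (w (k + k0)%N) f g|) @ \oo -->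
    `|T (f \o psi) (fun i => g i \o psi) - current_of v f g|.
  by apply: cvg_norm; rewrite -(cvg_shiftn k0) in cT; exact: cT.
apply: cvg_le_cst cT' _ => k /=; set l := (k + k0)%N.
have [u [iu u0 Su pu]] := partial_density l L0 rp close1.
rewrite -/(pushforward_current psi (S l) f g) pu//.
apply: le_trans (hC _ _ iu (iw l) _ _) _.
- by move=> x hx; apply: u0; apply: le_lt_trans hx; rewrite /r le_max lexx orbT.
- by move=> x hx; apply: w0; apply: le_lt_trans hx; rewrite /r le_max lexx.
rewrite -[leRHS]mulrA; apply: ler_wpM2l => //.
apply: (partial_L1_close iu (iw l) Su (@Sw l)) => h hh h1.
apply: (sum_close hR rho1 V0 dn hM hB b0 bd C20 bsum alpha01 dtau) => //.
- exact: regular_le HL (conv_regular (tk0 l)).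
- move=> j x; have /andP[a0 _] := alpha01 j.
  have k1 := close j x; have k2 := conv_near alpha01 H0 hphi j x (tk0 l).
  have k3 : H * tk l `^ alpha j <= H * e `^ alpha j.
    apply: ler_wpM2l => //; apply: powR_homo; [exact: ltW|exact: ltW|].
    by apply: hk0; rewrite leq_addl.
  apply: le_trans (ler_distD (coords phi j x) _ _) _.
  rewrite (_ : L * e `^ alpha j = (L - H) * e `^ alpha j + H * e `^ alpha j); last by ring.
  by apply: lerD => //; rewrite distrC; exact: le_trans k2 k3.
Qed.

End weights.

End core.

(** * Pushforwards under Hoelder maps *)

Section approximation.
Context {R : realType}.
Variables (X : metricType R) (n : nat).
Variable alpha : 'I_n.+1 -> R.
Hypothesis alpha01 : forall i, 0 < alpha i <= 1.
Local Notation Rn := 'rV[R]_n.+1.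
Variables (rho : R).
Hypothesis rho1 : 1 < rho.
Variables (phi : X -> Rn) (H : R).
Hypothesis H0 : 0 <= H.
Hypothesis hphi : forall j, hoelderc (alpha j) H (coords phi j).

Let rho0 : 0 < rho. Proof. exact: lt_trans ltr01 rho1. Qed.

Lemma scale_pow_cvg0 (a : R) : 0 < a -> (fun k : nat => scale rho k `^ a) @ \oo --> (0 : R).
Proof.
move=> a0; have e (k : nat) : scale rho k `^ a = (rho `^ (- a)) ^+ k.
  by rewrite scale_pow -powR_mulrn ?powR_ge0// -powRrM; congr (_ `^ _); ring.
rewrite (_ : (fun k => _) = fun k => (rho `^ (- a)) ^+ k); last by apply/funext.
apply: cvg_expr; rewrite ger0_norm ?powR_ge0//.
by rewrite /powR (gt_eqF rho0) -expR0 ltr_expR nmulr_rlt0 ?oppr_lt0// ln_gt0.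
Qed.

Lemma small_scale (C s z : R) : 0 <= C -> 0 < s -> 0 < z -> exists l, C * scale rho l `^ s <= z.
Proof.
move=> C0 s0 z0; have C1 : 0 < C + 1 by rewrite ltr_wpDl.
have /cvgrPdist_le /(_ _ (divr_gt0 z0 C1)) [l _ /(_ l (leqnn l))] := scale_pow_cvg0 s0.
rewrite /= sub0r normrN ger0_norm ?powR_ge0// ler_pdivlMr// mulrDr mulr1 => h; exists l.
by rewrite mulrC; apply: le_trans h; rewrite lerDl powR_ge0.
Qed.

Lemma approximates_regular phi_ : approximates alpha phi phi_ ->
  exists2 L, 0 <= L & forall k, regular alpha (phi_ k) L.
Proof.
move=> [hl _ [L hL]]; have hL' k j : 0 <= L /\ hoelderc (alpha j) L (coords (phi_ k) j).
  by apply/(HolderP _ _ (proj1 (andP (alpha01 j)))); exact: hL.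
exists L => [|k]; first exact: (hL' 0%N ord0).1.
split=> [|j]; last exact: (hL' k j).2.
have [c hc] := hl k; exists `|c| => // j x y.
have := row_norm_coord (phi_ k y - phi_ k x) j; rewrite !mxE distrC => /le_trans; apply.
by apply: le_trans (hc x y I I) _; rewrite ler_wpM2r ?mdist_ge0// ler_norm.
Qed.

Lemma approximates_near phi_ e : approximates alpha phi phi_ -> 0 < e ->
  \forall k \near \oo, forall j x, `|coords (phi_ k) j x - coords phi j x| <= e.
Proof.
move=> [_ /(uniform_cvg_ballP (R := R)) h _] e0; apply: filterS (h e e0) => k hk j x.
have := hk x; rewrite -ball_normE /= => /ltW; apply: le_trans.
by have := row_norm_coord (phi x - phi_ k x) j; rewrite !mxE distrC.
Qed.

Lemma approximates_bounded phi_ (K : set X) : approximates alpha phi phi_ -> compact K ->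
  exists r, forall k x, K x -> `|phi_ k x| <= r.
Proof.
move=> ha cK; have [L L0 hL] := approximates_regular ha.
have [[x0 Kx0]|K0] := pselect (exists x, K x); last first.
  by exists 0 => k x Kx; exfalso; apply: K0; exists x.
have [D D0 hD] := compact_diameter cK.
have cx : (fun k => phi_ k x0) @ \oo --> phi x0.
  case: ha => [_ /(uniform_cvg_ballP (R := R)) h _].
  by apply/cvg_ballP => e e0; apply: filterS (h e e0) => k; exact.
have [M hM] : exists M, forall k, `|phi_ k x0| <= M.
  have /cvg_seq_bounded [M [_ hM]] : cvgn (fun k => phi_ k x0) by apply/cvg_ex; exists (phi x0).
  by exists (M + 1) => k; apply: (hM (M + 1)) => //; rewrite ltrDl.
exists (M + L * (1 + D)) => k x Kx.
have := hoelder_diameter alpha01 L0 D0 (hL k).2 (hD x x0 Kx Kx0).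
by have := lerB_dist (phi_ k x) (phi_ k x0); have := hM k; lra.
Qed.

Lemma conv_approximates :
  approximates alpha phi (fun k => inf_convolution alpha H phi (scale rho k)).
Proof.
split.
- move=> k; have cj j : 0 <= H * scale rho k `^ (alpha j - 1) by rewrite mulr_ge0// powR_ge0.
  have [L _ hL] := coords_lip cj (fun j => conv_lip alpha01 H0 hphi j (scale_gt0 rho1 k)).
  by exists L => x y _ _; rewrite mdist_rowE distrC.
- apply/(uniform_cvg_ballP (R := R)) => e e0.
  have e20 : 0 < e / 2 by rewrite divr_gt0.
  have h : \forall k \near \oo, forall j, H * scale rho k `^ alpha j <= e / 2.
    apply: filter_forall => j; have /andP[a0 _] := alpha01 j.
    have cv : (fun k => H * scale rho k `^ alpha j) @ \oo --> (0 : R).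
      by rewrite -[X in _ --> X](mulr0 H); apply: cvgMl_tmp; exact: scale_pow_cvg0.
    have /cvgrPdist_le /(_ _ e20) := cv; apply: filterS => k.
    by rewrite sub0r normrN => /(le_trans (ler_norm _)).
  apply: filterS h => k hk x; rewrite -ball_normE /=.
  apply: (@le_lt_trans _ _ (e / 2)); last by rewrite ltr_pdivrMr// ltr_pMr// ltr1n.
  apply: row_norm_le => [|j]; first exact: ltW.
  rewrite !mxE distrC; have := conv_near alpha01 H0 hphi j x (scale_gt0 rho1 k).
  by rewrite /coords mxE => /le_trans; apply; exact: hk.
- exists (3 * H) => k j; have /andP[a0 _] := alpha01 j; apply/(HolderP _ _ a0); split.
    by rewrite mulr_ge0.
  exact: (conv_hoelder alpha01 H0 hphi j (scale_gt0 rho1 k)).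
Qed.

(** The approximants share a Hoelder constant and are eventually within [e <= e^(alpha j)] of [phi],
    so the estimate applies to them. *)
Lemma pushforward_of_estimate (T : functional X n.+1) (v : Rn -> R) (K : set X) (s : R) :
  compact K -> vanishes_off T K -> 0 < s ->
  (forall (L : R) f g, 3 * H <= L -> is_lip f -> (forall i, is_lip (g i)) ->
    exists2 C, 0 <= C & forall psi (e : R), 0 < e -> e <= 1 -> regular alpha psi L ->
    (forall j x, `|coords psi j x - coords phi j x| <= (L - H) * e `^ alpha j) ->
    `|T (f \o psi) (fun i => g i \o psi) - current_of v f g| <= C * e `^ s) ->
  is_pushforward alpha phi T (current_of v).
Proof.
move=> cK hK s0 est; split; first by eexists; exact: conv_approximates.
move=> phi_ ha; have [L L0 hL] := approximates_regular ha; split.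
  have [r hr] := approximates_bounded ha cK.
  exists [set y | `|y| <= r]; split; first exact: compact_norm_le.
  move=> k _; apply: support_in_ball; have [[c c0 lc] _] := hL k.
  exact: (push_vanishes (fun=> c0) lc hK (hr k)).
move=> f g hf hg.
(* The added 1 makes this constant minus [H], the coefficient in the closeness condition, at least
   1. *)
have HL : 3 * H <= 3 * H + L + 1 by rewrite -addrA lerDl addr_ge0.
have [C C0 hC] := est _ f g HL hf hg.
apply/cvgrPdist_le => z z0; have [l hl] := small_scale C0 s0 z0.
have e0 := scale_gt0 rho1 l; have e1 := scale_le1 rho1 l.
apply: filterS (approximates_near ha e0) => k hk; rewrite distrC; apply: le_trans hl.
apply: hC => //; first by apply: regular_le (hL k); rewrite -addrA addrC -addrA lerDl addr_ge0// mulr_ge0.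
move=> j x; apply: le_trans (hk j x) _; have /andP[a0 a1] := alpha01 j.
have h1 : scale rho l <= scale rho l `^ alpha j.
  by rewrite -[leLHS](powRr1 (ltW e0)); exact: powR_decr.
apply: le_trans h1 _; apply: ler_peMl; first exact: powR_ge0.
rewrite (_ : _ - H = 1 + (2 * H + L)); last by ring.
by rewrite lerDl addr_ge0// mulr_ge0.
Qed.

End approximation.

Lemma cvg_dist_le {R : realType} (u w : nat -> R) (l m a : R) : u @ \oo --> l -> w @ \oo --> m ->
  (exists k0, forall k, (k0 <= k)%N -> `|u k - w k| <= a) -> `|l - m| <= a.
Proof.
move=> ul wm [k0 h]; have c : (fun k => `|u (k + k0)%N - w (k + k0)%N|) @ \oo --> `|l - m|.
  have c' := cvgB ul wm; rewrite -(cvg_shiftn k0) in c'.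
  by apply: cvg_norm; exact: c'.
by apply: cvg_le_cst c _ => k; apply: h; exact: leq_addl.
Qed.

Section decompositions.
Context {R : realType}.
Variables (X : metricType R) (n : nat) (V d rho : R) (K : set X).
Hypothesis rho1 : 1 < rho.
Hypothesis V0 : 0 <= V.
Hypothesis dn : n%:R <= d.
Hypothesis cK : compact K.
Variable alpha : 'I_n.+1 -> R.
Hypothesis alpha01 : forall i, 0 < alpha i <= 1.
Local Notation Rn := 'rV[R]_n.+1.
Local Notation leb := (lebesgue_row R n.+1).
Let tau := \sum_i alpha i.
Hypothesis dtau : d < tau.
Let q := decay d rho alpha.
Let s0 : 0 < tau - d. Proof. by rewrite subr_gt0. Qed.

(* With [b l = rho `^ (l%:R * (d - n%:R))], [dec_sum] holds if [n < d]; if [d = n], and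
   for partial sums, it is secured by taking [b l = 0] for all large [l]. *)
Record decomposition (R_ : nat -> functional X n.+1) (T : functional X n.+1) (C2 : R) (b : nat -> R) :
    Prop := Decomposition {
  dec_current : forall l, is_current (R_ l) ;
  dec_mass : forall l : nat, (mass (R_ l) <= (V * rho `^ (l%:R * (d - n.+1%:R)))%:E)%E ;
  dec_boundary : forall l : nat, (mass (boundary (R_ l)) <= (V * b l)%:E)%E ;
  dec_ge0 : forall l, 0 <= b l ;
  dec_le : forall l : nat, b l <= rho `^ (l%:R * (d - n%:R)) ;
  dec_const : 0 <= C2 ;
  dec_sum : forall k : nat, \sum_(l < k) b l <= C2 * rho `^ (k%:R * (d - n%:R)) ;
  dec_vanishes : forall k, vanishes_off (partial_sum R_ k) K ;
  dec_limit : forall f g, is_lip f -> (forall i, is_lip (g i)) ->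
    (fun k => partial_sum R_ k f g) @ \oo --> T f g }.

(** The constant may depend on [f], [g] and [L] but not on the Lipschitz map; so the same statement
    serves sequences of approximants and the family of inf-convolutions used for the boundary. *)
Definition push_rate (phi : X -> Rn) (H : R) (T : functional X n.+1) (v : Rn -> R) : Prop :=
  forall (L : R) f g, 3 * H <= L -> is_lip f -> (forall i, is_lip (g i)) ->
    exists2 C, 0 <= C & forall psi (e : R), 0 < e -> e <= 1 -> regular alpha psi L ->
    (forall j x, `|coords psi j x - coords phi j x| <= (L - H) * e `^ alpha j) ->
    `|T (f \o psi) (fun i => g i \o psi) - current_of v f g| <= C * e `^ (tau - d).

Lemma decomposition_vanishes R_ T C2 b : decomposition R_ T C2 b -> vanishes_off T K.
Proof.
move=> D f g hf hg fK; have h := dec_limit D hf hg.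
have e : (fun k => partial_sum R_ k f g) = fun=> 0 by apply/funext => k; exact: (dec_vanishes D).
rewrite e in h; apply: (cvg_unique _ h (cvg_cst _)); exact: Rhausdorff.
Qed.

Section one_map.
Variables (phi : X -> Rn) (H r0 : R).
Hypothesis H0 : 0 <= H.
Hypothesis hphi : forall j, hoelderc (alpha j) H (coords phi j).
Hypothesis r00 : 0 <= r0.
Hypothesis phiK : forall x, K x -> `|phi x| <= r0.
Let r := box r0 (3 * H).
Let tau1 := tau - \big[Num.max/0]_i alpha i.

Lemma decomposition_density R_ T C2 b : decomposition R_ T C2 b ->
  exists v v_, [/\ intg leb v /\ forall x, r < `|x| -> v x = 0, push_rate phi H T v,
    forall k, [/\ intg leb (v_ k), forall x, r < `|x| -> v_ k x = 0,
      \int[leb]_x `|v_ k x| <= incr_const n rho C2 * V * H ^+ n.+1 * q ^+ k &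
      (variation_Rn (v_ k) <=
        (n.+1%:R * (2 * (C2 * V * H ^+ n * rho `^ (d - n%:R))) * rho `^ (k%:R * (d - tau1)))%:E)%E],
    (fun k => L1_dist v (fun x => \sum_(l < k.+1) v_ l x)) @ \oo --> 0%E &
    (forall l psi, lipschitz_map_on setT psi -> exists2 u, L1cZ u &
      eq_current (pushforward_current psi (R_ l)) (current_of u)) ->
    {ae leb, forall x, v x \is a Num.int}].
Proof.
case=> hR hM hB b0 bd C20 bsum hK limT.
have [w hw] := densities hR rho1 V0 hM hB bsum hK alpha01 H0 hphi r00 phiK.
have iw k : intg leb (w k) by case: (hw k).
have w0 k x : r < `|x| -> w k x = 0 by case: (hw k) => _ h _ _; exact: h.
have Sw k : forall f, is_lip f -> partial_sum R_ k (f \o inf_convolution alpha H phi (scale rho k))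
    (coords (inf_convolution alpha H phi (scale rho k))) = \int[leb]_x (w k x * f x).
  by case: (hw k).
have pw k : eq_current (pushforward_current (inf_convolution alpha H phi (scale rho k)) (partial_sum R_ k))
    (current_of (w k)) by case: (hw k).
have [v [iv v0 cv]] := weights_limit hR rho1 V0 hM hB C20 bsum alpha01 dtau H0 hphi iw w0 Sw.
exists v, (increment w); split => //.
- exact: (push_estimate hR rho1 V0 dn hM hB b0 bd C20 bsum hK limT alpha01 dtau H0 hphi r00 phiK iw w0 Sw iv v0 cv).
- move=> k; split.
  + exact: intg_increment.
  + exact: (increment_off w0 k).
  + exact: (increment_L1 hR rho1 V0 hM hB C20 bsum alpha01 H0 hphi iw Sw).
  + exact: (increment_variation hR rho1 V0 dn hM hB C20 bsum alpha01 H0 hphi iw pw).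
- have e k : L1_dist v (fun x => \sum_(l < k.+1) increment w l x) = (\int[leb]_x `|w k x - v x|)%:E.
    rewrite EFin_Int; last by apply: intg_abs; exact: intgB.
    by apply: eq_integral => x _; rewrite sum_increment distrC.
  rewrite (_ : (fun k => _) = fun k => (\int[leb]_x `|w k x - v x|)%:E); last by apply/funext.
  by apply: cvg_EFin => //; exact: nearW.
- move=> hint; apply: (ae_int_limit iw iv) cv.
  exact: (weights_integer rho1 alpha01 H0 hphi iw Sw hint).
Qed.

Lemma push_rate_pushforward R_ T C2 b v : decomposition R_ T C2 b -> push_rate phi H T v ->
  is_pushforward alpha phi T (current_of v).
Proof.
move=> D est; exact: (pushforward_of_estimate alpha01 rho1 H0 hphi cK (decomposition_vanishes D) s0 est).
Qed.

Let phit k := inf_convolution alpha H phi (scale rho k).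

Lemma pushforward_integral (T : functional X n.+1) v f : is_pushforward alpha phi T (current_of v) ->
  is_lip f -> (fun k => T (f \o phit k) (coords (phit k))) @ \oo --> \int[leb]_x (v x * f x).
Proof.
move=> [_ /(_ _ (conv_approximates alpha01 rho1 H0 hphi)) [_ h]] hf.
have := h f (fun i (y : Rn) => y ord0 i) hf (fun i => C11_is_lip (C11_coord i)).
by rewrite current_of_coords.
Qed.

End one_map.

(** Duality, with both currents reached through inf-convolutions at the same scale; coordinate slots
    turn their values into integrals of the densities. *)
Lemma pushforwards_L1 (phi psi : X -> Rn) (H : R) (S T : functional X n.+1) (u v : Rn -> R) A : 0 <= H ->
  (forall j, hoelderc (alpha j) H (coords phi j)) -> (forall j, hoelderc (alpha j) H (coords psi j)) ->
  intg leb u -> intg leb v ->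
  is_pushforward alpha phi S (current_of u) -> is_pushforward alpha psi T (current_of v) ->
  (exists k0, forall k f, (k0 <= k)%N -> is_lip f -> (forall y, `|f y| <= 1) ->
    `|S (f \o inf_convolution alpha H phi (scale rho k)) (coords (inf_convolution alpha H phi (scale rho k))) -
      T (f \o inf_convolution alpha H psi (scale rho k)) (coords (inf_convolution alpha H psi (scale rho k)))|
      <= A) ->
  \int[leb]_x `|u x - v x| <= A.
Proof.
move=> H0 hphi hpsi iu iv pu pv [k0 h]; apply: L1_duality => [|f hf f1]; first exact: intgB.
rewrite (@eq_Rintegral _ _ _ _ _ (fun x => u x * f x - v x * f x)) => [|x _]; last by rewrite mulrBl.
have mf := is_lip_measurable hf.
rewrite IntB; [|exact: intg_mulb iu mf f1|exact: intg_mulb iv mf f1].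
apply: cvg_dist_le (pushforward_integral H0 hphi pu hf) (pushforward_integral H0 hpsi pv hf) _.
by exists k0 => k kk; exact: h.
Qed.

(** [v] and [w] are known only through the currents they represent, so both maps are regularized at
    a common scale below [e]. The regularizations have Hoelder constant [3 * H], and three errors
    [H * e^(alpha j)] make up their distance. *)
Lemma pushforwards_close (R_ : nat -> functional X n.+1) T C2 b (phi psi : X -> Rn) (H e : R) (v w : Rn -> R) :
  decomposition R_ T C2 b -> 0 <= H ->
  (forall j, hoelderc (alpha j) H (coords phi j)) -> (forall j, hoelderc (alpha j) H (coords psi j)) ->
  0 < e -> e <= 1 -> (forall j x, `|coords phi j x - coords psi j x| <= H * e `^ alpha j) ->
  intg leb v -> intg leb w ->
  is_pushforward alpha phi T (current_of v) -> is_pushforward alpha psi T (current_of w) ->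
  \int[leb]_x `|v x - w x| <= sum_const d rho C2 alpha * V * (3 * H) ^+ n.+1 * e `^ (tau - d).
Proof.
move=> [hR hM hB b0 bd C20 bsum hK limT] H0 hphi hpsi e0 e1 close iv iw pv pw.
have H3 : 0 <= 3 * H by rewrite mulr_ge0.
apply: (pushforwards_L1 H0 hphi hpsi iv iw pv pw).
have [k0 hk0] := scale_eventually rho1 e0; exists k0 => k f kk hf f1.
have t0 := scale_gt0 rho1 k.
have rp := conv_regular alpha01 H0 hphi t0; have rq := conv_regular alpha01 H0 hpsi t0.
have [[c c0 lc] _] := rp; have [[c' c'0 lc'] _] := rq.
have cP := limT _ _ (comp_is_lip (fun=> c0) lc hf) (coords_is_lip (fun=> c0) lc).
have cQ := limT _ _ (comp_is_lip (fun=> c'0) lc' hf) (coords_is_lip (fun=> c'0) lc').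
apply: cvg_dist_le cP cQ _; exists 0%N => m _.
apply: (sum_close hR rho1 V0 dn hM hB b0 bd C20 bsum alpha01 dtau) => // j x.
have k1 := conv_near alpha01 H0 hphi j x t0; have k2 := conv_near alpha01 H0 hpsi j x t0.
have k3 : H * scale rho k `^ alpha j <= H * e `^ alpha j.
  have /andP[a0 _] := alpha01 j.
  by apply: ler_wpM2l => //; apply: powR_homo; [exact: ltW|exact: ltW|exact: hk0].
have k4 := close j x; set P := coords (inf_convolution alpha H phi _) j x in k1 *.
set Q := coords (inf_convolution alpha H psi _) j x in k2 *.
rewrite -mulrA [leRHS](_ : _ = H * e `^ alpha j + H * e `^ alpha j + H * e `^ alpha j); last by ring.
apply: le_trans (ler_distD (coords psi j x) _ _) _; apply: lerD; last by rewrite distrC; exact: le_trans k2 k3.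
apply: le_trans (ler_distD (coords phi j x) _ _) _; apply: lerD => //.
exact: le_trans k1 k3.
Qed.

End decompositions.

(** * The boundary of the pushforward *)

Section boundary_pushforward.
Context {R : realType}.
Variables (X : metricType R) (n : nat) (V d rho : R) (K : set X).
Hypothesis rho1 : 1 < rho.
Hypothesis V0 : 0 <= V.
Hypothesis dn : n%:R <= d.
Hypothesis cK : compact K.
Variable alpha : 'I_n.+1 -> R.
Hypothesis alpha01 : forall i, 0 < alpha i <= 1.
Local Notation Rn := 'rV[R]_n.+1.
Local Notation leb := (lebesgue_row R n.+1).
Let tau := \sum_i alpha i.
Hypothesis dtau : d < tau.
Variables (R_ : nat -> functional X n.+1) (T : functional X n.+1).
Hypothesis hR : forall l, is_current (R_ l).
Hypothesis hM : forall l : nat, (mass (R_ l) <= (V * rho `^ (l%:R * (d - n.+1%:R)))%:E)%E.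
Hypothesis hB : forall l : nat, (mass (boundary (R_ l)) <= (V * rho `^ (l%:R * (d - n%:R)))%:E)%E.
Hypothesis hK : forall k, vanishes_off (partial_sum R_ k) K.
Hypothesis limT : forall f g, is_lip f -> (forall i, is_lip (g i)) ->
  (fun k => partial_sum R_ k f g) @ \oo --> T f g.

Let q := decay d rho alpha.
Let q0 : 0 < q. Proof. by apply: decay_gt0. Qed.
Let q1 : q < 1. Proof. exact: decay_lt1. Qed.

(** It makes a partial sum a decomposed current in its own right, to which all results on [T]
    apply. *)
Definition truncated k : nat -> functional X n.+1 := fun l => if (l <= k)%N then R_ l else fun _ _ => 0.

Lemma partial_sum_truncated k m : partial_sum (truncated k) m = partial_sum R_ (minn m k).
Proof.
apply/funext => f; apply/funext => g; rewrite /partial_sum.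
rewrite (eq_bigr (fun l : 'I_m.+1 => if (l < k.+1)%N then R_ l f g else 0)) => [|l _]; last first.
  by rewrite /truncated ltnS; case: ifP.
rewrite -big_mkcond; have [mk|km] := leqP m k.
  by apply: eq_bigl => l; rewrite (leq_trans (ltn_ord l)).
by rewrite (big_ord_widen m.+1 (fun l => R_ l f g))// ltnS ltnW.
Qed.

Lemma decomposition_truncated k : decomposition V d rho K (truncated k) (partial_sum R_ k) k.+1%:R
  (fun l => if (l <= k)%N then rho `^ (l%:R * (d - n%:R)) else 0).
Proof.
split.
- by move=> l; rewrite /truncated; case: ifP => _; [exact: hR|exact: current_zero].
- move=> l; rewrite /truncated; case: ifP => _; first exact: hM.
  by rewrite mass_zero lee_fin mulr_ge0// powR_ge0.
- move=> l; rewrite /truncated; case: ifP => _; first exact: hB.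
  by rewrite boundary_zero mass_zero mulr0.
- by move=> l; case: ifP => _ //; exact: powR_ge0.
- by move=> l; case: ifP => _ //; exact: powR_ge0.
- by [].
(* At most [k + 1] terms are nonzero, each at most [rho^(m (d - n))] since [n <= d]. For [k = 0] the
   constant is 1; for larger [k] its growth is harmless, as only qualitative results are drawn from
   it. *)
- move=> m; rewrite -big_mkcond.
  apply: (@le_trans _ _ (\sum_(l < m | (l < k.+1)%N) rho `^ (m%:R * (d - n%:R)))).
    apply: ler_sum => l _; rewrite ler_powR ?(ltW rho1)//.
    by rewrite ler_wpM2r ?subr_ge0// ler_nat ltnW.
  rewrite sumr_const -[leLHS]mulr_natl; apply: ler_wpM2r; first exact: powR_ge0.
  rewrite ler_nat.
  have [km|mk] := leqP k.+1 m; last first.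
    by apply: leq_trans (max_card _) _; rewrite card_ord ltnW.
  rewrite -sum1_card -(big_ord_widen m (fun=> 1%N))//.
  by rewrite sum1_card card_ord.
- by move=> m; rewrite partial_sum_truncated.
- move=> f g hf hg; apply: cvg_near_cst; exists k => // m /= km.
  by rewrite partial_sum_truncated (minn_idPr km).
Qed.

Variables (phi : X -> Rn) (H r0 : R).
Hypothesis H0 : 0 <= H.
Hypothesis hphi : forall j, hoelderc (alpha j) H (coords phi j).
Hypothesis r00 : 0 <= r0.
Hypothesis phiK : forall x, K x -> `|phi x| <= r0.
Let r := box r0 (3 * H).
Let phit := inf_convolution alpha H phi.

Lemma extend_head_comp (psi : X -> Rn) (f : Rn -> R) (g : 'I_n -> Rn -> R) :
  extend_head (f \o psi) (fun i => g i \o psi) = fun i => extend_head f g i \o psi.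
Proof. by apply/funext => i; rewrite /extend_head; case: unliftP. Qed.

Lemma conv_le t j x : 0 < t -> `|coords (phit t) j x - coords phi j x| <= (3 * H - H) * t `^ alpha j.
Proof.
move=> t0; apply: le_trans (conv_near alpha01 H0 hphi j x t0) _.
apply: ler_wpM2r; first exact: powR_ge0.
by rewrite (_ : 3 * H - H = H + H) ?lerDl//; ring.
Qed.

(** The boundary is a value with first argument 1 and head slot [f], and forming it commutes with
    pushing forward by Lipschitz maps; so [push_rate], applied to the inf-convolution with [e = t],
    gives the limit. *)
Lemma boundary_truncated k u : push_rate d alpha phi H (partial_sum R_ k) u ->
  is_pushforward_normal alpha H phi (boundary (partial_sum R_ k)) (boundary (current_of u)).
Proof.
move=> est; have H3 : 0 <= 3 * H by rewrite mulr_ge0.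
split.
  exists [set y | `|y| <= r]; split; first exact: compact_norm_le.
  move=> t /andP[t0 t1]; apply: support_in_ball => f g hf hg fr.
  have close j x : `|coords (phit t) j x - coords phi j x| <= 3 * H.
    apply: le_trans (conv_le j x t0) _; have /andP[a0 _] := alpha01 j.
    have := powR_le1 (ltW t0) t1 (ltW a0) => h.
    apply: le_trans (ler_wpM2l _ h) _; last by rewrite mulr1 gerBl.
    by rewrite subr_ge0 ler_peMl// ler1n.
  have bsum m : \sum_(l < m) (if (l <= k)%N then rho `^ (l%:R * (d - n%:R)) else 0) <=
      k.+1%:R * rho `^ (m%:R * (d - n%:R)) by exact: (dec_sum (decomposition_truncated k)).
  have D := decomposition_truncated k.
  have [z [_ z0 _]] := partial_density (dec_current D) V0 (dec_mass D) (dec_boundary D) bsum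
    (dec_vanishes D) r00 phiK k H3 (conv_regular alpha01 H0 hphi t0) close.
  rewrite /= partial_sum_truncated minnn => pz.
  rewrite /pushforward_current /boundary /= extend_head_comp.
  rewrite -/(pushforward_current (phit t) (partial_sum R_ k) (fun=> 1) (extend_head f g)) pz; last 2 first.
  - exact: is_lip_cst.
  - exact: extend_head_lip.
  exact: (boundary_current_of_vanishes z0 hf hg fr).
move=> f g hf hg; have [C C0 hC] := est _ _ _ (lexx _) (is_lip_cst _ 1) (extend_head_lip hf hg).
apply/cvgrPdist_le => z z0; have s0 : 0 < tau - d by rewrite subr_gt0.
have [l hl] := small_scale rho1 C0 s0 z0; have l0 := scale_gt0 rho1 l.
have t0 : \forall t \near 0^'+, 0 < t :> R by exact: nbhs_right_gt.
have tl : \forall t \near 0^'+, t <= scale rho l by exact: nbhs_right_le.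
apply: filterS2 t0 tl => t t0 tl; rewrite distrC.
rewrite /pushforward_current /boundary /= extend_head_comp; apply: le_trans (hC (phit t) t t0 _ _ _) _.
- exact: le_trans tl (scale_le1 rho1 l).
- exact: conv_regular.
- by move=> j x; exact: conv_le.
- apply: le_trans hl; apply: ler_wpM2l => //; apply: powR_homo => //; exact: ltW.
Qed.

(** The densities [u k] of the partial sums approach [v] in L^1 at the geometric rate of [sum_tail],
    and [current_of_L1] with first argument 1 carries this over to the boundaries. *)
Lemma pushforward_boundary v : intg leb v -> (forall x, r < `|x| -> v x = 0) ->
  is_pushforward alpha phi T (current_of v) ->
  is_pushforward_boundary alpha H phi R_ (boundary (current_of v)).
Proof.
move=> iv v0 pv.
have [u hu] : exists u : nat -> Rn -> R, forall k, [/\ intg leb (u k), forall x, r < `|x| -> u k x = 0 &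
    push_rate d alpha phi H (partial_sum R_ k) (u k)].
  suff h k : exists u : Rn -> R, [/\ intg leb u, forall x, r < `|x| -> u x = 0 &
      push_rate d alpha phi H (partial_sum R_ k) u] by have [u hu] := choice h; exists u.
  have [u [_ [[iu u0] hu _ _ _]]] := decomposition_density rho1 V0 dn alpha01 dtau H0 hphi r00 phiK
    (decomposition_truncated k).
  by exists u.
have iu k : intg leb (u k) by case: (hu k).
have u0 k x : r < `|x| -> u k x = 0 by case: (hu k) => _ h _; exact: h.
have est k : push_rate d alpha phi H (partial_sum R_ k) (u k) by case: (hu k).
exists (fun k => boundary (current_of (u k))); split; first by move=> k; exact: boundary_truncated.
pose A := (1 + scale_const alpha) * V * (3 * H) ^+ n.+1 / (1 - q) * q.
have H3 : 0 <= 3 * H by rewrite mulr_ge0.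
have uv k : \int[leb]_x `|u k x - v x| <= A * q ^+ k.
  have D := decomposition_truncated k.
  have pu := push_rate_pushforward rho1 cK alpha01 dtau H0 hphi D (est k).
  apply: (pushforwards_L1 rho1 alpha01 H0 hphi hphi (iu k) iv pu pv).
  exists 0%N => j f _ hf f1; have t0 := scale_gt0 rho1 j.
  have rp := conv_regular alpha01 H0 hphi t0; have [[c c0 lc] _] := rp.
  have cP := limT (comp_is_lip (fun=> c0) lc hf) (coords_is_lip (fun=> c0) lc).
  apply: cvg_dist_le (cvg_cst _) cP _; exists k => m km; rewrite distrC.
  apply: le_trans (sum_tail hR rho1 V0 dn hM hB _ _ alpha01 dtau km H3 rp hf f1) _.
  - by move=> l; exact: powR_ge0.
  - by move=> l.
  - rewrite /A -/q [q ^+ k.+1]exprS le_eqVlt; apply/orP; left; apply/eqP.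
    by set z := (1 - q)^-1; set y := q ^+ k; ring.
have uv0 : (fun k => \int[leb]_x `|u k x - v x|) @ \oo --> (0 : R).
  have c : (fun k => A * q ^+ k) @ \oo --> (0 : R).
    rewrite -[X in _ --> X](mulr0 A); apply: cvgMl_tmp.
    by apply: cvg_expr; rewrite gtr0_norm.
  apply: (squeeze_cvgr _ (cvg_cst 0) c); apply: nearW => k.
  by rewrite uv andbT Int_ge0.
have r_ge0 : 0 <= r by apply: le_trans (box_ge r00 H3); rewrite addr_ge0.
split.
  exists [set y | `|y| <= r]; split; first exact: compact_norm_le.
  move=> k _; apply: support_in_ball; exact: (boundary_current_of_vanishes (u0 k)).
move=> f g hf hg; have [C C0 hC] := current_of_L1 r_ge0 (is_lip_cst _ 1) (extend_head_lip hf hg).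
have c : (fun k => C * \int[leb]_x `|u k x - v x|) @ \oo --> (0 : R).
  by rewrite -[X in _ --> X](mulr0 C); exact: cvgMl_tmp.
apply/cvgrPdist_le => z z0; move/cvgrPdist_le : c => /(_ _ z0); apply: filterS => k.
rewrite sub0r normrN ger0_norm ?mulr_ge0 ?Int_ge0// distrC; apply: le_trans.
exact: (hC _ _ (iu k) iv (u0 k) v0).
Qed.

End boundary_pushforward.

Section integral_pushforward.
Context {R : realType}.
Variables (X : metricType R) (n : nat).
Local Notation Rn := 'rV[R]_n.
Local Notation leb := (lebesgue_row R n).

Lemma L1cZ_zero : L1cZ (fun _ : Rn => 0 : R).
Proof.
split; last by apply: aeW => x; exact: int_num0.
split; first exact: intg0.
by exists set0; split; [exact: compact0|apply: aeW].
Qed.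

Lemma current_of_zero f g : current_of (fun _ : Rn => 0 : R) f g = 0.
Proof.
rewrite /current_of (@eq_Rintegral _ _ _ _ _ (fun=> 0)) => [|x _]; last by rewrite !mul0r.
by rewrite Rintegral_cst// mul0r.
Qed.

(** The restriction to the whole space is the current itself, as the constant approximating sequence
    shows. If [X] is empty, the image is zero. *)
Lemma integral_density (S : functional X n) (psi : X -> Rn) : is_integral S ->
  lipschitz_map_on setT psi -> exists2 u, L1cZ u &
    eq_current (pushforward_current psi S) (current_of u).
Proof.
move=> [[hS _] rS] lpsi.
have [c c0 lc] : exists2 c : R, 0 <= c & forall x y, `|psi x - psi y| <= c * mdist x y.
  have [c hc] := lpsi; exists `|c| => // x y.
  rewrite distrC -mdist_rowE; apply: le_trans (hc x y I I) _.
  by rewrite ler_wpM2r ?mdist_ge0// ler_norm.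
have comp f : is_lip f -> is_lip (f \o psi).
  move=> /is_lipP[b b0 hb]; apply: (@is_lip_lipc _ _ (b * c)); first exact: mulr_ge0.
  move=> x y; apply: le_trans (hb _ _) _; rewrite -mulrA ler_wpM2l//.
  by rewrite mdist_rowE distrC.
have [[x0 _]|noX] := pselect (exists x : X, True); last first.
  exists (fun=> 0); first exact: L1cZ_zero.
  move=> f g hf hg; rewrite current_of_zero; have [K [_ hK]] := current_compact hS.
  apply: hK; [exact: comp|by move=> i; exact: comp|].
  by rewrite -subset0 => x _; apply: noX; exists x.
have [mu [_ _ /(_ setT psi measurableT lpsi)[S' [u [hS' uZ Su]]]]] := rS x0.
exists u => // f g hf hg; rewrite -Su//.
rewrite /pushforward_current.
have h := hS' (f \o psi) (fun i => g i \o psi) (fun=> f \o psi) (comp _ hf) (fun i => comp _ (hg i))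
  (fun=> comp _ hf).
apply: (cvg_unique _ (cvg_cst _) (h _)); first exact: Rhausdorff.
rewrite (_ : (fun k => _) = fun=> 0%E); first exact: cvg_cst.
apply/funext => k; rewrite (eq_integral (fun=> 0%E)) ?integral0// => x _.
by rewrite indicT mul1r subrr normr0.
Qed.

End integral_pushforward.

(** * Scalar identities and the final assembly *)

Section scalars.
Context {R : realType}.

Lemma sum_powR_le (rho e : R) (k : nat) : 1 < rho -> 0 < e ->
  \sum_(l < k) rho `^ (l%:R * e) <= (rho `^ e - 1)^-1 * rho `^ (k%:R * e).
Proof.
move=> r1 e0; have r0 : 0 < rho by exact: lt_trans ltr01 r1.
have re : 1 < rho `^ e by rewrite -expR0 /powR (gt_eqF r0) ltr_expR mulr_gt0// ln_gt0.
have pw (l : nat) : rho `^ (l%:R * e) = (rho `^ e) ^+ l.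
  by rewrite mulrC powRrM powR_mulrn// powR_ge0.
rewrite mulrC ler_pdivlMr ?subr_gt0// pw.
rewrite (eq_bigr (fun l : 'I_k => (rho `^ e) ^+ l)) => [|l _]; last by rewrite pw.
by rewrite mulrC -subrX1 lerBlDr lerDl.
Qed.

(** [C'] has to be a function of [tau], and these constants see [alpha] only through its sum. *)
Lemma sum_const_sum n (d rho C2 : R) (alpha beta : 'I_n.+1 -> R) : \sum_i alpha i = \sum_i beta i ->
  sum_const d rho C2 alpha = sum_const d rho C2 beta.
Proof. by move=> e; rewrite /sum_const /close_const /decay /scale_const e. Qed.

Lemma max_alpha n (alpha : 'I_n.+1 -> R) : (forall i, 0 < alpha i <= 1) ->
  0 < \big[Num.max/0]_i alpha i.
Proof.
move=> a01; have [i0 _ ->] := eq_bigmax ord0 xpredT alpha isT (fun i _ => ltW (proj1 (andP (a01 i)))).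
by case/andP: (a01 i0).
Qed.

Lemma powR_rescale (rho a x y : R) (k : nat) : a * x = y ->
  (rho `^ a) `^ (k%:R * x) = rho `^ (k%:R * y).
Proof. by move=> <-; rewrite -powRrM; congr (_ `^ _); ring. Qed.

End scalars.

Theorem theorem5p5 (R : realType) (n : nat) (d rho : R) :
  (1 <= n)%N -> n%:R - 1 <= d -> d < n%:R -> 1 < rho ->
  exists (C : R) (C' : R -> R), 0 <= C /\ (forall tau, 0 <= C' tau) /\
  forall (X : metricType R) (T : functional X n) (R_ : nat -> functional X n)
    (V : R),
  is_current T ->
  (forall k, is_normal (R_ k)) ->
  weak_cvg setT \oo (partial_sum R_) T ->
  0 <= V ->
  (forall k : nat,
    (mass (R_ k) <= (V * rho `^ (k%:R * (d - n%:R)))%:E)%E /\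
    (mass (boundary (R_ k)) <= (V * rho `^ (k%:R * (d - (n%:R - 1))))%:E)%E) ->
  (d = n%:R - 1 -> eq_current T (R_ 0%N)) ->
  forall (alpha : 'I_n -> R) (H : R),
  (forall i, 0 < alpha i <= 1) ->
  let tau := \sum_(i < n) alpha i in
  let tau1 := tau - \big[Num.max/0]_(i < n) alpha i in
  let eta := rho `^ (tau - tau1) in
  let d' := n%:R - 1 + (d - tau1) / (tau - tau1) in
  d < tau ->
  (forall phi : X -> 'rV[R]_n, holder_le alpha H phi ->
    exists v : 'rV[R]_n -> R,
    [/\ L1c v,
        (forall k, is_integral (R_ k)) -> L1cZ v,
        is_pushforward alpha phi T (current_of v),
        is_pushforward_boundary alpha H phi R_ (boundary (current_of v)) &
        exists v_ : nat -> 'rV[R]_n -> R,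
        [/\ forall k, BVc (v_ k),
            (fun k : nat => L1_dist v (fun x => \sum_(l < k.+1) v_ l x))
              @ \oo --> 0%E,
            bounded_set (\bigcup_k ess_support (v_ k)) &
            forall k : nat,
            (L1_norm (v_ k) <=
              (C * V * H ^+ n * eta `^ (k%:R * (d' - n%:R)))%:E)%E /\
            (variation_Rn (v_ k) <=
              (C * V * H ^+ n.-1 * eta `^ (k%:R * (d' - (n%:R - 1))))%:E)%E]]) /\
  (forall (epsilon : R) (phi psi : X -> 'rV[R]_n),
    0 < epsilon <= 1 ->
    holder_le alpha H phi -> holder_le alpha H psi ->
    (forall i x, `|phi x ord0 i - psi x ord0 i| <= H * epsilon `^ alpha i) ->
    forall v w : 'rV[R]_n -> R, L1c v -> L1c w ->
    is_pushforward alpha phi T (current_of v) ->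
    is_pushforward alpha psi T (current_of w) ->
    (L1_dist v w <= (C' tau * V * H ^+ n * epsilon `^ (tau - d))%:E)%E) /\
  [/\ 1 < eta, d' = n%:R + (d - tau) / (tau - tau1) &
      forall a : R, (forall i, alpha i = a) -> eta = rho `^ a /\ d' = d / a].
Proof.
case: n => [//|m] _; have em : m.+1%:R - 1 = m%:R :> R by rewrite -natr1 addrK.
rewrite em => md dm rho1; have rho0 : 0 < rho by exact: lt_trans ltr01 rho1.
(* The constant for sums of boundary masses: a single term if [d = n - 1], otherwise a geometric
   series of ratio [rho^(d - (n - 1))]. *)
pose C2 : R := if d == m%:R then 1%:R else (rho `^ (d - m%:R) - 1)^-1.
have C20 : 0 <= C2.
  rewrite /C2; case: eqP => // /eqP dm'; rewrite invr_ge0 subr_ge0 -{1}(powRr0 rho).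
  by apply: ler_powR; [exact: ltW|rewrite subr_ge0].
pose Cv := m.+1%:R * (2 * (C2 * rho `^ (d - m%:R))).
have Cv0 : 0 <= Cv by rewrite !mulr_ge0// powR_ge0.
have Ci0 : 0 <= incr_const m rho C2 by exact: incr_const_ge0.
exists (incr_const m rho C2 + Cv).
(* Equal exponents of sum [tau] express the constant; 3 is the factor lost in the Hoelder constant
   of the regularizations. The absolute value makes it nonnegative for every real [tau]. *)
exists (fun tau => `|sum_const d rho C2 (fun _ : 'I_m.+1 => tau / m.+1%:R) * 3 ^+ m.+1|).
split; first exact: addr_ge0.
split => [//|X T R_ V hT hN [[K [cK sK]] limT] V0 hMB hT0 alpha H a01 tau tau1 eta d' dtau].
have hR l : is_current (R_ l) by case: (hN l).
have hM l : (mass (R_ l) <= (V * rho `^ (l%:R * (d - m.+1%:R)))%:E)%E by case: (hMB l).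
have hB l : (mass (boundary (R_ l)) <= (V * rho `^ (l%:R * (d - m%:R)))%:E)%E by case: (hMB l).
have hK k : vanishes_off (partial_sum R_ k) K.
  by apply: vanishes_off_support; [exact: current_partial_sum|exact: sK].
(* If [d = n - 1], the given bounds on all the boundaries need not imply [dec_sum]; as [T] is then
   [R_ 0], the later terms are replaced by zero. The boundary statement keeps the original
   sequence. *)
have [R' [b [D hR']]] : exists R' b, decomposition V d rho K R' T C2 b /\
    forall l, R' l = R_ l \/ R' l = fun _ _ => 0.
  rewrite /C2; case: eqP => [e|/eqP ne].
    exists (truncated R_ 0), (fun l => if (l <= 0)%N then rho `^ (l%:R * (d - m%:R)) else 0); split; last first.
      by move=> l; rewrite /truncated; case: ifP; [left|right].
    case: (decomposition_truncated rho1 V0 md hR hM hB hK 0) => ? ? ? ? ? ? ? ? lim; split => //.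
    by move=> f g hf hg; rewrite (hT0 e f g hf hg) -partial_sum0; exact: lim.
  exists R_, (fun l : nat => rho `^ (l%:R * (d - m%:R))); split; last by left.
  split => //.
  - by move=> l; exact: powR_ge0.
  - by move: C20; rewrite /C2 (negPf ne).
  - by move=> k; apply: sum_powR_le => //; rewrite subr_gt0 lt_neqAle eq_sym ne.
have a0 := max_alpha a01; set a := \big[Num.max/0]_i alpha i in a0.
have ta : tau - tau1 = a by rewrite /tau1 opprB addrC subrK.
have d'E : d' = m%:R + (d - tau1) / a by rewrite /d' ta.
have ae : a * ((d - tau1) / a) = d - tau1 by rewrite mulrC divfK ?gt_eqF.
(* With [e1] below, the powers of [eta] in the conclusion become [rho^(k (d - tau1))] and
   [rho^(k (d - tau))], the rates in which the bounds were obtained. *)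
have e2 : a * (d' - m%:R) = d - tau1 by rewrite d'E [m%:R + _]addrC addrK.
have e1 : a * (d' - m.+1%:R) = d - tau.
  have -> : d' - m.+1%:R = (d - tau1) / a - 1 by rewrite d'E -natr1; ring.
  by rewrite mulrBr ae mulr1 -ta; ring.
have holderE phi : holder_le alpha H phi -> 0 <= H /\ forall j, hoelderc (alpha j) H (coords phi j).
  move=> h; have h' j : 0 <= H /\ hoelderc (alpha j) H (coords phi j).
    by apply/(HolderP _ _ (proj1 (andP (a01 j)))); exact: h.
  by split=> [|j]; [exact: (h' ord0).1|exact: (h' j).2].
split; last split.
- move=> phi /holderE [H0 hphi].
  have [r0 r00 phiK] := hoelder_bounded cK a01 H0 hphi.
  have [v [v_ [[iv v0] est hv_ cv vint]]] := decomposition_density rho1 V0 md a01 dtau H0 hphi r00 phiK D.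
  have pv := push_rate_pushforward rho1 cK a01 dtau H0 hphi D est.
  have L1v := L1c_ball iv v0.
  exists v; split => //.
  (* Terms of [R'] that were replaced by zero have density zero. *)
  + move=> hI; split => //; apply: vint => l psi lpsi; have [->|->] := hR' l.
      exact: integral_density.
    exists (fun=> 0); first exact: L1cZ_zero.
    by move=> f g _ _; rewrite current_of_zero.
  + exact: (pushforward_boundary rho1 V0 md cK a01 dtau hR hM hB hK limT H0 hphi r00 phiK iv v0 pv).
  + exists v_; split => //.
    * move=> k; have [ik k0 _ vk] := hv_ k; split; first exact: L1c_ball ik k0.
      exact: le_lt_trans vk (ltry _).
    * exists (box r0 (3 * H)); split; first exact: num_real.
      move=> M rM x [k _ /(ess_support_ball _) h]; have [_ k0 _ _] := hv_ k.
      exact: le_trans (h _ k0) (ltW rM).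
    * move=> k; have [ik _ nk vk] := hv_ k; split.
        rewrite /L1_norm -EFin_Int ?lee_fin; last exact: intg_abs.
        apply: le_trans nk _; rewrite /eta ta (powR_rescale _ _ e1) decayX//.
        apply: ler_wpM2r; first by rewrite exprn_ge0// ltW// decay_gt0.
        apply: ler_wpM2r; first exact: exprn_ge0.
        by apply: ler_wpM2r => //; rewrite lerDl.
      apply: le_trans vk _; rewrite lee_fin /eta ta (powR_rescale _ _ e2).
      apply: ler_wpM2r; first exact: powR_ge0.
      rewrite [leLHS](_ : _ = Cv * V * H ^+ m); last by rewrite /Cv; ring.
      apply: ler_wpM2r; first exact: exprn_ge0.
      by apply: ler_wpM2r => //; rewrite lerDr.
- move=> e phi psi /andP[e0 e1'] /holderE[H0 hphi] /holderE[_ hpsi] close v w [iv _] [iw _] pv pw.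
  rewrite /L1_dist -EFin_Int; last by apply: intg_abs; exact: intgB.
  rewrite lee_fin.
  apply: le_trans (pushforwards_close rho1 V0 md a01 dtau D H0 hphi hpsi e0 e1' close iv iw pv pw) _.
  apply: ler_wpM2r; first exact: powR_ge0.
  rewrite (@sum_const_sum _ _ d rho C2 alpha (fun=> tau / m.+1%:R)); last first.
    by rewrite sumr_const card_ord -[RHS]mulr_natr divfK// pnatr_eq0.
  set S := sum_const _ _ _ _.
  rewrite (_ : S * V * (3 * H) ^+ m.+1 = S * 3 ^+ m.+1 * (V * H ^+ m.+1)); last by rewrite exprMn; ring.
  rewrite -[leRHS]mulrA; apply: ler_wpM2r; last exact: ler_norm.
  by rewrite mulr_ge0// exprn_ge0.
- split.
  + by rewrite /eta ta -expR0 /powR (gt_eqF rho0) ltr_expR mulr_gt0// ln_gt0.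
  + rewrite ta -e1 [a * _]mulrC mulfK ?gt_eqF//; ring.
  + move=> b' hb; have ab : a = b'.
      have [i0 _ e] := eq_bigmax ord0 xpredT alpha isT (fun i _ => ltW (proj1 (andP (a01 i)))).
      by rewrite /a e hb.
    rewrite /eta ta ab; split => //.
    have tE : tau = m.+1%:R * b'.
      by rewrite /tau (eq_bigr (fun=> b')) => [|i _ //]; rewrite sumr_const card_ord mulr_natl.
    rewrite d'E /tau1 -/a ab tE; have b0 : b' != 0 by rewrite -ab gt_eqF.
    by rewrite -natr1; field.
Qed.
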